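(* Let $Y \subset \mathbb{R}^n$ be an L-regular cell and let $p \in \overline{Y}$. If the link of $Y$ at $p$ is connected, then $Y$ is LLNE at $p$. In particular, any L-regular cell $Y \subset \mathbb{R}^n$ of dimension $k\geq 2$ is LLNE at every $p \in \overline{Y}$.
   Context: $\|\cdot\|$ is the Euclidean norm on $\mathbb{R}^n$ and $\mathbb{S}^{n-1}(p;t)=\{x\in\mathbb{R}^n:\|x-p\|=t\}$. For $Z\subset\mathbb{R}^n$ and $q,\tilde q\in Z$, the inner distance is $d_Z(q,\tilde q)=\inf\{\mathrm{Length}(\gamma)\}$, where $\gamma$ runs over rectifiable paths in $Z$ connecting $q$ to $\tilde q$ (with value $+\infty$ if there is none). For $X\subset\mathbb{R}^n$ and $p\in\overline X$, $X$ is LLNE (link Lipschitz normally embedded) at $p$ if there is a constant $C\ge 1$ such that, for all small enough $t>0$, the set $X_t=X\cap\mathbb{S}^{n-1}(p;t)$ satisfies $d_{X_t}(q,\tilde q)\le C\|q-\tilde q\|$ for all $q,\tilde q\in X_t$. The link of $Y$ at $p$ is $Y\cap\mathbb{S}^{n-1}(p;t)$ for sufficiently small $t>0$ (its topological type does not depend on small $t$ for subanalytic $Y$). L-regular cells (recursive definition): a subanalytic set $Y\subset \mathbb{R}^n$ is an L-regular cell with constant $C$ when it is a point or has, for some coordinates of $\mathbb{R}^n$, one of the forms (i) $Y=\{(x',y) \in \mathbb{R}^{n-1} \times \mathbb{R} : y=f_0(x'),\ x' \in \tilde Y\}$ (graph type), or (ii) $Y=\{(x',y) \in \mathbb{R}^{n-1}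 \times \mathbb{R} : f_1(x') < y < f_2(x'),\ x' \in \tilde Y\}$ (band type), where: (1) $\tilde Y\subset\mathbb{R}^{n-1}$ is an analytic submanifold (homeomorphic to an open ball) and is itself of one of the previous forms (i.e. it is an L-regular cell in $\mathbb{R}^{n-1}$); (2) each $f_i$ is analytic on $\tilde Y$ and subanalytic on the closure of $\tilde Y$, with $f_1(x')<f_2(x')$ for all $x'\in\tilde Y$; (3) there is a constant $C>0$ such that $\|\nabla f_i(x')\|\le C$ for all $x'\in\tilde Y$, $i=0,1,2$. *)

(* Defs.v *)
From HB Require Import structures.
From mathcomp Require Import all_boot all_order all_algebra.
From mathcomp Require Import all_classical all_reals all_analysis.

Set Implicit Arguments.
Unset Strict Implicit.
Unset Printing Implicit Defensive.

Import Order.TTheory GRing.Theory Num.Theory.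
Import numFieldNormedType.Exports.

Local Open Scope classical_set_scope.
Local Open Scope ring_scope.

(* The library norm `|x| on 'rV[R]_n is the sup norm. It induces the usual
   topology, but spheres, lengths and gradients need the Euclidean norm. *)
Definition dotv (R : realType) (n : nat) (x y : 'rV[R]_n) : R :=
  \sum_(i < n) x 0 i * y 0 i.

Definition enorm (R : realType) (n : nat) (x : 'rV[R]_n) : R :=
  Num.sqrt (dotv x x).

(** Inner distance and LLNE sets *)

Definition curve_length (R : realType) (n : nat) (a b : R)
    (g : R -> 'rV[R]_n) : \bar R :=
  ereal_sup [set (let G := g \o nth b (a :: s) in
                  \sum_(0 <= i < size s) enorm (G i.+1 - G i))%:E
            | s in itv_partition a b].

Definition rectifiable_path (R : realType) (n : nat) (Z : set 'rV[R]_n)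
    (q q' : 'rV[R]_n) (g : R -> 'rV[R]_n) : Prop :=
  [/\ {within `[0, 1], continuous g}, g 0 = q, g 1 = q',
      g @` `[0, 1] `<=` Z & (curve_length 0 1 g < +oo)%E].

(* ereal_inf set0 = +oo *)
Definition inner_dist (R : realType) (n : nat) (Z : set 'rV[R]_n)
    (q q' : 'rV[R]_n) : \bar R :=
  ereal_inf [set curve_length 0 1 g | g in rectifiable_path Z q q'].

Definition slice (R : realType) (n : nat) (X : set 'rV[R]_n) (p : 'rV[R]_n)
    (t : R) : set 'rV[R]_n := X `&` [set x | enorm (x - p) = t].

Definition LLNE (R : realType) (n : nat) (X : set 'rV[R]_n) (p : 'rV[R]_n) :
    Prop :=
  exists2 C : R, 1 <= C & \forall t \near 0^'+,
    forall q q', slice X p t q -> slice X p t q' ->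
      (inner_dist (slice X p t) q q' <= (C * enorm (q - q'))%:E)%E.

Definition connected_link (R : realType) (n : nat) (X : set 'rV[R]_n)
    (p : 'rV[R]_n) : Prop :=
  \forall t \near 0^'+, connected (slice X p t).

(** Real analytic functions *)

Definition monomial (R : realType) (n : nat) (x : 'rV[R]_n)
    (al : {ffun 'I_n -> nat}) : R := \prod_(i < n) x 0 i ^+ al i.

(* The power series converges absolutely; its sum is then the limit of the
   partial sums over the multi-indices with all entries < N. *)
Definition power_series_sum (R : realType) (n : nat)
    (c : {ffun 'I_n -> nat} -> R) (x : 'rV[R]_n) (l : R) : Prop :=
  summable [set: {ffun 'I_n -> nat}] (fun al => (c al * monomial x al)%:E) /\
  (fun N : nat => \sum_(al : {ffun 'I_n -> 'I_N})
     (let be := [ffun i => val (al i)] in c be * monomial x be)) @ \oo --> l.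

Definition analytic_at (R : realType) (n : nat) (f : 'rV[R]_n -> R)
    (a : 'rV[R]_n) : Prop :=
  exists c : {ffun 'I_n -> nat} -> R,
    \forall x \near a, power_series_sum c (x - a) (f x).

Definition analytic_on (R : realType) (n : nat) (U : set 'rV[R]_n)
    (f : 'rV[R]_n -> R) : Prop := forall a, U a -> analytic_at f a.

Definition analytic_map_on (R : realType) (n m : nat) (U : set 'rV[R]_n)
    (f : 'rV[R]_n -> 'rV[R]_m) : Prop :=
  forall i : 'I_m, analytic_on U (fun x => f x 0 i).

(** Semianalytic and subanalytic sets *)

(* Near each point of the whole space (not only of X), X is a finite union of
   sets given by finitely many equations and strict inequalities. *)
Definition semianalytic (R : realType) (n : nat) (X : set 'rV[R]_n) : Prop :=
  forall a : 'rV[R]_n, exists2 U : set 'rV[R]_n, open_nbhs a U &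
    exists (r s : nat) (f g : 'I_r -> 'I_s -> 'rV[R]_n -> R),
      (forall i j, analytic_on U (f i j) /\ analytic_on U (g i j)) /\
      forall x, U x ->
        (X x <-> exists i, forall j, f i j x = 0 /\ 0 < g i j x).

Definition subanalytic (R : realType) (n : nat) (X : set 'rV[R]_n) : Prop :=
  forall a : 'rV[R]_n, exists2 U : set 'rV[R]_n, open_nbhs a U &
    exists (m : nat) (B : set 'rV[R]_(n + m)),
      [/\ semianalytic B, bounded_set B & X `&` U = lsubmx @` B].

(** Analytic submanifolds *)

(* Embedded submanifolds, by straightening charts. Without (k <= m)%N an open
   set would have every dimension k >= m. *)
Definition analytic_submanifold (R : realType) (k m : nat)
    (M : set 'rV[R]_m) : Prop :=
  (k <= m)%N /\
  forall a, M a -> exists (U V : set 'rV[R]_m) (phi psi : 'rV[R]_m -> 'rV[R]_m),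
    [/\ open_nbhs a U, open V, analytic_map_on U phi & analytic_map_on V psi] /\
    [/\ phi @` U = V, {in U, cancel phi psi} &
        forall x, U x -> (M x <-> forall i : 'I_m, (k <= i)%N -> phi x 0 i = 0)].

Definition homeomorphic_to_ball (R : realType) (k m : nat)
    (M : set 'rV[R]_m) : Prop :=
  let B := [set u : 'rV[R]_k | enorm u < 1] in
  exists (phi : 'rV[R]_k -> 'rV[R]_m) (psi : 'rV[R]_m -> 'rV[R]_k),
    [/\ {within B, continuous phi}, {within M, continuous psi},
        phi @` B = M & {in B, cancel phi psi}].

Definition analytic_on_submanifold (R : realType) (m : nat) (M : set 'rV[R]_m)
    (f : 'rV[R]_m -> R) : Prop :=
  forall a, M a -> exists2 g : 'rV[R]_m -> R, analytic_at g a &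
    \forall x \near a, M x -> f x = g x.

Definition curve_through (R : realType) (m : nat) (M : set 'rV[R]_m)
    (x v : 'rV[R]_m) (g : R -> 'rV[R]_m) : Prop :=
  [/\ g 0 = x, \forall t \near (0 : R), M (g t) & is_derive (0 : R) (1 : R) g v].

Definition tangent (R : realType) (m : nat) (M : set 'rV[R]_m)
    (x v : 'rV[R]_m) : Prop := exists g, curve_through M x v g.

(* M may have positive codimension: w is the gradient of f : M -> R, i.e. the
   tangent vector representing the differential of f on the tangent space. *)
Definition is_gradient (R : realType) (m : nat) (M : set 'rV[R]_m)
    (f : 'rV[R]_m -> R) (x w : 'rV[R]_m) : Prop :=
  tangent M x w /\
  forall v g, curve_through M x v g ->
    is_derive (0 : R) (1 : R) (f \o g) (dotv w v).

(** L-regular cells *)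

(* A point of R^(m+1) = R^m x R is x = (x', y). *)
Definition base_coord (R : realType) (m : nat) (x : 'rV[R]_m.+1) : 'rV[R]_m :=
  col' ord_max x.
Definition last_coord (R : realType) (m : nat) (x : 'rV[R]_m.+1) : R :=
  x 0 ord_max.

Definition graph_set (R : realType) (m : nat) (D : set 'rV[R]_m)
    (f : 'rV[R]_m -> R) : set 'rV[R]_m.+1 :=
  [set x | D (base_coord x) /\ last_coord x = f (base_coord x)].

Definition band_set (R : realType) (m : nat) (D : set 'rV[R]_m)
    (f1 f2 : 'rV[R]_m -> R) : set 'rV[R]_m.+1 :=
  [set x | D (base_coord x) /\
           f1 (base_coord x) < last_coord x < f2 (base_coord x)].

(* "Subanalytic on the closure of D" means that the graph over the closure is a
   subanalytic set. The values of f outside the closure are irrelevant. *)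
Definition cell_function (R : realType) (m : nat) (C : R) (D : set 'rV[R]_m)
    (f : 'rV[R]_m -> R) : Prop :=
  [/\ analytic_on_submanifold D f, subanalytic (graph_set (closure D) f) &
      forall x, D x -> exists2 w, is_gradient D f x w & enorm w <= C].

(* "For some coordinates": some orthonormal linear coordinates x *m Q of R^n,
   chosen independently at each step of the recursion. *)
Fixpoint Lregular (R : realType) (C : R) (n : nat) : set 'rV[R]_n -> Prop :=
  match n with
  | 0 => fun Y => exists a, Y = [set a]
  | m.+1 => fun Y =>
      (exists a, Y = [set a]) \/
      (subanalytic Y /\
       exists (Q : 'M[R]_m.+1) (D : set 'rV[R]_m),
         [/\ Q *m Q^T = 1%:M,
             exists k, analytic_submanifold k D /\ homeomorphic_to_ball k D,
             Lregular C D &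
             (exists2 f0, cell_function C D f0 &
                Y = [set x | graph_set D f0 (x *m Q)]) \/
             (exists f1 f2,
                [/\ cell_function C D f1, cell_function C D f2,
                    (forall x, D x -> f1 x < f2 x) &
                    Y = [set x | band_set D f1 f2 (x *m Q)]])])
  end.

Definition Lregular_cell (R : realType) (n : nat) (Y : set 'rV[R]_n) : Prop :=
  exists2 C : R, 0 < C & Lregular C Y.

(* Main.v *)
(* Cells are built by lifting, from the base to graphs and bands, two structures: short
   Lipschitz paths (a path of the base, clamped between the two boundary functions), and
   a flow a |-> F_a, Lipschitz in space and asymptotically conic at p, in the sense that
   F_b x - p is (b / a) (F_a x - p) up to an error e (1 - b / a) |F_a x - p| near p.
   The boundary functions are Lipschitz because their gradients are bounded and the base
   is quasiconvex. The flow lifts because they obey a discrete form of Euler's identity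
   at p: otherwise curve selection would give an analytic arc, of some order a, of pairs of
   points violating it, whereas the arc itself, reparametrized by
   tau |-> (1 - lam)^(1/a) tau, provides a comparison point. Curve selection for analytic
   sign conditions is proved by Weierstrass preparation, elimination of the last variable,
   and Puiseux parametrization of the roots.
   Along the flow, |F_a x - p| is strictly monotone with controlled speed, so points near
   the sphere of radius t can be pushed to it in a Lipschitz way; hence close points of a
   link are joined by short paths. Points far apart are joined by a chain of small steps
   (by connectedness, or by pushing to the sphere a path avoiding p), and the chain can be
   shortened to a number of steps bounded independently of t. *)
From HB Require Import structures.
From mathcomp Require Import all_boot all_order all_algebra.
From mathcomp Require Import all_classical all_reals all_analysis.
From mathcomp Require Import polyrcf.
From mathcomp Require qe_rcf_th qe_rcf.
From mathcomp Require Import ring lra zify.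
Require Import Defs.

Set Implicit Arguments.
Unset Strict Implicit.
Unset Printing Implicit Defensive.

Import Order.TTheory GRing.Theory Num.Theory.
Import numFieldNormedType.Exports.

Local Open Scope classical_set_scope.
Local Open Scope ring_scope.

(** * Germs of analytic functions *)

(** The obstacle is that subanalytic sets are given only as projections of semianalytic ones, with
    no complements at hand. So the one fact extracted from subanalyticity, the estimate on the
    boundary functions, is shaped to have a purely existential negation: a violating pair, together
    with lifts witnessing that both points lie in the graph and in the base, is a point of a set cut
    out by analytic signs, and an arc found upstairs projects down. The flow stands in for the
    dilation at [p], which in general leaves the cell. Its error is proportional to the step
    [1 - b / a], so the radial speed never degenerates. Its Lipschitz constant is fixed before the
    error [e], so asking for a smaller error on the base at each lifting costs nothing. The
    constants are scale invariant, hence independent of the radius [t] of the link. Analytic germs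
    are treated as limits of polynomials in a weighted norm, because substitution, Taylor expansion
    and Weierstrass division are bounded operations on polynomials; neither partial derivatives nor
    complex variables are required for them. *)

Section IteratedPolynomials.
Variable R : realType.

(* Polynomials in n variables, the last variable being outermost. *)
Fixpoint mP (n : nat) : comNzRingType :=
  if n is m.+1 then {poly (mP m)} else R.

(** The l1 norm of the coefficients, weighted by the radii [r]. It bounds the polynomial on the box
    of radius [r] and, unlike a supremum over real points, it controls each coefficient
    separately. *)
Fixpoint nrm (r : nat -> R) (n : nat) : mP n -> R :=
  match n return mP n -> R with
  | 0 => fun x : R => `|x|
  | m.+1 => fun p : {poly mP m} => \sum_(k < size p) nrm r p`_k * r m ^+ k
  end.

Fixpoint cst (n : nat) : {rmorphism R -> mP n} :=
  match n return {rmorphism R -> mP n} with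
  | 0 => (idfun : {rmorphism R -> R})
  | m.+1 => (polyC \o cst m : {rmorphism R -> {poly mP m}})
  end.

Fixpoint var (n : nat) (i : nat) : mP n :=
  match n return mP n with
  | 0 => (0 : R)
  | m.+1 => if i == m then ('X : {poly mP m}) else (var m i)%:P
  end.

(** The target algebra is arbitrary because two are needed: [R] for values, and another polynomial
    ring for substitution. *)
Fixpoint evA (A : comNzRingType) (iota : {rmorphism R -> A}) (v : nat -> A)
    (n : nat) : {rmorphism mP n -> A} :=
  match n return {rmorphism mP n -> A} with
  | 0 => iota
  | m.+1 => (horner_morph (fun x => mulrC (v m) (evA iota v m x))
             : {rmorphism {poly mP m} -> A})
  end.

Lemma nrmS (r : nat -> R) n (p : mP n.+1) :
  nrm r p = \sum_(k < size (p : {poly mP n})) nrm r (p : {poly mP n})`_k * r n ^+ k.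
Proof. by []. Qed.

Lemma nrm0 r n : nrm r (0 : mP n) = 0.
Proof. case: n => [|n] /=; first exact: normr0. by rewrite size_poly0 big_ord0. Qed.

Lemma nrmS_wide r n (p : {poly mP n}) N : (size p <= N)%N ->
  nrm r (p : mP n.+1) = \sum_(k < N) nrm r p`_k * r n ^+ k.
Proof.
move=> hN; rewrite nrmS (big_ord_widen _ (fun k => nrm r p`_k * r n ^+ k) hN).
rewrite big_mkcond; apply: eq_bigr => k _; case: ifPn => //; rewrite -leqNgt => h.
by rewrite nth_default // nrm0 mul0r.
Qed.

Section Nrm.
Variables (r : nat -> R) (r0 : forall i, 0 <= r i).

Lemma nrm_ge0 n (p : mP n) : 0 <= nrm r p.
Proof.
elim: n p => [|n IH] p /=; first exact: normr_ge0.
by apply: sumr_ge0 => k _; rewrite mulr_ge0 ?exprn_ge0.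
Qed.

Lemma nrmN n (p : mP n) : nrm r (- p) = nrm r p.
Proof.
elim: n p => [|n IH] p /=; first exact: normrN.
rewrite size_polyN; apply: eq_bigr => k _; by rewrite coefN IH.
Qed.

Lemma nrmD n (p q : mP n) : nrm r (p + q) <= nrm r p + nrm r q.
Proof.
elim: n p q => [|n IH] p q; first exact: ler_normD.
pose N := maxn (size (p : {poly mP n})) (size (q : {poly mP n})).
rewrite (@nrmS_wide _ _ _ N) ?size_polyD //.
rewrite (@nrmS_wide _ _ p N) ?leq_maxl // (@nrmS_wide _ _ q N) ?leq_maxr //.
rewrite -big_split; apply: ler_sum => k _ /=.
by rewrite coefD -mulrDl ler_wpM2r ?exprn_ge0.
Qed.

Lemma nrmB n (p q : mP n) : nrm r (p - q) <= nrm r p + nrm r q.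
Proof. by rewrite -(nrmN q) nrmD. Qed.

Lemma nrm_dist n (p q s : mP n) : nrm r (p - q) <= nrm r (p - s) + nrm r (s - q).
Proof. by rewrite (_ : p - q = (p - s) + (s - q)) ?nrmD // addrA subrK. Qed.

Lemma nrm_sum n I (s : seq I) (P : pred I) (F : I -> mP n) :
  nrm r (\sum_(i <- s | P i) F i) <= \sum_(i <- s | P i) nrm r (F i).
Proof.
elim/big_ind2: _ => [|x a y b ha hb|i _]; rewrite ?nrm0 //.
by apply: le_trans (nrmD _ _) _; apply: lerD.
Qed.

Lemma nrm_mono n (a : mP n) i (q : {poly mP n}) (K : R) :
  (forall b : mP n, nrm r (a * b) <= K * nrm r b) ->
  nrm r (a%:P * 'X^i * q : mP n.+1) <= K * r n ^+ i * nrm r (q : mP n.+1).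
Proof.
move=> hK; rewrite (@nrmS_wide _ _ _ (i + size q)); last first.
  rewrite -mulrA mul_polyC (leq_trans (size_scale_leq _ _)) //.
  by rewrite (leq_trans (size_polyMleq _ _)) // size_polyXn.
rewrite big_split_ord /= big1 ?add0r => [|k _]; last first.
  by rewrite -mulrA coefCM coefXnM ltn_ord mulr0 nrm0 mul0r.
rewrite mulr_sumr; apply: ler_sum => k _.
rewrite -mulrA coefCM coefXnM ltnNge leq_addr /= addKn exprD.
by rewrite [leRHS]mulrACA ler_wpM2r ?mulr_ge0 ?exprn_ge0.
Qed.

Lemma nrmM n (p q : mP n) : nrm r (p * q) <= nrm r p * nrm r q.
Proof.
elim: n p q => [|n IH] p q; first by rewrite /= normrM.
pose p' : {poly mP n} := p; rewrite -[p]/(p').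
have <- : (\sum_(k < size p') p'`_k *: 'X^k) * (q : {poly mP n}) = p' * q.
  by rewrite -poly_def coefK.
rewrite mulr_suml.
apply: le_trans (nrm_sum _ _ _) _; rewrite nrmS mulr_suml.
apply: ler_sum => k _; rewrite -mul_polyC; apply: nrm_mono => b; exact: IH.
Qed.

Lemma nrm_cst n (c : R) : nrm r (cst n c) = `|c|.
Proof.
elim: n => [|n IH] //; rewrite (@nrmS_wide _ _ _ 1) ?size_polyC_leq1 //.
by rewrite big_ord1 /= coefC /= IH expr0 mulr1.
Qed.

Lemma nrm1 n : nrm r (1 : mP n) = 1.
Proof. by rewrite -(rmorph1 (cst n)) nrm_cst normr1. Qed.

Lemma nrm_polyC n (a : mP n) : nrm r (a%:P : mP n.+1) = nrm r a.
Proof. by rewrite (@nrmS_wide _ _ _ 1) ?size_polyC_leq1 // big_ord1 /= coefC /= expr0 mulr1. Qed.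

Lemma nrm_var n i : nrm r (var n i) <= r i.
Proof.
elim: n => [|n IH]; first by rewrite /= normr0.
rewrite [var _ _]/=; case: eqP => [->|_]; last by rewrite nrm_polyC.
rewrite (@nrmS_wide _ _ _ 2) ?size_polyX // big_ord_recl big_ord1 /=.
by rewrite !coefX /= nrm0 mul0r add0r nrm1 mul1r expr1.
Qed.

Lemma nrmX n (p : mP n) k : nrm r (p ^+ k) <= nrm r p ^+ k.
Proof.
elim: k => [|k IH]; first by rewrite !expr0 nrm1.
rewrite !exprS; apply: le_trans (nrmM _ _) _; by rewrite ler_wpM2l ?nrm_ge0.
Qed.

Lemma nrm_coef n (p : {poly mP n}) k : nrm r p`_k * r n ^+ k <= nrm r (p : mP n.+1).
Proof.
rewrite (@nrmS_wide _ _ _ (maxn (size p) k.+1)) ?leq_maxl //.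
have hk : (k < maxn (size p) k.+1)%N by rewrite leq_max ltnSn orbT.
rewrite (bigD1 (Ordinal hk)) //= lerDl.
by apply: sumr_ge0 => i _; rewrite mulr_ge0 ?exprn_ge0 ?nrm_ge0.
Qed.

End Nrm.

Lemma nrm_le (r r' : nat -> R) n (p : mP n) : (forall i, 0 <= r i) ->
  (forall i, r i <= r' i) -> nrm r p <= nrm r' p.
Proof.
move=> r0 rr; elim: n p => [|n IH] p //=; apply: ler_sum => k _.
by apply: ler_pM; rewrite ?nrm_ge0 ?exprn_ge0 // lerXn2r ?nnegrE // (le_trans (r0 n)).
Qed.

(** Common properties of the absolute value of [R] and of [nrm], so that bounds on [evA] and Cauchy
    arguments serve values and substitutions alike. *)
Definition seminorm (A : comNzRingType) (iota : {rmorphism R -> A}) (nu : A -> R) :=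
  [/\ forall a, 0 <= nu a, forall a b, nu (a + b) <= nu a + nu b,
      forall a b, nu (a * b) <= nu a * nu b & forall c, nu (iota c) <= `|c|].

Lemma seminorm_mP r n : (forall i, 0 <= r i) -> seminorm (cst n) (@nrm r n).
Proof.
move=> r0; split=> *; rewrite ?nrm_ge0 ?nrmD ?nrmM ?nrm_cst //.
Qed.

Lemma seminorm_R : seminorm (idfun : {rmorphism R -> R}) Num.norm.
Proof. by split=> * /=; rewrite ?normr_ge0 ?ler_normD ?normrM. Qed.

Lemma evAS (A : comNzRingType) (iota : {rmorphism R -> A}) (v : nat -> A) n
  (p : {poly mP n}) :
  evA iota v n.+1 p = \sum_(k < size p) evA iota v n p`_k * v n ^+ k.
Proof.
rewrite /= /horner_morph -[p in LHS]coefK poly_def rmorph_sum /= horner_sum.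
by apply: eq_bigr => k _; rewrite map_polyZ /= map_polyXn hornerZ hornerXn.
Qed.

Lemma evA_cst (A : comNzRingType) (iota : {rmorphism R -> A}) (v : nat -> A) n c :
  evA iota v n (cst n c) = iota c.
Proof. by elim: n => [|n IH] //=; rewrite horner_morphC. Qed.

Lemma evA_polyC (A : comNzRingType) (iota : {rmorphism R -> A}) (v : nat -> A) n
  (a : mP n) : evA iota v n.+1 (a%:P) = evA iota v n a.
Proof. by rewrite /= horner_morphC. Qed.

Lemma evA_polyX (A : comNzRingType) (iota : {rmorphism R -> A}) (v : nat -> A) n :
  evA iota v n.+1 ('X : {poly mP n}) = v n.
Proof. by rewrite /= horner_morphX. Qed.

Lemma evA_var (A : comNzRingType) (iota : {rmorphism R -> A}) (v : nat -> A) n i :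
  (i < n)%N -> evA iota v n (var n i) = v i.
Proof.
elim: n => [|n IH] // hi /=; case: eqP => [->|/eqP ne]; first by rewrite horner_morphX.
by rewrite horner_morphC IH // ltn_neqAle ne -ltnS.
Qed.

Lemma evA_ext (A : comNzRingType) (iota : {rmorphism R -> A}) (v w : nat -> A) n
  (p : mP n) : (forall i, (i < n)%N -> v i = w i) -> evA iota v n p = evA iota w n p.
Proof.
elim: n p => [|n IH] // p h; rewrite !evAS; apply: eq_bigr => k _.
by rewrite (IH p`_k) ?h // => i hi; rewrite h // ltnW.
Qed.

Lemma evA_comp (A B : comNzRingType) (iota : {rmorphism R -> A})
  (jota : {rmorphism R -> B}) (f : {rmorphism A -> B}) (v : nat -> A) n (p : mP n) :
  (forall c, f (iota c) = jota c) ->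
  f (evA iota v n p) = evA jota (fun i => f (v i)) n p.
Proof.
move=> h; elim: n p => [|n IH] p; first exact: h.
rewrite !evAS rmorph_sum; apply: eq_bigr => k _.
by rewrite rmorphM rmorphXn /= IH.
Qed.

Lemma evA_bound (A : comNzRingType) (iota : {rmorphism R -> A}) (nu : A -> R)
   (r : nat -> R) (v : nat -> A) n (p : mP n) : seminorm iota nu ->
  (forall i, (i < n)%N -> nu (v i) <= r i) -> nu (evA iota v n p) <= nrm r p.
Proof.
case=> n0 nD nM nC; elim: n p => [|n IH] p h; first exact: nC.
rewrite evAS nrmS.
have nu0 : nu 0 <= 0 by rewrite -(rmorph0 iota) (le_trans (nC _)) ?normr0.
have rn : 0 <= r n by apply: le_trans (h n _); rewrite ?n0.
elim/big_rec2: _ => // k a b _ hab.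
apply: le_trans (nD _ _) _; apply: lerD => //; apply: le_trans (nM _ _) _.
apply: ler_pM; rewrite ?n0 //; first by apply: IH => i hi; rewrite h // ltnW.
elim: (k : nat) => [|j IHj].
  by rewrite !expr0 -(rmorph1 iota) (le_trans (nC _)) ?normr1.
by rewrite !exprS (le_trans (nM _ _)) // ler_pM ?n0 ?h.
Qed.

Definition ev (v : nat -> R) n : {rmorphism mP n -> R} :=
  evA (idfun : {rmorphism R -> R}) v n.

Definition box n (r : nat -> R) (v : nat -> R) := forall i, (i < n)%N -> `|v i| <= r i.

Lemma ev_bound n r v (p : mP n) : box n r v -> `|ev v n p| <= nrm r p.
Proof. exact: evA_bound seminorm_R. Qed.

(** Every monomial but the constant one gains at least one factor [th] when the radii shrink; the
    constant term is the value at the origin. *)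
Lemma nrm_scale (r : nat -> R) (th : R) n (p : mP n) :
  (forall i, 0 <= r i) -> 0 <= th <= 1 ->
  nrm (fun i => th * r i) p <= `|ev (fun=> 0) n p| + th * nrm r p.
Proof.
move=> r0 /andP[th0 th1].
elim: n p => [|n IH] p; first by rewrite /= lerDl mulr_ge0.
have sr0 i : 0 <= th * r i by rewrite mulr_ge0.
rewrite (@nrmS_wide _ _ _ (size (p : {poly mP n})).+1) //.
rewrite [X in _ + th * X](@nrmS_wide _ _ _ (size (p : {poly mP n})).+1) //.
rewrite big_ord_recl [X in _ + th * X]big_ord_recl /= !expr0 !mulr1 mulrDr.
rewrite addrA; apply: lerD.
  have -> : ev (fun=> 0) n.+1 p = ev (fun=> 0) n (p : {poly mP n})`_0; last exact: IH.
  by rewrite /ev /= /horner_morph horner_coef0 coef_map.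
rewrite mulr_sumr; apply: ler_sum => k _; rewrite /bump /= add1n mulrCA.
apply: ler_pM; rewrite ?nrm_ge0 ?exprn_ge0 //.
  by apply: nrm_le => // i; rewrite ler_piMl.
rewrite exprMn ler_wpM2r ?exprn_ge0 // exprS ler_piMr // exprn_ile1 //.
Qed.

End IteratedPolynomials.
Arguments nrm {R} r {n} _ : simpl never.

Section Limits.
Variable R : realType.

Definition tends (u : nat -> R) (l : R) :=
  forall e, 0 < e -> exists N, forall k, (N <= k)%N -> `|u k - l| < e.

Lemma tends_cst c : tends (fun=> c) c.
Proof. by move=> e e0; exists 0%N => k _; rewrite subrr normr0. Qed.

Lemma tendsD u v a b : tends u a -> tends v b -> tends (fun k => u k + v k) (a + b).
Proof.
move=> hu hv e e0; have e2 : 0 < e / 2 by rewrite divr_gt0.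
have [N hN] := hu _ e2; have [M hM] := hv _ e2.
exists (maxn N M) => k; rewrite geq_max => /andP[/hN h1 /hM h2].
rewrite opprD addrACA [e]splitr; apply: le_lt_trans (ler_normD _ _) _; exact: ltrD.
Qed.

Lemma tends_bounded u a : tends u a -> exists N, forall k, (N <= k)%N -> `|u k| <= `|a| + 1.
Proof.
move=> hu; have [N hN] := hu _ ltr01; exists N => k /hN h; rewrite -[u k](subrK a) addrC.
by apply: le_trans (ler_normD _ _) _; rewrite lerD2l ltW.
Qed.

Lemma tendsM u v a b : tends u a -> tends v b -> tends (fun k => u k * v k) (a * b).
Proof.
move=> hu hv e e0; have [N0 hb] := tends_bounded hu.
have A0 : 0 < `|a| + 1 by rewrite ltr_wpDl.
have B0 : 0 < `|b| + 1 by rewrite ltr_wpDl.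
have [N hN] := hu (e / 2 / (`|b| + 1)) ltac:(by rewrite !divr_gt0).
have [M hM] := hv (e / 2 / (`|a| + 1)) ltac:(by rewrite !divr_gt0).
exists (maxn N0 (maxn N M)) => k; rewrite !geq_max => /and3P[/hb h0 /hN h1 /hM h2].
have -> : u k * v k - a * b = u k * (v k - b) + (u k - a) * b by ring.
rewrite [e]splitr; apply: le_lt_trans (ler_normD _ _) _; rewrite !normrM.
move: h1; rewrite ltr_pdivlMr // => h1; move: h2; rewrite ltr_pdivlMr // => h2.
apply: ler_ltD.
  by apply: le_trans _ (ltW h2); rewrite mulrC ler_wpM2l.
by apply: le_lt_trans _ h1; rewrite ler_wpM2l // lerDl.
Qed.

Lemma tendsN u a : tends u a -> tends (fun k => - u k) (- a).
Proof.
move=> hu e e0; have [N hN] := hu _ e0; exists N => k /hN.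
by rewrite -opprD normrN.
Qed.

Lemma tendsX u a n : tends u a -> tends (fun k => u k ^+ n) (a ^+ n).
Proof.
move=> hu; elim: n => [|n IH]; first exact: tends_cst.
have := tendsM hu IH; rewrite -exprS; congr tends; apply/funext => k; by rewrite exprS.
Qed.

Lemma tends_le u a N b : tends u a -> (forall k, (N <= k)%N -> `|u k| <= b) -> `|a| <= b.
Proof.
move=> hu h; rewrite leNgt; apply/negP => lt.
have [M hM] := hu (`|a| - b) ltac:(by rewrite subr_gt0).
have h1 := hM (maxn N M) (leq_maxr _ _); have h2 := h (maxn N M) (leq_maxl _ _).
have := ler_distD (u (maxn N M)) a 0; rewrite !subr0 distrC; lra.
Qed.

Lemma tends_uniq u a b : tends u a -> tends u b -> a = b.
Proof.
move=> ha hb; apply/eqP; rewrite -subr_eq0 -normr_le0.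
have h := tendsD ha (tendsN hb); apply: (tends_le (N := 0%N) h) => k _.
by rewrite subrr normr0.
Qed.

Lemma tends_ext u v a : (forall k, u k = v k) -> tends u a -> tends v a.
Proof. by move=> /funext ->. Qed.

Lemma tends_shift u a K : tends u a -> tends (fun k => u (k + K)%N) a.
Proof.
move=> h e e0; have [N hN] := h _ e0; exists N => k hk; apply: hN.
by rewrite (leq_trans hk) ?leq_addr.
Qed.

Section Cauchy.
Variables (A : comNzRingType) (iota : {rmorphism R -> A}) (nu : A -> R).
Hypothesis snu : seminorm iota nu.

Let nu0 : nu 0 = 0.
Proof.
case: snu => n0 _ _ nC; apply/eqP; rewrite eq_le n0 andbT.
by rewrite -(rmorph0 iota) (le_trans (nC _)) ?normr0.
Qed.

Let nuN a : nu (- a) <= nu a.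
Proof.
case: snu => n0 _ nM nC; rewrite -mulN1r (le_trans (nM _ _)) // ler_piMl //.
by rewrite -(rmorph1 iota) -rmorphN (le_trans (nC _)) // normrN1.
Qed.

Definition cau (u : nat -> A) := forall e, 0 < e -> exists N, forall i j,
  (N <= i)%N -> (N <= j)%N -> nu (u i - u j) < e.

Lemma cau_cst a : cau (fun=> a).
Proof. by move=> e e0; exists 0%N => i j _ _; rewrite subrr nu0. Qed.

Lemma cauD u v : cau u -> cau v -> cau (fun k => u k + v k).
Proof.
case: snu => _ nD _ _ hu hv e e0; have e2 : 0 < e / 2 by rewrite divr_gt0.
have [N hN] := hu _ e2; have [M hM] := hv _ e2.
exists (maxn N M) => i j; rewrite !geq_max => /andP[i1 i2] /andP[j1 j2].
rewrite opprD addrACA [e]splitr; apply: le_lt_trans (nD _ _) _.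
by rewrite ltrD ?hN ?hM.
Qed.

Lemma cau_bounded u : cau u -> exists2 M, 0 <= M & forall k, nu (u k) <= M.
Proof.
case: snu => n0 nD _ _ hu; have [N hN] := hu _ ltr01.
exists (nu (u N) + 1 + \sum_(i < N) nu (u i)) => [|k].
  by rewrite !addr_ge0 ?sumr_ge0.
case: (ltnP k N) => hk.
  rewrite (bigD1 (Ordinal hk)) //= [X in _ <= X]addrCA lerDl.
  by rewrite !addr_ge0 ?sumr_ge0.
apply: (@le_trans _ _ (nu (u N) + 1)); last by rewrite lerDl sumr_ge0.
rewrite -[u k](subrK (u N)) addrC (le_trans (nD _ _)) // lerD2l.
by rewrite ltW // hN.
Qed.

Lemma cauM u v : cau u -> cau v -> cau (fun k => u k * v k).
Proof.
case: snu => n0 nD nM _ hu hv e e0.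
have [A1 A10 hA] := cau_bounded hu; have [B1 B10 hB] := cau_bounded hv.
have A0 : 0 < A1 + 1 by rewrite ltr_wpDl.
have B0 : 0 < B1 + 1 by rewrite ltr_wpDl.
have [N hN] := hu (e / 2 / (B1 + 1)) ltac:(by rewrite !divr_gt0).
have [M hM] := hv (e / 2 / (A1 + 1)) ltac:(by rewrite !divr_gt0).
exists (maxn N M) => i j; rewrite !geq_max => /andP[i1 i2] /andP[j1 j2].
have -> : u i * v i - u j * v j = u i * (v i - v j) + (u i - u j) * v j by ring.
have := hN i j i1 j1; rewrite ltr_pdivlMr // => h1.
have := hM i j i2 j2; rewrite ltr_pdivlMr // => h2.
rewrite [e]splitr; apply: le_lt_trans (nD _ _) _.
apply: ler_ltD.
  apply: le_trans _ (ltW h2); rewrite (le_trans (nM _ _)) // mulrC ler_wpM2l //.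
  by rewrite (le_trans (hA _)) // lerDl.
apply: le_lt_trans _ h1; rewrite (le_trans (nM _ _)) // ler_wpM2l //.
by rewrite (le_trans (hB _)) // lerDl.
Qed.

Lemma cauX u n : cau u -> cau (fun k => u k ^+ n).
Proof.
move=> hu; elim: n => [|n IH]; first exact: cau_cst.
have := cauM hu IH; congr cau; apply/funext => k; by rewrite exprS.
Qed.

Lemma cau_sum I (s : seq I) (u : I -> nat -> A) :
  (forall i, cau (u i)) -> cau (fun k => \sum_(i <- s) u i k).
Proof.
move=> hu; elim: s => [|i s IH].
  have := cau_cst 0; congr cau; apply/funext => k; by rewrite big_nil.
have := cauD (hu i) IH; congr cau; apply/funext => k; by rewrite big_cons.
Qed.

Lemma cau_evA n (p : mP R n) (Q : nat -> nat -> A) :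
  (forall i, (i < n)%N -> cau (Q i)) -> cau (fun k => evA iota (fun i => Q i k) n p).
Proof.
elim: n p => [|n IH] p h; first exact: cau_cst.
have -> : (fun k => evA iota (fun i => Q i k) n.+1 p) =
   (fun k => \sum_(j < size (p : {poly mP R n}))
      evA iota (fun i => Q i k) n (p : {poly mP R n})`_j * Q n k ^+ j).
  by apply/funext => k; rewrite evAS.
apply: cau_sum => j; apply: cauM; first by apply: IH => i hi; apply: h; rewrite ltnW.
by apply: cauX; apply: h.
Qed.

Lemma cau_shift u K : cau u -> cau (fun k => u (k + K)%N).
Proof.
move=> h e e0; have [N hN] := h _ e0; exists N => i j hi hj; apply: hN.
  by rewrite (leq_trans hi) ?leq_addr.
by rewrite (leq_trans hj) ?leq_addr.
Qed.

End Cauchy.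

Lemma tends_ev n (p : mP R n) (w : nat -> nat -> R) (w0 : nat -> R) :
  (forall i, (i < n)%N -> tends (w i) (w0 i)) ->
  tends (fun k => ev (fun i => w i k) n p) (ev w0 n p).
Proof.
elim: n p => [|n IH] p h; first exact: tends_cst.
rewrite /ev evAS.
have -> : (fun k => evA (idfun : {rmorphism R -> R}) (fun i => w i k) n.+1 p) =
   (fun k => \sum_(j < size (p : {poly mP R n}))
      ev (fun i => w i k) n (p : {poly mP R n})`_j * w n k ^+ j).
  by apply/funext => k; rewrite evAS.
elim: (index_enum _) => [|j s IHs].
  rewrite big_nil; apply: tends_ext (tends_cst _) => k; by rewrite big_nil.
rewrite big_cons; apply: tends_ext; first by move=> k; rewrite big_cons.
apply: tendsD IHs; apply: tendsM; first by apply: IH => i hi; apply: h; rewrite ltnW.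
by apply: tendsX; apply: h.
Qed.

Lemma cau_tends (u : nat -> R) : cau (Num.norm : R -> R) u -> exists l, tends u l.
Proof.
move=> hu; have [M M0 hM] := cau_bounded (seminorm_R R) hu.
(* Eventual lower bounds: their supremum is the lower limit of [u]. *)
pose S := [set x : R | exists N, forall k, (N <= k)%N -> x <= u k]%classic.
have hS : has_sup S.
  split.
    exists (- M), 0%N => k _; have := hM k; rewrite ler_norml; by case/andP.
  exists M => x [N hN]; apply: le_trans (hN N (leqnn _)) _.
  exact: le_trans (ler_norm _) (hM N).
exists (sup S) => e e0; have e2 : 0 < e / 2 by rewrite divr_gt0.
have [N hN] := hu _ e2; exists N => k hk.
have h1 : u k - e / 2 <= sup S.
  apply: ub_le_sup; first by case: hS.
  exists N => j hj; have := hN k j hk hj; rewrite ltr_norml; lra.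
have h2 : sup S <= u k + e / 2.
  apply: ge_sup; first by case: hS.
  move=> x [L hL]; apply: le_trans (hL (maxn L N) (leq_maxl _ _)) _.
  have := hN k (maxn L N) hk (leq_maxr _ _); rewrite ltr_norml; lra.
rewrite ltr_norml; lra.
Qed.

End Limits.

(** * The ring of analytic germs and substitution *)

Section Analytic.
Variable R : realType.
Implicit Types (r s v : nat -> R) (f g : (nat -> R) -> R).

Definition pcau n r (P : nat -> mP R n) := cau (@nrm R r n) P.

Definition repr n r (P : nat -> mP R n) f :=
  pcau r P /\ forall v, box n r v -> tends (fun k => ev v n (P k)) (f v).

(* Germs at 0 of analytic functions, as limits of polynomials that are Cauchy for a
   weighted l1 norm; only the first n entries of the argument matter near 0. *)
Definition An n f := exists r P, (forall i, 0 < r i) /\ repr (n := n) r P f.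

Lemma box_le n r s v : (forall i, r i <= s i) -> box n r v -> box n s v.
Proof. by move=> rs h i hi; apply: le_trans (rs i); apply: h. Qed.

Lemma pos_ge0 r : (forall i, 0 < r i) -> forall i, 0 <= r i.
Proof. by move=> h i; apply: ltW. Qed.
Hint Resolve pos_ge0 : core.

Lemma repr_le n r s (P : nat -> mP R n) f : (forall i, 0 < r i) ->
  (forall i, r i <= s i) -> repr s P f -> repr r P f.
Proof.
move=> r0 rs [hc hv]; split; last by move=> v hb; apply: hv; apply: box_le hb.
move=> e e0; have [N hN] := hc _ e0; exists N => i j hi hj.
by apply: le_lt_trans (hN i j hi hj); apply: nrm_le => //; apply: pos_ge0.
Qed.

Lemma repr_ext n r (P : nat -> mP R n) f g :
  (forall v, box n r v -> f v = g v) -> repr r P f -> repr r P g.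
Proof. by move=> h [hc hv]; split=> // v hb; rewrite -h //; apply: hv. Qed.

Lemma repr_shift n r (P : nat -> mP R n) f K :
  repr r P f -> repr r (fun k => P (k + K)%N) f.
Proof.
move=> [hc hv]; split; first exact: cau_shift.
by move=> v hb; apply: (@tends_shift _ (fun k => ev v n (P k))); apply: hv.
Qed.

Lemma An_local n r f g : (forall i, 0 < r i) -> (forall v, box n r v -> f v = g v) ->
  An n f -> An n g.
Proof.
move=> r0 h [s [P [s0 hP]]]; exists (fun i => Num.min (r i) (s i)), P.
have m0 i : 0 < Num.min (r i) (s i) by rewrite lt_min r0 s0.
split=> //; apply: (@repr_ext _ _ _ f).
  by move=> v hv; apply: h; apply: box_le hv => i; rewrite ge_min lexx.
by apply: repr_le hP => // i; rewrite ge_min lexx orbT.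
Qed.

Lemma An_ext n f g : (forall v, f v = g v) -> An n f -> An n g.
Proof. by move=> /funext ->. Qed.

Lemma An_cst n c : An n (fun=> c).
Proof.
exists (fun=> 1), (fun=> cst R n c); split=> //; split.
  by apply: cau_cst; apply: seminorm_mP => i; apply: ler01.
by move=> v _; rewrite /ev evA_cst; apply: tends_cst.
Qed.

Lemma An_var n i : (i < n)%N -> An n (fun v => v i).
Proof.
move=> hi; exists (fun=> 1), (fun=> var R n i); split=> //; split.
  by apply: cau_cst; apply: seminorm_mP => j; apply: ler01.
by move=> v _; rewrite /ev evA_var //; apply: tends_cst.
Qed.

Lemma An_common n f g : An n f -> An n g -> exists r P Q, (forall i, 0 < r i) /\
  (repr (n := n) r P f /\ repr (n := n) r Q g).
Proof.
move=> [r [P [r0 hP]]] [s [Q [s0 hQ]]]; exists (fun i => Num.min (r i) (s i)), P, Q.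
have m0 i : 0 < Num.min (r i) (s i) by rewrite lt_min r0 s0.
split=> //; split.
  by apply: repr_le hP => // i; rewrite ge_min lexx.
by apply: repr_le hQ => // i; rewrite ge_min lexx orbT.
Qed.

Lemma AnD n f g : An n f -> An n g -> An n (fun v => f v + g v).
Proof.
move=> hf hg; have [r [P [Q [r0 [[c1 v1] [c2 v2]]]]]] := An_common hf hg.
exists r, (fun k => P k + Q k); split=> //; split.
  by apply: cauD => //; apply: seminorm_mP; apply: pos_ge0.
move=> v hv; apply: tends_ext (tendsD (v1 v hv) (v2 v hv)) => k.
by rewrite rmorphD.
Qed.

Lemma AnM n f g : An n f -> An n g -> An n (fun v => f v * g v).
Proof.
move=> hf hg; have [r [P [Q [r0 [[c1 v1] [c2 v2]]]]]] := An_common hf hg.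
exists r, (fun k => P k * Q k); split=> //; split.
  by apply: (cauM (seminorm_mP n (pos_ge0 r0))).
move=> v hv; apply: tends_ext (tendsM (v1 v hv) (v2 v hv)) => k.
by rewrite rmorphM.
Qed.

Lemma AnN n f : An n f -> An n (fun v => - f v).
Proof. by move=> hf; apply: An_ext (AnM (An_cst n (-1)) hf) => v; rewrite mulN1r. Qed.

Lemma AnB n f g : An n f -> An n g -> An n (fun v => f v - g v).
Proof. by move=> hf hg; apply: AnD => //; apply: AnN. Qed.

Lemma AnX n f k : An n f -> An n (fun v => f v ^+ k).
Proof.
move=> hf; elim: k => [|k IH]; first by apply: An_ext (An_cst n 1) => v; rewrite expr0.
by apply: An_ext (AnM hf IH) => v; rewrite exprS.
Qed.

Lemma An_sum n I (s : seq I) (p : pred I) (f : I -> (nat -> R) -> R) :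
  (forall i, p i -> An n (f i)) -> An n (fun v => \sum_(i <- s | p i) f i v).
Proof.
move=> hf; elim: s => [|i s IH].
  by apply: An_ext (An_cst n 0) => v; rewrite big_nil.
case hi: (p i).
  by apply: An_ext (AnD (hf i hi) IH) => v; rewrite big_cons hi.
by apply: An_ext IH => v; rewrite big_cons hi.
Qed.

Lemma box0 n r : (forall i, 0 < r i) -> box n r (fun=> 0).
Proof. by move=> r0 i _; rewrite normr0 ltW. Qed.

Lemma repr_bounded n r (P : nat -> mP R n) f : (forall i, 0 < r i) ->
  repr r P f -> exists2 M, 0 < M & forall k, nrm r (P k) <= M.
Proof.
move=> r0 [hc _]; have [M M0 hM] := cau_bounded (seminorm_mP n (pos_ge0 r0)) hc.
by exists (M + 1) => [|k]; rewrite ?ltr_wpDl // (le_trans (hM k)) // lerDl.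
Qed.

(** Shrinking the radii by [th] reduces everything but the constant terms, and these tend to
    [f 0 = 0], so dropping finitely many approximants makes them small too. This is what allows a
    germ vanishing at 0 to be substituted into another one. *)
Lemma An_small n f (e : R) : An n f -> f (fun=> 0) = 0 -> 0 < e ->
  exists r P, [/\ forall i, 0 < r i, repr (n := n) r P f & forall k, nrm r (P k) <= e].
Proof.
move=> [r [P [r0 hP]]] f0 e0.
have [M M0 hM] := repr_bounded r0 hP.
have [N hN] : exists N, forall k, (N <= k)%N -> `|ev (fun=> 0) n (P k)| < e / 2.
  have [N hN] := (hP.2 _ (box0 r0)) (e / 2) ltac:(by rewrite divr_gt0).
  by exists N => k /hN; rewrite f0 subr0.
pose th := Num.min 1 (e / 2 / M).
have th0 : 0 < th by rewrite lt_min ltr01 !divr_gt0.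
have th1 : th <= 1 by rewrite ge_min lexx.
exists (fun i => th * r i), (fun k => P (k + N)%N); split.
- by move=> i; rewrite mulr_gt0.
- apply: (@repr_le _ _ r) => [i|i|]; rewrite ?mulr_gt0 ?ler_piMl //; first exact: ltW.
  exact: repr_shift.
move=> k; apply: le_trans (nrm_scale (th := th) _ _ _) _ => //.
- exact: pos_ge0.
- by rewrite ltW.
rewrite [e]splitr; apply: lerD; first by rewrite ltW // hN // leq_addl.
apply: (@le_trans _ _ (th * M)); first by rewrite ler_wpM2l // ltW.
by rewrite -ler_pdivlMr // ge_min lexx orbT.
Qed.

Lemma minr_seq n (r : nat -> R) : (forall i, 0 < r i) ->
  exists2 d, 0 < d & forall i, (i < n)%N -> d <= r i.
Proof.
move=> r0; elim: n => [|n [d d0 hd]]; first by exists 1.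
exists (Num.min d (r n)); first by rewrite lt_min d0 r0.
move=> i; rewrite ltnS leq_eqVlt => /orP[/eqP ->|/hd h]; first by rewrite ge_min lexx orbT.
by rewrite ge_min h.
Qed.

Lemma repr_lim_bound n r (P : nat -> mP R n) f (M : R) v : repr r P f ->
  (forall k, nrm r (P k) <= M) -> box n r v -> `|f v| <= M.
Proof.
move=> [_ hv] hM hb; apply: (@tends_le _ _ _ 0%N _ (hv v hb)) => k _.
exact: le_trans (ev_bound _ hb) (hM k).
Qed.

Lemma An_cont0 n f (e : R) : An n f -> 0 < e -> exists2 d, 0 < d &
  forall v, (forall i, (i < n)%N -> `|v i| <= d) -> `|f v - f (fun=> 0)| <= e.
Proof.
move=> hf e0.
have hg : An n (fun v => f v - f (fun=> 0)) by apply: AnB hf (An_cst _ _).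
have [|r [P [r0 hP hM]]] := An_small hg _ e0; first by rewrite subrr.
have [d d0 hd] := minr_seq n r0; exists d => // v hv.
apply: (repr_lim_bound hP hM) => i hi; exact: le_trans (hv i hi) (hd i hi).
Qed.

Lemma An_common_small n m (y : nat -> (nat -> R) -> R) (r : nat -> R) :
  (forall i, 0 < r i) -> (forall i, (i < n)%N -> An m (y i) /\ y i (fun=> 0) = 0) ->
  exists s, (forall i, 0 < s i) /\ exists Q : nat -> nat -> mP R m,
    forall i, (i < n)%N -> repr s (Q i) (y i) /\ forall k, nrm s (Q i k) <= r i.
Proof.
move=> r0; elim: n => [|n IH] hy.
  by exists (fun=> 1); split=> //; exists (fun _ _ => 0).
have [|s [s0 [Q hQ]]] := IH; first by move=> i hi; apply: hy; rewrite ltnW.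
have [hyn yn0] := hy n (ltnSn n).
have [s' [P [s'0 hP hM]]] := An_small hyn yn0 (r0 n).
pose m' i := Num.min (s i) (s' i).
have m0 i : 0 < m' i by rewrite lt_min s0 s'0.
have ms i : m' i <= s i by rewrite ge_min lexx.
have ms' i : m' i <= s' i by rewrite ge_min lexx orbT.
exists m'; split=> //; exists (fun i => if i == n then P else Q i) => i.
rewrite ltnS leq_eqVlt; case: eqP => [->|_] /= h.
  split; first exact: repr_le hP.
  by move=> k; apply: le_trans (hM k); apply: nrm_le => //; apply: pos_ge0.
have [h1 h2] := hQ i h; split; first exact: repr_le h1.
by move=> k; apply: le_trans (h2 k); apply: nrm_le => //; apply: pos_ge0.
Qed.

(** The approximants can be composed because those of the inner germs have norms at most the radii
    of [f]: replacing [P k] by [P N] then costs at most the norm of [P k - P N], and substitution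
    into the fixed polynomial [P N] is continuous. *)
Lemma An_subst n m f (y : nat -> (nat -> R) -> R) : An n f ->
  (forall i, (i < n)%N -> An m (y i) /\ y i (fun=> 0) = 0) ->
  An m (fun v => f (fun i => y i v)).
Proof.
move=> [r [P [r0 hP]]] hy.
have [s [s0 [Q hQ]]] := An_common_small r0 hy.
have snu := seminorm_mP m (pos_ge0 s0).
exists s, (fun k => evA (cst R m) (fun i => Q i k) n (P k)); split=> //; split.
  move=> e e0; have e3 : 0 < e / 3 by rewrite divr_gt0.
  have [N hN] := hP.1 _ e3.
  have [M hM] : exists M, forall i j, (M <= i)%N -> (M <= j)%N ->
      nrm s (evA (cst R m) (fun l => Q l i) n (P N) - evA (cst R m) (fun l => Q l j) n (P N)) < e / 3.
    apply: (cau_evA snu (P N) (Q := Q)) e3 => i hi; exact: (hQ i hi).1.1.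
  have key k : (N <= k)%N ->
      nrm s (evA (cst R m) (fun l => Q l k) n (P k) - evA (cst R m) (fun l => Q l k) n (P N)) < e / 3.
    move=> hk; rewrite -rmorphB; apply: le_lt_trans (hN k N hk (leqnn _)).
    apply: (evA_bound _ snu) => i hi; exact: (hQ i hi).2.
  exists (maxn N M) => i j; rewrite !geq_max => /andP[i1 i2] /andP[j1 j2].
  have h1 := key i i1; have h2 := key j j1; have h3 := hM i j i2 j2.
  have g1 := nrm_dist (pos_ge0 s0) (evA (cst R m) (fun l => Q l i) n (P i))
     (evA (cst R m) (fun l => Q l j) n (P j)) (evA (cst R m) (fun l => Q l i) n (P N)).
  have g2 := nrm_dist (pos_ge0 s0) (evA (cst R m) (fun l => Q l i) n (P N))
     (evA (cst R m) (fun l => Q l j) n (P j)) (evA (cst R m) (fun l => Q l j) n (P N)).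
  have g3 := nrmN s (evA (cst R m) (fun l => Q l j) n (P N) - evA (cst R m) (fun l => Q l j) n (P j)).
  rewrite opprB in g3; lra.
move=> v hv e e0; have e3 : 0 < e / 3 by rewrite divr_gt0.
have [N hN] := hP.1 _ e3.
have hw : forall i, (i < n)%N -> tends (fun k => ev v m (Q i k)) (y i v).
  by move=> i hi; apply: (hQ i hi).1.2.
have bw : box n r (fun i => y i v).
  by move=> i hi; apply: (repr_lim_bound (hQ i hi).1 (hQ i hi).2).
have [M hM] := tends_ev (P N) (w := fun i k => ev v m (Q i k)) hw e3.
exists (maxn N M) => k; rewrite geq_max => /andP[k1 k2].
have -> : ev v m (evA (cst R m) (fun i => Q i k) n (P k))
     = ev (fun i => ev v m (Q i k)) n (P k).
  by apply: evA_comp => c; apply: evA_cst.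
have h1 : `|ev (fun i => ev v m (Q i k)) n (P k) - ev (fun i => ev v m (Q i k)) n (P N)| < e / 3.
  rewrite -rmorphB; apply: le_lt_trans (hN k N k1 (leqnn _)).
  apply: ev_bound => i hi; apply: le_trans (ev_bound _ hv) _; exact: (hQ i hi).2.
have h2 := hM k k2.
have h3 : `|ev (fun i => y i v) n (P N) - f (fun i => y i v)| <= e / 3.
  have ht := tendsD (tends_cst (ev (fun i => y i v) n (P N))) (tendsN (hP.2 _ bw)).
  apply: (@tends_le _ _ _ N _ ht) => j hj; rewrite -rmorphB.
  apply: ltW; apply: le_lt_trans (hN N j (leqnn _) hj); exact: ev_bound.
have g1 := ler_distD (ev (fun i => ev v m (Q i k)) n (P N)) (ev (fun i => ev v m (Q i k)) n (P k)) (f (fun i => y i v)).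
have g2 := ler_distD (ev (fun i => y i v) n (P N)) (ev (fun i => ev v m (Q i k)) n (P N)) (f (fun i => y i v)).
lra.
Qed.

End Analytic.

(** * Taylor expansion in the last variable and the identity principle *)

Section Taylor.
Variable R : realType.
Implicit Types (r s v : nat -> R) (f g : (nat -> R) -> R).

Lemma repr_lim n r (P : nat -> mP R n) : (forall i, 0 < r i) -> pcau r P ->
  exists f, repr r P f /\ forall v w, (forall i, (i < n)%N -> v i = w i) -> f v = f w.
Proof.
move=> r0 hc.
have /choice [f hf] : forall v, exists l : R,
    box n r v -> tends (fun k => ev v n (P k)) l.
  move=> v.
  case: (pselect (box n r v)) => hb; last by exists 0.
  have [|l hl] := @cau_tends _ (fun k => ev v n (P k)).
    move=> e e0; have [N hN] := hc _ e0; exists N => i j hi hj.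
    by rewrite -rmorphB; apply: le_lt_trans (hN i j hi hj); apply: ev_bound.
  by exists l.
(* Resetting the entries of index at least [n] makes the limit depend on the first [n] entries
   everywhere, not only on the box. *)
pose cut v i : R := if (i < n)%N then v i else 0.
exists (fun v => f (cut v)); split.
  split=> // v hv; have hcut : box n r (cut v) by move=> i hi; rewrite /cut hi hv.
  apply: tends_ext (hf _ hcut) => k; apply: evA_ext => i hi.
  by rewrite /cut hi.
move=> v w h; congr f; apply/funext => i; rewrite /cut; case: ifP => // hi.
exact: h.
Qed.

Lemma pcau_lin n m r s (L : mP R n -> mP R m) (c : R) (P : nat -> mP R n) : 0 < c ->
  (forall p q, L (p - q) = L p - L q) -> (forall p, nrm s (L p) * c <= nrm r p) ->
  pcau r P -> pcau s (fun k => L (P k)).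
Proof.
move=> c0 hL hn hc e e0; have [N hN] := hc (e * c) ltac:(by rewrite mulr_gt0).
exists N => i j hi hj; rewrite -hL -(ltr_pM2r c0).
exact: le_lt_trans (hn _) (hN i j hi hj).
Qed.

Lemma nrm_take_drop r n d (p : {poly mP R n}) :
  nrm r (p : mP R n.+1) =
  nrm r (take_poly d p : mP R n.+1) + nrm r (drop_poly d p : mP R n.+1) * r n ^+ d.
Proof.
rewrite (@nrmS_wide _ _ _ p (d + size p)) ?leq_addl //.
rewrite (@nrmS_wide _ _ _ (take_poly d p) d) ?size_take_poly //.
rewrite (@nrmS_wide _ _ _ (drop_poly d p) (size p)); last first.
  by rewrite size_drop_poly leq_subr.
rewrite big_split_ord /=; congr (_ + _).
  by apply: eq_bigr => i _; rewrite coef_take_poly ltn_ord.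
rewrite mulr_suml; apply: eq_bigr => i _.
by rewrite coef_drop_poly addnC exprD mulrA.
Qed.

Lemma nrm_take r n d (p : {poly mP R n}) : (forall i, 0 <= r i) ->
  nrm r (take_poly d p : mP R n.+1) <= nrm r (p : mP R n.+1).
Proof.
move=> r0; rewrite (nrm_take_drop r d p) lerDl.
by rewrite mulr_ge0 ?exprn_ge0 ?nrm_ge0.
Qed.

Lemma nrm_drop r n d (p : {poly mP R n}) : (forall i, 0 <= r i) ->
  nrm r (drop_poly d p : mP R n.+1) * r n ^+ d <= nrm r (p : mP R n.+1).
Proof. by move=> r0; rewrite (nrm_take_drop r d p) lerDr nrm_ge0. Qed.

Lemma drop_polyB n d (p q : {poly mP R n}) :
  drop_poly d (p - q) = drop_poly d p - drop_poly d q.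
Proof. by apply/polyP => i; rewrite coefB !coef_drop_poly coefB. Qed.

Lemma evS_take_drop v n d (p : {poly mP R n}) :
  ev v n.+1 p = \sum_(i < d) ev v n p`_i * v n ^+ i + ev v n.+1 (drop_poly d p) * v n ^+ d.
Proof.
rewrite -[in LHS](poly_take_drop d p) rmorphD rmorphM rmorphXn; congr (_ + _ * _ ^+ _).
  rewrite /take_poly poly_def rmorph_sum; apply: eq_bigr => i _.
  rewrite -mul_polyC rmorphM rmorphXn; congr (_ * _ ^+ _).
    exact: evA_polyC.
  exact: evA_polyX.
exact: evA_polyX.
Qed.

(** Extracting a coefficient and dropping the low degrees are bounded linear maps for [nrm], so they
    turn the Cauchy sequence [P] into Cauchy sequences; their limits are the coefficients and the
    remainders, and the identity passes to the limit. *)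
Lemma taylor n r (P : nat -> mP R n.+1) f : (forall i, 0 < r i) -> repr r P f ->
  exists a h : nat -> (nat -> R) -> R,
  [/\ forall i, repr r (fun k => (P k : {poly mP R n})`_i) (a i),
      forall d, repr r (fun k => drop_poly d (P k : {poly mP R n}) : mP R n.+1) (h d) &
      forall d v, box n.+1 r v ->
        f v = \sum_(i < d) a i v * v n ^+ i + h d v * v n ^+ d].
Proof.
move=> r0 [hc hv].
have r0' := pos_ge0 r0.
have ca i : pcau r (fun k => (P k : {poly mP R n})`_i).
  apply: (@pcau_lin _ _ r r (fun p : mP R n.+1 => (p : {poly mP R n})`_i) (r n ^+ i)) hc.
  - by rewrite exprn_gt0.
  - by move=> p q; rewrite coefB.
  - by move=> p; apply: nrm_coef.
have ch d : pcau r (fun k => drop_poly d (P k : {poly mP R n}) : mP R n.+1).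
  apply: (@pcau_lin _ _ r r (fun p : mP R n.+1 => drop_poly d (p : {poly mP R n}) : mP R n.+1) (r n ^+ d)) hc.
  - by rewrite exprn_gt0.
  - by move=> p q; rewrite drop_polyB.
  - by move=> p; apply: nrm_drop.
have /choice [a /all_and2[ha _]] := fun i => repr_lim r0 (ca i).
have /choice [h /all_and2[hh _]] := fun i => repr_lim r0 (ch i).
exists a, h; split=> // d v hb.
apply: (tends_uniq (hv v hb)).
apply: (@tends_ext _ (fun k => \sum_(i < d) ev v n (P k : {poly mP R n})`_i * v n ^+ i
   + ev v n.+1 (drop_poly d (P k : {poly mP R n})) * v n ^+ d)).
  by move=> k; rewrite -evS_take_drop.
apply: tendsD; last by apply: tendsM (tends_cst _); apply: (hh d).2.
elim: (index_enum _) => [|j s IHs].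
  rewrite big_nil; apply: tends_ext (tends_cst _) => k; by rewrite big_nil.
rewrite big_cons; apply: tends_ext; first by move=> k; rewrite big_cons.
apply: tendsD IHs; apply: tendsM (tends_cst _); apply: (ha j).2 => i hi.
by apply: hb; rewrite ltnW.
Qed.

Lemma small_pow (q : R) (e : R) : 0 <= q <= 1 / 2 -> 0 < e ->
  exists m, q ^+ m <= e.
Proof.
move=> /andP[q0 q1] e0; have [m hm] : exists m, e^-1 < m%:R.
  by exists (Num.bound e^-1); apply: archi_boundP; rewrite invr_ge0 ltW.
exists m; have : q ^+ m <= m.+1%:R^-1; last first.
  move=> h; apply: le_trans h _; rewrite -[e]invrK lef_pV2 ?posrE ?invr_gt0 //.
  by rewrite (le_trans (ltW hm)) // ler_nat.
elim: m {hm} => [|m IH]; first by rewrite expr0 invr1.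
rewrite exprS; apply: (@le_trans _ _ (1 / 2 * m.+1%:R^-1)).
  by apply: ler_pM => //; rewrite exprn_ge0.
rewrite mul1r -invfM lef_pV2 ?posrE ?mulr_gt0 // -natrM ler_nat; lia.
Qed.

(** Only the remainder of order [m] survives, so [f v] is at most [M * (|v n| / r n) ^+ m] in
    absolute value for every [m], with a ratio at most one half. *)
Lemma taylor_zero n r (P : nat -> mP R n.+1) f a h v :
  (forall i, 0 < r i) -> repr r P f ->
  (forall i, repr r (fun k => (P k : {poly mP R n})`_i) (a i)) ->
  (forall d, repr r (fun k => drop_poly d (P k : {poly mP R n}) : mP R n.+1) (h d)) ->
  (forall d v, box n.+1 r v ->
        f v = \sum_(i < d) a i v * v n ^+ i + h d v * v n ^+ d) ->
  box n.+1 r v -> `|v n| <= r n / 2 -> (forall i, a i v = 0) -> f v = 0.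
Proof.
move=> r0 hP ha hh hf hb hn h0.
have [M M0 hM] := repr_bounded r0 hP.
apply/eqP; rewrite -normr_le0; apply/ler_addgt0Pl => e e0; rewrite addr0.
have rn := r0 n.
have [|m hm] := @small_pow (`|v n| / r n) (e / M) _ (divr_gt0 e0 M0).
  apply/andP; split; first by rewrite divr_ge0 ?(ltW rn).
  by rewrite ler_pdivrMr // mul1r mulrC.
rewrite (hf m v hb) big1 ?add0r => [|i _]; last by rewrite h0 mul0r.
have hb2 : `|h m v| <= M / r n ^+ m.
  apply: (repr_lim_bound (hh m) _ hb) => k.
  rewrite ler_pdivlMr ?exprn_gt0 //; apply: le_trans (hM k).
  by apply: nrm_drop; apply: pos_ge0.
rewrite normrM normrX; apply: (@le_trans _ _ (M / r n ^+ m * `|v n| ^+ m)).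
  by rewrite ler_wpM2r ?exprn_ge0.
have -> : M / r n ^+ m * `|v n| ^+ m = M * (`|v n| / r n) ^+ m.
  by rewrite expr_div_n mulrAC mulrA.
by rewrite mulrC -ler_pdivlMr.
Qed.

End Taylor.

(** * Germs in one variable *)

Section OneVariable.
Variable R : realType.

Definition An1 (phi : R -> R) := An 1 (fun v => phi (v 0%N)).

Lemma box1 (r : nat -> R) x : `|x| <= r 0%N <-> box 1 r (fun=> x).
Proof. by split=> [h i|h]; [rewrite ltnS leqn0 => /eqP -> | apply: h]. Qed.

Lemma An1_subst n f (y : nat -> R -> R) : An n f ->
  (forall i, (i < n)%N -> An1 (y i) /\ y i 0 = 0) -> An1 (fun x => f (fun i => y i x)).
Proof. move=> hf hy; exact: (@An_subst _ _ 1 f (fun i v => y i (v 0%N)) hf hy). Qed.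

Lemma An1_id : An1 id. Proof. exact: An_var. Qed.

Lemma An1_comp phi psi : An1 phi -> An1 psi -> psi 0 = 0 -> An1 (fun x => phi (psi x)).
Proof.
move=> h1 h2 h0; exact: (@An1_subst 1 (fun v => phi (v 0%N)) (fun=> psi) h1 (fun _ _ => conj h2 h0)).
Qed.

(** Either all Taylor coefficients vanish, or the first nonzero one gives the order [m], and the
    remainder [h m] takes its value at 0. The radius in the first case is explicit because
    [line_nonzero] needs vanishing at a prescribed point, not merely near 0. *)
Lemma repr1_dich (r : nat -> R) (P : nat -> mP R 1) phi : (forall i, 0 < r i) ->
  repr r P (fun v => phi (v 0%N)) ->
  (forall x, `|x| <= r 0%N / 2 -> phi x = 0) \/
  (exists a psi, [/\ An1 psi, psi 0 <> 0 &
     exists2 d, 0 < d & forall x, `|x| <= d -> phi x = x ^+ a * psi x]).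
Proof.
move=> r0 hP.
have [a [h [ha hh hf]]] := taylor r0 hP.
have a_cst i x : a i (fun=> x) = a i (fun=> 0).
  have b0 w : box 0 r w by move=> j.
  apply: (tends_uniq ((ha i).2 _ (b0 _))).
  by apply: tends_ext ((ha i).2 (fun=> 0) (b0 _)) => k; apply: evA_ext.
have h_cst d v : box 1 r v -> h d v = h d (fun=> v 0%N).
  move=> hb; have hb' : box 1 r (fun=> v 0%N) by apply/box1; apply: hb.
  apply: (tends_uniq ((hh d).2 v hb)).
  apply: tends_ext ((hh d).2 _ hb') => k.
  by apply: evA_ext => i; rewrite ltnS leqn0 => /eqP ->.
case: (pselect (exists i, a i (fun=> 0) != 0)) => [ex|nex].
  right; have := ex_minnP ex; case=> m hm hmin.
  exists m, (fun x => h m (fun=> x)).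
  have hfx x : `|x| <= r 0%N -> phi x = x ^+ m * h m (fun=> x).
    move=> hx; have hb : box 1 r (fun=> x) by apply/box1.
    have -> := hf m _ hb; rewrite big1 ?add0r 1?mulrC // => i _.
    case: (eqVneq (a i (fun=> 0)) 0) => [ai0|]; first by rewrite a_cst ai0 mul0r.
    by move/hmin; rewrite leqNgt ltn_ord.
  split; last by exists (r 0%N).
    exists r, (fun k => drop_poly m (P k : {poly mP R 0}) : mP R 1); split=> //.
    by apply: repr_ext (hh m) => v /h_cst.
  have hb : box 1 r (fun=> 0) by apply/box1; rewrite normr0 ltW.
  have e1 := hf m.+1 (fun=> 0) hb; have e2 := hf m (fun=> 0) hb.
  have hd : h m (fun=> 0) = a m (fun=> 0).
    apply: (tends_uniq ((hh m).2 _ hb)).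
    have hb0 : box 0 r (fun=> 0) by move=> ?; rewrite ltn0.
    apply: tends_ext ((ha m).2 _ hb0) => k; rewrite (evS_take_drop _ 1).
    by rewrite big_ord1 coef_drop_poly add0n expr0 mulr1 expr1 mulr0 addr0.
  by rewrite hd; apply/eqP.
left=> x hx; have hb : box 1 r (fun=> x).
  by apply/box1; apply: le_trans hx _; rewrite ler_pdivrMr // ler_peMr ?ltW // ltr1n.
apply: (taylor_zero r0 hP ha hh hf hb hx) => i; rewrite a_cst.
by apply/eqP; apply/negPn/negP => hi; apply: nex; exists i.
Qed.

Lemma An1_dich phi : An1 phi ->
  (exists2 d, 0 < d & forall x, `|x| <= d -> phi x = 0) \/
  (exists a psi, [/\ An1 psi, psi 0 <> 0 &
     exists2 d, 0 < d & forall x, `|x| <= d -> phi x = x ^+ a * psi x]).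
Proof.
move=> [r [P [r0 hP]]]; case: (repr1_dich r0 hP) => h; last by right.
by left; exists (r 0%N / 2); rewrite ?divr_gt0.
Qed.

Lemma An1_cont0 phi (e : R) : An1 phi -> 0 < e -> exists2 d, 0 < d &
  forall x, `|x| <= d -> `|phi x - phi 0| <= e.
Proof.
move=> hf e0; have [d d0 hd] := An_cont0 hf e0; exists d => // x hx.
by apply: (hd (fun=> x)).
Qed.

Lemma An1_sg0 phi : An1 phi -> phi 0 != 0 -> exists2 d, 0 < d &
  forall x, `|x| <= d -> Num.sg (phi x) = Num.sg (phi 0).
Proof.
move=> hf h0; have p0 : 0 < `|phi 0| by rewrite normr_gt0.
have [d d0 hd] := An1_cont0 hf (divr_gt0 p0 (ltr0n R 2)); exists d => // x /hd.
rewrite ler_distl => /andP[h1 h2].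
case: (ltrgtP (phi 0) 0) h0 p0 h1 h2 => // hs _ _.
  by rewrite ltr0_norm // => h1 h2; rewrite !ltr0_sg //; lra.
by rewrite gtr0_norm // => h1 h2; rewrite !gtr0_sg //; lra.
Qed.

Lemma An1_sg phi : An1 phi -> exists2 d, 0 < d &
  forall x y, 0 < x <= d -> 0 < y <= d -> Num.sg (phi x) = Num.sg (phi y).
Proof.
move=> hf; case: (An1_dich hf) => [[d d0 hd]|[a [psi [h1 h2 [d d0 hd]]]]].
  exists d => // x y /andP[x0 xd] /andP[y0 yd].
  by rewrite !hd // gtr0_norm.
have [d' d'0 hd'] := An1_sg0 h1 (introN eqP h2).
exists (Num.min d d'); first by rewrite lt_min d0 d'0.
have key x : 0 < x <= Num.min d d' -> Num.sg (phi x) = Num.sg (psi 0).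
  move=> /andP[x0]; rewrite le_min => /andP[xd xd'].
  by rewrite hd ?gtr0_norm // sgrM sgrX gtr0_sg // expr1n mul1r hd' // gtr0_norm.
by move=> x y /key -> /key ->.
Qed.

Lemma expr_lip (D x y : R) k : 0 <= D -> `|x| <= D -> `|y| <= D ->
  `|x ^+ k.+1 - y ^+ k.+1| <= k.+1%:R * D ^+ k * `|x - y|.
Proof.
move=> D0 hx hy; elim: k => [|k IH]; first by rewrite !expr1 expr0 mulr1 mul1r.
have -> : x ^+ k.+2 - y ^+ k.+2 = x * (x ^+ k.+1 - y ^+ k.+1) + (x - y) * y ^+ k.+1.
  by rewrite ![_ ^+ k.+2]exprS; ring.
apply: le_trans (ler_normD _ _) _; rewrite !normrM normrX.
have -> : k.+2%:R * D ^+ k.+1 * `|x - y| =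
  D * (k.+1%:R * D ^+ k * `|x - y|) + `|x - y| * D ^+ k.+1.
  by rewrite -[k.+2]addn1 natrD exprS; ring.
apply: lerD; first exact: ler_pM.
by rewrite ler_wpM2l // lerXn2r ?nnegrE.
Qed.

(** On half the radius, the factor [k.+1] coming from a difference of powers is absorbed by
    [2 ^+ k.+1]. *)
Lemma poly_lip (r : nat -> R) (p : {poly R}) x y : 0 < r 0%N ->
  `|x| <= r 0%N / 2 -> `|y| <= r 0%N / 2 ->
  `|p.[x] - p.[y]| <= 2 / r 0%N * nrm r (p : mP R 1) * `|x - y|.
Proof.
move=> r0 hx hy; rewrite !horner_coef -sumrB nrmS.
rewrite mulr_sumr mulr_suml; apply: le_trans (ler_norm_sum _ _ _) _.
apply: ler_sum => i _; rewrite -mulrBr normrM /=.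
rewrite mulrCA -mulrA ler_wpM2l //.
case: (i : nat) => [|k].
  by rewrite !expr0 subrr normr0 !mulr_ge0 // invr_ge0 ltW.
apply: le_trans (expr_lip _ _ hx hy) _; first by rewrite divr_ge0 // ltW.
rewrite ler_wpM2r // exprS mulrA divfK ?gt_eqF // expr_div_n.
rewrite mulrCA [leRHS]mulrC ler_wpM2l ?exprn_ge0 ?(ltW r0) //.
rewrite ler_pdivrMr ?exprn_gt0 // -exprS -natrX ler_nat.
by apply: ltnW; apply: ltn_expl.
Qed.

Lemma An1_lip phi : An1 phi -> exists2 K, 0 < K & exists2 d, 0 < d &
  forall x y, `|x| <= d -> `|y| <= d -> `|phi x - phi y| <= K * `|x - y|.
Proof.
move=> [r [P [r0 hP]]]; have [M M0 hM] := repr_bounded r0 hP.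
exists (2 / r 0%N * M); first by rewrite mulr_gt0 // divr_gt0.
exists (r 0%N / 2) => [|x y hx hy]; first by rewrite divr_gt0.
have hr : r 0%N / 2 <= r 0%N by rewrite ler_pdivrMr // ler_peMr ?ltW // ltr1n.
have bx : box 1 r (fun=> x) by apply/box1; exact: le_trans hx hr.
have by_ : box 1 r (fun=> y) by apply/box1; exact: le_trans hy hr.
have h := tendsD (hP.2 _ bx) (tendsN (hP.2 _ by_)).
apply: (@tends_le _ _ _ 0%N _ h) => k _.
have evh z : ev (fun=> z) 1 (P k) = (P k : {poly R}).[z].
  by rewrite /ev evAS horner_coef.
rewrite !evh; apply: le_trans (@poly_lip r (P k) x y (r0 0%N) hx hy) _.
by rewrite ler_wpM2r // ler_wpM2l // divr_ge0 // ltW.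
Qed.

End OneVariable.

(** * Weierstrass division and preparation *)

Section Weierstrass.
Variable R : realType.
Implicit Types (r s v : nat -> R) (f g : (nat -> R) -> R).

Definition axis n (t : R) : nat -> R := fun i => if i == n then t else 0.

(** Dividing by [t ^+ a] leaves a bound on [psi t] that tends to 0 with [t]. *)
Lemma An1_flat (psi : R -> R) a b (C e : R) : An1 psi -> (a < b)%N -> 0 < e ->
  (forall t, 0 < t <= e -> `|t ^+ a * psi t| <= C * t ^+ b) -> psi 0 = 0.
Proof.
move=> hpsi ab e0 h; apply/eqP; rewrite -normr_le0; apply/ler_addgt0Pl => x x0.
rewrite addr0; have x2 : 0 < x / 2 by rewrite divr_gt0.
have [d d0 hd] := An1_cont0 hpsi x2.
have C0 : 0 < `|C| + 1 by rewrite ltr_wpDl.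
pose t := Num.min (Num.min e d) (Num.min 1 (x / 2 / (`|C| + 1))).
have t0 : 0 < t by rewrite !lt_min e0 d0 ltr01 divr_gt0.
have /and3P[te td /andP[t1 tx]] :
  [&& t <= e, t <= d, t <= 1 & t <= x / 2 / (`|C| + 1)] by rewrite !ge_min !lexx ?orbT.
have h1 := h t; rewrite t0 te in h1; move/(_ isT): h1.
have td' : `|t| <= d by rewrite gtr0_norm.
have := hd t td'.
set k := (b - a.+1)%N.
have -> : C * t ^+ b = t ^+ a * (C * (t * t ^+ k)).
  by rewrite -(subnKC ab) exprD exprS; ring.
rewrite normrM normrX (gtr0_norm t0) ler_pM2l ?exprn_gt0 // => h2 h1.
have h3 : `|psi t| <= x / 2.
  apply: le_trans h1 _; apply: le_trans (ler_norm _) _; rewrite !normrM normrX (gtr0_norm t0).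
  apply: (@le_trans _ _ (t * `|C|)).
    by rewrite mulrCA ler_wpM2l ?(ltW t0) // ler_piMr // exprn_ile1 // ltW.
  apply: (@le_trans _ _ (t * (`|C| + 1))); first by rewrite ler_wpM2l ?(ltW t0) // lerDl.
  by rewrite -ler_pdivlMr.
have := ler_distD (psi t) 0 (psi 0); rewrite !sub0r !normrN; lra.
Qed.

Lemma An1_horner (p : {poly R}) : An1 (fun x => p.[x]).
Proof.
apply: (@An_ext _ _ (fun v => \sum_(i < size p) p`_i * v 0%N ^+ i)).
  by move=> v; rewrite horner_coef.
by apply: An_sum => i _; apply: AnM; [apply: An_cst | apply/AnX/An_var].
Qed.

Lemma poly_flat (p : {poly R}) d (C e : R) : (size p <= d)%N -> 0 < e ->
  (forall t, 0 < t <= e -> `|p.[t]| <= C * t ^+ d) -> p = 0.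
Proof.
move=> hs e0 h; apply/eqP/negPn/negP => p0.
have [m [q hq hp]] := multiplicity_XsubC p 0.
have q00 : q.[0] != 0 by move: hq; rewrite p0 /= /root.
have q0 : q != 0 by apply: contraNneq q00 => ->; rewrite horner0.
have md : (m < d)%N.
  apply: leq_trans hs; rewrite hp subr0 size_mulXn // -[ltnLHS]addn0 ltn_add2l.
  by rewrite size_poly_gt0.
move/eqP: q00; apply.
apply: (@An1_flat (fun x => q.[x]) m d C e (An1_horner q) md e0) => t /h.
by rewrite hp subr0 hornerM hornerXn mulrC.
Qed.

Section Iteration.
Variables (n d : nat) (s : nat -> R) (s0 : forall i, 0 < s i).
Let rho := s n ^+ d.
Let rho0 : 0 < rho. Proof. by rewrite exprn_gt0. Qed.
Let s0' := pos_ge0 s0.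

(** Successive errors in the division of [X^d] by [X^d + kap]: the current term is cut at degree
    [d], its factor [X^d] is replaced by the divisor, and the correction [- drop * kap] is the next
    term. The terms decay geometrically when [kap] is small. The high and low parts of their sum are
    the quotient and the remainder, as [wsum_id] records. *)
Fixpoint wit (kap : mP R n.+1) (j : nat) : mP R n.+1 :=
  if j is i.+1 then - ((drop_poly d (wit kap i : {poly mP R n}) : mP R n.+1) * kap)
  else 'X^d : {poly mP R n}.

Definition wsum (kap : mP R n.+1) (j : nat) : mP R n.+1 := \sum_(i < j) wit kap i.

Lemma nrm_drop_le (p : mP R n.+1) (b : R) : nrm s p <= b * rho ->
  nrm s (drop_poly d (p : {poly mP R n}) : mP R n.+1) <= b.
Proof.
move=> h; rewrite -(ler_pM2r rho0); exact: le_trans (nrm_drop d p s0') h.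
Qed.

Lemma wit_bound kap j : nrm s kap <= rho / 8 -> nrm s (wit kap j) <= (1 / 8) ^+ j * rho.
Proof.
move=> hk; elim: j => [|j IH].
  rewrite expr0 mul1r.
  change (wit kap 0) with ((('X : {poly mP R n}) : mP R n.+1) ^+ d).
  apply: le_trans (nrmX s0' _ d) _; rewrite lerXn2r ?nnegrE ?nrm_ge0 ?(ltW (s0 n)) //.
  by have := @nrm_var _ s s0' n.+1 n; rewrite [var _ _ _]/= eqxx.
rewrite /= nrmN; apply: le_trans (nrmM s0' _ _) _.
have -> : (1 / 8) ^+ j.+1 * rho = (1 / 8) ^+ j * (rho / 8) by rewrite exprS; field.
by apply: ler_pM => //; rewrite ?nrm_ge0 // nrm_drop_le.
Qed.

(** The divisor itself runs through a Cauchy sequence in the preparation theorem, so the dependence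
    on [kap] must be controlled too. Weakening the ratio from [1 / 8] to [1 / 2] leaves room for the
    two terms of the product rule. *)
Lemma wit_lip kap kap' j : nrm s kap <= rho / 8 -> nrm s kap' <= rho / 8 ->
  nrm s (wit kap j - wit kap' j) <= 4 * nrm s (kap - kap') * (1 / 2) ^+ j.
Proof.
move=> hk hk'; set de := nrm s (kap - kap').
have de0 : 0 <= de by apply: nrm_ge0.
elim: j => [|j IH]; first by rewrite /= subrr nrm0 expr0 mulr1 mulr_ge0.
rewrite /=; set a := drop_poly _ _; set b := drop_poly _ _.
have -> : - ((a : mP R n.+1) * kap) - - ((b : mP R n.+1) * kap') =
  - (((a - b : {poly mP R n}) : mP R n.+1) * kap + (b : mP R n.+1) * (kap - kap')).
  by rewrite mulrBl mulrBr opprK; ring.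
rewrite nrmN; apply: le_trans (nrmD s0' _ _) _.
have h1 : nrm s ((a - b : {poly mP R n}) : mP R n.+1) <= 4 * de * (1 / 2) ^+ j / rho.
  rewrite -drop_polyB; apply: nrm_drop_le; by rewrite divfK // gt_eqF.
have h2 : nrm s (b : mP R n.+1) <= (1 / 8) ^+ j by apply: nrm_drop_le; apply: wit_bound.
have h3 : nrm s (((a - b : {poly mP R n}) : mP R n.+1) * kap) <= de * (1 / 2) ^+ j.+1.
  apply: le_trans (nrmM s0' _ _) _.
  apply: (@le_trans _ _ (4 * de * (1 / 2) ^+ j / rho * (rho / 8))).
    by apply: ler_pM => //; rewrite nrm_ge0.
  rewrite exprS; have := gt_eqF rho0; move: ((1 / 2) ^+ j) => y /negbT r00.
  by rewrite (_ : _ * _ * _ / _ * _ = de * (1 / 2 * y)) //; field.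
have h4 : nrm s ((b : mP R n.+1) * (kap - kap')) <= 2 * de * (1 / 2) ^+ j.+1.
  apply: le_trans (nrmM s0' _ _) _.
  apply: (@le_trans _ _ ((1 / 8) ^+ j * de)); first by apply: ler_wpM2r.
  rewrite mulrC (_ : 2 * de * _ = de * (1 / 2) ^+ j); last by rewrite exprS; field.
  rewrite ler_wpM2l // lerXn2r ?nnegrE; lra.
apply: le_trans (lerD h3 h4) _; rewrite -mulrDl ler_wpM2r ?exprn_ge0 ?divr_ge0 //; lra.
Qed.

Lemma wit_step kap i : wit kap i =
  (drop_poly d (wit kap i : {poly mP R n}) : mP R n.+1) * (('X^d : {poly mP R n}) + kap)
  + (take_poly d (wit kap i : {poly mP R n}) : mP R n.+1) + wit kap i.+1.
Proof.
rewrite /= mulrDr; set a := drop_poly _ _.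
rewrite -[LHS](poly_take_drop d (wit kap i : {poly mP R n})) -/a.
set b := take_poly _ _; change ((b : mP R n.+1) + (a : mP R n.+1) * ('X^d : {poly mP R n}) =
 (a : mP R n.+1) * ('X^d : {poly mP R n}) + (a : mP R n.+1) * kap + b - (a : mP R n.+1) * kap).
by ring.
Qed.

Lemma drop_poly_sum (F : nat -> {poly mP R n}) j :
  drop_poly d (\sum_(i < j) F i) = \sum_(i < j) drop_poly d (F i).
Proof.
apply/polyP => k; rewrite coef_drop_poly !coef_sum; apply: eq_bigr => i _.
by rewrite coef_drop_poly.
Qed.

Lemma take_poly_sum (F : nat -> {poly mP R n}) j :
  take_poly d (\sum_(i < j) F i) = \sum_(i < j) take_poly d (F i).
Proof.
apply/polyP => k; rewrite coef_take_poly !coef_sum; case: ifP => hk.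
  by apply: eq_bigr => i _; rewrite coef_take_poly hk.
by rewrite big1 // => i _; rewrite coef_take_poly hk.
Qed.

Lemma wsum_id kap j : ('X^d : {poly mP R n}) =
  (drop_poly d (wsum kap j : {poly mP R n}) : mP R n.+1) * (('X^d : {poly mP R n}) + kap)
  + (take_poly d (wsum kap j : {poly mP R n}) : mP R n.+1) + wit kap j.
Proof.
rewrite /wsum drop_poly_sum take_poly_sum; elim: j => [|j IH].
  by rewrite !big_ord0 mul0r !add0r.
rewrite !big_ord_recr /= {1}IH {1}(wit_step kap j) -/(wit kap j.+1).
move: (\sum_(i < j) drop_poly _ _) (\sum_(i < j) take_poly _ _) => u w.
set x := 'X^d + kap; set y := drop_poly _ _; set z := take_poly _ _.
set q := wit _ _.
change ((u : mP R n.+1) * x + w + ((y : mP R n.+1) * x + z + q) =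
   ((u : mP R n.+1) + y) * x + ((w : mP R n.+1) + z) + q).
by ring.
Qed.

Lemma geo_sum l j : \sum_(l <= i < j) (1 / 2 : R) ^+ i <= 2 * (1 / 2) ^+ l.
Proof.
have key m : \sum_(l <= i < l + m) (1 / 2 : R) ^+ i + 2 * (1 / 2) ^+ (l + m) = 2 * (1 / 2) ^+ l.
  elim: m => [|m IH]; first by rewrite addn0 big_geq // add0r.
  rewrite addnS big_nat_recr ?leq_addr //= -IH -addrA exprS; congr (_ + _); by field.
case: (leqP l j) => h; last by rewrite big_geq ?(ltnW h) // mulr_ge0 ?exprn_ge0 ?divr_ge0.
by rewrite -(key (j - l)%N) subnKC // lerDl mulr_ge0 // exprn_ge0 ?divr_ge0.
Qed.

Lemma wsum_tail kap l j : nrm s kap <= rho / 8 ->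
  nrm s (\sum_(l <= i < j) wit kap i) <= 2 * (1 / 2) ^+ l * rho.
Proof.
move=> hk; apply: le_trans (nrm_sum s0' _ _ _) _.
apply: (@le_trans _ _ (\sum_(l <= i < j) (1 / 2) ^+ i * rho)).
  apply: ler_sum => i _; apply: le_trans (wit_bound i hk) _.
  by rewrite ler_wpM2r ?(ltW rho0) // lerXn2r ?nnegrE; lra.
by rewrite -mulr_suml ler_wpM2r ?geo_sum // ltW.
Qed.

(** The two sums differ both in the divisor and in the number of steps, as do the terms of the
    diagonal sequence used in [weierstrass]. *)
Lemma wsum_sub kap kap' l j : (l <= j)%N -> nrm s kap <= rho / 8 -> nrm s kap' <= rho / 8 ->
  nrm s (wsum kap j - wsum kap' l) <= 8 * nrm s (kap - kap') + 2 * (1 / 2) ^+ l * rho.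
Proof.
move=> lj hk hk'; rewrite /wsum -!(big_mkord xpredT) (big_cat_nat (leq0n l) lj) //=.
rewrite addrAC -sumrB; apply: le_trans (nrmD s0' _ _) _.
apply: lerD; last exact: wsum_tail.
apply: le_trans (nrm_sum s0' _ _ _) _.
apply: (@le_trans _ _ (\sum_(0 <= i < l) 4 * nrm s (kap - kap') * (1 / 2) ^+ i)).
  by apply: ler_sum => i _; apply: wit_lip.
rewrite -mulr_sumr; have := geo_sum 0 l; rewrite expr0 => h.
have : 0 <= 4 * nrm s (kap - kap') by rewrite mulr_ge0 ?nrm_ge0.
move=> h0; apply: le_trans (ler_wpM2l h0 h) _; lra.
Qed.

End Iteration.

End Weierstrass.

Section MonicForm.
Variable R : realType.
Implicit Types (r s v : nat -> R) (f g : (nat -> R) -> R).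

Lemma repr_indep n r (P : nat -> mP R n) f v w : repr r P f ->
  box n r v -> (forall i, (i < n)%N -> v i = w i) -> f v = f w.
Proof.
move=> [_ h] hv e; have hw : box n r w by move=> i hi; rewrite -e // hv.
apply: (tends_uniq (h v hv)); apply: tends_ext (h w hw) => k.
by apply: evA_ext => i hi; rewrite e.
Qed.

Lemma nrm_ext r s n (p : mP R n) : (forall i, (i < n)%N -> r i = s i) -> nrm r p = nrm s p.
Proof.
elim: n p => [|n IH] p h //; rewrite !nrmS h //; apply: eq_bigr => k _.
by rewrite IH // => i hi; rewrite h // ltnW.
Qed.

Lemma ev_take v n d (p : {poly mP R n}) :
  ev v n.+1 (take_poly d p : mP R n.+1) = \sum_(i < d) ev v n p`_i * v n ^+ i.
Proof.
rewrite (evS_take_drop v d) (_ : drop_poly d (take_poly d _) = 0); last first.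
  apply/polyP => i; rewrite coef_drop_poly coef_take_poly coef0.
  by rewrite ltnNge leq_addl.
rewrite rmorph0 mul0r addr0; apply: eq_bigr => i _.
by rewrite coef_take_poly ltn_ord.
Qed.

Lemma tends_pow (q : R) : 0 <= q <= 1 / 2 -> tends (fun k => q ^+ k) 0.
Proof.
move=> hq e e0; have [m hm] := small_pow hq (divr_gt0 e0 (ltr0n R 2)).
have /andP[q0 q1] := hq.
exists m => k mk; rewrite subr0 ger0_norm ?exprn_ge0 //.
apply: (@le_lt_trans _ _ (q ^+ m)); last by lra.
by rewrite -(subnKC mk) exprD ler_piMr ?exprn_ge0 // exprn_ile1 //; lra.
Qed.

Lemma tends_sum I (l : seq I) (u : I -> nat -> R) (a : I -> R) :
  (forall i, tends (u i) (a i)) ->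
  tends (fun k => \sum_(i <- l) u i k) (\sum_(i <- l) a i).
Proof.
move=> h; elim: l => [|i l IH].
  by rewrite big_nil; apply: tends_ext (tends_cst _) => k; rewrite big_nil.
by rewrite big_cons; apply: tends_ext (tendsD (h i) IH) => k; rewrite big_cons.
Qed.

Lemma tends_norm (u : nat -> R) a : tends u a -> tends (fun k => `|u k|) `|a|.
Proof.
move=> h e e0; have [N hN] := h e e0; exists N => k /hN.
by apply: le_lt_trans; rewrite ler_dist_dist.
Qed.

Lemma axis_box n r t : (forall i, 0 < r i) -> `|t| <= r n -> box n.+1 r (axis n t).
Proof. by move=> r0 h i _; rewrite /axis; case: eqP => [->|_] //; rewrite normr0 ltW. Qed.

(** Along the axis the terms of degree below [d] form a polynomial that is O(t^d), hence zero. If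
    the coefficient of degree [d] vanished as well, the expansion would be O(t^(d+1)), against
    [psi 0 != 0]. *)
Lemma regular_coef n g d psi (e : R) r (P : nat -> mP R n.+1) (A h : nat -> (nat -> R) -> R) :
  (forall i, 0 < r i) -> repr r P g ->
  (forall i, repr r (fun k => (P k : {poly mP R n})`_i) (A i)) ->
  (forall d, repr r (fun k => drop_poly d (P k : {poly mP R n}) : mP R n.+1) (h d)) ->
  (forall d v, box n.+1 r v -> g v = \sum_(i < d) A i v * v n ^+ i + h d v * v n ^+ d) ->
  An1 psi -> psi 0 != 0 -> 0 < e ->
  (forall t, `|t| <= e -> g (axis n t) = t ^+ d * psi t) ->
  (forall i, (i < d)%N -> A i (fun=> 0) = 0) /\ A d (fun=> 0) != 0.
Proof.
move=> r0 hP hA hh hg hpsi psi0 e0 hge.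
have [M M0 hM] := repr_bounded r0 hP.
have [e1 e10 he1] := An1_cont0 hpsi ltr01.
pose e' := Num.min (Num.min e e1) (r n).
have e'0 : 0 < e' by rewrite !lt_min e0 e10 r0.
have axn t : axis n t n = t by rewrite /axis eqxx.
have Aax i t : `|t| <= r n -> A i (axis n t) = A i (fun=> 0).
  move=> ht; apply: (repr_indep (hA i)) => [j hj|j hj]; last by rewrite /axis ltn_eqF.
  by apply: (axis_box r0 ht); rewrite ltnW.
pose Mh := M / r n ^+ d.+1.
have hhb t : `|t| <= r n -> `|h d.+1 (axis n t)| <= Mh.
  move=> ht; apply: (repr_lim_bound (hh d.+1) _ (axis_box r0 ht)) => k.
  rewrite ler_pdivlMr ?exprn_gt0 //; apply: le_trans (hM k).
  by apply: nrm_drop; apply: pos_ge0.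
have key t : 0 < t <= e' -> [/\ `|psi t| <= `|psi 0| + 1, `|h d.+1 (axis n t)| <= Mh, 0 < t &
    t ^+ d * psi t = \sum_(i < d) A i (fun=> 0) * t ^+ i + A d (fun=> 0) * t ^+ d
      + h d.+1 (axis n t) * t ^+ d.+1].
  move=> /andP[t0]; rewrite !le_min => /andP[/andP[te te1] tr].
  have nt : `|t| = t by rewrite gtr0_norm.
  split=> //; last 1 first.
  - rewrite -hge ?nt // (hg d.+1); last by apply: axis_box; rewrite ?nt.
    rewrite axn big_ord_recr /= Aax ?nt //; congr (_ + _ + _).
    by apply: eq_bigr => i _; rewrite Aax ?nt.
  - rewrite -[psi t](subrK (psi 0)) addrC; apply: le_trans (ler_normD _ _) _.
    by rewrite lerD2l he1 // nt.
  by apply: hhb; rewrite nt.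
have p0 : \poly_(i < d) A i (fun=> 0) = 0.
  apply: (@poly_flat _ _ d (`|psi 0| + 1 + `|A d (fun=> 0)| + Mh * e') e'); rewrite ?size_poly //.
  move=> t ht; have [h1 h2 t0 h3] := key t ht; have /andP[_ te'] := ht.
  rewrite horner_poly.
  have -> : \sum_(i < d) A i (fun=> 0) * t ^+ i = t ^+ d * (psi t - A d (fun=> 0) - h d.+1 (axis n t) * t).
    have -> : t ^+ d * (psi t - A d (fun=> 0) - h d.+1 (axis n t) * t) =
      t ^+ d * psi t - A d (fun=> 0) * t ^+ d - h d.+1 (axis n t) * t ^+ d.+1 by rewrite exprS; ring.
    by rewrite h3; ring.
  rewrite normrM normrX gtr0_norm // mulrC ler_wpM2r ?exprn_ge0 ?(ltW t0) //.
  apply: le_trans (ler_normB _ _) _; apply: lerD.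
    by apply: le_trans (ler_normB _ _) _; rewrite lerD2r.
  by rewrite normrM (gtr0_norm t0); apply: ler_pM => //; apply: ltW.
have Ai i : (i < d)%N -> A i (fun=> 0) = 0.
  by move=> hi; have := congr1 (fun p : {poly R} => p`_i) p0; rewrite coef_poly hi coef0.
split=> //; apply/eqP => Ad0.
move/eqP: psi0; apply; apply: (@An1_flat _ psi d d.+1 Mh e') => // t ht.
have [h1 h2 t0 h3] := key t ht.
rewrite h3 Ad0 mul0r addr0 big1 ?add0r => [|i _]; last by rewrite Ai ?mul0r.
by rewrite normrM ler_pM // normrX gtr0_norm.
Qed.

(** The unit of the preparation theorem is positive up to the sign of [c], so only signs are
    compared. The coefficients ignore the entries of index at least [n] for all arguments, because
    curve selection later changes the last entry. *)
Lemma weierstrass n g d psi (e : R) : An n.+1 g -> An1 psi -> psi 0 != 0 -> 0 < e ->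
  (forall t, `|t| <= e -> g (axis n t) = t ^+ d * psi t) ->
  exists a c s, [/\ c != 0, forall i, 0 < s i,
    forall i, (i < d)%N -> [/\ An n (a i), a i (fun=> 0) = 0 &
       forall v w, (forall k, (k < n)%N -> v k = w k) -> a i v = a i w] &
    forall v, box n.+1 s v ->
      Num.sg (v n ^+ d + \sum_(i < d) a i v * v n ^+ i) = Num.sg c * Num.sg (g v)].
Proof.
move=> [r [P [r0 hP]]] hpsi psi0 e0 hge.
have r0' := pos_ge0 r0.
have [M M0 hM] := repr_bounded r0 hP.
have [A [h [hA hh hg]]] := taylor r0 hP.
have [Ai Ad] := regular_coef r0 hP hA hh hg hpsi psi0 e0 hge.
set c := A d (fun=> 0) in Ad.
(* Normalised so that the coefficient of [X^d] at the origin tends to 1; what is left is small on a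
   suitable polydisc. *)
pose kap k : mP R n.+1 := cst R n.+1 c^-1 * P k - ('X^d : {poly mP R n}).
have snu := seminorm_mP n.+1 r0'.
have nX (s : nat -> R) : (forall i, 0 <= s i) -> nrm s (('X^d : {poly mP R n}) : mP R n.+1) <= s n ^+ d.
  move=> s0; change ('X^d : {poly mP R n}) with ((('X : {poly mP R n}) : mP R n.+1) ^+ d).
  apply: le_trans (nrmX s0 _ d) _; rewrite lerXn2r ?nnegrE ?nrm_ge0 //.
  by have := @nrm_var _ s s0 n.+1 n; rewrite [var _ _ _]/= eqxx.
pose M2 := `|c^-1| * M + r n ^+ d.
have M20 : 0 < M2 by rewrite ltr_wpDl ?exprn_gt0 // mulr_ge0 // ltW.
have hM2 k : nrm r (kap k) <= M2.
  apply: le_trans (nrmB r0' _ _) _; apply: lerD; last exact: nX.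
  by apply: le_trans (nrmM r0' _ _) _; rewrite nrm_cst ler_wpM2l.
pose M3 := M2 / r n ^+ d.+1.
have M30 : 0 < M3 by rewrite divr_gt0 // exprn_gt0.
(* The last radius is fixed first, to make the terms of degree above [d] small against [rh ^+ d];
   only then are the other radii shrunk by [th], to do the same for the terms of degree at most
   [d]. *)
pose rh := Num.min (r n) (1 / (16 * M3)).
have rh0 : 0 < rh by rewrite lt_min r0 divr_gt0 // mulr_gt0.
pose rd := rh ^+ d.
have rd0 : 0 < rd by rewrite exprn_gt0.
pose th := Num.min 1 (rd / 32 / M2).
have th0 : 0 < th by rewrite lt_min ltr01 !divr_gt0.
pose s i := if i == n then rh else th * r i.
have s0 i : 0 < s i by rewrite /s; case: ifP => // _; rewrite mulr_gt0.
have s0' := pos_ge0 s0.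
have sr i : s i <= r i.
  rewrite /s; case: eqP => [->|_]; first by rewrite ge_min lexx.
  by rewrite ler_piMl // ge_min lexx.
have sn : s n = rh by rewrite /s eqxx.
(* The values at the origin of the coefficients of degree at most [d], which shrinking the radii
   cannot reduce. They tend to 0 by [regular_coef] below [d], and by the normalisation in degree
   [d]. *)
pose E k := \sum_(i < d.+1) `|ev (fun=> 0) n (kap k : {poly mP R n})`_i| * rh ^+ i.
have hE : tends E 0.
  have -> : 0 = \sum_(i < d.+1) `|c^-1 * A i (fun=> 0) - (i == d :> nat)%:R| * rh ^+ i.
    rewrite big_ord_recr /= eqxx -/c mulVf // subrr normr0 mul0r addr0 big1 // => i _.
    by rewrite Ai // mulr0 (ltn_eqF (ltn_ord i)) subrr normr0 mul0r.
  apply: tends_sum => i; apply: tendsM (tends_cst _); apply: tends_norm.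
  have b0 : box n r (fun=> 0) by apply: box0.
  apply: tends_ext (tendsD (tendsM (tends_cst c^-1) ((hA i).2 _ b0)) (tends_cst _)) => k.
  rewrite /kap coefB; change ((cst R n.+1 c^-1 : {poly mP R n})) with ((cst R n c^-1)%:P).
  rewrite coefCM coefXn rmorphB rmorphM /= /ev evA_cst rmorph_nat.
  by [].
have [K hK] := hE (rd / 32) ltac:(by rewrite divr_gt0).
have kb k : nrm s (kap (k + K)%N) <= s n ^+ d / 8.
  have := hK (k + K)%N (leq_addl _ _); rewrite subr0 => hEk.
  have {hEk} hEk : E (k + K)%N <= rd / 32.
    by apply: ltW; apply: le_lt_trans hEk; apply: ler_norm.
  set p : {poly mP R n} := kap (k + K)%N.
  have hdrop : nrm s (drop_poly d.+1 p : mP R n.+1) * rh ^+ d.+1 <= rd / 16.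
    have h1 : nrm s (drop_poly d.+1 p : mP R n.+1) <= M3.
      apply: le_trans (nrm_le _ s0' sr) _.
      rewrite ler_pdivlMr ?exprn_gt0 //; apply: le_trans (nrm_drop _ _ r0') _; exact: hM2.
    have h2 : rh * M3 <= 1 / 16.
      have h0 : rh <= 1 / (16 * M3) by rewrite ge_min lexx orbT.
      have : rh * (16 * M3) <= 1 by rewrite -ler_pdivlMr // mulr_gt0.
      by move: (rh) (M3) => x y; lra.
    rewrite exprS mulrA -/rd (@le_trans _ _ (M3 * rh * rd)) //.
      by rewrite ler_wpM2r ?(ltW rd0) // ler_wpM2r // ltW.
    have -> : rd / 16 = 1 / 16 * rd by ring.
    by rewrite ler_wpM2r ?(ltW rd0) // mulrC.
  have htake : nrm s (take_poly d.+1 p : mP R n.+1) <= rd / 16.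
    rewrite (@nrmS_wide _ _ _ _ d.+1) ?size_take_poly // sn.
    have h1 (i : 'I_d.+1) : nrm s (take_poly d.+1 p)`_i * rh ^+ i <=
       `|ev (fun=> 0) n p`_i| * rh ^+ i + th * (nrm r p`_i * r n ^+ i).
      rewrite coef_take_poly ltn_ord (@nrm_ext _ (fun j => th * r j)); last first.
        by move=> j hj; rewrite /s ltn_eqF.
      apply: (@le_trans _ _ ((`|ev (fun=> 0) n p`_i| + th * nrm r p`_i) * rh ^+ i)).
        rewrite ler_wpM2r ?exprn_ge0 ?(ltW rh0) //; apply: nrm_scale => //.
        by rewrite (ltW th0) ge_min lexx.
      rewrite mulrDl lerD2l -mulrA ler_wpM2l ?(ltW th0) // ler_wpM2l ?nrm_ge0 //.
      by rewrite lerXn2r ?nnegrE ?(ltW rh0) ?(ltW (r0 n)) // ge_min lexx.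
    apply: le_trans (ler_sum _ (fun i _ => h1 i)) _; rewrite big_split /= -mulr_sumr.
    have h2 : \sum_(i < d.+1) nrm r p`_i * r n ^+ i <= M2.
      apply: le_trans (hM2 (k + K)%N); apply: le_trans (nrm_take d.+1 p r0').
      rewrite (@nrmS_wide _ _ _ _ d.+1) ?size_take_poly //.
      by apply: ler_sum => i _; rewrite coef_take_poly ltn_ord.
    have h3 : th * (\sum_(i < d.+1) nrm r p`_i * r n ^+ i) <= rd / 32.
      apply: le_trans (ler_wpM2l (ltW th0) h2) _.
      by rewrite -ler_pdivlMr // ge_min lexx orbT.
    have := lerD hEk h3; rewrite -/(E _); lra.
  rewrite sn -/rd (nrm_take_drop s d.+1 p) sn.
  by have := lerD htake hdrop; lra.
pose kp k := kap (k + K)%N.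
have ckp : pcau s kp.
  apply: cau_shift; apply: (@repr_le _ _ s r (fun k => kap k) (fun v => c^-1 * g v - v n ^+ d) s0 sr _).1.
  split.
    apply: (cauD snu) (cau_cst snu _); apply: (cauM snu) (cau_cst snu _) hP.1.
  move=> v hv; apply: tends_ext (tendsD (tendsM (tends_cst c^-1) (hP.2 v hv)) (tends_cst _)) => k.
  rewrite rmorphB rmorphM /ev evA_cst; congr (_ - _).
  by rewrite rmorphXn; congr (_ ^+ _); rewrite /= evA_polyX.
have snus := seminorm_mP n.+1 s0'.
have lkp v : box n.+1 s v -> tends (fun k => ev v n.+1 (kp k)) (c^-1 * g v - v n ^+ d).
  move=> hv; have hv' : box n.+1 r v by apply: box_le hv.
  apply: (@tends_shift _ (fun k => ev v n.+1 (kap k))).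
  apply: tends_ext (tendsD (tendsM (tends_cst c^-1) (hP.2 v hv')) (tends_cst _)) => k.
  rewrite rmorphB rmorphM /ev evA_cst; congr (_ - _).
  by rewrite rmorphXn; congr (_ ^+ _); rewrite /= evA_polyX.
(* Diagonal sequence: better approximations of the divisor are divided with more steps. *)
pose S k := wsum d (kp k) k.
have cS : pcau s S.
  have half : 0 <= (1 / 2 : R) <= 1 / 2 by lra.
  move=> x x0.
  have [N1 hN1] := ckp (x / 16) ltac:(by rewrite divr_gt0).
  have [N2 hN2] := tends_pow half (e := x / (8 * s n ^+ d)) ltac:(by rewrite divr_gt0 // mulr_gt0 // exprn_gt0).
  have wlog_le i j : (maxn N1 N2 <= j)%N -> (j <= i)%N -> nrm s (S i - S j) < x.
    rewrite geq_max => /andP[j1 j2] ji.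
    apply: le_lt_trans (wsum_sub s0 ji (kb i) (kb j)) _.
    have h1 := hN1 i j (leq_trans j1 ji) j1.
    have h2 := hN2 j j2; rewrite subr0 ger0_norm ?exprn_ge0 ?divr_ge0 // in h2.
    move: h2; rewrite ltr_pdivlMr ?mulr_gt0 ?exprn_gt0 // => h2.
    by move: h1 h2; rewrite /kp; move: (nrm s _) (_ ^+ j) (s n ^+ d) => y z w; lra.
  exists (maxn N1 N2) => i j hi hj; case: (leqP j i) => ij; first exact: wlog_le.
  by rewrite -opprB nrmN; apply: wlog_le => //; apply: ltnW.
pose dS k : mP R n.+1 := drop_poly d (S k : {poly mP R n}).
have cd : pcau s dS.
  apply: (@pcau_lin _ _ _ s s (fun p : mP R n.+1 => drop_poly d (p : {poly mP R n}) : mP R n.+1) (s n ^+ d)) cS.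
  - by rewrite exprn_gt0.
  - by move=> p q; rewrite drop_polyB.
  - by move=> p; apply: nrm_drop.
have [q [hq _]] := repr_lim s0 cd.
have cc i : pcau s (fun k => (S k : {poly mP R n})`_i).
  apply: (@pcau_lin _ _ _ s s (fun p : mP R n.+1 => (p : {poly mP R n})`_i) (s n ^+ i)) cS.
  - by rewrite exprn_gt0.
  - by move=> p p'; rewrite coefB.
  - by move=> p; apply: nrm_coef.
have /choice [b /all_and2[hb bind]] := fun i => repr_lim s0 (cc i).
(* The limit of [wsum_id]: division of [X^d] by [c^-1 * g], with quotient [q] and remainder of
   coefficients [b i]. *)
have ident v : box n.+1 s v -> v n ^+ d = q v * (c^-1 * g v) + \sum_(i < d) b i v * v n ^+ i.
  move=> hv.
  have lim : tends (fun=> v n ^+ d) (q v * (v n ^+ d + (c^-1 * g v - v n ^+ d)) + \sum_(i < d) b i v * v n ^+ i + 0).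
    have lw : tends (fun k => ev v n.+1 (wit d (kp k) k)) 0.
      have half : 0 <= (1 / 8 : R) <= 1 / 2 by lra.
      move=> x x0; have [N hN] := tends_pow half (e := x / s n ^+ d) ltac:(by rewrite divr_gt0 // exprn_gt0).
      exists N => k /hN; rewrite !subr0 [X in X < _ -> _]ger0_norm ?exprn_ge0 ?divr_ge0 //.
      rewrite ltr_pdivlMr ?exprn_gt0 // => h2; apply: le_lt_trans (ev_bound _ hv) _.
      exact: le_lt_trans (wit_bound s0 k (kb k)) h2.
    have ls : tends (fun k => \sum_(i < d) ev v n (S k : {poly mP R n})`_i * v n ^+ i)
        (\sum_(i < d) b i v * v n ^+ i).
      apply: tends_sum => i; apply: tendsM (tends_cst _); apply: (hb i).2 => j hj.
      by apply: hv; rewrite ltnW.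
    apply: tends_ext (tendsD (tendsD (tendsM (hq.2 v hv) (tendsD (tends_cst (v n ^+ d)) (lkp v hv))) ls) lw) => k.
    have := congr1 (ev v n.+1) (wsum_id d (kp k) k); rewrite -/(S k).
    set T1 := drop_poly d (S k); set T2 := take_poly d (S k); move: (kp k) => kk.
    rewrite (rmorphD (ev v n.+1) (_ + _) (wit d kk k)) (rmorphD (ev v n.+1) (_ * _) T2).
    rewrite rmorphM rmorphD rmorphXn (evA_polyX _ v n) => /esym; rewrite ev_take; exact.
  have -> : q v * (c^-1 * g v) = q v * (v n ^+ d + (c^-1 * g v - v n ^+ d)) by congr (_ * _); ring.
  by have := tends_uniq (tends_cst (v n ^+ d)) lim; rewrite addr0.
(* The first term [X^d] contributes exactly 1 to the quotient, and all the others together at most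
   [1 / 4]. *)
have qpos v : box n.+1 s v -> 1 / 2 <= q v <= 3 / 2.
  move=> hv.
  have hd1 k : `|ev v n.+1 (dS k.+1) - 1| <= 1 / 4.
    rewrite -(rmorph1 (ev v n.+1)) -rmorphB; apply: le_trans (ev_bound _ hv) _.
    have -> : dS k.+1 - 1 = drop_poly d ((\sum_(1 <= i < k.+1) wit d (kp k.+1) i : mP R n.+1) : {poly mP R n}) :> mP R n.+1.
      rewrite /dS /S /wsum big_ord_recl -(big_mkord xpredT (fun i => wit d (kp k.+1) i.+1)).
      rewrite big_add1 /=.
      rewrite drop_polyD addrAC (_ : drop_poly d 'X^d = 1) ?subrr ?add0r //.
      by rewrite -['X^d]mul1r drop_polyMXn_id.
    apply: (nrm_drop_le s0).
    apply: le_trans (nrm_sum s0' _ _ _) _.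
    apply: (@le_trans _ _ (\sum_(1 <= i < k.+1) (1 / 4) * (1 / 2) ^+ i * s n ^+ d)).
      rewrite big_nat_cond [leRHS]big_nat_cond; apply: ler_sum => i /andP[/andP[i1 _] _].
      apply: le_trans (wit_bound s0 i (kb _)) _.
      rewrite ler_wpM2r ?exprn_ge0 ?s0' //.
      have -> : (1 / 8 : R) = 1 / 4 * (1 / 2) by field.
      rewrite exprMn ler_wpM2r ?exprn_ge0 ?divr_ge0 // -(subnKC i1) exprD expr1.
      by rewrite ler_piMr ?divr_ge0 // exprn_ile1 //; lra.
    rewrite -mulr_suml ler_wpM2r ?exprn_ge0 ?s0' // -mulr_sumr.
    have := geo_sum R 1 k.+1; rewrite expr1; move: (\sum_(_ <= _ < _) _) => y; lra.
  have : `|q v - 1| <= 1 / 4.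
    apply: (@tends_le _ (fun k => ev v n.+1 (dS k) - 1) _ 1).
      by apply: tendsD (tends_cst _); apply: hq.2.
    by case=> // k _.
  rewrite ler_distl; lra.
(* On the axis the remainder equals [t ^+ d] times a bounded factor, while its degree is below
   [d]. *)
have b0 i : (i < d)%N -> b i (fun=> 0) = 0.
  have [e1 e10 he1] := An1_cont0 hpsi ltr01.
  pose e' := Num.min (Num.min e e1) (s n).
  have e'0 : 0 < e' by rewrite !lt_min e0 e10 s0.
  pose C := 1 + 3 / 2 * (`|c^-1| * (`|psi 0| + 1)).
  have p0 : \poly_(i < d) b i (fun=> 0) = 0.
    apply: (@poly_flat _ _ d C e'); rewrite ?size_poly //.
    move=> t /andP[t0]; rewrite !le_min => /andP[/andP[te te1] ts].
    have nt : `|t| = t by rewrite gtr0_norm.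
    have bt : box n.+1 s (axis n t) by apply: axis_box; rewrite ?nt.
    have axn : axis n t n = t by rewrite /axis eqxx.
    have := ident _ bt; rewrite axn hge ?nt // => hid.
    have -> : (\poly_(i < d) b i (fun=> 0)).[t] = t ^+ d * (1 - q (axis n t) * (c^-1 * psi t)).
      rewrite horner_poly.
      have -> : \sum_(i < d) b i (fun=> 0) * t ^+ i = \sum_(i < d) b i (axis n t) * t ^+ i.
        apply: eq_bigr => j _; congr (_ * _); apply: esym; apply: (repr_indep (hb j)) => [l hl|l hl].
          by apply: bt; rewrite ltnW.
        by rewrite /axis ltn_eqF.
      rewrite mulrBr mulr1 {1}hid; ring.
    rewrite normrM normrX nt mulrC ler_wpM2r ?exprn_ge0 ?(ltW t0) //.
    apply: le_trans (ler_normB _ _) _; rewrite normr1 lerD2l !normrM.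
    apply: ler_pM; rewrite ?mulr_ge0 //.
      by have := qpos _ bt; rewrite ler_norml; lra.
    apply: ler_pM => //.
    rewrite -[psi t](subrK (psi 0)) addrC; apply: le_trans (ler_normD _ _) _.
    by rewrite lerD2l he1 // nt.
  by move=> hi; have := congr1 (fun p : {poly R} => p`_i) p0; rewrite coef_poly hi coef0.
exists (fun i v => - b i v), c, s; split=> //.
  move=> i hi; split; last 2 first.
  - by rewrite b0 ?oppr0.
  - by move=> v w hvw; rewrite (bind i v w hvw).
  apply: AnN; exists s, (fun k => (S k : {poly mP R n})`_i); split=> //; exact: hb.
move=> v hv; rewrite {1}(ident v hv).
have -> : q v * (c^-1 * g v) + \sum_(i < d) b i v * v n ^+ i + \sum_(i < d) - b i v * v n ^+ i
   = q v * (c^-1 * g v).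
  rewrite -addrA -big_split /= big1 ?addr0 // => i _; by rewrite mulNr subrr.
rewrite !sgrM sgrV gtr0_sg ?mul1r //; by have := qpos v hv; lra.
Qed.

End MonicForm.

(** * Puiseux branches and curve selection *)

Section RootLists.
Variable R : realType.

(** Compactness of an interval in the form used throughout: the points reachable from [a] have a
    supremum, which the local hypothesis makes reachable and pushes up to [b]. *)
Lemma creeping (P : R -> R -> Prop) (a b : R) : a <= b ->
  (forall x, a <= x <= b -> exists2 e, 0 < e & forall y z, a <= y -> z <= b ->
     x - e <= y <= x -> x <= z <= x + e -> P y z) ->
  (forall x y z, P x y -> P y z -> P x z) -> P a b.
Proof.
move=> ab loc tr.
pose S := [set y : R | a <= y <= b /\ P a y]%classic.
have Sa : S a.
  split; first by rewrite lexx ab.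
  have [e e0 he] := loc a ltac:(by rewrite lexx ab).
  by apply: he => //; rewrite lexx /= ?gerBl ?lerDl ltW.
have hS : has_sup S by split; [exists a | exists b => y [/andP[]]].
pose s := sup S.
have as_ : a <= s by apply: ub_le_sup Sa; case: hS.
have sb : s <= b by apply: ge_sup; [case: hS | move=> y [/andP[]]].
have [e e0 he] := loc s ltac:(by rewrite as_ sb).
have [y Sy ys] : exists2 y, S y & s - e < y.
  by apply: sup_adherent.
have ys' : y <= s by apply: ub_le_sup Sy; case: hS.
case: Sy => /andP[ay yb] Pay.
pose z := Num.min b (s + e).
have sz : s <= z by rewrite le_min sb lerDl ltW.
have Paz : P a z.
  have zb : z <= b by rewrite /z ge_min lexx.
  have ze : z <= s + e by rewrite /z ge_min lexx orbT.
  by apply: (tr _ y) => //; apply: he => //; rewrite ?(ltW ys) ?sz.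
case: (leP b (s + e)) => h; first by move: Paz; rewrite /z min_l.
have : z <= s.
  by apply: ub_le_sup; [case: hS | split=> //; rewrite (le_trans as_ sz) /z ge_min lexx].
by rewrite /z min_r ?(ltW h) // gerDl leNgt e0.
Qed.

(* Unlike a germ in [An1], only the right half-neighbourhood of 0 is concerned. *)
Definition near0 (P : R -> Prop) := exists2 d, 0 < d & forall x, 0 < x <= d -> P x.

Lemma near0_and P Q : near0 P -> near0 Q -> near0 (fun x => P x /\ Q x).
Proof.
move=> [d d0 hd] [e e0 he]; exists (Num.min d e); first by rewrite lt_min d0 e0.
move=> x /andP[x0]; rewrite le_min => /andP[h1 h2].
by split; [apply: hd; rewrite x0 h1 | apply: he; rewrite x0 h2].
Qed.

Lemma near0_imp (P Q : R -> Prop) : (forall x, 0 < x -> P x -> Q x) -> near0 P -> near0 Q.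
Proof. by move=> h [d d0 hd]; exists d => // x hx; apply: h (hd x hx); case/andP: hx. Qed.

Lemma near0_lt d : 0 < d -> near0 (fun x => x <= d).
Proof. by move=> d0; exists d => // x /andP[]. Qed.

Lemma near0_true (P : R -> Prop) : (forall x, 0 < x -> P x) -> near0 P.
Proof. by move=> h; exists 1 => // x /andP[x0 _]; apply: h. Qed.

Lemma near0_fin (m : nat) (P : nat -> R -> Prop) :
  (forall i, (i < m)%N -> near0 (P i)) -> near0 (fun x => forall i, (i < m)%N -> P i x).
Proof.
elim: m => [|m IH] h; first by apply: near0_true.
apply: near0_imp (near0_and (IH _) (h m (ltnSn m))) => [x _ [h1 h2] i|i hi].
  by rewrite ltnS leq_eqVlt => /orP[/eqP ->|/h1].
by apply: h; rewrite ltnW.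
Qed.

Lemma near0_pow P k : (0 < k)%N -> near0 P -> near0 (fun x => P (x ^+ k)).
Proof.
move=> k0 [d d0 hd]; exists (Num.min d 1); first by rewrite lt_min d0 ltr01.
move=> x /andP[x0]; rewrite le_min => /andP[xd x1]; apply: hd.
by rewrite exprn_gt0 //= (le_trans _ xd) // ler_iXnr // ltW.
Qed.

(* [Z tau] is near 0 a finite set of analytic branches in a root of tau. *)
Definition branches (Z : R -> R -> Prop) := exists q m (xi : nat -> R -> R),
  [/\ (0 < q)%N, forall l, (l < m)%N -> An1 (xi l) &
      near0 (fun x => forall t, Z (x ^+ q) t <-> exists2 l, (l < m)%N & t = xi l x)].

Lemma branches_ext Z Z' : near0 (fun x => forall t, Z x t <-> Z' x t) ->
  branches Z -> branches Z'.
Proof.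
move=> h [q [m [xi [q0 h1 h2]]]]; exists q, m, xi; split=> //.
apply: near0_imp (near0_and (near0_pow q0 h) h2) => x _ [/= e1 /= e2] t.
exact: iff_trans (iff_sym (e1 t)) (e2 t).
Qed.

Lemma branches_pow Z k : (0 < k)%N -> branches (fun x => Z (x ^+ k)) -> branches Z.
Proof.
move=> k0 [q [m [xi [q0 h1 h2]]]]; exists (q * k)%N, m, xi; split=> //.
  by rewrite muln_gt0 q0.
by apply: near0_imp h2 => x _ h t; rewrite exprM.
Qed.

Lemma An1_pow phi k : (0 < k)%N -> An1 phi -> An1 (fun x : R => phi (x ^+ k)).
Proof.
move=> k0 h; apply: (An1_comp h); last by rewrite expr0n gtn_eqF.
apply: (@An_ext _ _ (fun v => v 0%N ^+ k)) => //; exact/AnX/An_var.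
Qed.

Lemma branches0 : branches (fun _ _ => False).
Proof.
exists 1%N, 0%N, (fun _ => id); split=> //.
by apply: near0_true => x _ t; split=> // [[]].
Qed.

Lemma branchesU Z Z' : branches Z -> branches Z' -> branches (fun x t => Z x t \/ Z' x t).
Proof.
move=> [q [m [xi [q0 h1 h2]]]] [q' [m' [xi' [q'0 h1' h2']]]].
exists (q' * q)%N, (m + m')%N,
  (fun l x => if (l < m)%N then xi l (x ^+ q') else xi' (l - m)%N (x ^+ q)); split.
- by rewrite muln_gt0 q0 q'0.
- move=> l hl; case: (ltnP l m) => hlm; first by apply: An1_pow => //; apply: h1.
  by apply: An1_pow => //; apply: h1'; move: hl hlm; lia.
apply: near0_imp (near0_and (near0_pow q'0 h2) (near0_pow q0 h2')) => x _ [/= e1 /= e2] t.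
have E1 := e1 t; have E2 := e2 t; rewrite -exprM in E1; rewrite -exprM mulnC in E2.
split.
  case=> [/E1[l hl ->]|/E2[l hl ->]].
    by exists l; rewrite ?hl // ltn_addr.
  exists (m + l)%N; first by rewrite ltn_add2l.
  by rewrite ltnNge leq_addr /= addKn.
case=> l hl; case: (ltnP l m) => hlm e; first by left; apply/E1; exists l.
by right; apply/E2; exists (l - m)%N => //; move: hl hlm; lia.
Qed.

Lemma branches_fin (T : eqType) (s : seq T) (Z : T -> R -> R -> Prop) :
  (forall c, c \in s -> branches (Z c)) ->
  branches (fun x t => exists2 c, c \in s & Z c x t).
Proof.
elim: s => [|c s IH] h.
  by apply: branches_ext branches0; apply: near0_true => x _ t; split=> // [[]].
have h1 : branches (Z c) by apply: h; rewrite mem_head.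
have h2 : branches (fun x t => exists2 c, c \in s & Z c x t).
  by apply: IH => c' hc'; apply: h; rewrite inE hc' orbT.
apply: branches_ext (branchesU h1 h2); apply: near0_true => x _ t; split.
  case=> [hz|[c' hc' hz]]; first by exists c; rewrite ?mem_head.
  by exists c' => //; rewrite inE hc' orbT.
by case=> c'; rewrite inE => /orP[/eqP -> | hc'] hz; [left|right; exists c'].
Qed.

Lemma branches_affine (Z Z' : R -> R -> Prop) (k : nat) (s : R -> R) : An1 s ->
  near0 (fun x => forall t, Z x (x ^+ k * t + s x) <-> Z' x t) ->
  branches Z' -> branches Z.
Proof.
move=> hs hz [q [m [xi [q0 h1 h2]]]].
exists q, m, (fun l x => x ^+ (q * k) * xi l x + s (x ^+ q)); split=> //.
  move=> l hl; apply: AnD (An1_pow q0 hs); apply: AnM (h1 l hl).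
  exact/AnX/An_var.
apply: near0_imp (near0_and (near0_pow q0 hz) h2) => x x0 [/= e1 /= e2] t.
have xk : x ^+ (q * k) != 0 by rewrite expf_neq0 // gt_eqF.
have -> : t = (x ^+ q) ^+ k * ((t - s (x ^+ q)) / x ^+ (q * k)) + s (x ^+ q).
  by rewrite -exprM mulrC divfK // subrK.
apply: iff_trans (e1 _) (iff_trans (e2 _) _).
split=> [[l hl e]|[l hl e]]; exists l => //.
  by rewrite e -exprM.
by move: e; rewrite -exprM => /addIr /(mulfI xk).
Qed.

Definition mono d (a : nat -> R) (t : R) := t ^+ d + \sum_(i < d) a i * t ^+ i.

Lemma mono_root_le1 d (a : nat -> R) t : \sum_(i < d) `|a i| <= 1 -> mono d a t = 0 ->
  `|t| <= 1.
Proof.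
move=> ha ht; rewrite leNgt; apply/negP => t1.
have t0 : 0 < `|t| by apply: lt_trans t1.
case: d ha ht => [|d] ha; first by rewrite /mono expr0 big_ord0 addr0 => /eqP; rewrite oner_eq0.
rewrite /mono => /eqP; rewrite addr_eq0 => /eqP h.
have : `|t| ^+ d.+1 <= `|t| ^+ d.
  rewrite -normrX h normrN; apply: le_trans (ler_norm_sum _ _ _) _.
  apply: (@le_trans _ _ (\sum_(i < d.+1) `|a i| * `|t| ^+ d)).
    apply: ler_sum => i _; rewrite normrM normrX ler_wpM2l //.
    by rewrite ler_weXn2l // ?ltW // -ltnS.
  by rewrite -mulr_suml ler_piMl // exprn_ge0.
by rewrite exprS ger_pMl ?exprn_gt0 // leNgt t1.
Qed.

Lemma mono_root_small d (a : nat -> R) t r : 0 < r -> \sum_(i < d) `|a i| <= 1 ->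
  \sum_(i < d) `|a i| < r ^+ d -> mono d a t = 0 -> `|t| < r.
Proof.
move=> r0 h1 h2 ht; have t1 := mono_root_le1 h1 ht.
rewrite ltNge; apply/negP => rt.
have : `|t| ^+ d <= \sum_(i < d) `|a i|.
  move: ht; rewrite /mono => /eqP; rewrite addr_eq0 => /eqP h.
  rewrite -normrX h normrN; apply: le_trans (ler_norm_sum _ _ _) _.
  by apply: ler_sum => i _; rewrite normrM normrX ler_piMr // exprn_ile1.
apply/negP; rewrite -ltNge; apply: lt_le_trans h2 _.
by rewrite lerXn2r ?nnegrE // ltW.
Qed.

Lemma An1_near phi (e : R) : An1 phi -> 0 < e -> near0 (fun x => `|phi x - phi 0| <= e).
Proof.
move=> h e0; have [d d0 hd] := An1_cont0 h e0; exists d => // x /andP[x0 xd].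
by apply: hd; rewrite gtr0_norm.
Qed.

Lemma sum_near d (a : nat -> R -> R) (e : R) : (forall i, (i < d)%N -> An1 (a i)) -> 0 < e ->
  near0 (fun x => \sum_(i < d) `|a i x - a i 0| <= e).
Proof.
move=> h e0; have d1 : 0 < d.+1%:R :> R by rewrite ltr0n.
have : near0 (fun x => forall i, (i < d)%N -> `|a i x - a i 0| <= e / d.+1%:R).
  by apply: near0_fin => i hi; apply: An1_near; rewrite ?divr_gt0 //; apply: h.
apply: near0_imp => x _ hx.
apply: (@le_trans _ _ (\sum_(i < d) e / d.+1%:R)); first by apply: ler_sum => i _; apply: hx.
rewrite sumr_const card_ord -[_ *+ d]mulr_natr mulrAC ler_pdivrMr // ler_wpM2l ?(ltW e0) //.
by rewrite ler_nat.
Qed.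

Lemma mono_dist d (a b : nat -> R) t B : 1 <= B -> `|t| <= B ->
  `|mono d a t - mono d b t| <= (\sum_(i < d) `|a i - b i|) * B ^+ d.
Proof.
move=> B1 tB; rewrite /mono opprD addrACA subrr add0r -sumrB mulr_suml.
apply: le_trans (ler_norm_sum _ _ _) _; apply: ler_sum => i _.
rewrite -mulrBl normrM normrX ler_wpM2l //.
apply: (@le_trans _ _ (B ^+ i)); first by rewrite lerXn2r ?nnegrE // (le_trans ler01).
by rewrite ler_weXn2l // ltnW.
Qed.

Lemma mono_root_bound d (a : nat -> R) t : mono d a t = 0 -> `|t| <= 1 + \sum_(i < d) `|a i|.
Proof.
move=> ht; rewrite leNgt; apply/negP => t1.
have S0 : 0 <= \sum_(i < d) `|a i| by apply: sumr_ge0.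
have t1' : 1 <= `|t| by apply: le_trans (ltW t1); rewrite lerDl.
have t0 : 0 < `|t| by apply: lt_le_trans t1'.
case: d ht t1 S0 => [|d]; first by rewrite /mono expr0 big_ord0 addr0 => /eqP; rewrite oner_eq0.
rewrite /mono => /eqP; rewrite addr_eq0 => /eqP h t1 S0.
have : `|t| ^+ d.+1 <= (\sum_(i < d.+1) `|a i|) * `|t| ^+ d.
  rewrite -normrX h normrN; apply: le_trans (ler_norm_sum _ _ _) _; rewrite mulr_suml.
  apply: ler_sum => i _; rewrite normrM normrX ler_wpM2l //.
  by rewrite ler_weXn2l // -ltnS.
by rewrite exprS ler_pM2r ?exprn_gt0 // leNgt (le_lt_trans _ t1) // lerDr.
Qed.

Lemma mono_poly d (a : nat -> R) t :
  mono d a t = ('X^d + \poly_(i < d) a i).[t].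
Proof. by rewrite hornerD hornerXn horner_poly. Qed.

Lemma mono_polyE d (a : nat -> R) : size ('X^d + \poly_(i < d) a i) = d.+1 /\
  'X^d + \poly_(i < d) a i \is monic.
Proof.
have hs : (size (\poly_(i < d) a i) < size ('X^d : {poly R}))%N.
  by rewrite size_polyXn ltnS size_poly.
by rewrite size_polyDl // size_polyXn monicE lead_coefDl // lead_coefXn eqxx.
Qed.

End RootLists.

(** * Puiseux's theorem for monic polynomials with analytic coefficients *)

Section Puiseux.
Variable R : realType.
Implicit Types (r s v : nat -> R) (f g : (nat -> R) -> R).

Lemma An_indep n f : An n f -> exists2 r, forall i, 0 < r i &
  forall v w, box n r v -> (forall i, (i < n)%N -> v i = w i) -> f v = f w.
Proof.
by move=> [r [P [r0 hP]]]; exists r => // v w hv e; apply: (repr_indep hP hv e).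
Qed.

Definition pairv (x t : R) : nat -> R := fun i => if i == 0%N then x else t.

(** The multiplicity [e] of the root 0 at [x = 0] is the degree of the Weierstrass polynomial, all
    of whose real roots are small. The first hypothesis is the inductive one of [puiseux] in degree
    [e]. *)
Lemma local_branches (e : nat) (g : R -> R -> R) psi (e0 : R) :
  (forall a, (forall i, (i < e)%N -> An1 (a i)) ->
     branches (fun x t => mono e (a^~ x) t = 0 :> R)) ->
  An 2 (fun v => g (v 0%N) (v 1%N)) -> An1 psi -> psi 0 != 0 -> 0 < e0 ->
  (forall t, `|t| <= e0 -> g 0 t = t ^+ e * psi t) ->
  exists2 rho, 0 < rho & branches (fun x t => `|t| <= rho /\ g x t = 0).
Proof.
move=> IH hg hpsi psi0 e00 hgt.
have [a [c [s [c0 s0 ha hs]]]] := weierstrass hg hpsi psi0 e00 hgt.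
pose al i x := a i (fun=> x).
have ga i : (i < e)%N -> An1 (al i).
  move=> /ha [h _ _]; have [r r0 hr] := An_indep h.
  apply: (@An_local _ _ r _ _ r0) h => v hv; apply: hr => // j.
  by rewrite ltnS leqn0 => /eqP ->.
have al0 i : (i < e)%N -> al i 0 = 0 by move=> /ha [].
exists (s 1%N) => //.
have hal : near0 (fun x => forall i, (i < e)%N -> forall v, v 0%N = x -> a i v = al i x).
  apply: near0_fin => i /ha [h _ _]; have [r r0 hr] := An_indep h.
  exists (r 0%N) => // x /andP[x0 xr] v vx; apply: hr => j; rewrite ltnS leqn0 => /eqP -> //.
  by rewrite vx gtr0_norm.
pose eta := Num.min 1 (s 1%N ^+ e / 2).
have eta0 : 0 < eta by rewrite lt_min ltr01 divr_gt0 // exprn_gt0.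
apply: branches_ext (IH al ga).
apply: near0_imp (near0_and (near0_and hal (near0_lt (s0 0%N))) (sum_near ga eta0)).
move=> x x0 [[h1 h2] h3] t.
have hS : \sum_(i < e) `|al i x| <= eta.
  by apply: le_trans h3; apply: ler_sum => i _; rewrite al0 // subr0.
have key : `|t| <= s 1%N -> (mono e (al^~ x) t = 0 <-> g x t = 0).
  move=> ht; have hbx : box 2 s (pairv x t).
    by move=> [|[|i]] //= _; rewrite /pairv /= ?gtr0_norm.
  have := hs _ hbx; rewrite /pairv /=.
  rewrite (_ : t ^+ e + _ = mono e (al^~ x) t); last first.
    by rewrite /mono; congr (_ + _); apply: eq_bigr => i _; rewrite (h1 i).
  move=> hsg; split=> h0.
    move: hsg; rewrite h0 sgr0 => /esym /eqP; rewrite mulf_eq0 !sgr_eq0 (negPf c0) /=.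
    by move/eqP.
  by move: hsg; rewrite h0 sgr0 mulr0 => /eqP; rewrite sgr_eq0 => /eqP.
split=> [h0|[ht h0]]; last exact/key.
have ht : `|t| < s 1%N.
  apply: (mono_root_small (s0 1%N) _ _ h0); first by rewrite (le_trans hS) // ge_min lexx.
  apply: le_lt_trans hS _; apply: (@le_lt_trans _ _ (s 1%N ^+ e / 2)).
    by rewrite ge_min lexx orbT.
  by rewrite ltr_pdivrMr // ltr_pMr ?exprn_gt0 // ltr1n.
by split; [apply: ltW | apply/key; first exact: ltW].
Qed.

Lemma An_mono n d (b : nat -> (nat -> R) -> R) f :
  (forall i, (i < d)%N -> An n (b i)) -> An n f ->
  An n (fun v => mono d (fun i => b i v) (f v)).
Proof.
move=> hb hf; apply: AnD (AnX _ hf) _; apply: An_sum => i _; apply: AnM (AnX _ hf).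
exact: hb.
Qed.

Lemma horner_near (p : {poly R}) (t0 e : R) : 0 < e -> exists2 d, 0 < d &
  forall t, `|t - t0| <= d -> `|p.[t] - p.[t0]| <= e.
Proof.
move=> e0; have [d d0 hd] := An1_cont0 (An1_horner (p \Po ('X + t0%:P))) e0.
exists d => // t /hd; rewrite !horner_comp !hornerD !hornerX !hornerC add0r subrK; exact.
Qed.

(** If the polynomial at [x = 0] is not a pure power, each of its real roots has multiplicity below
    [d], so the roots near it are handled by [local_branches] in a smaller degree. *)
Lemma branches_split d (b : nat -> R -> R) :
  (forall i, (i < d)%N -> An1 (b i)) ->
  (forall e, (e < d)%N -> forall a, (forall i, (i < e)%N -> An1 (a i)) ->
     branches (fun x t => mono e (a^~ x) t = 0 :> R)) ->
  (forall c, 'X^d + \poly_(i < d) b i 0 <> ('X - c%:P) ^+ d) ->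
  branches (fun x t => mono d (b^~ x) t = 0).
Proof.
move=> hb IH hc; set p0 := 'X^d + \poly_(i < d) b i 0 in hc.
have [sp0 mp0] := mono_polyE d (b^~ 0); rewrite -/p0 in sp0 mp0.
have p00 : p0 != 0 by rewrite -size_poly_eq0 sp0.
have hroot c : exists rho, 0 < rho /\ (root p0 c ->
    branches (fun x t => `|t - c| <= rho /\ mono d (b^~ x) t = 0)).
  case: (boolP (root p0 c)) => [rc|_]; last by exists 1.
  have [e [q hq hp]] := multiplicity_XsubC p0 c.
  have qc : q.[c] != 0 by move: hq; rewrite p00.
  have q0 : q != 0 by apply: contraNneq qc => ->; rewrite horner0.
  have hsz : d.+1 = (e + size q)%N.
    rewrite -sp0 hp size_Mmonic // ?monic_exp ?monicXsubC //.
    by rewrite size_exp_XsubC addnS /= addnC.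
  have sq0 : (0 < size q)%N by rewrite size_poly_gt0.
  have ed : (e < d)%N.
    rewrite ltn_neqAle; apply/andP; split; last by move: hsz sq0; lia.
    apply/eqP => ed; have sq1 : size q = 1%N by move: hsz; rewrite ed; lia.
    have [k k0 qk] : exists2 k, k != 0 & q = k%:P by apply/size_poly1P; rewrite sq1.
    have mq : q \is monic.
      by have := mp0; rewrite hp monicMr // monic_exp // monicXsubC.
    move: mq; rewrite qk monicE lead_coefC => /eqP k1.
    by apply: (hc c); rewrite hp qk k1 mul1r ed.
  pose g x t := mono d (b^~ x) (c + t).
  have hg : An 2 (fun v => g (v 0%N) (v 1%N)).
    apply: (@An_mono _ d (fun i v => b i (v 0%N))) => // [i hi|].
      apply: (@An_subst _ 1 2 (fun v => b i (v 0%N)) (fun _ v => v 0%N)); first exact: hb.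
      by move=> j _; split=> //; apply: An_var.
    by apply: AnD (An_cst _ _) (An_var _ _).
  have hpsi := An1_horner (q \Po ('X + c%:P)).
  have psi0 : (q \Po ('X + c%:P)).[0] != 0.
    by rewrite horner_comp hornerD hornerX hornerC add0r.
  have hgt t : `|t| <= 1 -> g 0 t = t ^+ e * (q \Po ('X + c%:P)).[t].
    move=> _; rewrite /g mono_poly -/p0 hp hornerM horner_exp !hornerE addrAC subrr add0r.
    by rewrite horner_comp !hornerE mulrC [c + t]addrC.
  have [rho rho0 hrho] := local_branches (IH e ed) hg hpsi psi0 ltr01 hgt.
  exists rho; split=> // _.
  apply: (branches_affine (k := 0) (s := fun=> c)) hrho; first exact: An_cst.
  by apply: near0_true => x _ t; rewrite expr0 mul1r addrK /g [c + t]addrC.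
have /choice [rho hrho] := hroot.
pose s := rootsR p0.
have sE c : (c \in s) = root p0 c by rewrite -(roots_on_rootsR p00) in_itv.
have hb1 : branches (fun x t => exists2 c, c \in s &
     (`|t - c| <= rho c /\ mono d (b^~ x) t = 0)).
  by apply: branches_fin => c; rewrite sE => rc; apply: (hrho c).2.
apply: branches_ext hb1.
pose B := 2 + \sum_(i < d) `|b i 0|.
have S0 : 0 <= \sum_(i < d) `|b i 0| by apply: sumr_ge0.
have B0 : 0 < B by rewrite ltr_wpDr.
have B1 : 1 <= B by rewrite /B; lra.
(* Away from the roots of [p0] a small change of the coefficients creates no root. [creeping] makes
   this uniform on [[- B, B]], and [B] bounds all roots for small [x]. *)
pose P y z := near0 (fun x => forall t, y <= t <= z -> mono d (b^~ x) t = 0 ->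
   exists2 c, c \in s & `|t - c| <= rho c).
have PB : P (- B) B.
  apply: creeping; first by rewrite ge0_cp // ltW.
    move=> t0 ht0; case: (boolP (root p0 t0)) => rt.
      exists (rho t0); first by case: (hrho t0).
      move=> y z _ _ /andP[y1 y2] /andP[z1 z2]; apply: near0_true => x _ t /andP[t1 t2] _.
      exists t0; first by rewrite sE.
      rewrite ler_distl; lra.
    have m0 : 0 < `|p0.[t0]| by rewrite normr_gt0.
    have [e e0 he] := horner_near p0 t0 (divr_gt0 m0 (ltr0n R 4)).
    exists e => // y z yB zB /andP[y1 y2] /andP[z1 z2].
    have BX : 0 < B ^+ d by rewrite exprn_gt0.
    have := sum_near hb (divr_gt0 (divr_gt0 m0 (ltr0n R 4)) BX).
    apply: near0_imp => x _; rewrite ler_pdivlMr // => hx t /andP[t1 t2] h0.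
    exfalso.
    have tB : `|t| <= B by rewrite ler_norml; lra.
    have h1 : `|p0.[t]| <= `|p0.[t0]| / 4.
      have h3 := mono_dist d (b^~ x) (b^~ 0) B1 tB.
      rewrite h0 sub0r normrN mono_poly in h3; exact: le_trans h3 hx.
    have h2 : `|p0.[t] - p0.[t0]| <= `|p0.[t0]| / 4 by apply: he; rewrite ler_distl; lra.
    have := ler_distD p0.[t] 0 p0.[t0]; rewrite !sub0r !normrN; lra.
  move=> x y z hxy hyz; apply: near0_imp (near0_and hxy hyz) => u _ [h1 h2] t /andP[t1 t2] h0.
  by case: (leP t y) => ty; [apply: h1 | apply: h2] => //; rewrite ?t1 ?t2 ?ty ?(ltW ty).
apply: near0_imp (near0_and PB (sum_near hb ltr01)) => x _ [h1 h2] t.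
split=> [[c _ []]//|h0].
have hS : \sum_(i < d) `|b i x| <= 1 + \sum_(i < d) `|b i 0|.
  apply: (@le_trans _ _ (\sum_(i < d) (`|b i x - b i 0| + `|b i 0|))).
    by apply: ler_sum => i _; rewrite -{1}[b i x](subrK (b i 0)) ler_normD.
  by rewrite big_split /= lerD2r.
have tB : `|t| <= B.
  apply: le_trans (mono_root_bound h0) _; rewrite /B; lra.
have [|c cs hcs] := h1 t _ h0; first by rewrite -ler_norml.
by exists c.
Qed.

End Puiseux.

Section PuiseuxBranches.
Variable R : realType.

Lemma XsubC_exp_coef (c : R) d : (('X - c%:P) ^+ d.+1)`_d = - (c *+ d.+1).
Proof.
have := @coefPn_prod_XsubC R (nseq d.+1 c); rewrite size_nseq !big_nseq iter_mulr_1 iter_addr_0.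
exact.
Qed.

Lemma An1_sum I (l : seq I) (F : I -> R -> R) : (forall i, An1 (F i)) ->
  An1 (fun x => \sum_(i <- l) F i x).
Proof. by move=> h; apply: (@An_sum _ 1 _ l xpredT (fun i v => F i (v 0%N))) => i _; apply: h. Qed.

Lemma An1M (f g : R -> R) : An1 f -> An1 g -> An1 (fun x => f x * g x).
Proof. exact: AnM. Qed.

Lemma An1X (f : R -> R) k : An1 f -> An1 (fun x => f x ^+ k).
Proof. exact: AnX. Qed.

Lemma An1_cst (c : R) : An1 (fun=> c).
Proof. exact: An_cst. Qed.

Lemma near0_ex (P : R -> Prop) : near0 P -> exists2 x, 0 < x & P x.
Proof. by move=> [d d0 h]; exists d => //; apply: h; rewrite d0 lexx. Qed.

(* Completing the d-th power removes the coefficient of degree d - 1. *)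
Lemma tschirnhaus d (a : nat -> R -> R) : (forall i, (i < d.+1)%N -> An1 (a i)) ->
  exists s b, [/\ An1 s, forall i, An1 (b i), forall x, b d x = 0 :> R &
    forall x t, mono d.+1 (a^~ x) (t + s x) = mono d.+1 (b^~ x) t].
Proof.
move=> ha.
pose A j x : R := if j == d.+1 then 1 else if (j < d.+1)%N then a j x else 0.
pose s x := - a d x / d.+1%:R.
pose b i x := \sum_(j < d.+2) (A j x * s x ^+ (j - i)) *+ 'C(j, i).
have hA j : An1 (A j).
  rewrite /A; case: eqP => _; first exact: An1_cst.
  by case: ltnP => h; [apply: ha | apply: An1_cst].
have hs : An1 s.
  by apply: An1M (An1_cst _); apply: (@AnN _ 1 (fun v => a d (v 0%N))); apply: ha.
have hat x t : mono d.+1 (a^~ x) t = \sum_(j < d.+2) A j x * t ^+ j.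
  rewrite big_ord_recr /= {2}/A eqxx mul1r addrC; congr (_ + _); apply: eq_bigr => i _.
  by rewrite /A ltn_eqF // ltn_ord.
have bd1 x : b d.+1 x = 1.
  rewrite /b big_ord_recr /= big1 ?add0r => [|i _]; last by rewrite bin_small.
  by rewrite /A eqxx subnn expr0 mulr1 binn.
exists s, b; split=> // [i|x|x t].
- apply: An1_sum => j.
  have h : An1 (fun x => (A j x * s x ^+ (j - i)) * 'C(j, i)%:R).
    by apply: An1M (An1_cst _); apply: An1M => //; apply: An1X.
  by apply: An_ext h => v /=; rewrite mulr_natr.
- rewrite /b !big_ord_recr /= big1 ?add0r => [|i _]; last by rewrite bin_small.
  rewrite {1}/A ltn_eqF // ltnSn subnn expr0 binn mulr1 mulr1n.
  rewrite {1}/A eqxx mul1r subSnn expr1 binSn -[_ *+ _]mulr_natr /s.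
  by rewrite divfK ?pnatr_eq0 // subrr.
rewrite hat /mono.
have -> : \sum_(j < d.+2) A j x * (t + s x) ^+ j =
   \sum_(j < d.+2) \sum_(i < d.+2) ((A j x * s x ^+ (j - i)) *+ 'C(j, i)) * t ^+ i.
  apply: eq_bigr => j _; rewrite addrC exprDn mulr_sumr.
  rewrite (big_ord_widen d.+2 (fun i => A j x * (s x ^+ (j - i) * t ^+ i *+ 'C(j, i)))) //.
  rewrite big_mkcond; apply: eq_bigr => i _; case: ltnP => hij.
    by rewrite mulrnAr mulrA mulrnAl.
  by rewrite bin_small // mulr0n mul0r.
rewrite exchange_big /= big_ord_recr /= addrC; congr (_ + _).
  by rewrite -mulr_suml -/(b d.+1 x) bd1 mul1r.
by apply: eq_bigr => i _; rewrite -mulr_suml.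
Qed.

(** Newton's polygon: once the coefficient of degree [d - 1] is removed, rescaling [t] along the
    lowest slope leaves at [x = 0] a polynomial with a nonzero lower coefficient. It is therefore
    not a pure power, and [branches_split] lowers the degree. *)
Theorem puiseux d (a : nat -> R -> R) : (forall i, (i < d)%N -> An1 (a i)) ->
  branches (fun x t => mono d (a^~ x) t = 0).
Proof.
elim/ltn_ind: d a => d IH a ha.
case: d IH ha => [|d] IH ha.
  apply: branches_ext (branches0 R); apply: near0_true => x _ t; split=> //.
  by rewrite /mono expr0 big_ord0 addr0 => /eqP; rewrite oner_eq0.
have [s [b [hs hb bd hab]]] := tschirnhaus ha.
apply: (branches_affine (k := 0) (s := s) (Z' := fun x t => mono d.+1 (b^~ x) t = 0)) => //.
  by apply: near0_true => x _ t; rewrite expr0 mul1r hab.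
(* Order and unit of each coefficient; a coefficient that is identically zero gets the unit 0, and
   [nz] tells the two cases apart. *)
have /choice [m hm] : forall i, exists mb : nat * (R -> R), [/\ An1 mb.2,
    mb.2 0 = 0 -> mb.2 = (fun=> 0) &  near0 (fun x => b i x = x ^+ mb.1 * mb.2 x)].
  move=> i; case: (An1_dich (hb i)) => [[e e0 he]|[k [psi [h1 h2 [e e0 he]]]]].
    exists (0%N, fun=> 0); split=> //=; first exact: An1_cst.
    by exists e => // x /andP[x0 xe]; rewrite mulr0 he // gtr0_norm.
  exists (k, psi); split=> //=; exists e => // x /andP[x0 xe].
  by rewrite he // gtr0_norm.
pose be i := (m i).2; pose nz i := be i 0 != 0.
have bE : near0 (fun x => forall i, (i < d.+1)%N -> b i x = x ^+ (m i).1 * be i x).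
  by apply: near0_fin => i _; case: (hm i).
have be0 i : ~~ nz i -> be i = fun=> 0 by move/negPn/eqP; case: (hm i).
have nzd : ~~ nz d.
  apply/negP => h; have [hd _ hd2] := hm d; have [e e0 he] := An1_sg0 hd h.
  have [x x0 [xe hx]] := near0_ex (near0_and (near0_lt e0) hd2).
  have := he x; rewrite gtr0_norm // => /(_ xe) /eqP.
  move: hx; rewrite bd => /esym/eqP; rewrite mulf_eq0 expf_eq0 (gt_eqF x0) andbF /=.
  by move=> /eqP ->; rewrite sgr0 eq_sym sgr_eq0 (negPf h).
case: (pickP (fun i : 'I_d.+1 => nz i)) => [i1 hi1|none]; last first.
  exists 1%N, 1%N, (fun _ _ => 0); split=> // [l _|]; first exact: An1_cst.
  apply: near0_imp bE => x x0 h t; rewrite expr1.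
  have -> : mono d.+1 (b^~ x) t = t ^+ d.+1.
    rewrite /mono big1 ?addr0 // => i _; rewrite h // be0 ?mulr0 ?mul0r //.
    by rewrite none.
  split=> [/eqP|[l _ ->]]; last by rewrite expr0n.
  by rewrite expf_eq0 /= => /eqP ->; exists 0%N.
(* Slopes of the Newton polygon: the exponent of [x] that [t] should carry for the term of index [i]
   to balance the leading one. *)
pose key (i : 'I_d.+1) : R := (m i).1%:R / (d.+1 - i)%:R.
have : exists2 i0 : 'I_d.+1, nz i0 & forall j : 'I_d.+1, nz j -> key i0 <= key j.
  by exists (Order.arg_min i1 (fun i : 'I_d.+1 => nz i) key); case: Order.TotalTheory.arg_minP.
case=> i0 hi0 hmin; pose q0 := (d.+1 - i0)%N; pose M := (m i0).1.
have q00 : (0 < q0)%N by rewrite subn_gt0.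
have hk (i : 'I_d.+1) : nz i -> (M * (d.+1 - i) <= q0 * (m i).1)%N.
  move=> /hmin; rewrite /key ler_pdivrMr ?ltr0n ?subn_gt0 //.
  rewrite mulrAC ler_pdivlMr ?ltr0n ?subn_gt0 // -!natrM ler_nat.
  by rewrite mulnC [(_ * q0)%N]mulnC mulnC.
(* Coefficients after [x] becomes [x ^+ q0], [t] becomes [x ^+ M * t] and [x ^+ (M * d.+1)] is
   divided out. Minimality of the slope is exactly what keeps the exponents natural numbers. *)
pose c i x : R := if nz i then x ^+ (q0 * (m i).1 - M * (d.+1 - i)) * be i (x ^+ q0) else 0.
apply: (branches_pow q00).
apply: (branches_affine (k := M) (s := fun=> 0) (Z' := fun x t => mono d.+1 (c^~ x) t = 0)).
- exact: An1_cst.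
- apply: near0_imp (near0_pow q00 bE) => x x0 /= h t.
  have -> : mono d.+1 (b^~ (x ^+ q0)) (x ^+ M * t + 0) = x ^+ (M * d.+1) * mono d.+1 (c^~ x) t.
    rewrite addr0 /mono mulrDr exprMn exprM; congr (_ + _).
    rewrite mulr_sumr; apply: eq_bigr => i _; rewrite h // /c.
    case: ifP => hi; last by rewrite be0 ?hi // !(mulr0, mul0r).
    have -> : (x ^+ q0) ^+ (m i).1 = x ^+ (M * (d.+1 - i)) * x ^+ (q0 * (m i).1 - M * (d.+1 - i)).
      by rewrite -exprD subnKC ?hk // exprM.
    have -> : (x ^+ M) ^+ d.+1 = x ^+ (M * (d.+1 - i)) * (x ^+ M) ^+ i.
      by rewrite -!exprM -exprD -mulnDr subnK // ltnW.
    by rewrite exprMn; ring.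
  have xn : x ^+ (M * d.+1) != 0 by rewrite expf_neq0 // gt_eqF.
  split=> [/eqP|->]; last by rewrite mulr0.
  by rewrite mulf_eq0 (negPf xn) /= => /eqP.
apply: branches_split => [i hi|e ed a' ha'|cc].
- rewrite /c; case: (nz i); last exact: An1_cst.
  by apply: An1M (An1_pow _ _) => //; [apply/An1X/An1_id | case: (hm i)].
- exact: IH.
(* A pure power of ['X - cc] has coefficient [- cc *+ d.+1] in degree [d]. As that coefficient is 0,
   so is [cc], against the nonzero coefficient of index [i0]. *)
have ci0 : c i0 0 != 0.
  by rewrite /c hi0 mulnC subnn expr0 mul1r expr0n gtn_eqF.
move=> hpoly; have := congr1 (fun p : {poly R} => p`_d) hpoly.
rewrite /= XsubC_exp_coef coefD coefXn coef_poly ltnSn ltn_eqF // {1}/c (negPf nzd) addr0.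
move=> /esym/eqP; rewrite oppr_eq0 mulrn_eq0 /= => /eqP cc0.
have := congr1 (fun p : {poly R} => p`_i0) hpoly.
rewrite /= cc0 subr0 coefD coefXn coef_poly ltn_ord ltn_eqF // add0r => /eqP.
by rewrite (negPf ci0).
Qed.

End PuiseuxBranches.

(** * Germs form an integral domain *)

Section Domain.
Variable R : realType.
Implicit Types (r s v w : nat -> R) (f g : (nat -> R) -> R).

Definition zerog n f := exists2 d, 0 < d &
  forall v, (forall i, (i < n)%N -> `|v i| <= d) -> f v = 0.

Lemma line_repr n r (P : nat -> mP R n) f v : repr r P f ->
  (forall i, (i < n)%N -> `|v i| <= r i / 2) ->
  repr (fun=> 2) (fun k => evA (cst R 1) (fun i => cst R 1 (v i) * var R 1 0) n (P k))
    (fun w => f (fun i => w 0%N * v i)).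
Proof.
move=> [hc hv] hvr.
have two0 (i : nat) : 0 <= (2 : R) by [].
have hn i : (i < n)%N -> nrm (fun=> 2) (cst R 1 (v i) * var R 1 0) <= r i.
  move=> hi; apply: le_trans (nrmM two0 _ _) _; rewrite nrm_cst.
  apply: (@le_trans _ _ (`|v i| * 2)); first by rewrite ler_wpM2l // nrm_var.
  by rewrite -ler_pdivlMr // hvr.
split.
  move=> e e0; have [N hN] := hc e e0; exists N => i j hi hj.
  rewrite -rmorphB; apply: le_lt_trans (hN i j hi hj).
  exact: (evA_bound _ (seminorm_mP 1 two0)).
move=> w hw; have hb : box n r (fun i => w 0%N * v i).
  move=> i hi; rewrite normrM; apply: (@le_trans _ _ (2 * (r i / 2))).
    by apply: ler_pM => //; [apply: hw | apply: hvr].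
  by rewrite mulrC divfK ?lexx ?pnatr_eq0.
apply: tends_ext (hv _ hb) => k.
rewrite /ev (evA_comp (jota := idfun)) => [|c]; last by apply: evA_cst.
by apply: evA_ext => i hi; rewrite rmorphM evA_cst evA_var //= mulrC.
Qed.

(** On the line through [v], the point [v] has parameter 1, half of the radius 2 supplied by
    [line_repr]; vanishing near 0 on the line would therefore reach [v]. *)
Lemma line_nonzero n f : An n f -> exists2 rho, 0 < rho &
  forall v, (forall i, (i < n)%N -> `|v i| <= rho) -> f v <> 0 ->
  exists a psi, [/\ An1 psi, psi 0 != 0 & exists2 d, 0 < d &
     forall x, `|x| <= d -> f (fun i => x * v i) = x ^+ a * psi x].
Proof.
move=> [r [P [r0 hP]]]; have [d d0 hd] := minr_seq n r0.
exists (d / 2); first by rewrite divr_gt0.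
move=> v hv fv.
have hv' i : (i < n)%N -> `|v i| <= r i / 2.
  by move=> hi; apply: le_trans (hv i hi) _; rewrite ler_wpM2r ?invr_ge0 ?hd.
have hl := line_repr hP hv'.
have [h|[a [psi [h1 /eqP h2 h3]]]] := repr1_dich (phi := fun x => f (fun i => x * v i)) (fun=> ltr0n R 2) hl.
  case: fv; rewrite -(h 1); last by rewrite normr1 divff ?pnatr_eq0 ?lexx.
  by congr f; apply/funext => i; rewrite mul1r.
by exists a, psi.
Qed.

Lemma taylor2_bound r (P : nat -> mP R 2) (h : nat -> (nat -> R) -> R) d :
  (forall i, 0 < r i) ->
  repr r (fun k => drop_poly d (P k : {poly mP R 1}) : mP R 2) (h d) ->
  exists2 M, 0 < M & forall v, box 2 r v -> `|h d v| <= M.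
Proof.
move=> r0 hh; have [M M0 hM] := repr_bounded r0 hh.
by exists M => // v hv; apply: (repr_lim_bound hh hM).
Qed.

(** Leading terms in the second variable: for a fixed small [x] at which both [f] on the axis and
    the first nonzero coefficient of [g] are nonzero, letting [y] tend to 0 in the product forces
    [A * B = 0]. *)
Lemma An2_domain f g : An 2 f -> An 2 g -> near0 (fun x => f (pairv x 0) <> 0) ->
  ~ zerog 2 g -> ~ zerog 2 (fun v => f v * g v).
Proof.
move=> hf hg hf0 hg0 [d d0 hd].
have [r [P [Q [r0 [hP hQ]]]]] := An_common hf hg.
have [a [h [ha hh hfe]]] := taylor r0 hP.
have [b [k [hb hk hge]]] := taylor r0 hQ.
have aE c (p : nat -> mP R 1) x y : `|x| <= r 0%N -> repr r p c -> c (pairv x y) = c (fun=> x).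
  move=> hx hp; apply: (repr_indep hp) => j; rewrite ltnS leqn0 => /eqP -> //.
have hb' i : repr r (fun k => (Q k : {poly mP R 1})`_i : mP R 1) (fun v => b i (fun=> v 0%N)).
  apply: repr_ext (hb i) => v hv; apply: (repr_indep (hb i) hv) => j.
  by rewrite ltnS leqn0 => /eqP ->.
have dich i := repr1_dich (phi := fun x => b i (fun=> x)) r0 (hb' i).
pose nzb i := exists a psi, [/\ An1 psi, psi 0 <> 0 &
     exists2 d, 0 < d & forall x, `|x| <= d -> b i (fun=> x) = x ^+ a * psi x].
have hr2 i : r i / 2 <= r i by rewrite ler_pdivrMr // ler_peMr ?(ltW (r0 i)) // ler1n.
have bx x y : `|x| <= r 0%N -> `|y| <= r 1%N -> box 2 r (pairv x y).
  by move=> hx hy [|[|i]].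
case: (pselect (exists i, nzb i)) => [ex|nex]; last first.
  case: hg0; exists (Num.min (r 0%N / 2) (r 1%N / 2)).
    by rewrite lt_min !divr_gt0.
  move=> v hv; have := hv 0%N isT; have := hv 1%N isT; rewrite !le_min.
  move=> /andP[_ h1] /andP[h0 _].
  have hbv : box 2 r v.
    by move=> [|[|i]] // _; [apply: le_trans h0 _ | apply: le_trans h1 _].
  apply: (taylor_zero r0 hQ hb hk hge hbv h1) => i.
  case: (dich i) => [hz|hz]; last by case: nex; exists i.
  rewrite (repr_indep (hb i) (w := fun=> v 0%N)) ?hz // => j hj.
    by apply: hbv; rewrite ltnW.
  by move: hj; rewrite ltnS leqn0 => /eqP ->.
have [m hm hmin] : exists2 m, nzb m & forall i, (i < m)%N -> ~ nzb i.
  have ex' : exists i, `[<nzb i>] by case: ex => i hi; exists i; apply/asboolP.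
  case: (ex_minnP ex') => m /asboolP hm hmin; exists m => // i im /asboolP /hmin.
  by rewrite leqNgt im.
case: hm => al [psi [hpsi psi0 [e e0 he]]].
have [e1 e10 he1] := An1_sg0 hpsi (introN eqP psi0).
have [M1 M10 hM1] := taylor2_bound r0 (hh 1%N).
have [M2 M20 hM2] := taylor2_bound r0 (hk m.+1).
have nb : near0 (fun x => b m (fun=> x) <> 0).
  apply: near0_imp (near0_and (near0_lt e0) (near0_lt e10)) => x x0 [xe xe1].
  rewrite he ?gtr0_norm // => /eqP; rewrite mulf_eq0 expf_eq0 (gt_eqF x0) andbF /=.
  have := he1 x; rewrite gtr0_norm // => /(_ xe1) hsg /eqP h0.
  by move/eqP: hsg; rewrite h0 sgr0 eq_sym sgr_eq0 => /eqP.
have r02 : 0 < r 0%N / 2 by rewrite divr_gt0.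
have [x x0 [[xr xd] [hfx hbx]]] := near0_ex (near0_and (near0_and (near0_lt r02) (near0_lt d0))
   (near0_and hf0 nb)).
have nx : `|x| = x by rewrite gtr0_norm.
have xr' : `|x| <= r 0%N by rewrite nx; apply: le_trans (hr2 _).
pose A := f (pairv x 0); pose B := b m (fun=> x).
suff AB : A * B = 0.
  by move/eqP: AB; rewrite mulf_eq0 => /orP[/eqP|/eqP].
apply/eqP; rewrite -normr_le0; apply/ler_addgt0Pl => z z0; rewrite addr0.
pose C := `|A| * M2 + M1 * (`|B| + M2) + 1.
have C0 : 0 < C by rewrite ltr_wpDl // addr_ge0 // mulr_ge0 ?addr_ge0 // ltW.
have r10 : 0 < r 1%N by [].
have [y y0 [[[y1 yr] yd] yz]] := near0_ex (near0_and (near0_and (near0_and (near0_lt ltr01) (near0_lt r10))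
   (near0_lt d0)) (near0_lt (divr_gt0 z0 C0))).
have ny : `|y| = y by rewrite gtr0_norm.
have hbxy : box 2 r (pairv x y) by apply: bx; rewrite ?nx ?ny // -nx.
have hbx0 : box 2 r (pairv x 0) by apply: bx; rewrite ?nx ?normr0 ?(ltW r10) // -nx.
have fE : f (pairv x y) = A + y * h 1%N (pairv x y).
  rewrite (hfe 1%N _ hbxy) /A (hfe 1%N _ hbx0) !big_ord1 !expr0 !mulr1 !expr1 /=.
  by rewrite mulr0 addr0 !(aE _ _ _ _ xr' (ha 0%N)) mulrC.
have gE : g (pairv x y) = y ^+ m * (B + y * k m.+1 (pairv x y)).
  rewrite (hge m.+1 _ hbxy) big_ord_recr /= big1 ?add0r => [|i _].
    by rewrite (aE _ _ _ _ xr' (hb m)) exprS -/B (_ : pairv x y 1 = y) //; ring.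
  rewrite (aE _ _ _ _ xr' (hb i)); case: (dich i) => [-> |hz]; first by rewrite mul0r.
    by rewrite nx.
  by case: (hmin i (ltn_ord i)).
have := hd (pairv x y) _; rewrite fE gE => hprod.
have {hprod} /eqP : (A + y * h 1%N (pairv x y)) * (y ^+ m * (B + y * k m.+1 (pairv x y))) = 0.
  by apply: hprod => [[|[|i]]] // _; rewrite /pairv /= ?nx ?ny.
rewrite mulrCA mulf_eq0 expf_eq0 (gt_eqF y0) andbF /= => /eqP h0.
have -> : A * B = - y * (A * k m.+1 (pairv x y) + h 1%N (pairv x y) * (B + y * k m.+1 (pairv x y))).
  move: h0; move: (k _ _) (h _ _) => p q h0.
  have -> : A * B = (A + y * q) * (B + y * p) - y * (A * p + q * (B + y * p)) by ring.
  by rewrite h0 sub0r mulNr.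
rewrite normrM normrN ny.
apply: (@le_trans _ _ (y * C)); last by rewrite -ler_pdivlMr.
rewrite ler_wpM2l ?(ltW y0) //; apply: le_trans (ler_normD _ _) _; rewrite !normrM.
have k1 := hM2 _ hbxy; have k2 := hM1 _ hbxy.
have l1 : `|A| * `|k m.+1 (pairv x y)| <= `|A| * M2 by rewrite ler_wpM2l.
have l2 : `|h 1%N (pairv x y)| * `|B + y * k m.+1 (pairv x y)| <= M1 * (`|B| + M2).
  apply: ler_pM => //; apply: le_trans (ler_normD _ _) _; rewrite lerD2l normrM ny.
  by rewrite -[leRHS]mul1r; apply: ler_pM => //; rewrite ltW.
rewrite /C; move: l1 l2; lra.
Qed.

(** Restricting to the plane spanned by a line on which [f] is nonzero and a line on which [g] is
    nonzero reduces the claim to two variables. *)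
Lemma An_domain n f g : An n f -> An n g -> ~ zerog n f -> ~ zerog n g ->
  ~ zerog n (fun v => f v * g v).
Proof.
move=> hf hg zf zg [d d0 hd].
have get h : An n h -> ~ zerog n h -> exists v a psi, [/\ An1 psi, psi 0 != 0 & exists2 d, 0 < d &
     forall x, `|x| <= d -> h (fun i => x * v i) = x ^+ a * psi x].
  move=> hh zh; have [rho rho0 hl] := line_nonzero hh.
  case: (pselect (exists2 v, (forall i, (i < n)%N -> `|v i| <= rho) & h v <> 0)) => [[v h1 h2]|nex].
    by have [a [psi h3]] := hl v h1 h2; exists v, a, psi.
  case: zh; exists rho => // v hv; apply: contrapT => h2; apply: nex; by exists v.
have [v [a [psi [h1 h2 [e e0 he]]]]] := get f hf zf.
have [w [b [chi [h3 h4 [c c0 hc]]]]] := get g hg zg.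
pose y i u := u 0%N * v i + u 1%N * w i.
have hy i : An 2 (y i) /\ y i (fun=> 0) = 0.
  split; last by rewrite /y !mul0r addr0.
  by apply: AnD; apply: AnM (An_cst _ _); apply: An_var.
have nz phi k (P : R -> R) z : An1 phi -> phi 0 != 0 -> 0 < z ->
   (forall x, `|x| <= z -> P x = x ^+ k * phi x) -> near0 (fun x => P x <> 0).
  move=> hphi phi0 z0 hP; have [e1 e10 he1] := An1_sg0 hphi phi0.
  apply: near0_imp (near0_and (near0_lt z0) (near0_lt e10)) => x x0 [xe xe1].
  rewrite hP ?gtr0_norm // => /eqP; rewrite mulf_eq0 expf_eq0 (gt_eqF x0) andbF /=.
  have := he1 x; rewrite gtr0_norm // => /(_ xe1) hsg /eqP h0.
  by move/eqP: hsg; rewrite h0 sgr0 eq_sym sgr_eq0 (negPf phi0).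
have hf2 := An_subst (y := y) hf (fun i _ => hy i).
have hg2 := An_subst (y := y) hg (fun i _ => hy i).
apply: (An2_domain hf2 hg2).
- apply: near0_imp (nz _ _ _ _ h1 h2 e0 he) => x _; rewrite (_ : (fun i => y i (pairv x 0)) = fun i => x * v i) //.
  by apply/funext => i; rewrite /y /pairv /= mul0r addr0.
- case=> z z0 hz.
  have [x x0 [xz]] := near0_ex (near0_and (near0_lt z0) (nz _ _ _ _ h3 h4 c0 hc)).
  apply; rewrite -(hz (fun i => if i == 0%N then 0 else x)).
    by congr g; apply/funext => i; rewrite /y /= mul0r add0r.
  by move=> [|i] _ /=; rewrite ?normr0 ?(ltW z0) // gtr0_norm.
pose M := \sum_(i < n) (`|v i| + `|w i|) + 1.
have S0 : 0 <= \sum_(i < n) (`|v i| + `|w i|) by apply: sumr_ge0 => i _; rewrite addr_ge0.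
have M0 : 0 < M by rewrite ltr_wpDl.
exists (d / M); first by rewrite divr_gt0.
move=> u hu; apply: hd => i hi.
have u0 := hu 0%N isT; have u1 := hu 1%N isT.
apply: le_trans (ler_normD _ _) _; rewrite !normrM.
apply: (@le_trans _ _ (d / M * (`|v i| + `|w i|))).
  by rewrite mulrDr lerD // ler_wpM2r.
rewrite mulrAC ler_pdivrMr // ler_wpM2l ?(ltW d0) // /M (bigD1 (Ordinal hi)) //= -addrA lerDl.
by rewrite addr_ge0 // sumr_ge0 // => j _; rewrite addr_ge0.
Qed.

Lemma An_prod_nonzero n N (G : nat -> (nat -> R) -> R) :
  (forall j, (j < N)%N -> An n (G j) /\ ~ zerog n (G j)) ->
  An n (fun v => \prod_(j < N) G j v) /\ ~ zerog n (fun v => \prod_(j < N) G j v).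
Proof.
elim: N => [|N IH] h.
  split; first by apply: An_ext (An_cst n 1) => v; rewrite big_ord0.
  case=> d d0 /(_ (fun=> 0)); rewrite big_ord0 => h0.
  have /eqP : 1 = 0 :> R by apply: h0 => i _; rewrite normr0 ltW.
  by rewrite oner_eq0.
have [h1 h2] := IH (fun j hj => h j (ltnW hj)); have [h3 h4] := h N (ltnSn N).
split; first by apply: An_ext (AnM h1 h3) => v; rewrite big_ord_recr.
have := An_domain h1 h3 h2 h4; apply: contra_not => -[d d0 hd]; exists d => // v /hd.
by rewrite big_ord_recr.
Qed.

End Domain.

(** * Elimination of the last variable *)

Section FibreElimination.
Variable R : realType.

Lemma horner_Poly_sum (l : seq R) (t : R) : (Poly l).[t] = \sum_(i < size l) l`_i * t ^+ i.
Proof.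
rewrite (horner_coef_wide _ (size_Poly l)); apply: eq_bigr => i _.
by rewrite coef_Poly.
Qed.

Definition is_sgn (s : R) := [|| s == -1, s == 0 | s == 1].

Lemma is_sgn_sg (x : R) : is_sgn (Num.sg x).
Proof. by rewrite /is_sgn; case: sgrP; rewrite ?eqxx ?orbT. Qed.

Lemma sg_mul_gt0 (s x : R) : is_sgn s -> s != 0 -> (0 < s * x) = (Num.sg x == s).
Proof.
rewrite /is_sgn => /or3P[/eqP->|/eqP->|/eqP->]; rewrite ?eqxx // => _.
  by rewrite mulN1r oppr_gt0 sgr_cp0.
by rewrite mul1r sgr_cp0.
Qed.

(** Variable number [j * D + i] stands for the coefficient of index [i] of the polynomial number
    [j], and the leading coefficient is the constant 1. [fenv] supplies the matching environment. *)
Definition fpoly (D d j : nat) : seq (qe_rcf.term R) :=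
  rcons [seq qe_rcf.Var R (j * D + i) | i <- iota 0 d] (qe_rcf.Const 1).

Definition fenv (N D : nat) (c : nat -> nat -> R) : seq R :=
  mkseq (fun k => c (k %/ D)%N (k %% D)%N) (N * D).

Lemma eval_fpoly N D d j c t : (j < N)%N -> (d <= D)%N ->
  (qe_rcf.eval_poly (fenv N D c) (fpoly D d j)).[t] = mono d (c j) t.
Proof.
move=> jN dD; rewrite qe_rcf.eval_polyP horner_Poly_sum size_map size_rcons size_map size_iota.
rewrite big_ord_recr /= addrC /mono (nth_map (qe_rcf.Const 0)) ?size_rcons ?size_map ?size_iota //.
rewrite nth_rcons size_map size_iota ltnn eqxx /= mul1r; congr (_ + _).
apply: eq_bigr => i _; rewrite (nth_map (qe_rcf.Const 0)); last first.
  by rewrite size_rcons size_map size_iota ltnW // ltnS ltn_ord.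
rewrite nth_rcons size_map size_iota ltn_ord (nth_map 0%N) ?size_iota // nth_iota // add0n /=.
have iD : (i < D)%N by apply: leq_trans dD.
have D0 : (0 < D)%N by apply: leq_ltn_trans iD.
rewrite nth_mkseq; last first.
  apply: (@leq_trans (j * D + D)); first by rewrite ltn_add2l.
  by rewrite addnC -mulSn leq_mul2r jN orbT.
by rewrite divnMDl // divn_small // addn0 modnMDl modn_small.
Qed.

(** Sign 0 becomes an equation and a nonzero sign [s] an inequality [0 < s * p], the input of real
    root counting. One formula serves all coefficients [c], which later vary along an arc. *)
Lemma fibre_elim N D (d : nat -> nat) (s : nat -> R) :
  (forall j, (j < N)%N -> (d j <= D)%N) -> (forall j, (j < N)%N -> is_sgn (s j)) ->
  exists Phi : qe_rcf.formula R, forall c,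
    qe_rcf.qf_eval (fenv N D c) Phi <->
    exists t, forall j, (j < N)%N -> Num.sg (mono (d j) (c j) t) = s j.
Proof.
move=> hD hs.
pose sp := [seq fpoly D (d j) j | j <- iota 0 N & s j == 0].
pose sq := [seq qe_rcf.ScalPoly (qe_rcf.Const (s j)) (fpoly D (d j) j) | j <- iota 0 N & s j != 0].
exists (qe_rcf.CcountGt0 sp sq) => c; rewrite qe_rcf.eval_CcountGt0.
split.
  move=> /qe_rcf_th.ccount_gt0P[t]; rewrite !big_all !all_map !all_filter.
  move=> /andP[/allP h1 /allP h2].
  exists t => j jN; have js : j \in iota 0 N by rewrite mem_iota.
  case: (eqVneq (s j) 0) => sj.
    have := h1 j js; rewrite /= sj eqxx eval_fpoly ?hD //= => /eqP ->.
    by rewrite sgr0.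
  have := h2 j js.
  by rewrite /= sj qe_rcf.eval_ScalPoly hornerZ eval_fpoly ?hD //= sg_mul_gt0 ?hs // => /eqP.
case=> t ht; apply/qe_rcf_th.ccount_gt0P; exists t; rewrite !big_all !all_map !all_filter.
apply/andP; split; apply/allP => j; rewrite mem_iota add0n => /andP[_ jN] /=.
  by apply/implyP => /eqP sj; rewrite eval_fpoly ?hD // -sgr_eq0 ht // sj.
apply/implyP => sj; rewrite qe_rcf.eval_ScalPoly hornerZ eval_fpoly ?hD //=.
by rewrite sg_mul_gt0 ?hs // ht.
Qed.

(** The differences whose signs decide the formula. Fixing these signs turns an arbitrary formula
    into a sign condition, the form to which the induction on the number of variables applies. *)
Fixpoint atoms (f : qe_rcf.formula R) : seq (qe_rcf.term R) :=
  match f with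
  | qe_rcf.Bool _ => [::]
  | qe_rcf.Equal a b => [:: qe_rcf.Add a (qe_rcf.Opp b)]
  | qe_rcf.Lt a b => [:: qe_rcf.Add a (qe_rcf.Opp b)]
  | qe_rcf.Le a b => [:: qe_rcf.Add a (qe_rcf.Opp b)]
  | qe_rcf.And g h => atoms g ++ atoms h
  | qe_rcf.Or g h => atoms g ++ atoms h
  | qe_rcf.Implies g h => atoms g ++ atoms h
  | qe_rcf.Not g => atoms g
  end.

Lemma qf_eval_atoms f e1 e2 :
  (forall k, (k < size (atoms f))%N ->
     Num.sg (qe_rcf.eval e1 (nth (qe_rcf.Const 0) (atoms f) k)) =
     Num.sg (qe_rcf.eval e2 (nth (qe_rcf.Const 0) (atoms f) k))) ->
  qe_rcf.qf_eval e1 f = qe_rcf.qf_eval e2 f.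
Proof.
have cat_split (l l' : seq (qe_rcf.term R)) (P : qe_rcf.term R -> Prop) :
    (forall k, (k < size (l ++ l'))%N -> P (nth (qe_rcf.Const 0) (l ++ l') k)) ->
    (forall k, (k < size l)%N -> P (nth (qe_rcf.Const 0) l k)) /\
    (forall k, (k < size l')%N -> P (nth (qe_rcf.Const 0) l' k)).
  move=> h; split=> k hk.
    by have := h k; rewrite nth_cat hk size_cat ltn_addr //; apply.
  have := h (size l + k)%N; rewrite nth_cat size_cat ltn_add2l hk.
  by rewrite ltnNge leq_addr /= addKn; apply.
elim: f => //= [a b|a b|a b|g IHg h IHh|g IHg h IHh|g IHg h IHh|g IHg].
- move=> /(_ 0%N isT) /= h; rewrite -[LHS]subr_eq0 -[RHS]subr_eq0.
  by rewrite -sgr_eq0 h sgr_eq0.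
- move=> /(_ 0%N isT) /= h; rewrite -[LHS]subr_lt0 -[RHS]subr_lt0.
  by rewrite -sgr_lt0 h sgr_lt0.
- move=> /(_ 0%N isT) /= h; rewrite -[LHS]subr_le0 -[RHS]subr_le0.
  by rewrite -sgr_le0 h sgr_le0.
- by move=> /(cat_split _ _ (fun t => Num.sg (qe_rcf.eval e1 t) = Num.sg (qe_rcf.eval e2 t)))[/IHg -> /IHh ->].
- by move=> /(cat_split _ _ (fun t => Num.sg (qe_rcf.eval e1 t) = Num.sg (qe_rcf.eval e2 t)))[/IHg -> /IHh ->].
- by move=> /(cat_split _ _ (fun t => Num.sg (qe_rcf.eval e1 t) = Num.sg (qe_rcf.eval e2 t)))[/IHg -> /IHh ->].
by move=> /IHg ->.
Qed.

Lemma An_eval n N D (c : nat -> nat -> (nat -> R) -> R) (t : qe_rcf.term R) :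
  (forall j i, An n (c j i)) ->
  An n (fun v => qe_rcf.eval (fenv N D (fun j i => c j i v)) t).
Proof.
move=> hc; elim: t => [k|x|k|a IHa b IHb|a IHa|a IHa k|a IHa b IHb|a IHa k] /=.
- case: (ltnP k (N * D)) => hk.
    by apply: An_ext (hc (k %/ D)%N (k %% D)%N) => v; rewrite nth_mkseq.
  by apply: An_ext (An_cst n 0) => v; rewrite nth_default // size_mkseq.
- exact: An_cst.
- exact: An_cst.
- exact: AnD.
- exact: AnN.
- by apply: An_ext (AnM IHa (An_cst n k%:R)) => v; rewrite mulr_natr.
- exact: AnM.
- exact: AnX.
Qed.

End FibreElimination.

Section FibreChoice.
Variable R : realType.

Lemma mono_sg_le d (a : nat -> R) u w : u <= w ->
  (forall y, u <= y <= w -> mono d a y <> 0) ->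
  Num.sg (mono d a u) = Num.sg (mono d a w).
Proof.
move=> uw h; have hu : mono d a u <> 0 by apply: h; rewrite lexx uw.
have hw : mono d a w <> 0 by apply: h; rewrite lexx uw.
set p := 'X^d + \poly_(i < d) a i.
have hp y : mono d a y = p.[y] by apply: mono_poly.
have nor y : u <= y <= w -> ~~ root p y.
  by move=> /h hy; apply/negP => /rootP; rewrite -hp.
case: (ltrgtP (mono d a u) 0) => // su; case: (ltrgtP (mono d a w) 0) => // sw.
- by rewrite !ltr0_sg.
- have [||y hy ry] := @poly_ivt _ p u w; rewrite -?hp ?(ltW su) ?(ltW sw) //.
  by have := nor y hy; rewrite ry.
- have [||y hy] := @poly_ivt _ (- p) u w => //.
    by rewrite !hornerN -!hp oppr_le0 oppr_ge0 ?(ltW su) ?(ltW sw).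
  by rewrite rootN (negPf (nor y hy)).
by rewrite !gtr0_sg.
Qed.

Lemma near0_finT (I : finType) (P : I -> R -> Prop) :
  (forall i, near0 (P i)) -> near0 (fun x => forall i, P i x).
Proof.
move=> h; have : near0 (fun x => forall k, (k < #|I|)%N ->
    forall i, enum_rank i = k :> nat -> P i x).
  apply: near0_fin => k hk; apply: near0_imp (h (enum_val (Ordinal hk))) => x _ hx i ei.
  by rewrite (_ : i = enum_val (Ordinal hk)) // -[i]enum_rankK; congr enum_val; apply: val_inj.
by apply: near0_imp => x _ hx i; apply: (hx (enum_rank i)).
Qed.

Lemma near0_pick (I : finType) (A : I -> R -> Prop) :
  (forall i, near0 (A i) \/ near0 (fun x => ~ A i x)) ->
  near0 (fun x => exists i, A i x) -> exists i, near0 (A i).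
Proof.
move=> h1 h2; apply: contrapT => nex.
have h3 : near0 (fun x => forall i, ~ A i x).
  by apply: near0_finT => i; case: (h1 i) => // hi; case: nex; exists i.
by have [x x0 [[i hi] /(_ i)]] := near0_ex (near0_and h2 h3).
Qed.

Lemma near0_sgs N (F : nat -> R -> R) (s : nat -> R) :
  (forall j, (j < N)%N -> An1 (F j)) ->
  near0 (fun x => forall j, (j < N)%N -> Num.sg (F j x) = s j) \/
  near0 (fun x => ~ forall j, (j < N)%N -> Num.sg (F j x) = s j).
Proof.
move=> hF; case: (pselect (exists2 j, (j < N)%N & near0 (fun x => Num.sg (F j x) <> s j))).
  move=> [j jN h]; right; apply: near0_imp h => x _ hx h; exact: hx (h j jN).
move=> nex; left; apply: near0_fin => j jN.
have [d d0 hd] := An1_sg (hF j jN).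
case: (eqVneq (Num.sg (F j d)) (s j)) => e.
  exists d => // x hx; rewrite -e; apply: hd => //; by rewrite d0 lexx.
case: nex; exists j => //; exists d => // x hx; apply/eqP; apply: contra_neq e => <-.
by apply: hd => //; rewrite d0 lexx.
Qed.

(** The branches cut the fibre into points and intervals on which all signs are constant, and each
    piece is met by one of finitely many analytic candidates. Signs of germs are constant for small
    [x], so a single candidate works all along. *)
Lemma fibre_choice N (d : nat -> nat) (al : nat -> nat -> R -> R) (s : nat -> R) :
  (forall j i, (j < N)%N -> (i < d j)%N -> An1 (al j i) /\ al j i 0 = 0) ->
  near0 (fun x => exists t, forall j, (j < N)%N -> Num.sg (mono (d j) (fun i => al j i x) t) = s j) ->
  exists q tau, [/\ (0 < q)%N, An1 tau, tau 0 = 0 &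
    near0 (fun x => forall j, (j < N)%N ->
      Num.sg (mono (d j) (fun i => al j i (x ^+ q)) (tau x)) = s j)].
Proof.
move=> hal hex.
have hbr : branches (fun x t => exists2 j, j \in iota 0 N & mono (d j) (fun i => al j i x) t = 0).
  apply: branches_fin => j; rewrite mem_iota => jN; apply: puiseux => i hi.
  by case: (hal j i).
have [q [m [xi [q0 hxi hroots]]]] := hbr.
have small (r : R) : 0 < r -> near0 (fun x => forall j, (j < N)%N -> forall t,
    mono (d j) (fun i => al j i x) t = 0 -> `|t| <= r).
  move=> r0; apply: near0_fin => j jN.
  pose eta := Num.min 1 (r ^+ d j / 2).
  have eta0 : 0 < eta by rewrite lt_min ltr01 divr_gt0 // exprn_gt0.
  have := @sum_near _ (d j) (al j) eta (fun i hi => (hal j i jN hi).1) eta0.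
  apply: near0_imp => x _ hx t ht; apply: ltW.
  have hS : \sum_(i < d j) `|al j i x| <= eta.
    by apply: le_trans hx; apply: ler_sum => i _; rewrite (hal j i jN (ltn_ord i)).2 subr0.
  apply: (mono_root_small r0 _ _ ht).
    by apply: le_trans hS _; rewrite ge_min lexx.
  apply: le_lt_trans hS _; apply: (@le_lt_trans _ _ (r ^+ d j / 2)).
    by rewrite ge_min lexx orbT.
  by rewrite ltr_pdivrMr // ltr_pMr ?exprn_gt0 // ltr1n.
have xi0 l : (l < m)%N -> xi l 0 = 0.
  move=> lm; apply/eqP; rewrite -normr_le0; apply/ler_addgt0Pl => r r0; rewrite addr0.
  have r2 : 0 < r / 2 by rewrite divr_gt0.
  have [x x0 [[/= h1 h2] h3]] := near0_ex (near0_and (near0_and (near0_pow q0 (small _ r2)) hroots)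
     (An1_near (hxi l lm) r2)).
  have [j jN h0] : exists2 j, j \in iota 0 N & mono (d j) (fun i => al j i (x ^+ q)) (xi l x) = 0.
    by apply/h2; exists l.
  rewrite mem_iota in jN; have h4 := h1 j jN _ h0.
  have := ler_distD (xi l x) 0 (xi l 0); rewrite !sub0r !normrN; lra.
(* Code 0 is the midpoint of two branches (a branch itself when [l = k]), codes 1 and 2 lie beyond a
   branch on either side, and [None] is for a fibre without branches. *)
pose I := option ('I_m * 'I_m * 'I_3)%type.
pose cand (i : I) (x : R) : R := match i with
  | None => 0
  | Some (l, k, c) => if c == 0%N :> nat then (xi l x + xi k x) / 2
                      else if c == 1%N :> nat then xi l x + x else xi l x - x end.
have hc1 i : An1 (cand i).
  rewrite /cand; case: i => [[[l k] c]|]; last exact: An1_cst.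
  case: (c == 0%N :> nat) => /=; first by apply: (@An1M _ (fun x => xi l x + xi k x) (fun=> 2^-1)); [apply: AnD; apply: hxi | apply: An1_cst].
  case: (c == 1%N :> nat) => /=; first by apply: AnD; [apply: hxi|apply: An1_id].
  by apply: AnB; [apply: hxi|apply: An1_id].
have hc0 i : cand i 0 = 0.
  rewrite /cand; case: i => [[[l k] c]|] //; rewrite !xi0 //.
  case: ifP => _; first by rewrite addr0 mul0r.
  by case: ifP => _; rewrite ?addr0 ?subr0.
pose A i x := forall j, (j < N)%N -> Num.sg (mono (d j) (fun i => al j i (x ^+ q)) (cand i x)) = s j.
have hA : exists i, near0 (A i).
  apply: near0_pick => [i|].
    apply: near0_sgs => j jN; apply: (@An_mono _ 1 _ (fun i v => al j i (v 0%N ^+ q)) (fun v => cand i (v 0%N))) => [i' hi'|]; last exact: hc1.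
    by apply: An1_pow => //; case: (hal j i').
  apply: near0_imp (near0_and (near0_pow q0 hex) hroots) => x x0 [/= [t ht] hr].
  pose z (l : 'I_m) := xi l x.
  have noroot u w : u <= w -> (forall y, u <= y <= w -> forall l, y <> z l) -> forall j, (j < N)%N ->
     Num.sg (mono (d j) (fun i => al j i (x ^+ q)) u) = Num.sg (mono (d j) (fun i => al j i (x ^+ q)) w).
    move=> uw h j jN; apply: mono_sg_le => // y hy h0.
    have [l lm yl] : exists2 l, (l < m)%N & y = xi l x.
      by apply/hr; exists j => //; rewrite mem_iota.
    exact: (h y hy (Ordinal lm)).
  (* It suffices that no branch separates [t] from the candidate, or that the two coincide. *)
  suff [i hi] : exists i, forall y, Num.min t (cand i x) <= y <= Num.max t (cand i x) ->
      forall l, y = z l -> t = cand i x.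
    exists i => j jN; rewrite -ht //.
    case: (eqVneq t (cand i x)) => [<- //|ne].
    case: (leP t (cand i x)) => tc.
      apply/esym/noroot => // y hy l e; move/eqP: ne; apply; apply: (hi y _ l) => //.
      by rewrite min_l // max_r.
    apply: noroot => // [|y hy l e]; first exact: ltW.
    by move/eqP: ne; apply; apply: (hi y _ l) => //; rewrite min_r ?max_l // ltW.
  case: (pselect (exists l, t = z l)) => [[l tl]|nr].
    exists (Some (l, l, ord0)) => y _ _ _ /=; rewrite tl /z; by field.
  case: (pickP (fun l => z l < t)) => [l0 hl0|noL].
    have [l hl hlm] : exists2 p, z p < t & forall p', z p' < t -> z p' <= z p.
      by case: (@Order.TotalTheory.arg_maxP _ _ _ l0 (fun p => z p < t) z) => // p; exists p.
    case: (pickP (fun k => t < z k)) => [k0 hk0|noU].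
      have [k hk hkm] : exists2 p, t < z p & forall p', t < z p' -> z p <= z p'.
        by case: (@Order.TotalTheory.arg_minP _ _ _ k0 (fun p => t < z p) z) => // p; exists p.
      exists (Some (l, k, ord0)) => y /= hy l' yl'; exfalso.
      have h1 : z l < (z l + z k) / 2 < z k by lra.
      have /andP[h2 h3] : z l < y < z k.
        move: hy h1 hl hk; rewrite /z; case: (leP t ((xi l x + xi k x) / 2)); lra.
      have {}yl' : y = z l' by [].
      case: (ltrgtP (z l') t) => [lt|gt|e].
      - by have := hlm _ lt; rewrite -yl' leNgt h2.
      - by have := hkm _ gt; rewrite -yl' leNgt h3.
      - by apply: nr; exists l'.
    exists (Some (l, l, Ordinal (isT : 1 < 3)%N)) => y /= hy l' yl'; exfalso.
    have h2 : z l < y by move: hy hl; rewrite /z; case: (leP t (xi l x + x)); lra.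
    case: (ltrgtP (z l') t) => [lt|gt|e].
    - by have := hlm _ lt; rewrite -yl' leNgt h2.
    - by have := noU l'; rewrite gt.
    - by apply: nr; exists l'.
  case: (pickP (fun k => t < z k)) => [k0 hk0|noU].
    have [k hk hkm] : exists2 p, t < z p & forall p', t < z p' -> z p <= z p'.
      by case: (@Order.TotalTheory.arg_minP _ _ _ k0 (fun p => t < z p) z) => // p; exists p.
    exists (Some (k, k, Ordinal (isT : 2 < 3)%N)) => y /= hy l' yl'; exfalso.
    have h2 : y < z k by move: hy hk; rewrite /z; case: (leP t (xi k x - x)); lra.
    case: (ltrgtP (z l') t) => [lt|gt|e].
    - by have := noL l'; rewrite lt.
    - by have := hkm _ gt; rewrite -yl' leNgt h2.
    - by apply: nr; exists l'.
  exists None => y _ l' _; exfalso.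
  case: (ltrgtP (z l') t) => [lt|gt|e]; last by apply: nr; exists l'.
    by have := noL l'; rewrite lt.
  by have := noU l'; rewrite gt.
by have [i hi] := hA; exists q, (cand i).
Qed.

End FibreChoice.

(** * Curve selection for analytic sign conditions *)

Section CurveSelection.
Variable R : realType.
Implicit Types (u v : nat -> R).

Definition accum n (P : (nat -> R) -> Prop) :=
  forall e, 0 < e -> exists2 v, (forall i, (i < n)%N -> `|v i| <= e) & P v.

Lemma accum_or n P Q : accum n (fun v => P v \/ Q v) -> accum n P \/ accum n Q.
Proof.
move=> h; apply: contrapT => /not_orP[/existsNP[e] + /existsNP[e']].
move=> /not_implyP[e0 h1] /not_implyP[e'0 h2].
have [|v hv [hP|hQ]] := h (Num.min e e'); first by rewrite lt_min e0 e'0.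
  by apply: h1; exists v => // i /hv; rewrite le_min => /andP[].
by apply: h2; exists v => // i /hv; rewrite le_min => /andP[].
Qed.

Lemma accum_imp n (P Q : (nat -> R) -> Prop) : (forall v, P v -> Q v) -> accum n P -> accum n Q.
Proof. by move=> h hP e /hP[v h1 h2]; exists v => //; apply: h. Qed.

Lemma accum_sg n K (H : nat -> (nat -> R) -> R) P : accum n P ->
  exists s : nat -> R, accum n (fun v => P v /\ forall k, (k < K)%N -> Num.sg (H k v) = s k).
Proof.
elim: K P => [|K IH] P hP.
  by exists (fun=> 0); apply: accum_imp hP => v; split.
have [s hs] := IH P hP.
have [c hc] : exists c, accum n (fun v => (P v /\ forall k, (k < K)%N -> Num.sg (H k v) = s k)
    /\ Num.sg (H K v) = c).
  have : accum n (fun v => ((P v /\ forall k, (k < K)%N -> Num.sg (H k v) = s k) /\ Num.sg (H K v) = 1) \/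
     (((P v /\ forall k, (k < K)%N -> Num.sg (H k v) = s k) /\ Num.sg (H K v) = -1) \/
     ((P v /\ forall k, (k < K)%N -> Num.sg (H k v) = s k) /\ Num.sg (H K v) = 0))).
    apply: accum_imp hs => v hv; case: (sgrP (H K v)) => _; [right; right|left|right; left] => //.
  by case/accum_or => [h|/accum_or[h|h]]; [exists 1|exists (-1)|exists 0].
exists (fun k => if k == K then c else s k); apply: accum_imp hc => v [[h1 h2] h3].
split=> // k; rewrite ltnS leq_eqVlt; case: eqP => [-> //|_ /= hk]; exact: h2.
Qed.

Lemma mono_ext d (a b : nat -> R) t : (forall i, (i < d)%N -> a i = b i) ->
  mono d a t = mono d b t.
Proof. by move=> h; congr (_ + _); apply: eq_bigr => i _; rewrite h. Qed.

Lemma is_sgn_mul (x y : R) : is_sgn x -> is_sgn y -> is_sgn (x * y).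
Proof.
by rewrite /is_sgn => /or3P[] /eqP -> /or3P[] /eqP ->;
  rewrite ?(mul0r, mulr0, mulrN1, mulr1, opprK, eqxx, orbT).
Qed.

(** The product of the nonzero germs is a nonzero germ. Germs that vanish identically are replaced
    in it by the coordinate [v n], which also fills the extra factor of index [N] and so gives
    [w n != 0]. *)
Lemma common_direction n N (G : nat -> (nat -> R) -> R) :
  (forall j, (j < N)%N -> An n.+1 (G j)) ->
  exists2 w : nat -> R, w n != 0 & forall j, (j < N)%N -> ~ zerog n.+1 (G j) ->
    exists a psi, [/\ An1 psi, psi 0 != 0 & exists2 d, 0 < d &
     forall x, `|x| <= d -> G j (fun i => x * w i) = x ^+ a * psi x].
Proof.
move=> hG.
pose z j := `[< zerog n.+1 (G j) >].
pose F j : (nat -> R) -> R := if (j < N)%N && ~~ z j then G j else fun v => v n.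
have hF j : An n.+1 (F j) /\ ~ zerog n.+1 (F j).
  rewrite /F; case: ifPn => [/andP[jN /asboolPn zj]|_]; first by split => //; apply: hG.
  split; first exact: An_var.
  case=> d d0 /(_ (axis n d)); rewrite /axis eqxx => h.
  have d00 : d = 0.
    by apply: h => i _; case: (i == n); rewrite ?normr0 ?gtr0_norm ?lexx ?(ltW d0).
  by move: d0; rewrite d00 ltxx.
have [_ nz] := @An_prod_nonzero _ n.+1 N.+1 F (fun j _ => hF j).
have /choice [rho hrho] : forall j, exists rho : R, 0 < rho /\
   forall v, (forall i, (i < n.+1)%N -> `|v i| <= rho) -> F j v <> 0 ->
   exists a psi, [/\ An1 psi, psi 0 != 0 & exists2 d, 0 < d &
     forall x, `|x| <= d -> F j (fun i => x * v i) = x ^+ a * psi x].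
  by move=> j; have [rho h1 h2] := line_nonzero (hF j).1; exists rho.
have [d d0 hd] := @minr_seq _ N.+1 rho (fun i => (hrho i).1).
have [w hw hw0] : exists2 w, (forall i, (i < n.+1)%N -> `|w i| <= d) & \prod_(j < N.+1) F j w <> 0.
  apply: contrapT => nex; apply: nz; exists d => // v hv; apply: contrapT => h.
  by apply: nex; exists v.
have hFw j : (j < N.+1)%N -> F j w != 0.
  move=> jN; apply/eqP => h0; apply: hw0.
  by rewrite (bigD1 (Ordinal jN)) //= h0 mul0r.
exists w; first by have := hFw N (ltnSn N); rewrite /F ltnn.
move=> j jN zj.
have FG : F j = G j by rewrite /F jN (_ : ~~ z j) //; apply/asboolPn.
rewrite -FG; apply: (hrho j).2; last by apply/eqP/hFw; rewrite ltnW.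
by move=> i hi; apply: le_trans (hw i hi) _; apply: hd; rewrite ltnW.
Qed.

Theorem curve_selection n N (G : nat -> (nat -> R) -> R) (s : nat -> R) :
  (forall j, (j < N)%N -> An n (G j)) ->
  accum n (fun v => forall j, (j < N)%N -> Num.sg (G j v) = s j) ->
  exists be : nat -> R -> R, (forall i, An1 (be i) /\ be i 0 = 0) /\
    near0 (fun x => forall j, (j < N)%N -> Num.sg (G j (fun i => be i x)) = s j).
Proof.
elim: n N G s => [|n IH] N G s hG hacc.
  exists (fun _ _ => 0); split; first by move=> i; split=> //; apply: An1_cst.
  apply: near0_true => x _ j jN; have [v _ hv] := hacc 1 ltr01.
  rewrite -hv //; have [r r0 hr] := An_indep (hG j jN).
  by rewrite (hr v (fun=> 0)) // => i.
have hs j : (j < N)%N -> is_sgn (s j).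
  by move=> jN; have [v _ hv] := hacc 1 ltr01; rewrite -hv // is_sgn_sg.
have [w wn hw] := common_direction hG.
pose z j := `[< zerog n.+1 (G j) >].
have sz j : (j < N)%N -> z j -> s j = 0.
  move=> jN /asboolP[d d0 hd]; have [v hv1 hv2] := hacc d d0.
  by rewrite -hv2 // hd // sgr0.
(* The linear change of variables sending the last axis to the direction [w], and its inverse [S]:
   it makes all nonzero germs regular in the last variable. *)
pose T u i := (if i == n then 0 else u i) + w i * u n.
pose S v i := if i == n then v n / w n else v i - w i * (v n / w n).
have TS v : T (S v) = v.
  apply/funext => i; rewrite /T /S eqxx; case: eqP => [->|_]; last by rewrite subrK.
  by rewrite add0r mulrC divfK.
pose K := \sum_(i < n.+1) `|w i| + 1.
have K0 : 0 < K by rewrite ltr_wpDl // sumr_ge0.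
have wK i : (i < n.+1)%N -> `|w i| <= K.
  by move=> hi; rewrite /K (bigD1 (Ordinal hi)) //= -addrA lerDl addr_ge0 // sumr_ge0.
have Tsmall u e i : (forall i, (i < n.+1)%N -> `|u i| <= e) -> (i < n.+1)%N -> `|T u i| <= e * (1 + K).
  move=> hu hi; have e0 : 0 <= e by apply: le_trans (hu n (ltnSn n)).
  apply: le_trans (ler_normD _ _) _; rewrite mulrDr mulr1; apply: lerD.
    by case: ifP => _; rewrite ?normr0 // hu.
  by rewrite normrM mulrC; apply: ler_pM => //; rewrite ?hu ?wK.
have hT i : An n.+1 (fun u => T u i) \/ (n < i)%N.
  case: (leqP i n) => hi; [left|by right]; apply: AnD.
    by case: (i == n); [apply: An_cst | exact: An_var].
  exact: (AnM (An_cst _ (w i)) (An_var _ (ltnSn n))).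
pose G' j u := G j (T u).
have hG' j : (j < N)%N -> An n.+1 (G' j).
  move=> jN; apply: (An_subst (y := fun i u => T u i)) (hG j jN) _ => i hi.
  case: (hT i) => [h|]; last by rewrite ltnNge -ltnS hi.
  by split=> //; rewrite /T mulr0 addr0; case: ifP.
(* [W j] packs the degree, the coefficients, the leading constant and the radii. A germ that
   vanishes identically gets degree 0, hence the polynomial 1, whose target sign in [s'] is 1. *)
have /choice [W hW] : forall j, exists W : nat * (nat -> (nat -> R) -> R) * R * (nat -> R),
   [/\ forall i, (i < W.1.1.1)%N -> [/\ An n (W.1.1.2 i), W.1.1.2 i (fun=> 0) = 0 &
          forall v w, (forall k, (k < n)%N -> v k = w k) -> W.1.1.2 i v = W.1.1.2 i w],
       forall i, 0 < W.2 i, W.1.2 != 0 &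
       (j < N)%N -> if z j then W.1.1.1 = 0%N else forall u, box n.+1 W.2 u ->
         Num.sg (mono W.1.1.1 (fun i => W.1.1.2 i u) (u n)) = Num.sg W.1.2 * Num.sg (G' j u)].
  move=> j; case: (boolP ((j < N)%N && ~~ z j)) => [/andP[jN zj]|]; last first.
    rewrite negb_and negbK => hz; exists (0%N, fun _ _ => 0, 1, fun=> 1); split=> //=; rewrite ?oner_eq0 //.
    by move=> jN; move: hz; rewrite jN /= => ->.
  have [a [psi [h1 h2 [d d0 h3]]]] := hw j jN (elimN (asboolP _) zj).
  have h3' t : `|t| <= d -> G' j (axis n t) = t ^+ a * psi t.
    move=> ht; rewrite -h3 // /G' /T /axis eqxx; congr G; apply/funext => i.
    by case: eqP => _; rewrite add0r mulrC.
  have [aa [c [sr [c0 sr0 ha hsg]]]] := weierstrass (hG' j jN) h1 h2 d0 h3'.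
  by exists (a, aa, c, sr); split=> //= _; rewrite (negPf zj).
pose d j := (W j).1.1.1; pose c j := (W j).1.2; pose sr j := (W j).2.
pose ca j i : (nat -> R) -> R := if (i < d j)%N then (W j).1.1.2 i else fun=> 0.
have hca j i : [/\ An n (ca j i), ca j i (fun=> 0) = 0 &
    forall v w, (forall k, (k < n)%N -> v k = w k) -> ca j i v = ca j i w].
  rewrite /ca; case: ifP => hi; last by split=> //; apply: An_cst.
  by have [h _ _ _] := hW j; apply: h.
have monoW j u t : mono (d j) (fun i => (W j).1.1.2 i u) t = mono (d j) (fun i => ca j i u) t.
  by apply: mono_ext => i hi; rewrite /ca hi.
pose s' j := if z j then 1 else Num.sg (c j) * s j.
have hs' j : (j < N)%N -> is_sgn (s' j).
  move=> jN; rewrite /s'; case: ifP => _; first by rewrite /is_sgn eqxx !orbT.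
  by rewrite is_sgn_mul ?is_sgn_sg ?hs.
have [r r0 hr] : exists2 r, 0 < r & forall u, (forall i, (i < n.+1)%N -> `|u i| <= r) ->
   (forall j, (j < N)%N -> Num.sg (G' j u) = s j) <->
   (forall j, (j < N)%N -> Num.sg (mono (d j) (fun i => ca j i u) (u n)) = s' j).
  have /choice [rr hrr] : forall j, exists r, 0 < r /\ ((j < N)%N -> forall u, (forall i, (i < n.+1)%N -> `|u i| <= r) ->
     (Num.sg (G' j u) = s j) <-> (Num.sg (mono (d j) (fun i => ca j i u) (u n)) = s' j)).
    move=> j; case: (ltnP j N) => jN; last by exists 1.
    have [h1 h2 h3] := hW j; rewrite jN /s' => /(_ isT); case: (boolP (z j)) => zj hz.
      have /asboolP[e e0 he] := zj; exists (e / (1 + K)).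
      split; first by rewrite divr_gt0 // addr_gt0.
      move=> _ u hu; rewrite /d hz /mono expr0 big_ord0 addr0 sgr1 sz //.
      split=> // _; rewrite /G' he ?sgr0 // => i hi.
      by apply: le_trans (Tsmall _ _ _ hu hi) _; rewrite divfK ?lexx // gt_eqF // addr_gt0.
    have [e e0 he] := minr_seq n.+1 h2; exists e; split=> // _ u hu.
    have bu : box n.+1 (W j).2 u by move=> i hi; apply: le_trans (hu i hi) (he i hi).
    rewrite -monoW hz // -/(c j); have c1 : Num.sg (c j) * Num.sg (c j) = 1.
      by rewrite -expr2 sqr_sg h3.
    split=> [-> //|/(congr1 (fun x => Num.sg (c j) * x))]; by rewrite !mulrA c1 !mul1r.
  have [e e0 he] := @minr_seq _ N rr (fun j => (hrr j).1).
  exists e => // u hu; split=> h j jN; have h2 := (hrr j).2 jN u (fun i hi => le_trans (hu i hi) (he j jN)).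
    by apply/h2/h.
  by apply/h2/h.
pose D := \max_(j < N) d j.
have hD j : (j < N)%N -> (d j <= D)%N.
  by move=> jN; apply: (@leq_bigmax _ (fun j : 'I_N => d j) (Ordinal jN)).
have [Phi hPhi] := fibre_elim hD hs'.
pose H k u := qe_rcf.eval (fenv N D (fun j i => ca j i u)) (nth (qe_rcf.Const 0) (atoms Phi) k).
have hH k : An n (H k) by apply: An_eval => j i; case: (hca j i).
have hacc2 : accum n (fun u => qe_rcf.qf_eval (fenv N D (fun j i => ca j i u)) Phi).
  move=> e e0; pose e1 := Num.min e r.
  have e10 : 0 < e1 by rewrite lt_min e0 r0.
  pose K2 := 1 + K / `|w n| + 1 / `|w n|.
  have wn0 : 0 < `|w n| by rewrite normr_gt0.
  have K20 : 0 < K2 by rewrite !addr_gt0 // divr_gt0.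
  have [v hv1 hv2] := hacc (e1 / K2) ltac:(by rewrite divr_gt0).
  have hS i : (i < n.+1)%N -> `|S v i| <= e1.
    move=> hi.
    have k0 : 0 <= e1 / K2 by rewrite divr_ge0 // ltW.
    have hvn : `|v n / w n| <= (e1 / K2) / `|w n|.
      by rewrite normrM normfV ler_wpM2r ?invr_ge0 // hv1.
    set k := e1 / K2 in k0 hvn hv1 *.
    have -> : e1 = k + k * (K / `|w n|) + k / `|w n|.
      have -> : e1 = k * K2 by rewrite /k divfK // gt_eqF.
      by rewrite /K2 !mulrDr mulr1 mul1r.
    rewrite /S; case: eqP => _.
      apply: le_trans hvn _; rewrite lerDr addr_ge0 // mulr_ge0 // divr_ge0 // ltW //.
    apply: le_trans (ler_normB _ _) _; rewrite -[leLHS]addr0; apply: lerD; last by rewrite divr_ge0.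
    apply: lerD; first exact: hv1.
    rewrite normrM mulrCA; apply: ler_pM => //; first exact: wK.
  exists (S v).
    by move=> i hi; apply: le_trans (hS i (ltnW hi)) _; rewrite ge_min lexx.
  apply/hPhi; exists (S v n); apply/hr.
    by move=> i hi; apply: le_trans (hS i hi) _; rewrite ge_min lexx orbT.
  by move=> j jN; rewrite /G' TS hv2.
(* By the pigeonhole principle, some choice of signs of the atoms occurs arbitrarily near 0; the
   induction hypothesis is applied to that choice. *)
have [sg hsg] := accum_sg (size (atoms Phi)) H hacc2.
have hacc3 : accum n (fun v => forall k, (k < size (atoms Phi))%N -> Num.sg (H k v) = sg k).
  by apply: accum_imp hsg => v [].
have [ga [hga hsga]] := IH _ H sg (fun k _ => hH k) hacc3.
(* A single point where [Phi] holds with these signs is enough: along the arc the atoms have the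
   same signs, so [Phi] holds there and each fibre has a solution. *)
have [u0 _ [hu1 hu2]] := hsg 1 ltr01.
pose al j i x := ca j i (fun k => ga k x).
have hal j i : An1 (al j i) /\ al j i 0 = 0.
  have [h1 h2 _] := hca j i; split.
    by apply: (An1_subst (y := ga) h1) => k _; apply: hga.
  rewrite /al (_ : (fun k => ga k 0) = fun=> 0) //.
  by apply/funext => k; case: (hga k).
have hex : near0 (fun x => exists t, forall j, (j < N)%N ->
    Num.sg (mono (d j) (fun i => al j i x) t) = s' j).
  apply: near0_imp hsga => x _ hx; apply/hPhi.
  by rewrite (@qf_eval_atoms _ Phi _ (fenv N D (fun j i => ca j i u0))) // => k hk; rewrite hu2 // hx.
have [q [tau [q0 htau tau0 hfin]]] := fibre_choice (fun j i _ _ => hal j i) hex.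
pose uu x i := if i == n then tau x else ga i (x ^+ q).
have huu i : An1 (fun x => uu x i) /\ uu 0 i = 0.
  rewrite /uu; case: eqP => _; first by [].
  split; first by apply: An1_pow => //; case: (hga i).
  by rewrite expr0n gtn_eqF //; case: (hga i).
exists (fun i x => T (uu x) i); split.
  move=> i; split; last first.
    by rewrite /T !(huu _).2 mulr0 addr0; case: ifP.
  apply: AnD; last by apply: AnM (An_cst _ _) _; apply: (huu n).1.
  by case: (i == n); [apply: An_cst|apply: (huu i).1].
have usmall : near0 (fun x => forall i, (i < n.+1)%N -> `|uu x i| <= r).
  apply: near0_fin => i _; have [h1 h2] := huu i.
  by apply: near0_imp (An1_near h1 r0) => x _; rewrite h2 subr0.
apply: near0_imp (near0_and usmall hfin) => x x0 [h1 h2].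
apply: (proj2 (hr (uu x) h1)) => j jN.
have -> : uu x n = tau x by rewrite /uu eqxx.
rewrite -h2 //; congr Num.sg; apply: mono_ext => i hi; rewrite /al.
have [_ _ hind] := hca j i; apply: hind => k hk.
by rewrite /uu ltn_eqF.
Qed.

End CurveSelection.

(** * From convergent power series to germs *)

Section AnalyticGerms.
Variable R : realType.
Implicit Types (r s v : nat -> R).

Definition rowv n (v : nat -> R) : 'rV[R]_n := \row_i v i.

Lemma tends_cvg (u : nat -> R) l : u @ \oo --> l -> tends u l.
Proof.
move=> /cvgrPdist_lt h e e0; have [N _ hN] := h e e0.
by exists N => k Nk; rewrite distrC; apply: hN.
Qed.

Lemma mono_cauchy (B : nat -> R) T : (forall i j, (i <= j)%N -> B i <= B j) ->
  (forall i, B i <= T) -> forall e, 0 < e -> exists N, forall i j, (N <= i)%N -> (i <= j)%N ->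
  B j - B i < e.
Proof.
move=> hB hT e e0; pose S := [set B i | i in [set: nat]].
have hS : has_sup S by split; [exists (B 0%N), 0%N | exists T => _ [i _ <-]].
have [_ [N _ <-] hN] : exists2 y, S y & sup S - e < y by apply: sup_adherent.
exists N => i j Ni ij; have h1 : B j <= sup S by apply: ub_le_sup; [case: hS | exists j].
have := hB N i Ni; lra.
Qed.

Definition emb n N (al : {ffun 'I_n -> 'I_N}) : {ffun 'I_n -> nat} := [ffun i => val (al i)].

Lemma emb_inj n N : injective (@emb n N).
Proof.
move=> a b h; apply/ffunP => i; apply: val_inj.
by have := congr1 (fun f : {ffun 'I_n -> nat} => f i) h; rewrite !ffunE.
Qed.

Lemma box_split (V : nmodType) n N M (F : {ffun 'I_n -> nat} -> V) : (N.+1 <= M)%N ->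
  \sum_(al : {ffun 'I_n -> 'I_M}) F (emb al) =
  \sum_(al : {ffun 'I_n -> 'I_N.+1}) F (emb al) +
  \sum_(al : {ffun 'I_n -> 'I_M} | ~~ [forall i, (al i < N.+1)%N]) F (emb al).
Proof.
move=> NM; rewrite (bigID (fun al : {ffun 'I_n -> 'I_M} => [forall i, (al i < N.+1)%N])) /=.
congr (_ + _).
pose h (al : {ffun 'I_n -> 'I_N.+1}) : {ffun 'I_n -> 'I_M} := [ffun i => widen_ord NM (al i)].
pose h' (al : {ffun 'I_n -> 'I_M}) : {ffun 'I_n -> 'I_N.+1} := [ffun i => inord (al i)].
rewrite (reindex_onto h h') /=; last first.
  move=> al /forallP hal; apply/ffunP => i; rewrite !ffunE; apply: val_inj => /=.
  by rewrite inordK.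
apply: eq_big => al.
  apply/andP; split; first by apply/forallP => i; rewrite ffunE /=.
  by apply/eqP/ffunP => i; rewrite !ffunE; apply: val_inj; rewrite /= inordK.
by move=> _; congr F; apply/ffunP => i; rewrite !ffunE.
Qed.

Lemma box_le_esum n N (w : {ffun 'I_n -> nat} -> R) (T : R) :
  (\esum_(al in [set: {ffun 'I_n -> nat}]) `|(w al)%:E| <= T%:E)%E ->
  \sum_(al : {ffun 'I_n -> 'I_N}) `|w (emb al)| <= T.
Proof.
move=> h; rewrite -lee_fin; apply: le_trans h; apply: esum_ge.
pose l := [seq emb al | al <- enum {ffun 'I_n -> 'I_N}].
have ul : uniq l by rewrite map_inj_uniq ?enum_uniq //; apply: emb_inj.
exists [set` l]; first by split=> //; apply: finite_seq.
rewrite -fsbig_seq // big_map big_enum -sumEFin.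
by rewrite le_eqVlt; apply/orP; left; apply/eqP; apply: eq_bigr.
Qed.

Definition pbox n (c : {ffun 'I_n -> nat} -> R) N : mP R n :=
  \sum_(al : {ffun 'I_n -> 'I_N})
    (cst R n (c (emb al)) * \prod_(i < n) var R n i ^+ emb al i).

Lemma nrm_prod r n I (l : seq I) (F : I -> mP R n) : (forall i, 0 <= r i) ->
  nrm r (\prod_(i <- l) F i) <= \prod_(i <- l) nrm r (F i).
Proof.
move=> r0; elim: l => [|i l IH]; first by rewrite !big_nil nrm1.
rewrite !big_cons; apply: le_trans (nrmM r0 _ _) _.
by apply: ler_wpM2l => //; apply: nrm_ge0.
Qed.

Lemma nrm_term n (c : R) (al : {ffun 'I_n -> nat}) (rho : R) : 0 <= rho ->
  nrm (fun=> rho) (cst R n c * \prod_(i < n) var R n i ^+ al i) <=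
  `|c * monomial (rowv n (fun=> rho)) al|.
Proof.
move=> r0; apply: le_trans (nrmM (fun=> r0) _ _) _; rewrite nrm_cst normrM ler_wpM2l //.
rewrite /monomial normr_prod; apply: le_trans (nrm_prod _ _ (fun=> r0)) _.
apply: ler_prod => i _; rewrite nrm_ge0 //=; apply: le_trans (nrmX (fun=> r0) _ _) _.
rewrite normrX mxE ger0_norm //; rewrite lerXn2r ?nnegrE ?nrm_ge0 //.
exact: (nrm_var (fun=> r0)).
Qed.

Lemma ev_pbox n c N v : ev v n (pbox c N) =
  \sum_(al : {ffun 'I_n -> 'I_N}) (let be := [ffun i => val (al i)] in
     c be * monomial (rowv n v) be).
Proof.
rewrite /pbox rmorph_sum; apply: eq_bigr => al _ /=.
rewrite rmorphM /= {1}/ev evA_cst /= rmorph_prod /monomial; congr (_ * _).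
apply: eq_bigr => i _; rewrite rmorphXn /= mxE; congr (_ ^+ _).
by rewrite /ev evA_var.
Qed.

Lemma rowv_norm n v (e : R) : 0 < e -> (forall i, (i < n)%N -> `|v i| < e) -> `|rowv n v| < e.
Proof.
move=> e0 h; rewrite -[`|_|]/(mx_norm _) mx_normrE; apply/bigmax_ltP; split => // -[i j] _.
by rewrite mxE h.
Qed.

(** Absolute convergence at the one point with all coordinates [rho] bounds the weighted norms of
    the partial sums and makes them Cauchy; [rho] is half the radius of the ball so that this point
    lies inside. *)
Lemma analytic_An n (f : 'rV[R]_n -> R) a : analytic_at f a ->
  An n (fun v => f (a + rowv n v)).
Proof.
case=> c /nbhs_ballP[e /= e0 he].
have hps v : (forall i, (i < n)%N -> `|v i| < e) ->
    power_series_sum c (rowv n v) (f (a + rowv n v)).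
  move=> hv; have := he (a + rowv n v); rewrite addrAC subrr add0r; apply.
  rewrite -ball_normE /= opprD addrA subrr add0r normrN; exact: rowv_norm.
pose rho := e / 2; have rho0 : 0 < rho by rewrite divr_gt0.
have rhoe : rho < e by rewrite ltr_pdivrMr // ltr_pMr // ltr1n.
have [hsum _] := hps (fun=> rho) (fun i _ => ltac:(by rewrite gtr0_norm)).
pose w al := c al * monomial (rowv n (fun=> rho)) al.
have [T hT] : exists T : R, (\esum_(al in [set: {ffun 'I_n -> nat}]) `|(w al)%:E| <= T%:E)%E.
  move: hsum; rewrite /summable -/w; case: (\esum_(_ in _) _) => [t _| |] //.
    by exists t.
  by exists 0; rewrite leNye.
pose B N := \sum_(al : {ffun 'I_n -> 'I_N.+1}) `|w (emb al)|.
have BT N : B N <= T by apply: box_le_esum.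
have Bm i j : (i <= j)%N -> B i <= B j.
  move=> ij; rewrite /B (@box_split _ n i j.+1 (fun al => `|w al|)) // lerDl.
  by apply: sumr_ge0.
exists (fun=> rho), (fun N => pbox c N.+1); split=> //; split.
  move=> d d0; have [N hN] := mono_cauchy Bm BT d0; exists N.
  have key i j : (N <= i)%N -> (i <= j)%N ->
      nrm (fun=> rho) (pbox c j.+1 - pbox c i.+1) < d.
    move=> Ni ij; apply: le_lt_trans (hN i j Ni ij).
    rewrite /pbox (@box_split _ n i j.+1 (fun al => cst R n (c al) * \prod_(i < n) var R n i ^+ al i)) //.
    rewrite addrAC subrr add0r /B (@box_split _ n i j.+1 (fun al => `|w al|)) //.
    rewrite addrAC subrr add0r; apply: le_trans (nrm_sum (fun=> ltW rho0) _ _ _) _.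
    by apply: ler_sum => al _; apply: nrm_term; apply: ltW.
  move=> i j Ni Nj; case: (leqP i j) => ij; last by apply: key => //; apply: ltnW.
  by rewrite -opprB nrmN; apply: key.
move=> v hv; have [|_ hc] := hps v.
  by move=> i hi; apply: le_lt_trans rhoe; apply: hv.
have := tends_shift 1 (tends_cvg hc); apply: tends_ext => k.
by rewrite ev_pbox addn1.
Qed.

Lemma An_lip0 n (f : (nat -> R) -> R) : An n f -> exists2 K, 0 < K & exists2 d0, 0 < d0 &
  forall d v, 0 <= d <= d0 -> (forall i, (i < n)%N -> `|v i| <= d) ->
    `|f v - f (fun=> 0)| <= K * d.
Proof.
move=> hf; have hg : An n (fun v => f v - f (fun=> 0)) by apply: AnB hf (An_cst _ _).
have [r [P [r0 hP]]] := hg; have [M M0 hM] := repr_bounded r0 hP.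
have [e e0 he] := minr_seq n r0.
exists (M / e); first by rewrite divr_gt0.
exists e => // d v /andP[d0 de] hv; have rr0 := pos_ge0 r0.
pose th := d / e.
have th01 : 0 <= th <= 1 by rewrite divr_ge0 ?(ltW e0) //= ler_pdivrMr // mul1r.
have hb : box n (fun i => th * r i) v.
  move=> i hi; apply: le_trans (hv i hi) _.
  apply: (@le_trans _ _ (th * e)); first by rewrite divfK // gt_eqF.
  by rewrite ler_wpM2l ?he //; case/andP: th01.
have hb' : box n r v by apply: box_le hb => i; rewrite ler_piMl //; case/andP: th01.
apply/ler_addgt0Pl => x x0.
have := hP.2 _ (box0 r0); rewrite subrr => /(_ x x0) [N hN].
apply: (@tends_le _ _ _ N _ (hP.2 v hb')) => k /hN; rewrite subr0 => h.
apply: le_trans (ev_bound _ hb) _; apply: le_trans (nrm_scale _ rr0 th01) _.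
apply: lerD; first exact: ltW.
have -> : M / e * d = th * M by rewrite /th; ring.
by rewrite ler_wpM2l ?hM //; case/andP: th01.
Qed.

(** Peeling off one variable at a time with [taylor] gives a first order expansion with quadratic
    error, without partial derivatives. *)
Lemma An_lin n (f : (nat -> R) -> R) : An n f ->
  exists (l : nat -> R), exists2 K, 0 < K & exists2 d0, 0 < d0 &
  forall d v, 0 <= d <= d0 -> (forall i, (i < n)%N -> `|v i| <= d) ->
    `|f v - f (fun=> 0) - \sum_(i < n) l i * v i| <= K * d ^+ 2.
Proof.
elim: n f => [|n IH] f hf.
  have [r r0 hr] := An_indep hf; exists (fun=> 0), 1 => //; exists 1 => // d v hd _.
  have -> : f v = f (fun=> 0) by apply: hr => i.
  by rewrite big_ord0 subr0 subrr normr0 mul1r exprn_ge0 //; case/andP: hd.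
have [r [P [r0 hP]]] := hf; have [a [h [ha hh hfe]]] := taylor r0 hP.
have An_a i : An n (a i) by exists r, (fun k => (P k : {poly mP R n})`_i).
have [l [K K0 [d0 d00 h0]]] := IH _ (An_a 0%N).
have [K1 K10 [d1 d10 h1]] := An_lip0 (An_a 1%N).
have [M M0 hM] := repr_bounded r0 (hh 2%N).
have [e e0 he] := minr_seq n.+1 r0.
exists (fun i => if i == n then a 1%N (fun=> 0) else l i), (K + K1 + M).
  by rewrite !addr_gt0.
exists (Num.min (Num.min d0 d1) e); first by rewrite !lt_min d00 d10 e0.
move=> d v /andP[dd0]; rewrite !le_min => /andP[/andP[dd1 dd2] de] hv.
have hb : box n.+1 r v by move=> i hi; apply: le_trans (hv i hi) (le_trans de (he i hi)).
have hv' i : (i < n)%N -> `|v i| <= d by move=> hi; apply: hv; rewrite ltnW.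
have -> : f (fun=> 0) = a 0%N (fun=> 0).
  by rewrite (hfe 1%N _ (box0 r0)) big_ord1 expr0 mulr1 mulr0 addr0.
rewrite (hfe 2%N v hb) big_ord_recr big_ord1 /= expr0 mulr1 expr1.
rewrite big_ord_recr /= eqxx.
have -> : \sum_(i < n) (if i == n :> nat then a 1%N (fun=> 0) else l i) * v i = \sum_(i < n) l i * v i.
  by apply: eq_bigr => i _; rewrite ltn_eqF.
have dd : 0 <= d <= d0 by rewrite dd0.
have dd' : 0 <= d <= d1 by rewrite dd0.
have := h0 d v dd hv'; have := h1 d v dd' hv'; have hvn := hv n (ltnSn n).
have hh2 : `|h 2%N v| <= M by apply: (repr_lim_bound (hh 2%N) (M := M) _ hb).
move: (\sum_(i < n) _) => S k1 k2.
have -> : a 0%N v + a 1%N v * v n + h 2%N v * v n ^+ 2 - a 0%N (fun=> 0) - (S + a 1%N (fun=> 0) * v n)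
  = (a 0%N v - a 0%N (fun=> 0) - S) + (a 1%N v - a 1%N (fun=> 0)) * v n + h 2%N v * v n ^+ 2 by ring.
have -> : (K + K1 + M) * d ^+ 2 = K * d ^+ 2 + K1 * d ^+ 2 + M * d ^+ 2 by ring.
apply: le_trans (ler_normD _ _) _; apply: lerD.
  apply: le_trans (ler_normD _ _) _; apply: lerD => //.
  by rewrite normrM expr2 mulrA; apply: ler_pM.
by rewrite normrM normrX; apply: ler_pM => //; rewrite ?exprn_ge0 // lerXn2r ?nnegrE.
Qed.

End AnalyticGerms.

(** * The Euclidean norm *)

Section Euclid.
Variable R : realType.
Variable n : nat.
Implicit Types (x y z : 'rV[R]_n) (a : R).

Lemma dotvC x y : dotv x y = dotv y x.
Proof. by apply: eq_bigr => i _; rewrite mulrC. Qed.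

Lemma dotvDl x y z : dotv (x + y) z = dotv x z + dotv y z.
Proof. by rewrite -big_split; apply: eq_bigr => i _; rewrite mxE mulrDl. Qed.

Lemma dotvZl a x z : dotv (a *: x) z = a * dotv x z.
Proof. by rewrite mulr_sumr; apply: eq_bigr => i _; rewrite mxE mulrA. Qed.

Lemma dotvDr x y z : dotv z (x + y) = dotv z x + dotv z y.
Proof. by rewrite !(dotvC z) dotvDl. Qed.

Lemma dotvZr a x z : dotv z (a *: x) = a * dotv z x.
Proof. by rewrite !(dotvC z) dotvZl. Qed.

Lemma dotv_ge0 x : 0 <= dotv x x.
Proof. by apply: sumr_ge0 => i _; rewrite -expr2 sqr_ge0. Qed.

Lemma enorm_ge0 x : 0 <= enorm x.
Proof. exact: sqrtr_ge0. Qed.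

Lemma enorm_sqr x : enorm x ^+ 2 = dotv x x.
Proof. by rewrite sqr_sqrtr // dotv_ge0. Qed.

Lemma enorm_le x a : 0 <= a -> (enorm x <= a) = (dotv x x <= a ^+ 2).
Proof. by move=> a0; rewrite -enorm_sqr ler_sqr ?nnegrE ?enorm_ge0. Qed.

Lemma enorm_eq0 x : enorm x = 0 -> x = 0.
Proof.
move=> h; have : dotv x x = 0 by rewrite -enorm_sqr h expr0n.
move/eqP; rewrite psumr_eq0 => [/allP hx|i _]; last by rewrite -expr2 sqr_ge0.
apply/rowP => i; rewrite mxE; have := hx i (mem_index_enum _).
by rewrite /= -expr2 sqrf_eq0 => /eqP.
Qed.

Lemma enorm0 : enorm (0 : 'rV[R]_n) = 0.
Proof. by rewrite /enorm (_ : dotv 0 0 = 0) ?sqrtr0 // /dotv big1 // => i _; rewrite mxE mul0r. Qed.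

Lemma enorm_gt0 x : x != 0 -> 0 < enorm x.
Proof.
move=> x0; rewrite lt_neqAle enorm_ge0 andbT eq_sym; apply: contraNneq x0 => /enorm_eq0 ->.
exact: eqxx.
Qed.

Lemma enormZ a x : enorm (a *: x) = `|a| * enorm x.
Proof.
rewrite /enorm dotvZl dotvZr mulrA -expr2 sqrtrM ?sqr_ge0 //.
by rewrite sqrtr_sqr.
Qed.

Lemma enormN x : enorm (- x) = enorm x.
Proof. by rewrite -scaleN1r enormZ normrN1 mul1r. Qed.

Lemma cauchy_schwarz x y : dotv x y <= enorm x * enorm y.
Proof.
case: (eqVneq y 0) => [->|y0].
  by rewrite enorm0 mulr0 /dotv big1 // => i _; rewrite mxE mulr0.
have N0 := enorm_gt0 y0; set N := enorm y in N0 *; set M := enorm x; set s := dotv x y.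
have h := dotv_ge0 (N ^+ 2 *: x - s *: y).
have e : dotv (N ^+ 2 *: x - s *: y) (N ^+ 2 *: x - s *: y) = N ^+ 2 * ((M * N) ^+ 2 - s ^+ 2).
  have -> : N ^+ 2 *: x - s *: y = N ^+ 2 *: x + (- s) *: y by rewrite scaleNr.
  rewrite !dotvDl !dotvDr !dotvZl !dotvZr (dotvC y x) -/s -(enorm_sqr x) -(enorm_sqr y).
  by rewrite -/M -/N; ring.
move: h; rewrite e pmulr_rge0 ?exprn_gt0 // subr_ge0 => h.
have MN0 : 0 <= M * N by rewrite mulr_ge0 ?enorm_ge0.
apply: le_trans (ler_norm _) _.
by rewrite -(ler_sqr (normr_ge0 s)) // real_normK // num_real.
Qed.

Lemma enormD x y : enorm (x + y) <= enorm x + enorm y.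
Proof.
rewrite enorm_le ?addr_ge0 ?enorm_ge0 // !dotvDl !dotvDr (dotvC y x).
rewrite sqrrD !enorm_sqr; have := cauchy_schwarz x y; lra.
Qed.

Lemma enorm_distC x y : enorm (x - y) = enorm (y - x).
Proof. by rewrite -opprB enormN. Qed.

Lemma enorm_dist x y z : enorm (x - y) <= enorm (x - z) + enorm (z - y).
Proof. by rewrite (_ : x - y = (x - z) + (z - y)) ?enormD // addrA subrK. Qed.

Lemma enorm_subl x y : enorm x - enorm y <= enorm (x - y).
Proof. by rewrite lerBlDr -{1}[x](subrK y) enormD. Qed.

Lemma enorm_dist_abs x y : `|enorm x - enorm y| <= enorm (x - y).
Proof.
rewrite ler_norml enorm_subl andbT lerNl opprB enorm_distC; exact: enorm_subl.
Qed.

Lemma coord_le x i : `|x 0 i| <= enorm x.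
Proof.
rewrite -(ler_sqr (normr_ge0 _)) ?nnegrE ?enorm_ge0 // enorm_sqr.
rewrite real_normK ?num_real // /dotv (bigD1 i) //= -expr2 lerDl.
by apply: sumr_ge0 => j _; rewrite -expr2 sqr_ge0.
Qed.

Lemma enorm_coord x (d : R) : 0 <= d -> (forall i, `|x 0 i| <= d) -> enorm x <= n.+1%:R * d.
Proof.
move=> d0 h; rewrite enorm_le ?mulr_ge0 //.
apply: (@le_trans _ _ (\sum_(i < n) d ^+ 2)).
  apply: ler_sum => i _; rewrite -expr2 -real_normK ?num_real //.
  by rewrite lerXn2r ?nnegrE.
rewrite sumr_const card_ord -[_ *+ n]mulr_natl exprMn ler_wpM2r ?exprn_ge0 //.
rewrite -natrX ler_nat; nia.
Qed.

End Euclid.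

Section Coordinates.
Variable R : realType.

Definition mkv m (b : 'rV[R]_m) (y : R) : 'rV[R]_m.+1 :=
  \row_i (if unlift ord_max i is Some j then b 0 j else y).

Lemma base_mkv m (b : 'rV[R]_m) y : base_coord (mkv b y) = b.
Proof. by apply/rowP => i; rewrite !mxE liftK. Qed.

Lemma last_mkv m (b : 'rV[R]_m) y : last_coord (mkv b y) = y.
Proof. by rewrite /last_coord mxE unlift_none. Qed.

Lemma mkvK m (x : 'rV[R]_m.+1) : mkv (base_coord x) (last_coord x) = x.
Proof.
apply/rowP => i; rewrite mxE; case: unliftP => [j ->|->] //.
by rewrite !mxE.
Qed.

Lemma mkvD m (b b' : 'rV[R]_m) y y' : mkv b y + mkv b' y' = mkv (b + b') (y + y').
Proof. by apply/rowP => i; rewrite !mxE; case: unliftP => [j|] _ //; rewrite mxE. Qed.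

Lemma mkvZ m a (b : 'rV[R]_m) y : a *: mkv b y = mkv (a *: b) (a * y).
Proof. by apply/rowP => i; rewrite !mxE; case: unliftP => [j|] _ //; rewrite mxE. Qed.

Lemma mkvB m (b b' : 'rV[R]_m) y y' : mkv b y - mkv b' y' = mkv (b - b') (y - y').
Proof. by rewrite -scaleN1r mkvZ mkvD scaleN1r mulN1r. Qed.


Lemma base_coordB m (x y : 'rV[R]_m.+1) : base_coord (x - y) = base_coord x - base_coord y.
Proof. by apply/rowP => i; rewrite !mxE. Qed.

Lemma last_coordB m (x y : 'rV[R]_m.+1) : last_coord (x - y) = last_coord x - last_coord y.
Proof. by rewrite /last_coord !mxE. Qed.

Lemma enorm_mkv m (b : 'rV[R]_m) y : enorm (mkv b y) ^+ 2 = enorm b ^+ 2 + y ^+ 2.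
Proof.
rewrite !enorm_sqr /dotv big_ord_recr /= !mxE unlift_none -expr2; congr (_ + _).
apply: eq_bigr => i _; rewrite (_ : widen_ord _ i = lift ord_max i) ?mxE ?liftK //.
by apply: val_inj; rewrite /= /bump leqNgt ltn_ord.
Qed.

Lemma enorm_base m (x : 'rV[R]_m.+1) : enorm (base_coord x) <= enorm x.
Proof.
rewrite -(ler_sqr (enorm_ge0 _)) ?nnegrE ?enorm_ge0 // -{2}(mkvK x) enorm_mkv.
by rewrite lerDl sqr_ge0.
Qed.

Lemma enorm_last m (x : 'rV[R]_m.+1) : `|last_coord x| <= enorm x.
Proof. exact: coord_le. Qed.

Lemma enorm_mkv_le m (b : 'rV[R]_m) y : enorm (mkv b y) <= enorm b + `|y|.
Proof.
rewrite -(ler_sqr (enorm_ge0 _)) ?nnegrE ?addr_ge0 ?enorm_ge0 // enorm_mkv sqrrD.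
rewrite real_normK ?num_real //.
have : 0 <= enorm b * `|y| by rewrite mulr_ge0 ?enorm_ge0.
move: (enorm b ^+ 2) (y ^+ 2) (enorm b * _) => p q r; lra.
Qed.

Lemma enorm_isom n (Q : 'M[R]_n) (x : 'rV[R]_n) : Q *m Q^T = 1%:M -> enorm (x *m Q) = enorm x.
Proof.
have dE (u : 'rV[R]_n) : dotv u u = (u *m u^T) 0 0.
  by rewrite mxE; apply: eq_bigr => i _; rewrite mxE.
by move=> hQ; rewrite /enorm !dE trmx_mul mulmxA -(mulmxA x) hQ mulmx1.
Qed.

End Coordinates.

(** * Subanalytic functions along arcs *)

Section SignDetermined.
Variable R : realType.
Implicit Types (u v w : nat -> R).

Definition small n (r : R) v := forall i, (i < n)%N -> `|v i| <= r.

(* Near 0, membership in P depends only on the signs of finitely many analytic germs. *)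
Definition sgdet n (P : (nat -> R) -> Prop) := exists K (H : nat -> (nat -> R) -> R) (r : R),
  [/\ forall k, (k < K)%N -> An n (H k), 0 < r &
      forall v w, small n r v -> small n r w ->
        (forall k, (k < K)%N -> Num.sg (H k v) = Num.sg (H k w)) -> P v -> P w].

Lemma small_le n r s v : r <= s -> small n r v -> small n s v.
Proof. by move=> rs h i hi; apply: le_trans rs; apply: h. Qed.

Lemma sgdet_and n P Q : sgdet n P -> sgdet n Q -> sgdet n (fun v => P v /\ Q v).
Proof.
move=> [K [H [r [hH r0 hP]]]] [K' [H' [r' [hH' r'0 hQ]]]].
exists (K + K')%N, (fun k => if (k < K)%N then H k else H' (k - K)%N), (Num.min r r'); split.
- move=> k hk; case: ltnP => h; first exact: hH.
  by apply: hH'; move: hk h; lia.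
- by rewrite lt_min r0 r'0.
move=> v w hv hw hs [pv qv]; split.
  apply: (hP v w) pv.
  - by apply: small_le hv; rewrite ge_min lexx.
  - by apply: small_le hw; rewrite ge_min lexx.
  - by move=> k hk; have := hs k (ltn_addr _ hk); rewrite hk.
apply: (hQ v w) qv.
- by apply: small_le hv; rewrite ge_min lexx orbT.
- by apply: small_le hw; rewrite ge_min lexx orbT.
- move=> k hk; have := hs (K + k)%N; rewrite ltn_add2l hk ltnNge leq_addr /= addKn; exact.
Qed.

Lemma sgdet_ext n P Q : (forall v, P v <-> Q v) -> sgdet n P -> sgdet n Q.
Proof.
move=> h [K [H [r [hH r0 hP]]]]; exists K, H, r; split=> // v w hv hw hs /h pv.
by apply/h; apply: (hP v w).
Qed.

Lemma sgdet_true n : sgdet n (fun=> True).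
Proof. by exists 0%N, (fun _ _ => 0), 1. Qed.

Lemma sgdet_all n N (P : nat -> (nat -> R) -> Prop) :
  (forall i, (i < N)%N -> sgdet n (P i)) -> sgdet n (fun v => forall i, (i < N)%N -> P i v).
Proof.
elim: N => [|N IH] h; first by apply: sgdet_ext (sgdet_true n).
apply: sgdet_ext (sgdet_and (IH (fun i hi => h i (ltnW hi))) (h N (ltnSn N))) => v.
split=> [[h1 h2] i|h1]; last by split=> [i hi|]; apply: h1 => //; rewrite ltnW.
by rewrite ltnS leq_eqVlt => /orP[/eqP ->|/h1].
Qed.

Lemma sgdet_1 n (f : (nat -> R) -> R) (A : R -> Prop) : An n f ->
  (forall x y, Num.sg x = Num.sg y -> A x -> A y) -> sgdet n (fun v => A (f v)).
Proof.
move=> hf hA; exists 1%N, (fun=> f), 1; split=> // v w _ _ hs; apply: hA.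
exact: (hs 0%N isT).
Qed.

Lemma sgdet_gt0 n (f : (nat -> R) -> R) : An n f -> sgdet n (fun v => 0 < f v).
Proof.
move=> hf; apply: (sgdet_1 (A := fun x => 0 < x) hf) => x y h.
by rewrite -sgr_gt0 h sgr_gt0.
Qed.

Lemma sgdet_ge0 n (f : (nat -> R) -> R) : An n f -> sgdet n (fun v => 0 <= f v).
Proof.
move=> hf; apply: (sgdet_1 (A := fun x => 0 <= x) hf) => x y h.
by rewrite -sgr_ge0 h sgr_ge0.
Qed.

Lemma sgdet_eq0 n (f : (nat -> R) -> R) : An n f -> sgdet n (fun v => f v = 0).
Proof.
move=> hf; apply: (sgdet_1 (A := fun x => x = 0) hf) => x y h /eqP.
by rewrite -sgr_eq0 h sgr_eq0 => /eqP.
Qed.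

Lemma sgdet_subst n m P (y : nat -> (nat -> R) -> R) : sgdet n P ->
  (forall i, (i < n)%N -> An m (y i) /\ y i (fun=> 0) = 0) ->
  sgdet m (fun v => P (fun i => y i v)).
Proof.
move=> [K [H [r [hH r0 hP]]]] hy.
have [s s0 hs] : exists2 s, 0 < s & forall v, small m s v -> small n r (fun i => y i v).
  have /choice [s hs] : forall i, exists s : R, 0 < s /\
     ((i < n)%N -> forall v, small m s v -> `|y i v| <= r).
    move=> i; case: (ltnP i n) => hi; last by exists 1.
    have [h1 h2] := hy i hi; have [d d0 hd] := An_cont0 h1 r0; exists d; split=> // _ v /hd.
    by rewrite h2 subr0.
  have [s1 s10 h1] := @minr_seq _ n s (fun i => (hs i).1).
  exists s1 => // v hv i hi; apply: (hs i).2 => //.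
  by apply: small_le hv; apply: h1.
exists K, (fun k v => H k (fun i => y i v)), s; split=> //.
  by move=> k hk; exact: (An_subst (y := y) (hH k hk) hy).
by move=> v w hv hw hsg; apply: hP; [apply: hs|apply: hs|].
Qed.

Lemma sgdet_curve n P : sgdet n P -> accum n P ->
  exists be : nat -> R -> R, (forall i, An1 (be i) /\ be i 0 = 0) /\
    near0 (fun x => P (fun i => be i x)).
Proof.
move=> [K [H [r [hH r0 hP]]]] hacc.
have [s hs] := accum_sg K H hacc.
have hs2 : accum n (fun v => forall k, (k < K)%N -> Num.sg (H k v) = s k).
  by apply: accum_imp hs => v [].
have [be [hbe hsg]] := curve_selection hH hs2.
exists be; split=> //.
have [v hv [pv sv]] := hs r r0.
have hsm : near0 (fun x => forall i, (i < n)%N -> `|be i x| <= r).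
  apply: near0_fin => i _; have [h1 h2] := hbe i.
  by apply: near0_imp (An1_near h1 r0) => x _; rewrite h2 subr0.
apply: near0_imp (near0_and hsm hsg) => x _ [h1 h2].
by apply: (hP v) => // k hk; rewrite sv // h2.
Qed.

Lemma nbhs_rowv n (a : 'rV[R]_n) (U : set 'rV[R]_n) : nbhs a U ->
  exists2 r, 0 < r & forall v, small n r v -> U (a + rowv n v).
Proof.
move=> /nbhs_ballP[e /= e0 he]; exists (e / 2); first by rewrite divr_gt0.
move=> v hv; apply: he; rewrite -ball_normE /= opprD addrA subrr add0r normrN.
apply: rowv_norm => // i hi; apply: le_lt_trans (hv i hi) _.
by rewrite ltr_pdivrMr // ltr_pMr // ltr1n.
Qed.

Lemma sgdet_semianalytic n (B : set 'rV[R]_n) a : semianalytic B ->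
  sgdet n (fun v => B (a + rowv n v)).
Proof.
move=> /(_ a)[U [oU Ua] [p [q [f [g [hfg hB]]]]]].
have [r r0 hr] : exists2 r, 0 < r & forall v, small n r v -> U (a + rowv n v).
  by apply: nbhs_rowv; apply: open_nbhs_nbhs.
(* The pair of indices [(i, j)] has code [i * q + j]; failed decodings give the germ 0. *)
pose F k v := if insub (k %/ q)%N is Some i then
                if insub (k %% q)%N is Some j then f i j (a + rowv n v) else 0 else 0.
pose G k v := if insub (k %/ q)%N is Some i then
                if insub (k %% q)%N is Some j then g i j (a + rowv n v) else 0 else 0.
have hF k : An n (F k).
  rewrite /F; case: insub => [i|]; last exact: An_cst.
  by case: insub => [j|]; [apply/analytic_An/(hfg i j).1 | apply: An_cst].
have hG k : An n (G k).
  rewrite /G; case: insub => [i|]; last exact: An_cst.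
  by case: insub => [j|]; [apply/analytic_An/(hfg i j).2 | apply: An_cst].
exists (p * q + p * q)%N, (fun k => if (k < p * q)%N then F k else G (k - p * q)%N), r.
split=> // [k _|v w hv hw hs]; first by case: ifP.
have code (i : 'I_p) (j : 'I_q) : (i * q + j < p * q)%N.
  apply: (@leq_trans (i * q + q)); first by rewrite ltn_add2l.
  by rewrite addnC -mulSn leq_mul2r ltn_ord orbT.
have q0 (j : 'I_q) : (0 < q)%N by apply: leq_ltn_trans (ltn_ord j).
have hdiv (i : 'I_p) (j : 'I_q) : ((i * q + j) %/ q = i)%N.
  by rewrite divnMDl ?(q0 j) // divn_small // addn0.
have hmod (i : 'I_p) (j : 'I_q) : ((i * q + j) %% q = j)%N by rewrite modnMDl modn_small.
have FE (i : 'I_p) (j : 'I_q) u : F (i * q + j)%N u = f i j (a + rowv n u).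
  by rewrite /F hdiv hmod !valK.
have GE (i : 'I_p) (j : 'I_q) u : G (i * q + j)%N u = g i j (a + rowv n u).
  by rewrite /G hdiv hmod !valK.
move=> /(hB _ (hr v hv))[i hi]; apply/(hB _ (hr w hw)); exists i => j.
have [h1 h2] := hi j; split.
  have := hs (i * q + j)%N (ltn_addr _ (code i j)); rewrite code !FE h1 sgr0.
  by move=> /esym/eqP; rewrite sgr_eq0 => /eqP.
have := hs (p * q + (i * q + j))%N; rewrite ltn_add2l code ltnNge leq_addr /= addKn !GE.
by move=> /(_ isT) h; rewrite -sgr_gt0 -h sgr_gt0.
Qed.

(** Bolzano-Weierstrass for a family of bounded sets decreasing with [d], one coordinate at a time:
    the last one is an upper limit [s], and the constraint of being near [s] is added to the family
    before the induction. *)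
Lemma bolzano M (C : R) (S : R -> (nat -> R) -> Prop) :
  (forall d d' v, 0 < d <= d' -> S d v -> S d' v) ->
  (forall d, 0 < d -> exists v, S d v) ->
  (forall d v i, 0 < d -> S d v -> (i < M)%N -> `|v i| <= C) ->
  exists c : nat -> R, forall d, 0 < d -> exists2 v, S d v &
    forall i, (i < M)%N -> `|v i - c i| <= d.
Proof.
elim: M S => [|M IH] S hS hne hb.
  by exists (fun=> 0) => d /hne[v hv]; exists v.
pose X := [set y : R | forall d, 0 < d -> exists2 v, S d v & y <= v M].
have hX : has_sup X.
  split.
    exists (- C) => d d0; have [v hv] := hne d d0; exists v => //.
    by have := hb d v M d0 hv (ltnSn M); rewrite ler_norml => /andP[].
  exists C => y /(_ 1 ltr01)[v hv yv]; apply: le_trans yv _.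
  by have := hb 1 v M ltr01 hv (ltnSn M); rewrite ler_norml => /andP[].
pose s := sup X.
have near_s d : 0 < d -> exists2 v, S d v & `|v M - s| <= d.
  move=> d0; have : ~ X (s + d).
    move=> h; have : s + d <= s by apply: ub_le_sup => //; case: hX.
    by rewrite gerDl leNgt d0.
  move=> /existsNP[d1 /not_implyP[d10 h1]].
  have [y Xy sy] : exists2 y, X y & s - d < y by apply: sup_adherent.
  have [v hv yv] := Xy (Num.min d d1) ltac:(by rewrite lt_min d0 d10).
  exists v; first by apply: hS hv; rewrite lt_min d0 d10 ge_min lexx.
  have : v M < s + d.
    rewrite ltNge; apply/negP => h; apply: h1; exists v => //.
    by apply: hS hv; rewrite lt_min d0 d10 ge_min lexx orbT.
  rewrite ler_distl; lra.
have [|||c hc] := IH (fun d v => S d v /\ `|v M - s| <= d).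
- move=> d d' v hd [h1 h2]; split; first exact: hS hd h1.
  by apply: le_trans h2 _; case/andP: hd.
- by move=> d /near_s[v h1 h2]; exists v.
- by move=> d v i d0 [h1 _] hi; apply: (hb d) => //; rewrite ltnW.
exists (fun i => if i == M then s else c i) => d d0.
have [v [h1 h2] h3] := hc d d0; exists v => // i; rewrite ltnS leq_eqVlt.
by case: eqP => [->|_] //= /h3.
Qed.

End SignDetermined.

Section Leading.
Variable R : realType.

Lemma An1_lip_fin N (g : nat -> R -> R) : (forall i, (i < N)%N -> An1 (g i)) ->
  exists2 K, 0 < K & exists2 d, 0 < d & forall i x y, (i < N)%N ->
    `|x| <= d -> `|y| <= d -> `|g i x - g i y| <= K * `|x - y|.
Proof.
elim: N => [|N IH] h; first by exists 1 => //; exists 1.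
have [K K0 [d d0 hd]] := IH (fun i hi => h i (ltnW hi)).
have [K' K'0 [d' d'0 hd']] := An1_lip (h N (ltnSn N)).
exists (K + K'); first by rewrite addr_gt0.
exists (Num.min d d'); first by rewrite lt_min d0 d'0.
move=> i x y; rewrite ltnS leq_eqVlt !le_min => /orP[/eqP ->|hi] /andP[x1 x2] /andP[y1 y2].
  apply: le_trans (hd' x y x2 y2) _; rewrite ler_wpM2r // lerDr ltW //.
by apply: le_trans (hd i x y hi x1 y1) _; rewrite ler_wpM2r // lerDl ltW.
Qed.

Lemma An1_order (phi : R -> R) : An1 phi -> exists k psi, [/\ An1 psi,
   psi 0 = 0 -> psi = (fun=> 0) & near0 (fun x => phi x = x ^+ k * psi x)].
Proof.
move=> h; case: (An1_dich h) => [[e e0 he]|[k [psi [h1 h2 [e e0 he]]]]].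
  exists 0%N, (fun=> 0); split=> //=; first exact: An1_cst.
  by exists e => // x /andP[x0 xe]; rewrite mulr0 he // gtr0_norm.
exists k, psi; split=> //=; exists e => // x /andP[x0 xe].
by rewrite he // gtr0_norm.
Qed.

Lemma near0_cont_eq (f g : R -> R) : An1 f -> An1 g -> near0 (fun x => f x = g x) -> f 0 = g 0.
Proof.
move=> hf hg h; apply/eqP; rewrite -subr_eq0 -normr_le0; apply/ler_addgt0Pl => e e0.
rewrite addr0; have e2 : 0 < e / 2 by rewrite divr_gt0.
have [x x0 [hx [h1 h2]]] := near0_ex (near0_and h (near0_and (An1_near hf e2) (An1_near hg e2))).
rewrite hx in h1; have := ler_distD (g x) (f 0) (g 0); rewrite (distrC (f 0) (g x)); lra.
Qed.

(** [a] is the least order of the components; dividing it out leaves a vector that is nonzero at 0,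
    so the norm of the arc is comparable to [x ^+ a]. *)
Lemma leading_power m (be : nat -> R -> R) :
  (forall i, (i < m)%N -> An1 (be i) /\ be i 0 = 0) ->
  near0 (fun x => exists2 i, (i < m)%N & be i x <> 0) ->
  exists a xi, [/\ (0 < a)%N, forall i, (i < m)%N -> An1 (xi i),
    exists2 i, (i < m)%N & xi i 0 <> 0 &
    near0 (fun x => forall i, (i < m)%N -> be i x = x ^+ a * xi i x)].
Proof.
move=> hbe hnz.
have /choice [k hk] : forall i, exists kp : nat * (R -> R), (i < m)%N -> [/\ An1 kp.2,
   kp.2 0 = 0 -> kp.2 = (fun=> 0) & near0 (fun x => be i x = x ^+ kp.1 * kp.2 x)].
  move=> i; case: (ltnP i m) => hi; last by exists (0%N, fun=> 0).
  by have [k [psi h]] := An1_order (hbe i hi).1; exists (k, psi).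
pose nz (i : 'I_m) := (k i).2 0 != 0.
have bE : near0 (fun x => forall i, (i < m)%N -> be i x = x ^+ (k i).1 * (k i).2 x).
  by apply: near0_fin => i hi; case: (hk i hi).
have z0 (i : 'I_m) : ~~ nz i -> (k i).2 = fun=> 0.
  by move/negPn/eqP; case: (hk i (ltn_ord i)).
have [i1 hi1] : exists i, nz i.
  have [x x0 [[i hi bi] h]] := near0_ex (near0_and hnz bE).
  exists (Ordinal hi); apply: contra_notT bi => /z0 /= e.
  by rewrite h // e mulr0.
have [i0 hi0 hmin] : exists2 i0, nz i0 & forall i, nz i -> ((k i0).1 <= (k i).1)%N.
  by case: (@arg_minnP _ i1 nz (fun i => (k i).1) hi1) => i h1 h2; exists i.
exists (k i0).1, (fun i x => if (k i).2 0 == 0 then 0 else x ^+ ((k i).1 - (k i0).1) * (k i).2 x).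
split.
- rewrite lt0n; apply/eqP => a0; move/eqP: hi0; apply.
  have [h1 h2 h3] := hk i0 (ltn_ord i0); have [h4 h5] := hbe i0 (ltn_ord i0).
  rewrite -[RHS]h5; apply: near0_cont_eq h1 h4 _; apply: near0_imp h3 => x _ ->.
  by rewrite a0 expr0 mul1r.
- move=> i hi; case: (_ == _); first exact: An1_cst.
  by apply: An1M; [apply/An1X/An1_id | case: (hk i hi)].
- by exists i0 => //=; rewrite (negPf hi0) subnn expr0 mul1r; apply/eqP.
apply: near0_imp bE => x x0 h i hi; rewrite h //; case: eqP => [e|/eqP e].
  by rewrite (z0 (Ordinal hi)) ?mulr0 // /nz e eqxx.
by rewrite mulrA -exprD subnKC // (hmin (Ordinal hi)).
Qed.

(** The ratio [y / x] is the root of order [a] of [1 - lam], hence at least [1 - lam]: the change of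
    parameter is of size [lam] whatever the order. *)
Lemma power_root a (lam x : R) : (0 < a)%N -> 0 <= lam <= 1 -> 0 < x ->
  exists y, [/\ 0 <= y <= x, y ^+ a = (1 - lam) * x ^+ a & x - y <= lam * x].
Proof.
move=> a0 /andP[l0 l1] x0.
pose p := 'X^a - ((1 - lam) * x ^+ a)%:P : {poly R}.
have xa : 0 <= x ^+ a by rewrite exprn_ge0 // ltW.
have [||y hy /rootP] := @poly_ivt _ p 0 x; first exact: ltW.
  rewrite /p !hornerD !hornerN !hornerC !hornerXn expr0n gtn_eqF //= sub0r oppr_le0.
  by rewrite mulr_ge0 ?subr_ge0 //= ler_piMl // lerBlDr lerDl.
rewrite /p hornerD hornerN hornerC hornerXn => /eqP; rewrite subr_eq0 => /eqP hya.
exists y; split=> //; have /andP[y0 yx] := hy.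
have yx1 : y / x <= 1 by rewrite ler_pdivrMr // mul1r.
have : 1 - lam <= y / x.
  have -> : 1 - lam = (y / x) ^+ a.
    by rewrite expr_div_n hya mulfK // expf_neq0 // gt_eqF.
  by rewrite ler_iXnr // divr_ge0 // ltW.
by rewrite ler_pdivlMr //; lra.
Qed.

End Leading.

Section Blocks.
Variable R : realType.

Definition blk o n (u : nat -> R) : 'rV[R]_n := rowv n (fun i => u (o + i)%N).

Definition vecf n (b : 'rV[R]_n) (i : nat) : R := if insub i is Some j then b 0 j else 0.

Lemma vecf_rowv n (b : 'rV[R]_n) : rowv n (vecf b) = b.
Proof. by apply/rowP => i; rewrite mxE /vecf valK. Qed.

Lemma lsub_blk o n k (u : nat -> R) : lsubmx (blk o (n + k) u) = blk o n u.
Proof. by apply/rowP => i; rewrite !mxE. Qed.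

Lemma base_blk o m (u : nat -> R) : base_coord (blk o m.+1 u) = blk o m u.
Proof.
apply/rowP => i; rewrite !mxE; congr (u (_ + _)%N).
by rewrite /= /bump leqNgt ltn_ord.
Qed.

Lemma last_blk o m (u : nat -> R) : last_coord (blk o m.+1 u) = u (o + m)%N.
Proof. by rewrite /last_coord !mxE. Qed.

Lemma bounded_coord n (B : set 'rV[R]_n) : bounded_set B ->
  exists2 C, 0 <= C & forall b i, B b -> `|b 0 i| <= C.
Proof.
move=> [M [_ hM]]; exists (`|M| + 1); first by rewrite addr_ge0.
move=> b i Bb; have : `|b| <= `|M| + 1.
  by apply: (hM (`|M| + 1)) => //; rewrite (le_lt_trans (ler_norm M)) // ltrDl.
rewrite -[`|b|]/(mx_norm b) mx_normrE => h; apply: le_trans h.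
by apply: (le_bigmax _ (fun ij : 'I_1 * 'I_n => `|b ij.1 ij.2|) (0, i)).
Qed.

End Blocks.

Section Euler.
Variables (R : realType) (m : nat).
Variables (D : set 'rV[R]_m) (f : 'rV[R]_m -> R) (fb : R) (p : 'rV[R]_m).
Variables (e e' : R).

Let pc (i : nat) := vecf p i.

Section Configurations.
Variables (N1 N2 : nat) (B1 : set 'rV[R]_(m.+1 + N1)) (B2 : set 'rV[R]_(m + N2)).
(** Layout of a configuration [u]: a lift to [B1] of the graph point over [x], at 0; one over [xh],
    at [o1]; lifts of [x] and [xh] to [B2], at [o2] and [o3]; and [lam] at [oL]. The entry [m] is
    thus the value at [x]. The separate lifts to [B2] are there because the graph is taken over the
    closure of [D]. *)
Let n1 := (m.+1 + N1)%N.
Let n2 := (m + N2)%N.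
Let o1 := n1.
Let o2 := (n1 + n1)%N.
Let o3 := (n1 + n1 + n2)%N.
Let oL := (n1 + n1 + n2 + n2)%N.

(** Squared quantities, so that the estimate becomes polynomial in [u] and hence a sign condition on
    analytic germs. *)
Definition cX2 (u : nat -> R) := \sum_(i < m) (u i - pc i) ^+ 2.
Definition cE2 (u : nat -> R) :=
  \sum_(i < m) (u i - u (o1 + i)%N - u oL * (u i - pc i)) ^+ 2.
Definition cY2 (u : nat -> R) := (u m - u (o1 + m)%N - u oL * (u m - fb)) ^+ 2.

(* A pair of points of the graph violating the estimate, lifted to [B1] and [B2]. *)
Definition bad_pair (u : nat -> R) : Prop :=
  ((B1 (blk 0 n1 u) /\ B1 (blk o1 n1 u)) /\ (B2 (blk o2 n2 u) /\ B2 (blk o3 n2 u))) /\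
  (((forall i, (i < m)%N -> u i - u (o2 + i)%N = 0) /\
    (forall i, (i < m)%N -> u (o1 + i)%N - u (o3 + i)%N = 0)) /\
   ((0 < cX2 u /\ (0 < u oL /\ 0 <= 1 / 2 - u oL)) /\
    (0 <= (e' * u oL) ^+ 2 * cX2 u - cE2 u /\ 0 < cY2 u - (e * u oL) ^+ 2 * cX2 u))).

Lemma sgdet_bad_pair (c : nat -> R) : semianalytic B1 -> semianalytic B2 ->
  sgdet oL.+1 (fun v => bad_pair (fun i => c i + v i)).
Proof.
move=> s1 s2.
have hv i : (i <= oL)%N -> An oL.+1 (fun v => c i + v i).
  by move=> hi; apply: AnD (An_cst _ _) (An_var _ _).
have hblk o n (B : set 'rV[R]_n) : (o + n <= oL)%N -> semianalytic B ->
    sgdet oL.+1 (fun v => B (blk o n (fun i => c i + v i))).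
  move=> hon sB.
  have := @sgdet_subst _ n oL.+1 _ (fun i v => v (o + i)%N) (sgdet_semianalytic (blk o n c) sB).
  move=> h; apply: sgdet_ext (h _) => [v|i hi]; last first.
    by split=> //; apply: An_var; move: hi hon; lia.
  rewrite (_ : blk o n c + _ = blk o n (fun i => c i + v i)) //.
  by apply/rowP => i; rewrite !mxE.
have ho1 : (o1 + m < oL)%N by rewrite /o1 /oL /n1 /n2; lia.
have hX2 : An oL.+1 (fun v => cX2 (fun i => c i + v i)).
  apply: An_sum => i _; apply: AnX; apply: AnB (An_cst _ _); apply: hv.
  by apply: ltnW; apply: ltn_trans ho1; have := ltn_ord i; lia.
have hoi (i : 'I_m) : (i <= oL)%N /\ (o1 + i <= oL)%N by have := ltn_ord i; move: ho1; lia.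
have hE2 : An oL.+1 (fun v => cE2 (fun i => c i + v i)).
  apply: An_sum => i _; have [i1 i2] := hoi i; apply: AnX; apply: AnB.
    by apply: AnB; apply: hv.
  by apply: AnM; [apply: hv | apply: AnB (An_cst _ _); apply: hv].
have hY2 : An oL.+1 (fun v => cY2 (fun i => c i + v i)).
  have mo : (m <= oL)%N by move: ho1; lia.
  apply: AnX; apply: AnB; first by apply: AnB; apply: hv => //; apply: ltnW.
  by apply: AnM; [apply: hv | apply: AnB (An_cst _ _); apply: hv].
have hlam (a : R) : An oL.+1 (fun v => (a * (c oL + v oL)) ^+ 2 * cX2 (fun i => c i + v i)).
  by apply: AnM => //; apply: AnX; apply: AnM (An_cst _ _) _; apply: hv.
apply: sgdet_and.
  by apply: sgdet_and; apply: sgdet_and; apply: hblk => //; rewrite /o1 /o2 /o3 /oL; lia.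
apply: sgdet_and; first apply: sgdet_and.
- apply: (sgdet_all (P := fun i v => c i + v i - (c (o2 + i)%N + v (o2 + i)%N) = 0)) => i hi.
  by apply: sgdet_eq0; apply: AnB; apply: hv; move: hi; rewrite /oL /o2 /n1 /n2; lia.
- apply: (sgdet_all (P := fun i v => c (o1 + i)%N + v (o1 + i)%N - (c (o3 + i)%N + v (o3 + i)%N) = 0)) => i hi.
  by apply: sgdet_eq0; apply: AnB; apply: hv; move: hi; rewrite /oL /o3 /o1 /n1 /n2; lia.
apply: sgdet_and.
  apply: sgdet_and; first exact: sgdet_gt0.
  by apply: sgdet_and; [apply/sgdet_gt0/hv | apply/sgdet_ge0; apply: AnB (An_cst _ _) (hv _ _)].
by apply: sgdet_and; [apply: sgdet_ge0; apply: AnB | apply: sgdet_gt0; apply: AnB].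
Qed.

Lemma cX2E u : cX2 u = enorm (blk 0 m u - p) ^+ 2.
Proof.
rewrite enorm_sqr; apply: eq_bigr => i _.
by rewrite !mxE add0n -expr2 /pc /vecf valK.
Qed.

Lemma cE2E u : cE2 u = enorm (blk 0 m u - blk o1 m u - u oL *: (blk 0 m u - p)) ^+ 2.
Proof.
rewrite enorm_sqr; apply: eq_bigr => i _.
by rewrite !mxE !add0n -expr2 /pc /vecf valK.
Qed.

Lemma bad_pair_graph (U1 : set 'rV[R]_m.+1) (U2 : set 'rV[R]_m) u :
  graph_set (closure D) f `&` U1 = lsubmx @` B1 -> D `&` U2 = lsubmx @` B2 ->
  bad_pair u -> [/\ D (blk 0 m u), D (blk o1 m u), u m = f (blk 0 m u) &
     u (o1 + m)%N = f (blk o1 m u)] /\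
  [/\ 0 < enorm (blk 0 m u - p), 0 < u oL <= 1 / 2,
      enorm (blk 0 m u - blk o1 m u - u oL *: (blk 0 m u - p)) <= e' * u oL * enorm (blk 0 m u - p) \/ e' < 0 &
      e * u oL * enorm (blk 0 m u - p) < `|u m - u (o1 + m)%N - u oL * (u m - fb)|].
Proof.
move=> h1 h2 [[[b1 b1h] [b2 b2h]] [[q1 q2] [[x0 [l0 l1]] [he hy]]]].
have g1 : graph_set (closure D) f (blk 0 m.+1 u).
  by have : (lsubmx @` B1) (lsubmx (blk 0 n1 u)) by [exists (blk 0 n1 u)]; rewrite -h1 lsub_blk => -[].
have g1h : graph_set (closure D) f (blk o1 m.+1 u).
  by have : (lsubmx @` B1) (lsubmx (blk o1 n1 u)) by [exists (blk o1 n1 u)]; rewrite -h1 lsub_blk => -[].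
have d1 : D (blk 0 m u).
  have : (lsubmx @` B2) (lsubmx (blk o2 n2 u)) by exists (blk o2 n2 u).
  rewrite -h2 lsub_blk => -[]; rewrite (_ : blk o2 m u = blk 0 m u) //.
  apply/rowP => i; rewrite !mxE; have /eqP := q1 i (ltn_ord i).
  by rewrite subr_eq0 => /eqP <-.
have d1h : D (blk o1 m u).
  have : (lsubmx @` B2) (lsubmx (blk o3 n2 u)) by exists (blk o3 n2 u).
  rewrite -h2 lsub_blk => -[]; rewrite (_ : blk o3 m u = blk o1 m u) //.
  apply/rowP => i; rewrite !mxE; have /eqP := q2 i (ltn_ord i).
  by rewrite subr_eq0 => /eqP <-.
have lp : 0 < u oL by [].
split.
  split=> //.
    by case: g1 => _; rewrite base_blk last_blk.
  by case: g1h => _; rewrite base_blk last_blk.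
split.
- by rewrite lt_neqAle enorm_ge0 andbT eq_sym -sqrf_eq0 -cX2E gt_eqF.
- by rewrite lp -subr_ge0.
- case: (leP 0 e') => ep; [left|by right].
  rewrite enorm_le ?mulr_ge0 ?enorm_ge0 ?(ltW lp) // -enorm_sqr -cE2E exprMn -cX2E.
  by rewrite -subr_ge0.
move: hy; rewrite subr_gt0 cX2E -exprMn /cY2 => hy.
apply: le_lt_trans (ler_norm _) _.
by rewrite -ltr_sqr ?nnegrE // !real_normK ?num_real.
Qed.

End Configurations.

End Euler.

Section Arc.
Variables (R : realType) (m : nat).
Variables (D : set 'rV[R]_m) (f : 'rV[R]_m -> R) (L fb : R) (p : 'rV[R]_m).
Hypothesis L0 : 0 <= L.
Hypothesis fL : forall x y, D x -> D y -> `|f x - f y| <= L * enorm (x - y).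
Hypothesis fp : forall x, D x -> `|f x - fb| <= L * enorm (x - p).
Variables (e e' : R).
Hypothesis e0 : 0 < e.
Hypothesis ee' : L * e' <= e / 2.

(* The second point of a bad pair is compared with the point of the same arc whose
   parameter y satisfies y^a = (1 - lam) x^a, a being the order of the arc. *)
Lemma no_bad_arc (o1 oL : nat) (c : nat -> R) (be : nat -> R -> R) :
  (forall i, An1 (be i) /\ be i 0 = 0) ->
  (forall i, (i < m)%N -> c i = vecf p i) -> c m = fb ->
  near0 (fun x => let u i := c i + be i x in
    [/\ D (blk 0 m u), D (blk o1 m u), u m = f (blk 0 m u) &
       u (o1 + m)%N = f (blk o1 m u)] /\
    [/\ 0 < enorm (blk 0 m u - p), 0 < u oL <= 1 / 2,
       enorm (blk 0 m u - blk o1 m u - u oL *: (blk 0 m u - p)) <= e' * u oL * enorm (blk 0 m u - p) &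
       e * u oL * enorm (blk 0 m u - p) < `|u m - u (o1 + m)%N - u oL * (u m - fb)|]) ->
  False.
Proof.
move=> hbe hc hcm hbad.
pose u x i := c i + be i x.
have XE x : blk 0 m (u x) - p = rowv m (fun i => be i x).
  by apply/rowP => i; rewrite !mxE add0n /u hc // /vecf valK addrAC subrr add0r.
have hnz : near0 (fun x => exists2 i, (i < m)%N & be i x <> 0).
  apply: near0_imp hbad => x x0 [_ [h _ _ _]]; apply: contrapT => hn.
  move: h; rewrite -[fun i => _]/(u x) XE (_ : rowv m _ = 0) ?enorm0 ?ltxx //.
  apply/rowP => i; rewrite !mxE; apply: contrapT => h; apply: hn; exists (val i) => //; apply: ltn_ord.
have [a [xi [a0 hxi [i0 hi0 xi0] hax]]] := leading_power (fun i _ => hbe i) hnz.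
pose c0 := enorm (rowv m (fun i => xi i 0)) / 2.
have c00 : 0 < c0.
  rewrite divr_gt0 // enorm_gt0 //; apply/eqP => /rowP /(_ (Ordinal hi0)).
  by rewrite !mxE.
have hnorm : near0 (fun x => c0 <= enorm (rowv m (fun i => xi i x)) <= 3 * c0).
  have d0 : 0 < c0 / m.+1%:R by rewrite divr_gt0.
  apply: near0_imp (near0_fin (fun i hi => An1_near (hxi i hi) d0)) => x x0 h.
  have h1 : enorm (rowv m (fun i => xi i x) - rowv m (fun i => xi i 0)) <= c0.
    apply: (@le_trans _ _ (m.+1%:R * (c0 / m.+1%:R))).
      by apply: enorm_coord (ltW d0) _ => i; rewrite !mxE h.
    by rewrite mulrC divfK.
  have h2 := enorm_subl (rowv m (fun i => xi i x)) (rowv m (fun i => xi i 0)).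
  have h3 := enorm_subl (rowv m (fun i => xi i 0)) (rowv m (fun i => xi i x)).
  rewrite enorm_distC in h3.
  have hc0 : enorm (rowv m (fun i => xi i 0)) = 2 * c0 by rewrite /c0 mulrC divfK.
  by rewrite hc0 in h2 h3; apply/andP; lra.
have XE2 : near0 (fun x => blk 0 m (u x) - p = x ^+ a *: rowv m (fun i => xi i x)).
  apply: near0_imp hax => x x0 h; rewrite XE; apply/rowP => i.
  by rewrite !mxE h.
(* The value coordinate has order at least [a], because [fp] bounds it by the distance of the base
   point to [p], which has order [a]. *)
have [eta [heta hetaE]] : exists eta, An1 eta /\ near0 (fun x => be m x = x ^+ a * eta x).
  have [k [psi [h1 h2 h3]]] := An1_order (hbe m).1.
  case: (leqP a k) => ak.
    exists (fun x => x ^+ (k - a) * psi x); split; first by apply: An1M => //; apply/An1X/An1_id.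
    by apply: near0_imp h3 => x _ ->; rewrite mulrA -exprD subnKC.
  exists (fun=> 0); split; first exact: An1_cst.
  have [d d0 hd] := near0_and h3 (near0_and hbad (near0_and hnorm XE2)).
  have psi0 : psi = fun=> 0.
    apply: h2; apply: (@An1_flat _ psi k a (L * (3 * c0)) d h1 ak d0) => t ht.
    have [hb [[[D1 _ uE _] _] [/andP[_ hn] hX]]] := hd t ht.
    have := fp D1; rewrite -uE -hb -hcm [c m + _]addrC addrK => h; apply: le_trans h _.
    rewrite -/(u t) hX enormZ -mulrA ler_wpM2l // mulrC ger0_norm; last first.
      by rewrite exprn_ge0 // ltW; case/andP: ht.
    by rewrite ler_wpM2r // exprn_ge0 // ltW; case/andP: ht.
  by apply: near0_imp h3 => x _ ->; rewrite psi0 !mulr0.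
pose g i := if (i < m)%N then xi i else eta.
have [K K0 [dK dK0 hK]] : exists2 K, 0 < K & exists2 d, 0 < d & forall i x y, (i < m.+1)%N ->
    `|x| <= d -> `|y| <= d -> `|g i x - g i y| <= K * `|x - y|.
  apply: An1_lip_fin => i _; rewrite /g; case: (ltnP i m) => // hi; exact: hxi.
have [d d0 hd] := near0_and hbad (near0_and hnorm (near0_and XE2 hetaE)).
pose M := K + L * (m.+1%:R * K).
have M0 : 0 < M by rewrite ltr_pwDl // !mulr_ge0 // ltW.
(* Small enough for the error [M * x] of the arc to fit into the half of [e] that [ee'] leaves
   free. *)
pose x := Num.min d (Num.min dK (e / 2 * c0 / M)).
have x0 : 0 < x by rewrite !lt_min d0 dK0 divr_gt0 // mulr_gt0 // divr_gt0.
have xd : x <= d by rewrite /x ge_min lexx.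
have xK : x <= dK by rewrite /x !ge_min lexx orbT.
have xM : M * x <= e / 2 * c0.
  by rewrite mulrC -ler_pdivlMr // /x !ge_min lexx !orbT.
have hx : 0 < x <= d by rewrite x0 xd.
have [[[D1 D1h uE uhE] [X0 lam01 hclose hviol]] [/andP[hn1 _] [hX hum]]] := hd x hx.
pose lam := u x oL.
have {}lam01 : 0 < lam <= 1 / 2 := lam01.
have {}hclose : enorm (blk 0 m (u x) - blk o1 m (u x) - lam *: (blk 0 m (u x) - p)) <=
  e' * lam * enorm (blk 0 m (u x) - p) := hclose.
have {}hviol : e * lam * enorm (blk 0 m (u x) - p) <
  `|u x m - u x (o1 + m)%N - lam * (u x m - fb)| := hviol.
have {}uE : u x m = f (blk 0 m (u x)) := uE.
have {}uhE : u x (o1 + m)%N = f (blk o1 m (u x)) := uhE.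
have {}D1 : D (blk 0 m (u x)) := D1.
have {}D1h : D (blk o1 m (u x)) := D1h.
have lam2 : 0 <= lam <= 1 by apply/andP; case/andP: lam01; lra.
have [y [/andP[y0 yx] ya xy]] := power_root a0 lam2 x0.
have lam0 : 0 < lam by case/andP: lam01.
have lam1 : 0 < 1 - lam by case/andP: lam01; lra.
have xa0 : 0 < x ^+ a by rewrite exprn_gt0.
have yp : 0 < y.
  rewrite lt_neqAle y0 andbT; apply/eqP => yz; have := mulr_gt0 lam1 xa0.
  by rewrite -ya -yz expr0n gtn_eqF //= ltxx.
have hy : 0 < y <= d by rewrite yp (le_trans yx).
have [[[D2 _ uyE _] _] [_ [hXy humy]]] := hd y hy.
have {}D2 : D (blk 0 m (u y)) := D2.
have {}uyE : u y m = f (blk 0 m (u y)) := uyE.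
(* Since [y ^+ a] is [(1 - lam) * x ^+ a], the difference is [x ^+ a * (1 - lam)] times the
   variation of [g] between [x] and [y]: the arc point at [y] is a dilation by [1 - lam] of that at
   [x], up to an error of order [lam * x ^+ a.+1]. *)
have gE i : (i < m.+1)%N -> `|x ^+ a * g i x - y ^+ a * g i y - lam * (x ^+ a * g i x)| <=
    x ^+ a * (K * (lam * x)).
  move=> hi; rewrite ya.
  have -> : x ^+ a * g i x - (1 - lam) * x ^+ a * g i y - lam * (x ^+ a * g i x) =
     x ^+ a * ((1 - lam) * (g i x - g i y)) by ring.
  rewrite normrM (gtr0_norm xa0) ler_pM2l // normrM (gtr0_norm lam1).
  apply: (@le_trans _ _ `|g i x - g i y|); first by rewrite ler_piMl // lerBlDr lerDl ltW.
  have xy0 : 0 <= x - y by rewrite subr_ge0.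
  apply: le_trans (hK i x y hi _ _) _; first by rewrite ger0_norm // ltW.
    by rewrite ger0_norm // (le_trans yx).
  by rewrite ler_pM2l // ger0_norm.
have base : enorm (blk 0 m (u x) - blk 0 m (u y) - lam *: (blk 0 m (u x) - p)) <=
    m.+1%:R * (x ^+ a * (K * (lam * x))).
  rewrite -[blk 0 m (u x) - blk 0 m (u y)](_ : (blk 0 m (u x) - p) - (blk 0 m (u y) - p) = _); last first.
    by rewrite opprB addrA subrK.
  rewrite hX hXy; apply: enorm_coord => [|j].
    by rewrite !mulr_ge0 // ltW.
  by rewrite !mxE; have := gE j (ltnW (ltn_ord j)); rewrite /g ltn_ord.
have fib : `|u x m - u y m - lam * (u x m - fb)| <= x ^+ a * (K * (lam * x)).
  have := gE m (ltnSn m); rewrite /g ltnn -hum -humy /u hcm.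
  by rewrite (_ : be m x - _ - _ = fb + be m x - (fb + be m y) - lam * (fb + be m x - fb)) //; ring.
have dist : enorm (blk o1 m (u x) - blk 0 m (u y)) <=
    e' * lam * enorm (blk 0 m (u x) - p) + m.+1%:R * (x ^+ a * (K * (lam * x))).
  rewrite [X in _ <= X]addrC; apply: le_trans (lerD base hclose).
  set A := blk 0 m (u x); set B := blk o1 m (u x); set C := blk 0 m (u y).
  have -> : B - C = (A - C - lam *: (A - p)) - (A - B - lam *: (A - p)).
    by apply/rowP => j; rewrite !mxE; ring.
  by apply: le_trans (enormD _ _) _; rewrite enormN.
move: hviol; apply/negP; rewrite -leNgt.
have hf : `|u x (o1 + m)%N - u y m| <= L * (e' * lam * enorm (blk 0 m (u x) - p) + m.+1%:R * (x ^+ a * (K * (lam * x)))).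
  by rewrite uhE uyE; apply: le_trans (fL D1h D2) _; rewrite ler_wpM2l.
have tri : `|u x m - u x (o1 + m)%N - lam * (u x m - fb)| <=
   `|u x m - u y m - lam * (u x m - fb)| + `|u x (o1 + m)%N - u y m|.
  apply: le_trans (ler_normB _ _); rewrite le_eqVlt; apply/orP; left; apply/eqP; congr `|_|; ring.
apply: le_trans tri _; apply: le_trans (lerD fib hf) _.
have hxa : x ^+ a * c0 <= enorm (blk 0 m (u x) - p).
  by rewrite hX enormZ gtr0_norm // ler_pM2l.
set N := enorm _ in hxa *.
have h1 : L * e' * (lam * N) <= e / 2 * (lam * N).
  by rewrite ler_wpM2r // mulr_ge0 ?enorm_ge0 // ltW.
have h2 : lam * (x ^+ a * (M * x)) <= lam * (e / 2 * N).
  rewrite ler_pM2l // (le_trans (_ : _ <= x ^+ a * (e / 2 * c0))) ?ler_pM2l //.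
  by rewrite mulrCA ler_pM2l // divr_gt0.
have h3 : x ^+ a * (K * (lam * x)) + L * (e' * lam * N + m.+1%:R * (x ^+ a * (K * (lam * x)))) =
  L * e' * (lam * N) + lam * (x ^+ a * (M * x)).
  rewrite /M; move: (x ^+ a) (m.+1%:R : R) => xa m1; ring.
by rewrite h3; apply: le_trans (lerD h1 h2) _; rewrite le_eqVlt; apply/orP; left; apply/eqP; field.
Qed.

End Arc.

Lemma nbhs_enorm (R : realType) n (a : 'rV[R]_n) (U : set 'rV[R]_n) : nbhs a U ->
  exists2 r, 0 < r & forall x, enorm (x - a) <= r -> U x.
Proof.
move=> /nbhs_rowv[r r0 h]; exists r => // x hx.
rewrite -[x](subrK a) addrC -[x - a]vecf_rowv; apply: h => i hi.
rewrite /vecf insubT; apply: le_trans hx; exact: coord_le.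
Qed.

Lemma blk_vecf (R : realType) o n (u : nat -> R) (b : 'rV[R]_n) :
  (forall i, (i < n)%N -> u (o + i)%N = vecf b i) -> blk o n u = b.
Proof. by move=> h; apply/rowP => i; rewrite mxE h // /vecf valK. Qed.

Definition join4 T n1 n2 (a b c d : nat -> T) (z : T) i :=
  if (i < n1)%N then a i else if (i < n1 + n1)%N then b (i - n1)%N else
  if (i < n1 + n1 + n2)%N then c (i - (n1 + n1))%N else
  if (i < n1 + n1 + n2 + n2)%N then d (i - (n1 + n1 + n2))%N else z.

Lemma join4E T n1 n2 (a b c d : nat -> T) (z : T) (u := join4 n1 n2 a b c d z) :
  [/\ forall i, (i < n1)%N -> u i = a i,
      forall i, (i < n1)%N -> u (n1 + i)%N = b i,
      forall i, (i < n2)%N -> u (n1 + n1 + i)%N = c i &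
      (forall i, (i < n2)%N -> u (n1 + n1 + n2 + i)%N = d i) /\
      u (n1 + n1 + n2 + n2)%N = z].
Proof.
have F x y : (y <= x)%N -> (x < y)%N = false by move=> h; apply/negbTE; rewrite -leqNgt.
rewrite /u /join4; split; last split => [i h|].
- by move=> i ->.
- by move=> i h; rewrite (F _ n1) ?leq_addr // ltn_add2l h addKn.
- by move=> i h; rewrite (F _ n1) ?(F _ (n1 + n1)%N) ?ltn_add2l ?h ?addKn //; lia.
- by rewrite (F _ n1) ?(F _ (n1 + n1)%N) ?(F _ (n1 + n1 + n2)%N) ?ltn_add2l ?h ?addKn //; lia.
- by rewrite (F _ n1) ?(F _ (n1 + n1)%N) ?(F _ (n1 + n1 + n2)%N) ?ltnn //; lia.
Qed.

Lemma subanalytic_lift (R : realType) n (X : set 'rV[R]_n) a : subanalytic X ->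
  exists N (B : set 'rV[R]_(n + N)) U, [/\ semianalytic B, bounded_set B,
    X `&` U = lsubmx @` B & exists2 r, 0 < r & forall x, enorm (x - a) <= r -> U x].
Proof.
move=> /(_ a)[U hU [N [B [h1 h2 h3]]]]; exists N, B, U; split=> //.
by apply: nbhs_enorm; apply: open_nbhs_nbhs.
Qed.

(* A discrete form of Euler's identity for homogeneous functions. *)
Lemma discrete_euler (R : realType) m (D : set 'rV[R]_m) (f : 'rV[R]_m -> R) (L fb : R)
    (p : 'rV[R]_m) (e : R) : 0 <= L -> 0 < e ->
  (forall x y, D x -> D y -> `|f x - f y| <= L * enorm (x - y)) ->
  (forall x, D x -> `|f x - fb| <= L * enorm (x - p)) ->
  subanalytic D -> subanalytic (graph_set (closure D) f) ->
  exists2 e', 0 < e' & exists2 d, 0 < d & forall x xh lam, D x -> D xh ->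
    0 <= lam <= 1 / 2 -> enorm (x - p) < d ->
    enorm (x - xh - lam *: (x - p)) <= e' * lam * enorm (x - p) ->
    `|f x - f xh - lam * (f x - fb)| <= e * lam * enorm (x - p).
Proof.
move=> L0 e0 fL fp sD sG.
have L1 : 0 < L + 1 by rewrite ltr_wpDl.
(* Half of [e] pays, through the Lipschitz constant, for the distance from [xh] to the comparison
   point. *)
pose e' := e / 2 / (L + 1).
have e'0 : 0 < e' by rewrite !divr_gt0.
have ee' : L * e' <= e / 2.
  rewrite /e' mulrA ler_pdivrMr // mulrC ler_pM2l ?divr_gt0 // lerDl //.
exists e' => //; apply: contrapT => hno.
have [N1 [B1 [U1 [sB1 bB1 h1 [r1 r10 hr1]]]]] := subanalytic_lift (mkv p fb) sG.
have [N2 [B2 [U2 [sB2 bB2 h2 [r2 r20 hr2]]]]] := subanalytic_lift p sD.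
have [C1 C10 hC1] := bounded_coord bB1.
have [C2 C20 hC2] := bounded_coord bB2.
pose bad := @bad_pair R m fb p e e' N1 N2 B1 B2.
pose n1 := (m.+1 + N1)%N; pose n2 := (m + N2)%N.
pose oL := (n1 + n1 + n2 + n2)%N.
(* If the conclusion fails for every radius, violating pairs exist arbitrarily near [p]; the factor
   [A] keeps both of their graph points where the lifts are available. *)
have hS d : 0 < d -> exists u, bad u /\ cX2 p u <= d ^+ 2.
  move=> d0; pose A := (1 + e') * (1 + L).
  have A0 : 0 < A by rewrite mulr_gt0 // ltr_wpDr // ltW.
  pose d' := Num.min d (Num.min (r1 / A) (r2 / A)).
  have d'0 : 0 < d' by rewrite !lt_min d0 !divr_gt0.
  apply: contrapT => hnu; apply: hno; exists d' => // x xh lam Dx Dxh lam01 hxd hcl.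
  apply: contrapT => /negP; rewrite -ltNge => hviol; apply: hnu.
  have /andP[l0 l1] := lam01.
  (* A pair with [x = p] or [lam = 0] satisfies the estimate, so a violating pair meets the strict
     inequalities required by [bad_pair]. *)
  have X0 : 0 < enorm (x - p).
    rewrite lt_neqAle enorm_ge0 andbT; apply/eqP => hx; move: hviol hcl.
    rewrite -hx !mulr0 => hviol hcl.
    have xp : x - p = 0 by apply: enorm_eq0.
    have /enorm_eq0 : enorm (x - xh - lam *: (x - p)) = 0 by apply/eqP; rewrite eq_le hcl enorm_ge0.
    rewrite xp scaler0 subr0 => /eqP; rewrite subr_eq0 => /eqP xxh.
    have := fp _ Dx; rewrite xp enorm0 mulr0 normr_le0 => /eqP h.
    by move: hviol; rewrite h -xxh subrr mulr0 subr0 normr0 ltxx.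
  have lam0 : 0 < lam.
    rewrite lt_neqAle l0 andbT; apply/eqP => hl; move: hviol hcl; rewrite -hl.
    rewrite mulr0 !mul0r scale0r !subr0 => hviol hcl.
    rewrite mulr0 mul0r in hcl.
    by have := lt_le_trans hviol (fL _ _ Dx Dxh); rewrite ltNge mulr_ge0_le0.
  have Xh : enorm (xh - p) <= (1 + e') * enorm (x - p).
    have -> : xh - p = (1 - lam) *: (x - p) - (x - xh - lam *: (x - p)).
      by apply/rowP => i; rewrite !mxE; ring.
    apply: le_trans (enormD _ _) _; rewrite enormN mulrDl lerD //.
      rewrite enormZ ler_wpM2r ?enorm_ge0 // ger0_norm; lra.
    apply: le_trans hcl _; rewrite ler_wpM2r ?enorm_ge0 // ler_piMr ?(ltW e'0) //; lra.
  have in12 z : D z -> enorm (z - p) <= (1 + e') * enorm (x - p) ->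
     (exists2 b1, B1 b1 & lsubmx b1 = mkv z (f z)) /\ (exists2 b2, B2 b2 & lsubmx b2 = z).
    move=> Dz hz.
    have hA : A * enorm (x - p) <= r1 /\ A * enorm (x - p) <= r2.
      rewrite ![A * _]mulrC -!ler_pdivlMr //.
      by move: hxd; rewrite !lt_min => /and3P[_ /ltW ? /ltW].
    have zp : enorm (z - p) <= A * enorm (x - p).
      apply: le_trans hz _; rewrite ler_pM2r // ler_peMr ?lerDl // addr_ge0 // ltW //.
    have zf : enorm (mkv z (f z) - mkv p fb) <= A * enorm (x - p).
      rewrite mkvB; apply: le_trans (enorm_mkv_le _ _) _.
      apply: le_trans (lerD (lexx _) (fp _ Dz)) _.
      rewrite -[X in X + _]mul1r -mulrDl /A [_ * (1 + L)]mulrC -mulrA ler_wpM2l //.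
      by rewrite addr_ge0.
    split.
      have : (lsubmx @` B1) (mkv z (f z)).
        rewrite -h1; split; last by apply: hr1; apply: le_trans zf hA.1.
        by split; rewrite ?base_mkv ?last_mkv //; apply: subset_closure.
      by case=> b Bb <-; exists b.
    have : (lsubmx @` B2) z by rewrite -h2; split=> //; apply: hr2; apply: le_trans zp hA.2.
    by case=> b Bb <-; exists b.
  have xx : enorm (x - p) <= (1 + e') * enorm (x - p) by rewrite ler_peMl ?enorm_ge0 // lerDl ltW.
  have [[b1 Bb1 b1E] [b2 Bb2 b2E]] := in12 x Dx xx.
  have [[b1h Bb1h b1hE] [b2h Bb2h b2hE]] := in12 xh Dxh Xh.
  pose u := join4 n1 n2 (vecf b1) (vecf b1h) (vecf b2) (vecf b2h) lam.
  have [hu1 hu2 hu3 [hu4 ul]] := join4E n1 n2 (vecf b1) (vecf b1h) (vecf b2) (vecf b2h) lam.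
  have {}ul : u oL = lam := ul.
  have u1 : blk 0 n1 u = b1 by apply: blk_vecf.
  have u2 : blk n1 n1 u = b1h by apply: blk_vecf.
  have u3 : blk (n1 + n1) n2 u = b2 by apply: blk_vecf.
  have u4 : blk (n1 + n1 + n2) n2 u = b2h by apply: blk_vecf.
  have gx : blk 0 m.+1 u = mkv x (f x) by rewrite -(lsub_blk _ _ N1) u1.
  have gxh : blk n1 m.+1 u = mkv xh (f xh) by rewrite -(lsub_blk _ _ N1) u2.
  have ex : blk 0 m u = x by rewrite -base_blk gx base_mkv.
  have exh : blk n1 m u = xh by rewrite -base_blk gxh base_mkv.
  have um : u m = f x by rewrite -[m]add0n -last_blk gx last_mkv.
  have uhm : u (n1 + m)%N = f xh by rewrite -last_blk gxh last_mkv.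
  have ex2 : blk (n1 + n1) m u = x by rewrite -(lsub_blk _ _ N2) u3.
  have exh2 : blk (n1 + n1 + n2) m u = xh by rewrite -(lsub_blk _ _ N2) u4.
  have co o o' : blk o m u = blk o' m u -> forall i, (i < m)%N -> u (o + i)%N - u (o' + i)%N = 0.
    by move=> /rowP h i hi; have := h (Ordinal hi); rewrite !mxE /= => ->; rewrite subrr.
  exists u; rewrite cX2E ex; split; last first.
    by rewrite ler_sqr ?nnegrE ?enorm_ge0 ?(ltW d0) // ltW // (lt_le_trans hxd) // /d' ge_min lexx.
  split; first by rewrite -/n1 -/n2 u1 u2 u3 u4.
  split; first by split; [apply: (co 0%N); rewrite ex -/n1 ex2 | apply: co; rewrite exh -/n1 -/n2 exh2].
  rewrite !cX2E !cE2E /cY2 -/n1 -/n2 -/oL ul um uhm ex exh.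
  split; first by split; [rewrite exprn_gt0 | split=> //; rewrite subr_ge0].
  have c0 a : 0 <= a -> 0 <= a * lam * enorm (x - p) by move=> a_ge0; rewrite !mulr_ge0 ?enorm_ge0.
  rewrite subr_ge0 subr_gt0 -!exprMn; split.
    by rewrite ler_sqr ?nnegrE ?enorm_ge0 // c0 // ltW.
  rewrite -[X in _ < X](@real_normK R) ?num_real //.
  by rewrite ltr_sqr ?nnegrE // c0 // ltW.
have hcoord v i : bad v -> (i < oL.+1)%N -> `|v i| <= C1 + C2 + 1.
  move=> h.
  have bblk o n (B : set 'rV[R]_n) C : (forall b i, B b -> `|b 0 i| <= C) -> B (blk o n v) ->
      (o <= i)%N -> (i < o + n)%N -> `|v i| <= C.
    move=> hB Bv oi io; have io' : (i - o < n)%N by rewrite ltn_subLR.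
    by have := hB _ (Ordinal io') Bv; rewrite mxE /= subnKC.
  rewrite ltnS leq_eqVlt => /orP[/eqP ->|hi].
    have [[_ _ _ _] [_ /andP[l0 l1] _ _]] := bad_pair_graph h1 h2 h.
    apply: (@le_trans _ _ (1 / 2)); last by lra.
    by rewrite ger0_norm // ltW.
  case: h => -[[b1 b1h] [b2 b2h]] _.
  have C12 : C1 <= C1 + C2 + 1 /\ C2 <= C1 + C2 + 1 by split; lra.
  case: (ltnP i n1) => i1; first by apply: le_trans (bblk _ _ _ _ hC1 b1 _ _) C12.1.
  case: (ltnP i (n1 + n1)) => i2; first by apply: le_trans (bblk _ _ _ _ hC1 b1h _ _) C12.1.
  case: (ltnP i (n1 + n1 + n2)) => i3; first by apply: le_trans (bblk _ _ _ _ hC2 b2 _ _) C12.2.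
  by apply: le_trans (bblk _ _ _ _ hC2 b2h _ _) C12.2.
(* The lifts are bounded, so bad configurations accumulate at some [c]. Its fibre coordinates are
   arbitrary, but its part over the first point is [(p, fb)], which is all that [no_bad_arc]
   asks. *)
have [c hc] : exists c : nat -> R, forall d, 0 < d ->
   exists2 v, (bad v /\ cX2 p v <= d ^+ 2) & forall i, (i < oL.+1)%N -> `|v i - c i| <= d.
  apply: (@bolzano R oL.+1 (C1 + C2 + 1)); last 1 first.
  - move=> d v i d0 [h _].
    exact: hcoord h.
  - move=> d d' v /andP[d0 dd'] [h h']; split=> //; apply: le_trans h' _.
    by rewrite lerXn2r ?nnegrE ?(ltW d0) // (le_trans (ltW d0)).
  - by move=> d /hS[v hv]; exists v.
have mL : (m < oL.+1)%N by rewrite /oL /n1; clear; lia.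
have small_eq0 (a : R) K : 0 <= K -> (forall d, 0 < d -> `|a| <= K * d) -> a = 0.
  move=> K0 h; apply/eqP; rewrite -normr_le0; apply/ler_addgt0Pl => d d0; rewrite addr0.
  apply: le_trans (h (d / (K + 1)) _) _; first by rewrite divr_gt0 // ltr_wpDl.
  by rewrite mulrA ler_pdivrMr ?ltr_wpDl // mulrC ler_pM2l // lerDl.
have hdist d v : 0 < d -> cX2 p v <= d ^+ 2 -> enorm (blk 0 m v - p) <= d.
  by move=> d0; rewrite cX2E ler_sqr ?nnegrE ?enorm_ge0 // ltW.
have cp i : (i < m)%N -> c i = vecf p i.
  move=> hi; apply/eqP; rewrite -subr_eq0; apply/eqP; apply: (small_eq0 _ 2) => // d d0.
  have [v [_ hX] hv] := hc d d0.
  have := le_trans (coord_le _ (Ordinal hi)) (hdist _ _ d0 hX).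
  rewrite !mxE /= add0n => h3; have := hv i (ltn_trans hi mL).
  rewrite /vecf insubT; set b := p _ _ in h3 *.
  have := ler_distD (v i) (c i) b; rewrite (distrC (c i) (v i)); lra.
have cm : c m = fb.
  apply/eqP; rewrite -subr_eq0; apply/eqP; apply: (small_eq0 _ (1 + L)); first by rewrite addr_ge0.
  move=> d d0; have [v [hb hX] hv] := hc d d0.
  have [[D1 _ vE _] _] := bad_pair_graph h1 h2 hb.
  have h3 := fp _ D1; rewrite -vE in h3.
  have h4 : L * enorm (blk 0 m v - p) <= L * d by rewrite ler_wpM2l // hdist.
  have := hv m mL; have := ler_distD (v m) (c m) fb; rewrite (distrC (c m) (v m)); lra.
have hacc : accum oL.+1 (fun v => bad (fun i => c i + v i)).
  move=> d d0; have [v [hb _] hv] := hc d d0; exists (fun i => v i - c i) => //.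
  by rewrite (_ : (fun i => _) = v) //; apply/funext => i; rewrite addrC subrK.
have [be [hbe hbad]] := sgdet_curve (sgdet_bad_pair fb p e e' c sB1 sB2) hacc.
apply: (no_bad_arc L0 fL fp e0 ee' (o1 := n1) (oL := oL) hbe cp cm).
apply: near0_imp hbad => x x0 /(bad_pair_graph h1 h2)[ha [hb1 hb2 hb3 hb4]]; split=> //; split=> //.
by case: hb3 => // h; move: (lt_trans e'0 h); rewrite ltxx.
Qed.

(** * Lipschitz functions and quasiconvexity of cells *)

Section FirstOrder.
Variable R : realType.

Lemma fin_min n (d : 'I_n -> R) : (forall i, 0 < d i) -> exists2 e, 0 < e & forall i, e <= d i.
Proof.
move=> d0; have S0 : 0 < 1 + \sum_i (d i)^-1.
  by rewrite ltr_pwDl // sumr_ge0 // => i _; rewrite invr_ge0 ltW.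
exists (1 + \sum_i (d i)^-1)^-1; first by rewrite invr_gt0.
move=> i; rewrite -[leRHS]invrK lef_pV2 ?posrE ?invr_gt0 // (bigD1 i) //= addrCA lerDl.
by rewrite addr_ge0 // sumr_ge0 // => j _; rewrite invr_ge0 ltW.
Qed.

Lemma enorm_mulmx n m (A : 'M[R]_(n, m)) : exists2 K, 0 < K & forall v, enorm (v *m A) <= K * enorm v.
Proof.
pose S := \sum_i \sum_j `|A i j|.
have S0 : 0 <= S by rewrite !sumr_ge0 // => i _; rewrite sumr_ge0.
exists (m.+1%:R * (1 + S)); first by rewrite mulr_gt0 // ltr_pwDl.
move=> v; rewrite -mulrA; apply: enorm_coord => [|j].
  by rewrite mulr_ge0 ?enorm_ge0 // addr_ge0.
rewrite mxE; apply: le_trans (ler_norm_sum _ _ _) _.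
apply: (@le_trans _ _ (\sum_i `|A i j| * enorm v)).
  by apply: ler_sum => i _; rewrite normrM mulrC ler_wpM2l // coord_le.
rewrite -mulr_suml ler_wpM2r ?enorm_ge0 //.
apply: (@le_trans _ _ S); last by rewrite lerDr.
by apply: ler_sum => i _; rewrite (bigD1 j) //= lerDl sumr_ge0.
Qed.

Lemma analytic_lin n (f : 'rV[R]_n -> R) a : analytic_at f a ->
  exists l : 'rV[R]_n, exists2 K, 0 < K & exists2 d, 0 < d & forall x, enorm (x - a) <= d ->
    `|f x - f a - dotv l (x - a)| <= K * enorm (x - a) ^+ 2.
Proof.
move=> /analytic_An/An_lin[l [K K0 [d d0 h]]].
exists (rowv n l), K => //; exists d => // x hx.
have := h (enorm (x - a)) (vecf (x - a)); rewrite hx enorm_ge0 => /(_ isT).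
have -> : a + rowv n (vecf (x - a)) = x by rewrite vecf_rowv addrC subrK.
have -> : a + rowv n (fun=> 0) = a.
  by rewrite (_ : rowv n _ = 0) ?addr0 //; apply/rowP => i; rewrite !mxE.
have -> : dotv (rowv n l) (x - a) = \sum_(i < n) l i * vecf (x - a) i.
  by apply: eq_bigr => i _; rewrite mxE /vecf valK.
by apply => i hi; rewrite /vecf insubT; exact: coord_le.
Qed.

Lemma analytic_map_lin n m (f : 'rV[R]_n -> 'rV[R]_m) a :
  (forall i, analytic_at (fun x => f x 0 i) a) ->
  exists A : 'M[R]_(n, m), exists2 K, 0 < K & exists2 d, 0 < d & forall x, enorm (x - a) <= d ->
    enorm (f x - f a - (x - a) *m A) <= K * enorm (x - a) ^+ 2.
Proof.
move=> h.
have /choice[l hl] : forall i, exists lKd : 'rV[R]_n * R * R, [/\ 0 < lKd.1.2, 0 < lKd.2 &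
    forall x, enorm (x - a) <= lKd.2 ->
    `|f x 0 i - f a 0 i - dotv lKd.1.1 (x - a)| <= lKd.1.2 * enorm (x - a) ^+ 2].
  by move=> i; have [l [K K0 [d d0 hd]]] := analytic_lin (h i); exists (l, K, d).
have [d d0 hd] := @fin_min m (fun i => (l i).2) (fun i => let: And3 _ h _ := hl i in h).
pose K := 1 + \sum_i (l i).1.2.
have S0 : 0 <= \sum_i (l i).1.2 by apply: sumr_ge0 => i _; case: (hl i) => /ltW.
exists (\matrix_(i, j) (l j).1.1 0 i), (m.+1%:R * K).
  by rewrite mulr_gt0 // ltr_pwDl.
exists d => // x hx; rewrite -mulrA; apply: enorm_coord => [|i].
  by rewrite mulr_ge0 ?sqr_ge0 // addr_ge0.
have [K0 _ /(_ x (le_trans hx (hd i))) hi] := hl i.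
have -> : (f x - f a - (x - a) *m \matrix_(i, j) (l j).1.1 0 i) 0 i =
    f x 0 i - f a 0 i - dotv (l i).1.1 (x - a).
  rewrite !mxE; congr (_ - _); apply: eq_bigr => j _; by rewrite !mxE mulrC.
apply: le_trans hi _; rewrite ler_wpM2r ?sqr_ge0 // /K (bigD1 i) //= addrCA lerDl addr_ge0 //.
by apply: sumr_ge0 => j _; case: (hl j) => /ltW.
Qed.

Lemma is_derive_quadratic (W : normedModType R) (g : R -> W) (v : W) (K d : R) : 0 < d ->
  (forall t, `|t| <= d -> `|g t - g 0 - t *: v| <= K * t ^+ 2) -> is_derive (0 : R) (1 : R) g v.
Proof.
move=> d0 h.
have lim : h^-1 *: (g (h *: (1 : R^o) + 0) - g 0) @[h --> (0 : R)^'] --> v.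
  apply/cvgrPdist_le => e e0; near=> t.
  have t0 : t != 0 by near: t; apply: nbhs_dnbhs_neq.
  have td : `|t| <= d by near: t; apply: dnbhs0_le.
  have te : `|t| <= e / (`|K| + 1) by near: t; apply: dnbhs0_le; rewrite divr_gt0 // ltr_wpDl.
  rewrite addr0 [t *: _]mulr1 distrC.
  have -> : t^-1 *: (g t - g 0) - v = t^-1 *: (g t - g 0 - t *: v).
    by rewrite [RHS]scalerBr scalerA mulVf // scale1r.
  rewrite normrZ normfV ler_pdivrMl ?normr_gt0 //.
  apply: le_trans (h t td) _; rewrite -real_normK ?num_real // expr2 mulrCA ler_wpM2l //.
  move: te; rewrite ler_pdivlMr ?ltr_wpDl //; apply: le_trans.
  by rewrite mulrC ler_wpM2l // (le_trans (ler_norm _)) // lerDl.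
split; first by apply/cvg_ex; exists v.
by apply/cvg_lim.
Unshelve. all: by end_near.
Qed.

Lemma norm_enorm n (x : 'rV[R]_n) : `|x| <= enorm x.
Proof.
rewrite -[`|x|]/(mx_norm x) mx_normrE; apply: bigmax_le; first exact: enorm_ge0.
by move=> [i j] _ /=; rewrite (ord1 i) coord_le.
Qed.

Lemma cauchy_schwarz_abs n (x y : 'rV[R]_n) : `|dotv x y| <= enorm x * enorm y.
Proof.
rewrite ler_norml cauchy_schwarz andbT lerNl -mulN1r -dotvZl scaleN1r -[enorm x]enormN.
by apply: cauchy_schwarz.
Qed.

End FirstOrder.

Section LocalLipschitz.
Variable R : realType.

(** The gradient bound concerns only directions tangent to [D], so the differential [l] of the
    ambient extension is not bounded by [C]. A displacement inside [D] is tangent up to second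
    order, as a chart shows, and [eta] absorbs the second order terms. *)
Lemma cell_function_locally_lipschitz m k C (D : set 'rV[R]_m) f x eta :
  analytic_submanifold k D -> 0 <= C -> cell_function C D f -> D x -> 0 < eta ->
  exists2 r, 0 < r & forall y, D y -> enorm (y - x) <= r -> `|f y - f x| <= (C + eta) * enorm (y - x).
Proof.
move=> [_ hD] C0 [hf _ hg] Dx eta0.
have [U [V [phi [psi [[oU oV aphi apsi] [UV phiK DU]]]]]] := hD x Dx.
have [g ag fg] := hf x Dx.
have Ux : U x by case: oU.
have Vx : V (phi x) by rewrite -UV; exists x.
have psiK v : V v -> U (psi v) /\ phi (psi v) = v.
  by rewrite -UV => -[y Uy <-]; rewrite phiK ?inE.
have psix : psi (phi x) = x by rewrite phiK ?inE.
have [A [KA KA0 [dA dA0 hA]]] := analytic_map_lin (fun i => aphi i x Ux).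
have [B [KB KB0 [dB dB0 hB]]] := analytic_map_lin (fun i => apsi i _ Vx).
have [l [Kl Kl0 [dl dl0 hl]]] := analytic_lin ag.
have [NA NA0 hNA] := enorm_mulmx A.
have [NB NB0 hNB] := enorm_mulmx B.
have [rU rU0 hU] := nbhs_enorm (open_nbhs_nbhs oU).
have [rV rV0 hV] := nbhs_enorm (open_nbhs_nbhs (conj oV Vx)).
have [rf rf0 hrf] := nbhs_enorm fg.
have fgx : f x = g x by apply: hrf Dx; rewrite subrr enorm0 ltW.
have [w [_ hw] wC] := hg x Dx.
(* The differential of g along D at x is represented by w on images of slices. *)
have lin (u : 'rV[R]_m) : (forall i : 'I_m, (k <= i)%N -> u 0 i = 0) -> dotv l (u *m B) = dotv w (u *m B).
  move=> hu; pose ga (t : R) := psi (phi x + t *: u).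
  have gaE (t : R) : phi x + t *: u - phi x = t *: u by rewrite addrAC subrr add0r.
  have ga0 : ga 0 = x by rewrite /ga scale0r addr0.
  pose N := enorm u + 1.
  have N0 : 0 < N by rewrite ltr_pwDr // enorm_ge0.
  have tuN (t : R) : enorm (t *: u) <= `|t| * N by rewrite enormZ ler_wpM2l // lerDl.
  pose d1 := Num.min (dB / N) (rV / N).
  have d10 : 0 < d1 by rewrite lt_min !divr_gt0.
  have small (t : R) : `|t| <= d1 -> `|t| * N <= dB /\ `|t| * N <= rV.
    by rewrite le_min -!ler_pdivlMr // => /andP[].
  have q1 (t : R) : `|t| <= d1 -> enorm (ga t - ga 0 - t *: (u *m B)) <= KB * N ^+ 2 * t ^+ 2.
    move=> /small[h1 _]; rewrite ga0 scalemxAl.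
    have := hB (phi x + t *: u); rewrite gaE -/(ga t) psix => h.
    apply: le_trans (h (le_trans (tuN t) h1)) _; rewrite -mulrA ler_pM2l // -exprMn.
    rewrite -[in leRHS]real_normK ?num_real // normrM (gtr0_norm N0) [N * _]mulrC.
    by rewrite lerXn2r ?nnegrE ?enorm_ge0 // mulr_ge0 // ltW.
  have Dga (t : R) : `|t| <= d1 -> D (ga t).
    move=> /small[_ h1]; have vV : V (phi x + t *: u) by apply: hV; rewrite gaE (le_trans (tuN t)).
    have [U1 pE] := psiK _ vV; apply/(DU _ U1) => i ki; rewrite pE !mxE hu // mulr0 addr0.
    by apply: (DU x Ux).1.
  have cur : curve_through D x (u *m B) ga.
    split=> //.
      apply/nbhs_ballP; exists d1 => //= t; rewrite /ball /= sub0r normrN => /ltW; exact: Dga.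
    apply: (@is_derive_quadratic _ _ ga _ (KB * N ^+ 2) d1) => // t ht.
    by apply: le_trans (norm_enorm _) _; exact: q1.
  have d1w := hw _ _ cur.
  (* f along the curve is g along the curve, hence has derivative l . uB. *)
  pose S := NB * N + KB * N ^+ 2 * d1.
  have S0 : 0 < S by rewrite ltr_pwDl ?mulr_gt0 // mulr_ge0 ?(ltW d10) // mulr_ge0 ?sqr_ge0 // ltW.
  have lipga (t : R) : `|t| <= d1 -> enorm (ga t - x) <= S * `|t|.
    move=> ht; rewrite -[ga t - x](subrK (t *: (u *m B))) -{1}ga0.
    apply: le_trans (enormD _ _) _; rewrite addrC /S mulrDl lerD //.
      rewrite enormZ mulrC ler_wpM2r //; apply: le_trans (hNB _) _.
      by rewrite ler_pM2l // lerDl.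
    apply: le_trans (q1 t ht) _; rewrite -[t ^+ 2]real_normK ?num_real // [`|t| ^+ 2]expr2.
    rewrite -[leRHS]mulrA; apply: ler_wpM2l; first by rewrite mulr_ge0 ?sqr_ge0 // ltW.
    by rewrite ler_wpM2r.
  pose d2 := Num.min d1 (Num.min (dl / S) (rf / S)).
  have d20 : 0 < d2 by rewrite lt_min d10 lt_min !divr_gt0.
  have d1l : is_derive (0 : R) (1 : R) (f \o ga) (dotv l (u *m B)).
    apply: (@is_derive_quadratic _ R^o (f \o ga) _ (enorm l * (KB * N ^+ 2) + Kl * S ^+ 2) d2) => // t.
    rewrite le_min => /andP[ht1]; rewrite le_min => /andP[ht2 ht3] /=.
    move: (lipga t ht1) ht2 ht3; rewrite !ler_pdivlMr // [_ * S]mulrC => h1 h2 h3.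
    have -> : f (ga t) = g (ga t) by apply: hrf; [rewrite (le_trans h1) | apply: Dga].
    rewrite ga0 fgx.
    rewrite -[t *: dotv l _]/(t * dotv l (u *m B)).
    have -> : g (ga t) - g x - t * dotv l (u *m B) =
       (g (ga t) - g x - dotv l (ga t - x)) + dotv l (ga t - ga 0 - t *: (u *m B)).
      rewrite ga0 -[ - (t *: (u *m B))]scaleNr [dotv l (ga t - x + _)]dotvDr dotvZr mulNr.
      by ring.
    apply: le_trans (ler_normD _ _) _; rewrite addrC mulrDl lerD //.
      rewrite -mulrA; apply: le_trans (_ : _ <= enorm l * enorm (ga t - ga 0 - t *: (u *m B))) _.
        exact: cauchy_schwarz_abs.
      by rewrite ler_wpM2l ?enorm_ge0 // q1.
    apply: le_trans (hl _ (le_trans h1 h2)) _; rewrite -mulrA ler_pM2l // -[t ^+ 2]real_normK ?num_real //.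
    by rewrite -exprMn lerXn2r ?nnegrE ?enorm_ge0 // mulr_ge0 // ltW.
  by rewrite -(@derive_val _ _ _ _ _ _ _ d1l) -(@derive_val _ _ _ _ _ _ _ d1w).
pose N := NA + KA * dA.
have N0 : 0 < N by rewrite ltr_pwDl // mulr_ge0 ?ltW.
pose E := Kl + enorm l * KB * N ^+ 2 + C * KB * N ^+ 2.
have E0 : 0 < E.
  by rewrite /E -addrA ltr_pwDl // addr_ge0 // !mulr_ge0 ?enorm_ge0 // ltW.
pose r := Num.min (Num.min rU dA) (Num.min (Num.min dl rf) (Num.min (dB / N) (eta / E))).
have r0 : 0 < r by rewrite !lt_min rU0 dA0 dl0 rf0 /= !divr_gt0.
exists r => // y Dy; rewrite !le_min => /andP[/andP[y1 y2] /andP[/andP[y3 y4] /andP[]]].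
set n := enorm (y - x) in y1 y2 y3 y4 *; rewrite !ler_pdivlMr // => y5 y6.
have n0 : 0 <= n by apply: enorm_ge0.
have Uy := hU y y1.
pose u := phi y - phi x.
have hu : forall i : 'I_m, (k <= i)%N -> u 0 i = 0.
  by move=> i ki; rewrite !mxE ((DU x Ux).1 Dx) // ((DU y Uy).1 Dy) // subrr.
have un : enorm u <= N * n.
  rewrite -[u](subrK ((y - x) *m A)); apply: le_trans (enormD _ _) _.
  rewrite addrC /N mulrDl lerD // (le_trans (hA y y2)) // expr2 -mulrA ler_pM2l //.
  by rewrite ler_wpM2r.
have hy : enorm (y - x - u *m B) <= KB * N ^+ 2 * n ^+ 2.
  have := hB (phi y); rewrite psix phiK ?inE // => h.
  apply: le_trans (h _) _; first by rewrite (le_trans un) // mulrC.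
  by rewrite -mulrA ler_pM2l // -exprMn lerXn2r ?nnegrE ?enorm_ge0 // mulr_ge0 // ltW.
have e1 : `|dotv l (y - x - u *m B)| <= enorm l * (KB * N ^+ 2 * n ^+ 2).
  apply: le_trans (_ : _ <= enorm l * enorm (y - x - u *m B)) _.
    exact: cauchy_schwarz_abs.
  by rewrite ler_wpM2l ?enorm_ge0.
have e2 : `|dotv l (u *m B)| <= C * (n + KB * N ^+ 2 * n ^+ 2).
  rewrite lin //; apply: le_trans (_ : _ <= enorm w * enorm (u *m B)) _.
    exact: cauchy_schwarz_abs.
  apply: ler_pM; rewrite ?enorm_ge0 //.
  rewrite -[u *m B](subKr (y - x)); apply: le_trans (enormD _ _) _.
  by rewrite enormN lerD.
have -> : f y = g y by apply: hrf.
have dE : dotv l (y - x) = dotv l (y - x - u *m B) + dotv l (u *m B) by rewrite -dotvDr subrK.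
rewrite fgx -[g y - g x](subrK (dotv l (y - x))) {2}dE.
apply: le_trans (ler_normD _ _) _; apply: le_trans (lerD (hl y y3) (ler_normD _ _)) _.
apply: le_trans (lerD (lexx _) (lerD e1 e2)) _.
rewrite -/n mulrDl (_ : _ + _ = C * n + n * E * n); last by rewrite /E; ring.
by rewrite lerD2l ler_wpM2r.
Qed.

End LocalLipschitz.

Section Clamp.
Variable R : realFieldType.

Definition clamp (v lo hi : R) := Num.max lo (Num.min v hi).

Lemma clamp_bounds v lo hi : lo <= hi -> lo <= clamp v lo hi <= hi.
Proof. by move=> h; rewrite /clamp le_max lexx ge_max h ge_min lexx orbT. Qed.

Lemma clamp_id v lo hi : lo <= v <= hi -> clamp v lo hi = v.
Proof. by move=> /andP[h1 h2]; rewrite /clamp (min_idPl h2) (max_idPr h1). Qed.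

Lemma max_lip (a b a' b' : R) : `|Num.max a b - Num.max a' b'| <= `|a - a'| + `|b - b'|.
Proof.
have h1 := ler_norm (a - a'); have h2 := ler_norm (b - b').
have h3 := ler_norm (a' - a); have h4 := ler_norm (b' - b).
rewrite distrC in h3; rewrite distrC in h4.
rewrite ler_norml; case: (leP a b) => h5; case: (leP a' b') => h6; apply/andP; split; lra.
Qed.

Lemma min_lip (a b a' b' : R) : `|Num.min a b - Num.min a' b'| <= `|a - a'| + `|b - b'|.
Proof.
have h1 := ler_norm (a - a'); have h2 := ler_norm (b - b').
have h3 := ler_norm (a' - a); have h4 := ler_norm (b' - b).
rewrite distrC in h3; rewrite distrC in h4.
rewrite ler_norml; case: (leP a b) => h5; case: (leP a' b') => h6; apply/andP; split; lra.
Qed.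

Lemma clamp_lip v lo hi v' lo' hi' :
  `|clamp v lo hi - clamp v' lo' hi'| <= `|lo - lo'| + (`|v - v'| + `|hi - hi'|).
Proof. by apply: le_trans (max_lip _ _ _ _) _; rewrite lerD2l min_lip. Qed.

End Clamp.

Section Paths.
Variable R : realType.

Definition lip_path n (Y : set 'rV[R]_n) (K : R) q q' (g : R -> 'rV[R]_n) :=
  [/\ g 0 = q, g 1 = q', forall s, 0 <= s <= 1 -> Y (g s) &
      forall s t, 0 <= s <= 1 -> 0 <= t <= 1 -> enorm (g s - g t) <= K * `|s - t|].

Definition quasiconvex n (L : R) (Y : set 'rV[R]_n) := forall q q', Y q -> Y q' ->
  exists g, lip_path Y (L * enorm (q - q')) q q' g.

Definition lipschitz_fun n (L : R) (D : set 'rV[R]_n) (f : 'rV[R]_n -> R) :=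
  forall x y, D x -> D y -> `|f x - f y| <= L * enorm (x - y).

(** The local bounds are added up along a path inside [D], since the segment from [x] to [y] may
    leave it; [creeping] performs the addition. *)
Lemma quasiconvex_lipschitz n L C (D : set 'rV[R]_n) f : 0 <= L -> 0 <= C -> quasiconvex L D ->
  (forall x, D x -> exists2 r, 0 < r & forall y, D y -> enorm (y - x) <= r ->
     `|f y - f x| <= C * enorm (y - x)) -> lipschitz_fun (C * L) D f.
Proof.
move=> L0 C0 qD hf x y Dx Dy; have [g [g0 g1 gD gL]] := qD x y Dx Dy.
pose K := L * enorm (x - y); have K0 : 0 <= K by rewrite mulr_ge0 ?enorm_ge0.
suff : `|f (g 1) - f (g 0)| <= C * K * (1 - 0).
  by rewrite g0 g1 subr0 mulr1 distrC mulrA.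
apply: (@creeping R (fun s t => `|f (g t) - f (g s)| <= C * K * (t - s))) => //.
  move=> s hs; have [r r0 hr] := hf _ (gD s hs).
  have K1 : 0 < K + 1 by rewrite ltr_wpDl.
  exists (r / (K + 1)); first by rewrite divr_gt0.
  have loc t : 0 <= t <= 1 -> `|t - s| <= r / (K + 1) -> `|f (g t) - f (g s)| <= C * K * `|t - s|.
    move=> ht hts; have h := gL t s ht hs; rewrite -mulrA.
    apply: le_trans (hr _ (gD t ht) _) _; last by rewrite ler_wpM2l.
    apply: le_trans h _; move: hts; rewrite ler_pdivlMr // => hts; apply: le_trans hts.
    by rewrite mulrC ler_wpM2l // lerDl.
  move=> a b a0 b1 /andP[a1 a2] /andP[b2 b3]; case/andP: hs => s0 s1.
  have ha : 0 <= a <= 1 by rewrite a0 (le_trans a2).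
  have hb : 0 <= b <= 1 by rewrite b1 (le_trans s0).
  have h1 := loc a ha; rewrite ler0_norm ?subr_le0 // in h1.
  have h2 := loc b hb; rewrite [`|b - s|]ger0_norm ?subr_ge0 // in h2.
  have := lerD (h2 _) (h1 _) => /(_ ltac:(lra) ltac:(lra)).
  rewrite [X in _ + X <= _]distrC => h; apply: le_trans (ler_distD (f (g s)) _ _) _.
  apply: le_trans h _; rewrite -mulrDr [b - s + _](_ : _ = b - a) //; ring.
move=> a b c h1 h2; apply: le_trans (ler_distD (f (g b)) _ _) _.
apply: le_trans (lerD h2 h1) _; rewrite -mulrDr [c - b + _](_ : _ = c - a) //; ring.
Qed.

Lemma lip_path_isom n (Q : 'M[R]_n) (Y : set 'rV[R]_n) K q q' g : Q *m Q^T = 1%:M ->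
  lip_path Y K (q *m Q) (q' *m Q) g ->
  lip_path [set x | Y (x *m Q)] K q q' (fun s => g s *m Q^T).
Proof.
move=> hQ [g0 g1 gY gL]; have hQ' := mulmx1C hQ.
split.
- by rewrite g0 -mulmxA hQ mulmx1.
- by rewrite g1 -mulmxA hQ mulmx1.
- by move=> s hs /=; rewrite -mulmxA hQ' mulmx1; apply: gY.
move=> s t hs ht; rewrite -mulmxBl enorm_isom ?trmxK //; exact: gL.
Qed.

Lemma quasiconvex_isom n L (Q : 'M[R]_n) (Y : set 'rV[R]_n) : Q *m Q^T = 1%:M ->
  quasiconvex L Y -> quasiconvex L [set x | Y (x *m Q)].
Proof.
move=> hQ qY q q' Yq Yq'; have [g hg] := qY _ _ Yq Yq'.
exists (fun s => g s *m Q^T); apply: lip_path_isom => //.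
by rewrite -mulmxBl enorm_isom in hg.
Qed.

Lemma quasiconvex_graph m L Lf (D : set 'rV[R]_m) f : 0 <= L -> 0 <= Lf ->
  quasiconvex L D -> lipschitz_fun Lf D f -> quasiconvex (L * (1 + Lf)) (graph_set D f).
Proof.
move=> L0 Lf0 qD fL q q' [Dq yq] [Dq' yq']; have [g [g0 g1 gD gL]] := qD _ _ Dq Dq'.
exists (fun s => mkv (g s) (f (g s))); split.
- by rewrite g0 -yq mkvK.
- by rewrite g1 -yq' mkvK.
- by move=> s hs; rewrite /graph_set /= base_mkv last_mkv; split=> //; apply: gD.
move=> s t hs ht; rewrite mkvB; apply: le_trans (enorm_mkv_le _ _) _.
apply: le_trans (lerD (lexx _) (fL _ _ (gD s hs) (gD t ht))) _.
rewrite -[X in X + _]mul1r -mulrDl.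
rewrite [leRHS](_ : _ = (1 + Lf) * (L * (enorm (q - q') * `|s - t|))); last by ring.
apply: ler_wpM2l; first by rewrite addr_ge0.
apply: le_trans (gL s t hs ht) _; rewrite -!mulrA ler_wpM2l // ler_wpM2r //.
by rewrite -base_coordB enorm_base.
Qed.

Lemma quasiconvex_band m L Lf (D : set 'rV[R]_m) f1 f2 : 0 <= L -> 0 <= Lf ->
  quasiconvex L D -> lipschitz_fun Lf D f1 -> lipschitz_fun Lf D f2 ->
  (forall x, D x -> f1 x < f2 x) ->
  quasiconvex (L + 1 + 3 * (Lf * L)) (band_set D f1 f2).
Proof.
move=> L0 Lf0 qD fL1 fL2 f12 q q' [Dq /andP[y1 y2]] [Dq' /andP[y1' y2']].
have [g [g0 g1 gD gL]] := qD _ _ Dq Dq'.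
set b := base_coord q in Dq y1 y2 g0 gL; set b' := base_coord q' in Dq' y1' y2' g1 gL.
set y := last_coord q in y1 y2; set y' := last_coord q' in y1' y2'.
pose N := Num.min (Num.min (y - f1 b) (f2 b - y)) (Num.min (y' - f1 b') (f2 b' - y')).
have N0 : 0 < N by rewrite !lt_min !subr_gt0 y1 y2 y1' y2'.
have [[N1 N2] [N1' N2']] : (N <= y - f1 b /\ N <= f2 b - y) /\ (N <= y' - f1 b' /\ N <= f2 b' - y').
  by rewrite /N !ge_min !lexx !orbT.
(* Clamping to the boundary functions themselves could put the path on the boundary, so the barriers
   are moved inwards by a quarter of [h]. Capping the gap by the margins [N] of the endpoints keeps
   the endpoints fixed. *)
pose h x := Num.min (f2 x - f1 x) N.
have h0 x : D x -> 0 < h x by move=> Dx; rewrite lt_min subr_gt0 f12.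
have hh x : h x <= f2 x - f1 x by rewrite ge_min lexx.
have hN x : h x <= N by rewrite ge_min lexx orbT.
pose lo x := f1 x + 1 / 4 * h x; pose hi x := f2 x - 1 / 4 * h x.
have lohi x : D x -> lo x <= hi x.
  by move=> Dx; have := h0 x Dx; have := hh x; rewrite /lo /hi; lra.
pose Y s := clamp ((1 - s) * y + s * y') (lo (g s)) (hi (g s)).
exists (fun s => mkv (g s) (Y s)); split.
- rewrite /Y g0 subr0 mul1r mul0r addr0 clamp_id ?mkvK //.
  by have := h0 b Dq; have := hN b; rewrite /lo /hi; lra.
- rewrite /Y g1 subrr mul1r mul0r add0r clamp_id ?mkvK //.
  by have := h0 b' Dq'; have := hN b'; rewrite /lo /hi; lra.
- move=> s hs; rewrite /band_set /= base_mkv last_mkv; split; first exact: gD.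
  have Dg := gD s hs; have /andP[h1 h2] := clamp_bounds ((1 - s) * y + s * y') (lohi _ Dg).
  rewrite -/(Y s) in h1 h2; have h3 := h0 _ Dg.
  by rewrite /lo in h1; rewrite /hi in h2; apply/andP; split; lra.
move=> s t hs ht; rewrite mkvB; apply: le_trans (enorm_mkv_le _ _) _.
have Ds := gD s hs; have Dt := gD t ht.
have e1 := fL1 _ _ Ds Dt; have e2 := fL2 _ _ Ds Dt; have e0 := gL s t hs ht.
set n := enorm (g s - g t) in e0 e1 e2 *.
have eh : `|h (g s) - h (g t)| <= 2 * (Lf * n).
  apply: le_trans (min_lip _ _ _ _) _; rewrite subrr normr0 addr0.
  rewrite (_ : _ - _ = (f2 (g s) - f2 (g t)) - (f1 (g s) - f1 (g t))); last by ring.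
  by apply: le_trans (ler_normB _ _) _; lra.
have elo : `|lo (g s) - lo (g t)| <= 3 / 2 * (Lf * n).
  rewrite /lo (_ : _ - _ = (f1 (g s) - f1 (g t)) + 1 / 4 * (h (g s) - h (g t))); last by ring.
  by apply: le_trans (ler_normD _ _) _; rewrite normrM (ger0_norm (_ : 0 <= 1 / 4)) //; lra.
have ehi : `|hi (g s) - hi (g t)| <= 3 / 2 * (Lf * n).
  rewrite /hi (_ : _ - _ = (f2 (g s) - f2 (g t)) - 1 / 4 * (h (g s) - h (g t))); last by ring.
  by apply: le_trans (ler_normB _ _) _; rewrite normrM (ger0_norm (_ : 0 <= 1 / 4)) //; lra.
have ey : `|(1 - s) * y + s * y' - ((1 - t) * y + t * y')| <= enorm (q - q') * `|s - t|.
  rewrite (_ : _ - _ = (y' - y) * (s - t)); last by ring.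
  rewrite normrM ler_wpM2r // distrC /y /y' -last_coordB; exact: enorm_last.
have := clamp_lip ((1 - s) * y + s * y') (lo (g s)) (hi (g s))
  ((1 - t) * y + t * y') (lo (g t)) (hi (g t)).
rewrite -/(Y s) -/(Y t) => eY.
have en : n <= L * (enorm (q - q') * `|s - t|).
  apply: le_trans e0 _; rewrite -mulrA ler_wpM2l // ler_wpM2r // -base_coordB; exact: enorm_base.
have eLn := ler_wpM2l Lf0 en.
set Z := enorm (q - q') * `|s - t| in ey en eLn.
rewrite -mulrA -/Z; have -> : (L + 1 + 3 * (Lf * L)) * Z = L * Z + Z + 3 * (Lf * (L * Z)) by ring.
lra.
Qed.

End Paths.

(** * Almost conic flows *)

Section Barrier.
Variable R : realFieldType.
Implicit Types mu eta : R.

Lemma almost_min mu eta (a b a' b' : R) : 0 <= mu -> `|a' - mu * a| <= eta -> `|b' - mu * b| <= eta ->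
  `|Num.min a' b' - mu * Num.min a b| <= eta.
Proof.
move=> mu0; rewrite minr_pMr // !ler_norml => /andP[h1 h2] /andP[h3 h4].
by case: (leP a' b') => h5; case: (leP (mu * a) (mu * b)) => h6; apply/andP; split; lra.
Qed.

Lemma almost_max mu eta (a b a' b' : R) : 0 <= mu -> `|a' - mu * a| <= eta -> `|b' - mu * b| <= eta ->
  `|Num.max a' b' - mu * Num.max a b| <= eta.
Proof.
move=> mu0; rewrite maxr_pMr // !ler_norml => /andP[h1 h2] /andP[h3 h4].
by case: (leP a' b') => h5; case: (leP (mu * a) (mu * b)) => h6; apply/andP; split; lra.
Qed.

(* The barrier [f + s min(h, c)] either stays away from the point [y] or is
   homogeneous up to a small error; [z], [hb] are the limits of [f] and [h]. *)
Lemma barrier_dichotomy (L s kap mu E eta z hb fa fb ha hb' ca y : R) :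
  0 <= L -> 0 < s -> s <= 1 / 4 -> 1 / 2 <= mu -> mu <= 1 -> 0 <= E -> 0 <= eta ->
  16 * E + 16 * (L * E) < s * kap ->
  (z = 0 \/ kap <= `|z|) -> (hb = 0 \/ kap <= hb) -> (z < 0 -> z + s * hb <= z / 2) ->
  `|fa - z| <= L * E -> `|fb - z| <= 2 * (L * E) ->
  `|ha - hb| <= 2 * (L * E) -> `|hb' - hb| <= 4 * (L * E) ->
  `|fb - z - mu * (fa - z)| <= eta -> `|hb' - hb - mu * (ha - hb)| <= 2 * eta ->
  0 < ha -> 0 < ca -> `|y| <= E -> fa + s * Num.min ha ca <= y ->
  (fa + s * Num.min ha ca < - E /\ fb + s * Num.min hb' (mu * ca) < - (2 * E)) \/
  `|fb + s * Num.min hb' (mu * ca) - mu * (fa + s * Num.min ha ca)| <= 2 * eta.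
Proof.
move=> L0 s0 s4 mu2 mu1 E0 eta0 hE hz hh hzs.
move=> /ler_normlP[a1 a2] /ler_normlP[b1 b2] /ler_normlP[c1 c2] /ler_normlP[d1 d2] hf hH ha0 ca0.
move=> /ler_normlP[y1 y2] hy.
have P0 : 0 <= L * E by rewrite mulr_ge0.
have sP : s * (L * E) <= (L * E) / 4.
  by rewrite mulrC ler_wpM2l // (le_trans s4) // mul1r.
have sP0 : 0 <= s * (L * E) by rewrite mulr_ge0 // ltW.
have kap0 : 0 < kap by rewrite -(pmulr_rgt0 _ s0); lra.
have sk : s * kap <= kap / 4 by rewrite mulrC ler_wpM2l ?(ltW kap0) // (le_trans s4) // mul1r.
have m1 : s * Num.min ha ca <= s * ha by rewrite ler_pM2l // ge_min lexx.
have m2 : s * Num.min hb' (mu * ca) <= s * hb' by rewrite ler_pM2l // ge_min lexx.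
have m0 : 0 < s * Num.min ha ca by rewrite mulr_gt0 // lt_min ha0.
have h1 : s * ha <= s * hb + 2 * (s * (L * E)).
  have : s * ha <= s * (hb + 2 * (L * E)) by rewrite ler_pM2l //; lra.
  lra.
have h2 : s * hb' <= s * hb + 4 * (s * (L * E)).
  have : s * hb' <= s * (hb + 4 * (L * E)) by rewrite ler_pM2l //; lra.
  lra.
case: hz => hz; last first.
  left; case: (ltP z 0) => z0; last by move: hz; rewrite ger0_norm //; lra.
  by have := hzs z0; rewrite ltr0_norm // in hz; split; lra.
right; subst z; rewrite !subr0 in hf.
case: hh => hh.
  rewrite hh !subr0 in hH.
  have hm : `|Num.min hb' (mu * ca) - mu * Num.min ha ca| <= 2 * eta.
    apply: almost_min => //; first by lra.
    by rewrite subrr normr0; lra.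
  rewrite (_ : _ - _ = (fb - mu * fa) + s * (Num.min hb' (mu * ca) - mu * Num.min ha ca)); last by ring.
  apply: le_trans (ler_normD _ _) _; rewrite normrM (gtr0_norm s0).
  have : s * `|Num.min hb' (mu * ca) - mu * Num.min ha ca| <= 1 / 4 * (2 * eta).
    by apply: ler_pM => //; apply: ltW.
  lra.
have sh : s * kap <= s * hb by rewrite ler_pM2l.
have e1 : Num.min ha ca = ca.
  apply/min_idPr; rewrite leNgt; apply/negP => hc.
  have : s * (hb - 2 * (L * E)) <= s * ha by rewrite ler_pM2l //; lra.
  by move: hy; rewrite (min_idPl (ltW hc)); lra.
have e2 : Num.min hb' (mu * ca) = mu * ca.
  apply/min_idPr; rewrite leNgt; apply/negP => hc.
  have : s * (hb - 4 * (L * E)) <= s * hb' by rewrite ler_pM2l //; lra.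
  have : s * hb' <= s * ca.
    by rewrite ler_pM2l // (le_trans (ltW hc)) // ler_piMl // ltW.
  by move: hy; rewrite e1; lra.
rewrite e1 e2 (_ : _ - _ = fb - mu * fa); last by ring.
lra.
Qed.

(** By [barrier_dichotomy], each barrier is either out of reach of the points concerned, so that it
    does not act, or almost homogeneous like the clamped value; minima and maxima preserve almost
    homogeneity. *)
Lemma clamp_almost_homogeneous (L s kap mu E eta z1 z2 f1a f1b f2a f2b ca da va : R) :
  0 <= L -> 0 < s -> s <= 1 / 4 -> 1 / 2 <= mu -> mu <= 1 -> 0 <= E -> 0 <= eta ->
  16 * E + 16 * (L * E) < s * kap ->
  (z1 = 0 \/ kap <= `|z1|) -> (z2 = 0 \/ kap <= `|z2|) -> (z2 - z1 = 0 \/ kap <= `|z2 - z1|) ->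
  (z1 < 0 -> z1 + s * `|z2 - z1| <= z1 / 2) -> (0 < z2 -> z2 / 2 <= z2 - s * `|z2 - z1|) ->
  `|f1a - z1| <= L * E -> `|f1b - z1| <= 2 * (L * E) ->
  `|f2a - z2| <= L * E -> `|f2b - z2| <= 2 * (L * E) ->
  `|f1b - z1 - mu * (f1a - z1)| <= eta -> `|f2b - z2 - mu * (f2a - z2)| <= eta ->
  f1a < f2a -> f1b < f2b -> 0 < ca -> 0 < da ->
  let ya := clamp va (f1a + s * Num.min (f2a - f1a) ca) (f2a - s * Num.min (f2a - f1a) da) in
  let yb := clamp (mu * va) (f1b + s * Num.min (f2b - f1b) (mu * ca))
     (f2b - s * Num.min (f2b - f1b) (mu * da)) in
  `|ya| <= E -> `|yb - mu * ya| <= 2 * eta.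
Proof.
move=> L0 s0 s4 mu2 mu1 E0 eta0 hE hz1 hz2 hz hs1 hs2 a1 b1 a2 b2 q1 q2 ha hb ca0 da0.
have P0 : 0 <= L * E by rewrite mulr_ge0.
have half (h c : R) : 0 < h -> s * Num.min h c <= h / 4.
  move=> h0; apply: (@le_trans _ _ (s * h)); first by rewrite ler_pM2l // ge_min lexx.
  by rewrite mulrC ler_wpM2l ?(ltW h0) // (le_trans s4) // mul1r.
have mpos (h c : R) : 0 < h -> 0 < c -> 0 < s * Num.min h c.
  by move=> h0 c0; rewrite mulr_gt0 // lt_min h0.
have mu0 : 0 < mu by lra.
have ha' : 0 < f2a - f1a by rewrite subr_gt0.
have hb' : 0 < f2b - f1b by rewrite subr_gt0.
have := half _ ca ha'; have := half _ da ha'; have := half _ (mu * ca) hb'; have := half _ (mu * da) hb'.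
have := mpos _ _ ha' ca0; have := mpos _ _ ha' da0.
have := mpos _ _ hb' (mulr_gt0 mu0 ca0); have := mpos _ _ hb' (mulr_gt0 mu0 da0).
set m1 := s * Num.min (f2a - f1a) ca ; set m2 := s * Num.min (f2a - f1a) da.
set m3 := s * Num.min (f2b - f1b) (mu * ca).
set m4 := s * Num.min (f2b - f1b) (mu * da).
move=> m4p m3p m2p m1p m4h m3h m2h m1h ya yb hya.
have la : f1a + m1 <= f2a - m2 by clear -m1h m2h ha'; lra.
have lb : f1b + m3 <= f2b - m4 by clear -m3h m4h hb'; lra.
have /andP[ya1 ya2] := clamp_bounds va la; rewrite -/ya in ya1 ya2.
have := hya; rewrite ler_norml => /andP[E1 E2].
have := a1; rewrite ler_norml => /andP[a1l a1r]; have := a2; rewrite ler_norml => /andP[a2l a2r].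
have sk : 16 * E + 16 * (L * E) < kap / 4.
  have kap0 : 0 < kap by rewrite -(pmulr_rgt0 _ s0); lra.
  by apply: lt_le_trans hE _; rewrite mulrC ler_wpM2l ?(ltW kap0) // (le_trans s4) // mul1r.
(* The clamped value is within [E] of 0, and [E] is small against [kap]: a nonzero limit of the
   lower boundary must be negative, and one of the upper boundary positive. *)
have z1le : z1 <= 0.
  by case: hz1 => [-> //|]; case: (ltP 0 z1) => // z10; rewrite gtr0_norm //; clear -a1l E2 ya1 m1p sk E0 P0 z10; lra.
have z2ge : 0 <= z2.
  by case: hz2 => [-> //|]; case: (ltP z2 0) => // z20; rewrite ltr0_norm //; clear -a2r E1 ya2 m2p sk E0 P0 z20; lra.
have zz0 : 0 <= z2 - z1 by rewrite subr_ge0 (le_trans z1le).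
rewrite (ger0_norm zz0) in hz hs1 hs2.
have := b1; rewrite ler_norml => /andP[b1l b1r]; have := b2; rewrite ler_norml => /andP[b2l b2r].
have := q1; rewrite ler_norml => /andP[q1l q1r]; have := q2; rewrite ler_norml => /andP[q2l q2r].
have da1 : `|f2a - f1a - (z2 - z1)| <= 2 * (L * E).
  by clear -a1l a1r a2l a2r; rewrite ler_norml; apply/andP; split; lra.
have db1 : `|f2b - f1b - (z2 - z1)| <= 4 * (L * E).
  by clear -b1l b1r b2l b2r; rewrite ler_norml; apply/andP; split; lra.
have dq : `|f2b - f1b - (z2 - z1) - mu * (f2a - f1a - (z2 - z1))| <= 2 * eta.
  by clear -q1l q1r q2l q2r; rewrite ler_norml; apply/andP; split; lra.
have low := barrier_dichotomy L0 s0 s4 mu2 mu1 E0 eta0 hE hz1 hz hs1 a1 b1 da1 db1 q1 dq ha' ca0 hya ya1.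
have up : (- f2a + m2 < - E /\ - f2b + m4 < - (2 * E)) \/ `|- f2b + m4 - mu * (- f2a + m2)| <= 2 * eta.
  have nz : - z2 = 0 \/ kap <= `|- z2|.
    by rewrite normrN; case: hz2 => [->|h]; [left; rewrite oppr0|right].
  have n1 : - z2 < 0 -> - z2 + s * (z2 - z1) <= - z2 / 2.
    by rewrite oppr_lt0 => /hs2; clear; lra.
  have n2 : `|- f2a - - z2| <= L * E by rewrite -opprD normrN.
  have n3 : `|- f2b - - z2| <= 2 * (L * E) by rewrite -opprD normrN.
  have n4 : `|- f2b - - z2 - mu * (- f2a - - z2)| <= eta.
    have -> : - f2b - - z2 - mu * (- f2a - - z2) = - (f2b - z2 - mu * (f2a - z2)) by ring.
    by rewrite normrN.
  have n5 : `|- ya| <= E by rewrite normrN.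
  have n6 : - f2a + s * Num.min (f2a - f1a) da <= - ya.
    by rewrite -/m2; clear -ya2; lra.
  exact: barrier_dichotomy L0 s0 s4 mu2 mu1 E0 eta0 hE nz hz n1 n2 n3 da1 db1 n4 dq ha' da0 n5 n6.
rewrite -/m1 -/m3 in low.
have v0 : `|mu * va - mu * va| <= 2 * eta by rewrite subrr normr0; clear -eta0; lra.
have up' : (E < f2a - m2 /\ 2 * E < f2b - m4) \/ `|(f2b - m4) - mu * (f2a - m2)| <= 2 * eta.
  case: up => [[H H0]|h]; [by clear -H H0; left; split; lra|right].
  have -> : f2b - m4 - mu * (f2a - m2) = - (- f2b + m4 - mu * (- f2a + m2)) by ring.
  by rewrite normrN.
have mE (x : R) : x <= E -> mu * x <= E.
  move=> xE; case: (leP 0 x) => x0; first by apply: le_trans xE; rewrite ler_piMl.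
  by apply: le_trans E0; rewrite pmulr_rle0 // ltW.
have mE' (x : R) : - E <= x -> - E <= mu * x.
  by move=> xE; rewrite lerNl -mulrN; apply: mE; rewrite lerNl.
have yaE : ya = Num.max (f1a + m1) (Num.min va (f2a - m2)) by [].
have ybE : yb = Num.max (f1b + m3) (Num.min (mu * va) (f2b - m4)) by [].
case: up' => [[u1 u2]|hu].
  have va2 : va < f2a - m2.
    by rewrite ltNge; apply/negP => h; move: yaE; rewrite (min_idPr h) (max_idPr la); clear -u1 E2; lra.
  have vaE : va <= E by apply: le_trans E2; rewrite yaE (min_idPl (ltW va2)) le_max lexx orbT.
  have yaE' : ya = Num.max (f1a + m1) va by rewrite yaE (min_idPl (ltW va2)).
  have ybE' : yb = Num.max (f1b + m3) (mu * va).
    by rewrite ybE; congr Num.max; apply/min_idPl; have := mE _ vaE; clear -u2 E0; lra.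
  case: low => [[l1 l2]|hl]; last by rewrite yaE' ybE'; apply: almost_max => //; apply: ltW.
  have ev : ya = va by move: yaE'; case: (leP (f1a + m1) va) => // _; clear -l1 E1; lra.
  rewrite ybE' ev (max_idPr _) //; have := mE' va; rewrite -ev => /(_ E1); clear -l2 E0; lra.
case: low => [[l1 l2]|hl]; last first.
  by rewrite yaE ybE; apply: almost_max => //; [exact: ltW|apply: almost_min => //; exact: ltW].
have ev : ya = Num.min va (f2a - m2).
  by move: yaE; case: (leP (f1a + m1) (Num.min va (f2a - m2))) => // _; clear -l1 E1; lra.
have vE : - E <= va by apply: le_trans E1 _; rewrite ev ge_min lexx.
have -> : yb = Num.min (mu * va) (f2b - m4).
  by rewrite ybE; apply/max_idPr; rewrite le_min lb andbT; have := mE' _ vE; clear -l2 E0; lra.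
by rewrite ev; apply: almost_min => //; exact: ltW.
Qed.

End Barrier.

Section Lid.
Variable R : realFieldType.

(* [v] pushed between two barriers lying strictly between [g1] and [g2]. *)
Definition lid (s g1 g2 v c d : R) :=
  clamp v (g1 + s * Num.min (g2 - g1) c) (g2 - s * Num.min (g2 - g1) d).

Lemma lid_barriers (s g1 g2 c d : R) : 0 < s -> s <= 1 / 4 -> g1 < g2 -> 0 < c -> 0 < d ->
  [/\ g1 < g1 + s * Num.min (g2 - g1) c, g2 - s * Num.min (g2 - g1) d < g2 &
      g1 + s * Num.min (g2 - g1) c <= g2 - s * Num.min (g2 - g1) d].
Proof.
move=> s0 s4 g12 c0 d0; have h0 : 0 < g2 - g1 by rewrite subr_gt0.
have half x : s * Num.min (g2 - g1) x <= (g2 - g1) / 4.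
  apply: (@le_trans _ _ (s * (g2 - g1))); first by rewrite ler_pM2l // ge_min lexx.
  by rewrite mulrC ler_wpM2l ?(ltW h0) // (le_trans s4) // mul1r.
have pos x : 0 < x -> 0 < s * Num.min (g2 - g1) x by move=> x0; rewrite mulr_gt0 // lt_min h0.
have := half c; have := half d; have := pos c c0; have := pos d d0.
by move=> h1 h2 h3 h4; split; lra.
Qed.

Lemma lid_inside (s g1 g2 v c d : R) : 0 < s -> s <= 1 / 4 -> g1 < g2 -> 0 < c -> 0 < d ->
  g1 < lid s g1 g2 v c d < g2.
Proof.
move=> s0 s4 g12 c0 d0; have [h1 h2 h3] := lid_barriers s0 s4 g12 c0 d0.
have /andP[h4 h5] := clamp_bounds v h3.
by rewrite (lt_le_trans h1) // (le_lt_trans h5).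
Qed.

(** When [c] and [d] are the actual distances of [v] to the two boundaries, neither barrier reaches
    [v]. This makes the lifted flow the identity at time 1. *)
Lemma lid_id (s g1 g2 v : R) : 0 < s -> s <= 1 / 4 -> g1 < v < g2 -> lid s g1 g2 v (v - g1) (g2 - v) = v.
Proof.
move=> s0 s4 /andP[v1 v2]; apply: clamp_id.
have half x : 0 < x -> s * Num.min (g2 - g1) x <= x.
  move=> x0; apply: (@le_trans _ _ (1 * x)); last by rewrite mul1r.
  by apply: ler_pM; rewrite ?ge_min ?lexx ?orbT ?le_min ?(ltW s0) ?(ltW x0) ?subr_ge0 ?(ltW (lt_trans v1 v2)) //; lra.
by have := half (v - g1); have := half (g2 - v); rewrite !subr_gt0 v1 v2 => /(_ isT) ? /(_ isT) ?; lra.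
Qed.

Lemma lid_lip (s g1 g2 v c d g1' g2' v' c' d' N V W : R) : 0 < s -> s <= 1 / 4 ->
  `|g1 - g1'| <= N -> `|g2 - g2'| <= N -> `|v - v'| <= V -> `|c - c'| <= W -> `|d - d'| <= W ->
  `|lid s g1 g2 v c d - lid s g1' g2' v' c' d'| <= 3 * N + V + W.
Proof.
move=> s0 s4 h1 h2 h3 h4 h5.
have hm x x' : `|x - x'| <= W -> `|s * Num.min (g2 - g1) x - s * Num.min (g2' - g1') x'| <= 1 / 4 * (2 * N + W).
  move=> hx; rewrite -mulrBr normrM (gtr0_norm s0); apply: ler_pM => //; first exact: ltW.
  apply: le_trans (min_lip _ _ _ _) (lerD _ hx).
  rewrite (_ : _ - _ = (g2 - g2') - (g1 - g1')); last by ring.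
  by apply: le_trans (ler_normB _ _) _; rewrite mulr2n mulrDl mul1r lerD.
have W0 : 0 <= W by apply: le_trans h4.
apply: le_trans (clamp_lip _ _ _ _ _ _) _.
have e1 : `|g1 + s * Num.min (g2 - g1) c - (g1' + s * Num.min (g2' - g1') c')| <= N + 1 / 4 * (2 * N + W).
  by rewrite opprD addrACA; apply: le_trans (ler_normD _ _) (lerD h1 (hm _ _ h4)).
have e2 : `|g2 - s * Num.min (g2 - g1) d - (g2' - s * Num.min (g2' - g1') d')| <= N + 1 / 4 * (2 * N + W).
  have := hm _ _ h5; set m := s * _; set m' := s * _ => hm5.
  have -> : g2 - m - (g2' - m') = (g2 - g2') - (m - m') by ring.
  by apply: le_trans (ler_normB _ _) (lerD h2 hm5).
clear -e1 e2 h3 W0; lra.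
Qed.

End Lid.

Section Flow.
Variable R : realType.

(* [F a] mimics the dilation x |-> p + a (x - p) inside [Y]. *)
Definition flow n (Y : set 'rV[R]_n) (L : R) (F : R -> 'rV[R]_n -> 'rV[R]_n) :=
  [/\ forall a x, 0 < a -> Y x -> Y (F a x),
      forall x, Y x -> F 1 x = x,
      forall a x y, 0 < a -> Y x -> Y y -> enorm (F a x - F a y) <= L * (1 + a) * enorm (x - y) &
      forall x, Y x -> exists2 M, 0 <= M & forall a b, 0 < a -> 0 < b ->
        enorm (F a x - F b x) <= M * `|a - b|].

Definition almost_conic n (Y : set 'rV[R]_n) p (e d : R) (F : R -> 'rV[R]_n -> 'rV[R]_n) :=
  forall a b x, Y x -> 0 < a -> a / 2 <= b -> b <= a -> enorm (F a x - p) < d ->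
    enorm (F b x - p - (b / a) *: (F a x - p)) <= e * (1 - b / a) * enorm (F a x - p).

(** [L] comes before [e]: lifting a flow with error [e] asks for a smaller error on the base, and
    the Lipschitz constant must not be affected by that. *)
Definition conic n (Y : set 'rV[R]_n) p (L : R) := forall e, 0 < e ->
  exists2 d, 0 < d & exists2 F, flow Y L F & almost_conic Y p e d F.

Lemma conic_isom n (Q : 'M[R]_n) (Y : set 'rV[R]_n) p L : Q *m Q^T = 1%:M ->
  conic Y (p *m Q) L -> conic [set x | Y (x *m Q)] p L.
Proof.
move=> hQ hY e e0; have hQ' := mulmx1C hQ.
have hQt : Q^T *m Q^T^T = 1%:M by rewrite trmxK.
have [d d0 [F [f1 f2 f3 f4] hF]] := hY e e0.
exists d => //; exists (fun a x => F a (x *m Q) *m Q^T).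
  split.
  - by move=> a x a0 /= Yx; rewrite -mulmxA hQ' mulmx1; apply: f1.
  - by move=> x /= Yx; rewrite f2 // -mulmxA hQ mulmx1.
  - move=> a x y a0 Yx Yy; rewrite -mulmxBl enorm_isom //.
    by rewrite -(enorm_isom (x - y) hQ) mulmxBl; apply: f3.
  - by move=> x Yx; have [M M0 hM] := f4 _ Yx; exists M => // a b a0 b0; rewrite -mulmxBl enorm_isom //; exact: hM.
move=> a b x Yx a0 ab ba.
have E c : F c (x *m Q) *m Q^T - p = (F c (x *m Q) - p *m Q) *m Q^T.
  by rewrite mulmxBl -[p *m Q *m _]mulmxA hQ mulmx1.
by rewrite !E scalemxAl -mulmxBl !enorm_isom //; apply: hF.
Qed.

Lemma conic_point n (a p : 'rV[R]_n) : conic [set a] p 1.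
Proof.
move=> e e0; pose d := if a == p then 1 else enorm (a - p).
exists d; first by rewrite /d; case: eqP => // /eqP ap; rewrite enorm_gt0 // subr_eq0.
exists (fun _ x => x).
  split=> //.
  - by move=> b x y b0 _ _; rewrite mul1r ler_peMl ?enorm_ge0 // lerDl ltW.
  - by move=> x _; exists 0 => // b c _ _; rewrite subrr enorm0 mul0r.
move=> b c x ->; rewrite /d; case: eqP => [->|_] _ _ _; last by rewrite ltxx.
by move=> _; rewrite subrr scaler0 subr0 enorm0 mulr0.
Qed.

Definition euler_at n (D : set 'rV[R]_n) f p (fb : R) := forall e, 0 < e ->
  exists2 e', 0 < e' & exists2 d, 0 < d & forall x xh lam, D x -> D xh ->
    0 <= lam <= 1 / 2 -> enorm (x - p) < d ->
    enorm (x - xh - lam *: (x - p)) <= e' * lam * enorm (x - p) ->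
    `|f x - f xh - lam * (f x - fb)| <= e * lam * enorm (x - p).

(* Holds for the McShane extension of [f] to the point [p]. *)
Definition trace_at n (D : set 'rV[R]_n) f p (L fb : R) := forall x, D x -> `|f x - fb| <= L * enorm (x - p).

Lemma ratio_bounds (a b : R) : 0 < a -> a / 2 <= b -> b <= a -> 1 / 2 <= b / a <= 1.
Proof. by move=> a0 h1 h2; rewrite ler_pdivlMr // ler_pdivrMr //; apply/andP; split; lra. Qed.

(** [euler_at] is applied to the pair [F a x], [F b x] with [lam = 1 - b / a]; almost conicity of
    the flow is its closeness hypothesis, and [a / 2 <= b] gives [lam <= 1 / 2]. *)
Lemma euler_conic n (D : set 'rV[R]_n) f p fb e : euler_at D f p fb -> 0 < e ->
  exists2 e', 0 < e' & exists2 d, 0 < d & forall d' L F, d' <= d -> flow D L F ->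
  forall e'', e'' <= e' -> almost_conic D p e'' d' F ->
  forall a b x, D x -> 0 < a -> a / 2 <= b -> b <= a -> enorm (F a x - p) < d' ->
  `|f (F b x) - fb - (b / a) * (f (F a x) - fb)| <= e * ((1 - b / a) * enorm (F a x - p)).
Proof.
move=> hf e0; have [e' e'0 [d d0 h]] := hf e e0.
exists e' => //; exists d => // d' L F dd [f1 f2 f3 f4] e'' ee hF a b x Dx a0 ab ba hd.
have /andP[r1 r2] := ratio_bounds a0 ab ba.
have b0 : 0 < b by apply: lt_le_trans ab; rewrite divr_gt0.
have lam0 : 0 <= 1 - b / a by rewrite subr_ge0.
have -> : f (F b x) - fb - b / a * (f (F a x) - fb) =
  - (f (F a x) - f (F b x) - (1 - b / a) * (f (F a x) - fb)) by ring.
rewrite normrN mulrA.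
apply: h; rewrite ?(lt_le_trans hd) //; [exact: f1 | exact: f1 | by rewrite lam0 /=; lra |].
have -> : F a x - F b x - (1 - b / a) *: (F a x - p) = - (F b x - p - (b / a) *: (F a x - p)).
  by apply/rowP => i; rewrite !mxE; ring.
rewrite enormN; apply: le_trans (hF a b x Dx a0 ab ba hd) _.
by rewrite -!mulrA ler_wpM2r // mulr_ge0 ?enorm_ge0.
Qed.

Lemma flow_le n (Y : set 'rV[R]_n) L L' F : L <= L' -> flow Y L F -> flow Y L' F.
Proof.
move=> LL [f1 f2 f3 f4]; split=> // a x y a0 Yx Yy; apply: le_trans (f3 a x y a0 Yx Yy) _.
by rewrite -!mulrA ler_wpM2r // mulr_ge0 ?enorm_ge0 // addr_ge0 // ltW.
Qed.

Lemma conic_graph m (D : set 'rV[R]_m) f p L Lf fb : 0 <= L -> 0 <= Lf ->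
  conic D (base_coord p) L -> lipschitz_fun Lf D f -> trace_at D f (base_coord p) Lf fb ->
  euler_at D f (base_coord p) fb -> conic (graph_set D f) p (L * (1 + Lf)).
Proof.
move=> L0 Lf0 hD fL ft fe e e0; set p' := base_coord p in hD ft fe; pose y0 := last_coord p.
have e20 : 0 < e / 2 by rewrite divr_gt0.
have [e' e'0 [d1 d10 h1]] := euler_conic fe e20.
have [d2 d20 [F hF hc]] := hD (Num.min e' (e / 2)) ltac:(by rewrite lt_min e'0).
have [f1 f2 f3 f4] := hF.
have Lf1 : 0 < 1 + Lf by rewrite ltr_pwDl.
(* If [p] is not at the height [fb] of the graph over [p'], the graph stays at distance at least
   [dy] from [p], and the requirement becomes empty for [d <= dy]. *)
pose dy := if y0 == fb then 1 else `|y0 - fb| / (1 + Lf).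
have dy0 : 0 < dy by rewrite /dy; case: eqP => // /eqP h; rewrite divr_gt0 // normr_gt0 subr_eq0.
pose d := Num.min (Num.min d1 d2) dy.
have d0 : 0 < d by rewrite !lt_min d10 d20 dy0.
have [dd1 dd2 ddy] : [/\ d <= d1, d <= d2 & d <= dy] by rewrite /d !ge_min !lexx !orbT.
pose G a (x : 'rV[R]_m.+1) := mkv (F a (base_coord x)) (f (F a (base_coord x))).
have GE a b x y : D x -> D y -> 0 < a -> 0 < b ->
    enorm (mkv (F a x) (f (F a x)) - mkv (F b y) (f (F b y))) <= (1 + Lf) * enorm (F a x - F b y).
  move=> Dx Dy a0 b0; rewrite mkvB; apply: le_trans (enorm_mkv_le _ _) _.
  by rewrite mulrDl mul1r lerD2l fL //; apply: f1.
exists d => //; exists G.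
  split.
  - by move=> a x a0 [Dx _]; rewrite /graph_set /G /= base_mkv last_mkv; split=> //; apply: f1.
  - by move=> x [Dx hx]; rewrite /G f2 // -hx mkvK.
  - move=> a x y a0 [Dx _] [Dy _]; apply: le_trans (GE _ _ _ _ Dx Dy a0 a0) _.
    rewrite -!mulrA mulrCA ler_pM2l // mulrA.
    apply: le_trans (f3 _ _ _ a0 Dx Dy) _; rewrite -base_coordB ler_wpM2l ?enorm_base //.
    by rewrite mulr_ge0 // addr_ge0 // ltW.
  - move=> x [Dx _]; have [M M0 hM] := f4 _ Dx; exists ((1 + Lf) * M).
      by rewrite mulr_ge0 // ltW.
    move=> a b a0 b0; apply: le_trans (GE _ _ _ _ Dx Dx a0 b0) _.
    by rewrite -mulrA ler_pM2l // hM.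
move=> a b x [Dx _] a0 ab ba hd; set x' := base_coord x in Dx *.
have Eb : enorm (F a x' - p') <= enorm (G a x - p).
  by rewrite -[F a x'](base_mkv _ (f (F a x'))) -base_coordB enorm_base.
have Fa := f1 _ _ a0 Dx.
have y0E : y0 = fb.
  apply: contrapT => /eqP ne; move: ddy; rewrite /dy (negPf ne) ler_pdivlMr // leNgt => /negP; apply.
  apply: (@le_lt_trans _ _ (enorm (G a x - p) * (1 + Lf))); last by rewrite ltr_pM2r.
  have h3 := ft _ Fa; have := enorm_last (G a x - p); rewrite last_coordB last_mkv -/y0 distrC => h4.
  apply: le_trans (ler_distD (f (F a x')) y0 fb) _.
  by rewrite mulrDr mulr1 lerD // (le_trans h3) // mulrC ler_wpM2r.
have /andP[r1 r2] := ratio_bounds a0 ab ba.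
have pE : p = mkv p' y0 by rewrite mkvK.
rewrite {1 2}pE /G -/x' !mkvB mkvZ mkvB; apply: le_trans (enorm_mkv_le _ _) _.
have lE : 0 <= (1 - b / a) * enorm (F a x' - p') by rewrite mulr_ge0 ?enorm_ge0 // subr_ge0.
have hd1 := le_lt_trans Eb hd.
have k1 : enorm (F b x' - p' - (b / a) *: (F a x' - p')) <= e / 2 * ((1 - b / a) * enorm (F a x' - p')).
  apply: le_trans (hc a b x' Dx a0 ab ba (lt_le_trans hd1 dd2)) _.
  by rewrite -mulrA ler_wpM2r // ge_min lexx orbT.
have k2 : `|f (F b x') - y0 - b / a * (f (F a x') - y0)| <= e / 2 * ((1 - b / a) * enorm (F a x' - p')).
  rewrite y0E; apply: (h1 d L F dd1 hF (Num.min e' (e / 2))) => //; first by rewrite ge_min lexx.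
  by move=> a' b' z Dz ? ? ? hz; apply: hc => //; apply: lt_le_trans dd2.
apply: le_trans (lerD k1 k2) _; rewrite -mulrDl -splitr -mulrA ler_pM2l //.
by rewrite ler_wpM2l // subr_ge0.
Qed.

End Flow.

Section BandFlow.
Variable R : realType.

(* The proportion taken by the barriers: small enough for a barrier to stay on its
   side of 0 when the limit [z1] or [z2] of the corresponding boundary does. *)
Lemma barrier_proportion (z1 z2 : R) : exists s, [/\ 0 < s, s <= 1 / 4,
  z1 < 0 -> z1 + s * `|z2 - z1| <= z1 / 2 & 0 < z2 -> z2 / 2 <= z2 - s * `|z2 - z1|].
Proof.
pose t (z : R) := if z == 0 then 1 else `|z| / 2 / (1 + `|z2 - z1|).
have N0 : 0 < 1 + `|z2 - z1| by rewrite ltr_pwDl.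
have t0 z : 0 < t z.
  by rewrite /t; case: eqP => // /eqP h; rewrite !divr_gt0 // normr_gt0.
pose s := Num.min (1 / 4) (Num.min (t z1) (t z2)).
have s0 : 0 < s by rewrite !lt_min !t0 divr_gt0.
have [s4 s1 s2] : [/\ s <= 1 / 4, s <= t z1 & s <= t z2] by rewrite /s !ge_min !lexx !orbT.
have key z : z != 0 -> s <= t z -> s * `|z2 - z1| <= `|z| / 2.
  move=> hz; rewrite /t (negPf hz) ler_pdivlMr // => h; apply: le_trans h.
  by rewrite ler_wpM2l ?(ltW s0) // lerDr.
exists s; split=> // hz.
  by have := key z1 (ltr0_neq0 hz) s1; rewrite (ltr0_norm hz); lra.
by have := key z2 (lt0r_neq0 hz) s2; rewrite (gtr0_norm hz); lra.
Qed.

Lemma zero_or_far (z : R) : exists2 k, 0 < k & forall k', k' <= k -> z = 0 \/ k' <= `|z|.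
Proof.
case: (eqVneq z 0) => [->|h]; first by exists 1 => // k' _; left.
by exists `|z|; [rewrite normr_gt0|move=> k' hk; right].
Qed.

Variables (m : nat) (D : set 'rV[R]_m) (f1 f2 : 'rV[R]_m -> R) (y0 s : R).

(** The height [v] above [y0] is dilated by [a], and so are the two margins that cap the barriers:
    the whole construction is homogeneous wherever the boundary functions are. *)
Definition band_flow (F : R -> 'rV[R]_m -> 'rV[R]_m) (a : R) (q : 'rV[R]_m.+1) :=
  let x := base_coord q in let v := last_coord q - y0 in let X := F a x in
  mkv X (y0 + lid s (f1 X - y0) (f2 X - y0) (a * v) (a * (v - (f1 x - y0))) (a * (f2 x - y0 - v))).

Lemma band_flowP L Lf F : 0 <= L -> 0 <= Lf -> 0 < s -> s <= 1 / 4 ->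
  lipschitz_fun Lf D f1 -> lipschitz_fun Lf D f2 -> (forall x, D x -> f1 x < f2 x) ->
  flow D L F ->
  flow (band_set D f1 f2) ((1 + 3 * Lf) * L + 2 + Lf) (band_flow F).
Proof.
move=> L0 Lf0 s0 s4 l1 l2 f12 [F1 F2 F3 F4].
have g12 x : D x -> f1 x - y0 < f2 x - y0 by move=> Dx; rewrite ltrD2r f12.
have marg q : band_set D f1 f2 q -> 0 < last_coord q - y0 - (f1 (base_coord q) - y0) /\
    0 < f2 (base_coord q) - y0 - (last_coord q - y0).
  by move=> [_ /andP[h1 h2]]; split; lra.
split.
- move=> a q a0 hq; have [m1 m2] := marg q hq; have [Dx _] := hq.
  rewrite /band_flow /band_set /= base_mkv last_mkv; have FD := F1 _ _ a0 Dx; split=> //.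
  have /andP[h1 h2] := lid_inside (a * (last_coord q - y0)) s0 s4 (g12 _ FD) (mulr_gt0 a0 m1) (mulr_gt0 a0 m2).
  by rewrite -ltrBlDl h1 -ltrBrDl h2.
- move=> q hq; have [Dx /andP[h1 h2]] := hq.
  rewrite /band_flow /= F2 // !mul1r lid_id // ?ltrD2r ?h1 //.
  by rewrite addrC subrK mkvK.
- move=> a q q' a0 [Dx _] [Dx' _]; rewrite /band_flow /= mkvB; apply: le_trans (enorm_mkv_le _ _) _.
  set x := base_coord q in Dx *; set x' := base_coord q' in Dx' *.
  set v := last_coord q; set v' := last_coord q'.
  have n0 := enorm_ge0 (q - q'); set n := enorm (q - q') in n0 *.
  have nx : enorm (x - x') <= n by rewrite -base_coordB enorm_base.
  have nv : `|v - v'| <= n by rewrite /v /v' -last_coordB enorm_last.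
  have hN := F3 a x x' a0 Dx Dx'; set N := enorm (F a x - F a x') in hN *.
  have hN' : N <= L * ((1 + a) * n).
    apply: le_trans hN _; rewrite -mulrA ler_wpM2l // ler_wpM2l // addr_ge0 // ltW //.
  have FD := F1 _ _ a0 Dx; have FD' := F1 _ _ a0 Dx'.
  have d1 : `|f1 x - f1 x'| <= Lf * n by apply: le_trans (l1 _ _ Dx Dx') _; rewrite ler_wpM2l.
  have d2 : `|f2 x - f2 x'| <= Lf * n by apply: le_trans (l2 _ _ Dx Dx') _; rewrite ler_wpM2l.
  have E (b c : R) : b - y0 - (c - y0) = b - c by ring.
  have hl := @lid_lip R s (f1 (F a x) - y0) (f2 (F a x) - y0) (a * (v - y0)) (a * (v - y0 - (f1 x - y0)))
    (a * (f2 x - y0 - (v - y0))) (f1 (F a x') - y0) (f2 (F a x') - y0) (a * (v' - y0)) (a * (v' - y0 - (f1 x' - y0)))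
    (a * (f2 x' - y0 - (v' - y0))) (Lf * N) (a * n) (a * ((1 + Lf) * n)) s0 s4.
  rewrite !E in hl; have {}hl := hl (l1 _ _ FD FD') (l2 _ _ FD FD').
  rewrite (_ : y0 + _ - _ = lid s (f1 (F a x) - y0) (f2 (F a x) - y0) (a * (v - y0)) (a * (v - f1 x)) (a * (f2 x - v))
    - lid s (f1 (F a x') - y0) (f2 (F a x') - y0) (a * (v' - y0)) (a * (v' - f1 x')) (a * (f2 x' - v'))); last first.
    by rewrite !E; ring.
  apply: le_trans (lerD (lexx N) (hl _ _ _)) _.
  + by rewrite -mulrBr E normrM gtr0_norm // ler_pM2l.
  + rewrite -mulrBr normrM gtr0_norm // ler_pM2l // (_ : _ - _ = (v - v') - (f1 x - f1 x')); last by ring.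
    by apply: le_trans (ler_normB _ _) _; rewrite mulrDl mul1r lerD.
  + rewrite -mulrBr normrM gtr0_norm // ler_pM2l // (_ : _ - _ = (f2 x - f2 x') - (v - v')); last by ring.
    by apply: le_trans (ler_normB _ _) _; rewrite mulrDl mul1r addrC lerD.
  have h1 := ler_wpM2l Lf0 hN'; have an : 0 <= a * n by rewrite mulr_ge0 // ltW.
  have h2 : 0 <= Lf * n by rewrite mulr_ge0.
  have -> : ((1 + 3 * Lf) * L + 2 + Lf) * (1 + a) * n =
    L * ((1 + a) * n) + 3 * (Lf * (L * ((1 + a) * n))) + 2 * n + 2 * (a * n) + Lf * n + Lf * (a * n) by ring.
  have -> : a * ((1 + Lf) * n) = a * n + Lf * (a * n) by ring.
  by clear -hN' h1 an h2 n0; lra.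
move=> q hq; have [Dx _] := hq; set x := base_coord q in Dx.
have [M M0 hM] := F4 x Dx.
pose v := last_coord q - y0; pose c := v - (f1 x - y0); pose d := f2 x - y0 - v.
pose W := `|c| + `|d|.
exists (M + (3 * (Lf * M) + `|v| + W)); first by rewrite !addr_ge0 // !mulr_ge0.
move=> a b a0 b0; rewrite /band_flow /= mkvB -/x -/v -/c -/d; apply: le_trans (enorm_mkv_le _ _) _.
have ab0 := normr_ge0 (a - b); have hab := hM a b a0 b0.
have FD := F1 _ _ a0 Dx; have FD' := F1 _ _ b0 Dx.
rewrite mulrDl lerD // opprD addrACA subrr add0r.
have E (b1 c1 : R) : b1 - y0 - (c1 - y0) = b1 - c1 by ring.
have hf (f : 'rV[R]_m -> R) : lipschitz_fun Lf D f -> `|f (F a x) - y0 - (f (F b x) - y0)| <= Lf * M * `|a - b|.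
  by move=> lf; rewrite E; apply: le_trans (lf _ _ FD FD') _; rewrite -mulrA ler_wpM2l.
have -> : (3 * (Lf * M) + `|v| + W) * `|a - b| = 3 * (Lf * M * `|a - b|) + `|v| * `|a - b| + W * `|a - b| by ring.
apply: lid_lip => //; rewrite ?hf // -mulrBl normrM mulrC //.
  by rewrite ler_wpM2r // lerDl.
by rewrite ler_wpM2r // lerDr.
Qed.

End BandFlow.

Lemma conic_band (R : realType) m (D : set 'rV[R]_m) f1 f2 p L Lf z1 z2 : 0 <= L -> 0 <= Lf ->
  conic D (base_coord p) L -> lipschitz_fun Lf D f1 -> lipschitz_fun Lf D f2 ->
  (forall x, D x -> f1 x < f2 x) ->
  trace_at D f1 (base_coord p) Lf z1 -> trace_at D f2 (base_coord p) Lf z2 ->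
  euler_at D f1 (base_coord p) z1 -> euler_at D f2 (base_coord p) z2 ->
  conic (band_set D f1 f2) p ((1 + 3 * Lf) * L + 2 + Lf).
Proof.
move=> L0 Lf0 hD l1 l2 f12 t1 t2 e1 e2 e e0.
set p' := base_coord p in hD t1 t2 e1 e2; pose y0 := last_coord p.
have [s [s0 s4 sz1 sz2]] := barrier_proportion (z1 - y0) (z2 - y0).
(* The error of the boundary functions is doubled by clamping; with the [e / 2] of the base it adds
   up to [e]. *)
have e80 : 0 < e / 4 by rewrite divr_gt0.
have [e1' e1'0 [d1 d10 h1]] := euler_conic e1 e80.
have [e2' e2'0 [d2 d20 h2]] := euler_conic e2 e80.
pose ee := Num.min (Num.min e1' e2') (Num.min (e / 2) 1).
have ee0 : 0 < ee by rewrite !lt_min e1'0 e2'0 divr_gt0 //=.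
have [ee1 ee2 ee3 ee4] : [/\ ee <= e1', ee <= e2', ee <= e / 2 & ee <= 1].
  by rewrite /ee !ge_min !lexx !orbT.
have [d3 d30 [F hF hc]] := hD ee ee0.
have [F1 F2 F3 F4] := hF.
have [k1 k10 hk1] := zero_or_far (z1 - y0).
have [k2 k20 hk2] := zero_or_far (z2 - y0).
have [k3 k30 hk3] := zero_or_far (z2 - y0 - (z1 - y0)).
pose k := Num.min k1 (Num.min k2 k3).
have k0 : 0 < k by rewrite !lt_min k10 k20.
have [hz1 hz2 hz3] : [/\ z1 - y0 = 0 \/ k <= `|z1 - y0|, z2 - y0 = 0 \/ k <= `|z2 - y0| &
    z2 - y0 - (z1 - y0) = 0 \/ k <= `|z2 - y0 - (z1 - y0)|].
  by split; [apply: hk1|apply: hk2|apply: hk3]; rewrite /k !ge_min lexx ?orbT.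
have Lf1 : 0 < 1 + Lf by rewrite ltr_pwDl.
(* This bound is the smallness hypothesis of [clamp_almost_homogeneous], solved for [E]. *)
pose d4 := s * k / (16 * (1 + Lf)).
have d40 : 0 < d4 by rewrite !divr_gt0 // ?mulr_gt0.
pose d := Num.min (Num.min d1 d2) (Num.min d3 d4).
have d0 : 0 < d by rewrite !lt_min d10 d20 d30 d40.
have [dd1 dd2 dd3 dd4] : [/\ d <= d1, d <= d2, d <= d3 & d <= d4].
  by rewrite /d !ge_min !lexx !orbT.
exists d => //; exists (band_flow f1 f2 y0 s F); first exact: band_flowP.
move=> a b q hq a0 ab ba.
have b0 : 0 < b by apply: lt_le_trans ab; rewrite divr_gt0.
have [Dx /andP[q1 q2]] := hq; set x := base_coord q in Dx q1 q2.
pose v := last_coord q - y0.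
have c0 : 0 < v - (f1 x - y0) by rewrite /v; clear -q1; lra.
have c0' : 0 < f2 x - y0 - v by rewrite /v; clear -q2; lra.
have /andP[r1 r2] := ratio_bounds a0 ab ba; set mu := b / a in r1 r2 *.
pose Ya := lid s (f1 (F a x) - y0) (f2 (F a x) - y0) (a * v) (a * (v - (f1 x - y0))) (a * (f2 x - y0 - v)).
pose Yb := lid s (f1 (F b x) - y0) (f2 (F b x) - y0) (b * v) (b * (v - (f1 x - y0))) (b * (f2 x - y0 - v)).
have pE : p = mkv p' y0 by rewrite mkvK.
have FE c y : mkv (F c x) (y0 + y) - p = mkv (F c x - p') y.
  by rewrite {1}pE mkvB [y0 + y]addrC addrK.
rewrite /band_flow /= -/x -/v -/Ya -/Yb !FE; set E := enorm (mkv _ Ya) => hE.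
have E0 : 0 <= E := enorm_ge0 _.
have EX : enorm (F a x - p') <= E by rewrite -[F a x - p'](base_mkv _ Ya) enorm_base.
have EY : `|Ya| <= E by rewrite -[Ya](last_mkv (F a x - p')) enorm_last.
have hX : enorm (F a x - p') < d := le_lt_trans EX hE.
have FDa := F1 _ _ a0 Dx; have FDb := F1 _ _ b0 Dx.
have l0 : 0 <= 1 - mu by rewrite subr_ge0.
have hbase : enorm (F b x - p' - mu *: (F a x - p')) <= ee * ((1 - mu) * enorm (F a x - p')).
  by rewrite mulrA; apply: hc => //; apply: lt_le_trans dd3.
have lE : (1 - mu) * enorm (F a x - p') <= (1 - mu) * E by rewrite ler_wpM2l.
have lX0 : 0 <= (1 - mu) * enorm (F a x - p') by rewrite mulr_ge0 ?enorm_ge0.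
have EXb : enorm (F b x - p') <= 2 * E.
  rewrite -[F b x - p'](subrK (mu *: (F a x - p'))); apply: le_trans (enormD _ _) _.
  rewrite enormZ ger0_norm; last by clear -r1; lra.
  have h3 : mu * enorm (F a x - p') <= E by rewrite (le_trans _ EX) // ler_piMl ?enorm_ge0.
  have h4 : ee * ((1 - mu) * enorm (F a x - p')) <= E.
    apply: le_trans EX; apply: (@le_trans _ _ ((1 - mu) * enorm (F a x - p'))); first by rewrite ler_piMl.
    by rewrite ler_piMl ?enorm_ge0 //; clear -r1; lra.
  by move: (le_trans hbase h4); clear -h3; lra.
have q1' : `|f1 (F b x) - z1 - mu * (f1 (F a x) - z1)| <= e / 4 * ((1 - mu) * E).
  apply: le_trans (h1 d L F dd1 hF ee ee1 _ a b x Dx a0 ab ba hX) _; last by rewrite ler_pM2l.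
  by move=> a' b' z Dz ? ? ? hz; apply: hc => //; apply: lt_le_trans dd3.
have q2' : `|f2 (F b x) - z2 - mu * (f2 (F a x) - z2)| <= e / 4 * ((1 - mu) * E).
  apply: le_trans (h2 d L F dd2 hF ee ee2 _ a b x Dx a0 ab ba hX) _; last by rewrite ler_pM2l.
  by move=> a' b' z Dz ? ? ? hz; apply: hc => //; apply: lt_le_trans dd3.
have S (u w : R) : u - y0 - (w - y0) = u - w by ring.
have tra f z : trace_at D f p' Lf z -> `|f (F a x) - z| <= Lf * E /\ `|f (F b x) - z| <= 2 * (Lf * E).
  move=> ht; split; first by apply: le_trans (ht _ FDa) _; rewrite ler_wpM2l.
  by apply: le_trans (ht _ FDb) _; rewrite mulrCA ler_wpM2l.
have [t1a t1b] := tra _ _ t1; have [t2a t2b] := tra _ _ t2.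
have small : 16 * E + 16 * (Lf * E) < s * k.
  have : E < s * k / (16 * (1 + Lf)) := lt_le_trans hE dd4.
  by rewrite ltr_pdivlMr ?mulr_gt0 // (_ : E * _ = 16 * E + 16 * (Lf * E)) //; ring.
have mE (c : R) : mu * (a * c) = b * c by rewrite mulrA divfK // gt_eqF.
have := @clamp_almost_homogeneous R Lf s k mu E (e / 4 * ((1 - mu) * E)) (z1 - y0) (z2 - y0)
  (f1 (F a x) - y0) (f1 (F b x) - y0) (f2 (F a x) - y0) (f2 (F b x) - y0)
  (a * (v - (f1 x - y0))) (a * (f2 x - y0 - v)) (a * v) Lf0 s0 s4 r1 r2 E0.
rewrite !mE -/(lid _ _ _ _ _ _) -/Ya -/(lid _ _ _ _ _ _) -/Yb => hY.
have hYab : `|Yb - mu * Ya| <= 2 * (e / 4 * ((1 - mu) * E)).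
  apply: hY => //; rewrite ?S ?ltrD2r ?f12 ?mulr_gt0 //.
  - by rewrite !mulr_ge0 // ltW.
  - by rewrite subr_gt0.
  - by rewrite subr_gt0.
rewrite mkvZ mkvB; apply: le_trans (enorm_mkv_le _ _) _.
have b1 : enorm (F b x - p' - mu *: (F a x - p')) <= e / 2 * ((1 - mu) * E).
  by apply: le_trans hbase _; apply: ler_pM => //; apply: ltW.
by rewrite -mulrA; move: b1 hYab; clear; lra.
Qed.

Section Cells.
Variable R : realType.

Lemma trace_exists n (D : set 'rV[R]_n) f p L : 0 <= L -> D !=set0 -> lipschitz_fun L D f ->
  exists fb, trace_at D f p L fb.
Proof.
move=> L0 [x0 Dx0] fL; pose A := [set f x + L * enorm (x - p) | x in D].
have lbA x : D x -> lbound A (f x - L * enorm (x - p)).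
  move=> Dx _ [z Dz <-]; have h := fL x z Dx Dz; have := ler_norm (f x - f z) => h1.
  have h2 : L * enorm (x - z) <= L * enorm (x - p) + L * enorm (z - p).
    by rewrite -mulrDr ler_wpM2l // [enorm (z - p)]enorm_distC enorm_dist.
  by clear -h h1 h2; lra.
exists (inf A) => x Dx.
have h1 : inf A <= f x + L * enorm (x - p).
  by apply: ge_inf; [exists (f x0 - L * enorm (x0 - p)); exact: lbA | exists x].
have h2 : f x - L * enorm (x - p) <= inf A.
  by apply: lb_le_inf; [exists (f x0 + L * enorm (x0 - p)); exists x0 | exact: lbA].
by rewrite ler_norml; apply/andP; split; lra.
Qed.

(** With [e' < 1], the closeness condition compares [lam * enorm (a - p)] with half of itself and
    forces it to be 0. A point cell is treated apart because [Lregular] attaches no subanalyticity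
    to it. *)
Lemma euler_at_point n (a : 'rV[R]_n) f p L fb : 0 <= L -> trace_at [set a] f p L fb ->
  euler_at [set a] f p fb.
Proof.
move=> L0 ft e e0; exists (1 / 2); first by rewrite divr_gt0.
exists 1 => // x xh lam -> -> /andP[l0 _] _.
rewrite !subrr !sub0r enormN normrN enormZ (ger0_norm l0) => h.
have ln : lam * enorm (a - p) = 0.
  apply/eqP; rewrite eq_le mulr_ge0 ?enorm_ge0 // andbT; lra.
rewrite -mulrA ln mulr0 normrM (ger0_norm l0); apply: (@le_trans _ _ (lam * (L * enorm (a - p)))).
  by rewrite ler_wpM2l // ft.
by rewrite mulrCA ln mulr0.
Qed.

Lemma euler_at_cell n C (D : set 'rV[R]_n) f p L fb : 0 <= L -> Lregular C D ->
  lipschitz_fun L D f -> trace_at D f p L fb -> cell_function C D f -> euler_at D f p fb.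
Proof.
move=> L0 hD fL ft [_ sG _].
have [[a Da]|sD] : (exists a, D = [set a]) \/ subanalytic D.
  by case: n D hD {f p fL ft sG} => [|n] D; [left|case=> [|[]]; [left|right]].
  by move: ft; rewrite Da; apply: euler_at_point.
by move=> e e0; apply: (discrete_euler L0 e0 fL ft sD sG).
Qed.

Lemma Lregular_geometry n C (Y : set 'rV[R]_n) : 0 < C -> Lregular C Y ->
  exists2 L, 0 <= L & quasiconvex L Y /\ forall p, conic Y p L.
Proof.
move=> C0; elim: n Y => [|n IH] Y.
  move=> [a ->]; exists 1 => //; split; last by move=> p; apply: conic_point.
  move=> q q' -> ->; exists (fun=> a); split=> // s t _ _.
  by rewrite !subrr enorm0 mulr0 mul0r.
case=> [[a ->]|[_ [Q [D [hQ [k [mD [phi [psi [_ _ phiD _]]]]] hD hY]]]]].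
  exists 1 => //; split; last by move=> p; apply: conic_point.
  move=> q q' -> ->; exists (fun=> a); split=> // s t _ _.
  by rewrite !subrr enorm0 mulr0 mul0r.
have [L L0 [qD cD]] := IH D hD.
have D0 : D !=set0.
  by exists (phi 0); rewrite -phiD; exists 0 => //=; rewrite enorm0.
pose Lf := (C + C) * L; have CC : 0 <= C + C by rewrite addr_ge0 // ltW.
have Lf0 : 0 <= Lf by rewrite mulr_ge0.
have lip f : cell_function C D f -> lipschitz_fun Lf D f.
  move=> hf; apply: quasiconvex_lipschitz => // x Dx.
  exact: (cell_function_locally_lipschitz mD (ltW C0) hf Dx C0).
have tr f p : cell_function C D f -> exists2 fb, trace_at D f p Lf fb & euler_at D f p fb.
  move=> hf; have [fb hfb] := trace_exists p Lf0 D0 (lip f hf).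
  by exists fb => //; apply: euler_at_cell Lf0 hD (lip f hf) hfb hf.
case: hY => [[f hf ->]|[f1 [f2 [hf1 hf2 f12 ->]]]].
  exists (L * (1 + Lf)); first by rewrite mulr_ge0 // addr_ge0.
  split; first by apply: quasiconvex_isom => //; apply: quasiconvex_graph => //; exact: lip.
  move=> p; apply: conic_isom => //; have [fb h1 h2] := tr f (base_coord (p *m Q)) hf.
  by apply: conic_graph h1 h2 => //; exact: lip.
pose L1 := L + 1 + 3 * (Lf * L); pose L2 := (1 + 3 * Lf) * L + 2 + Lf.
have L10 : 0 <= L1 by rewrite !addr_ge0 // !mulr_ge0.
have L20 : 0 <= L2 by rewrite !addr_ge0 // mulr_ge0 // addr_ge0 // mulr_ge0.
exists (L1 + L2); first by rewrite addr_ge0.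
split.
  apply: quasiconvex_isom => // q q' Yq Yq'.
  have [g [g0 g1 gY gL]] := quasiconvex_band L0 Lf0 qD (lip _ hf1) (lip _ hf2) f12 Yq Yq'.
  exists g; split=> // s t hs ht; apply: le_trans (gL s t hs ht) _.
  rewrite -[leLHS]mulrA -[leRHS]mulrA; apply: ler_wpM2r; last by rewrite lerDl.
  by rewrite mulr_ge0 ?enorm_ge0.
move=> p; apply: conic_isom => // e e0.
have [z1 h1 h1'] := tr f1 (base_coord (p *m Q)) hf1.
have [z2 h2 h2'] := tr f2 (base_coord (p *m Q)) hf2.
have [d d0 [F hF hc]] := conic_band L0 Lf0 (cD _) (lip _ hf1) (lip _ hf2) f12 h1 h2 h1' h2' e0.
by exists d => //; exists F => //; apply: flow_le hF; rewrite lerDr.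
Qed.

End Cells.

(** * Orbits of the flow and radial projection onto spheres *)

Lemma power_unbounded (R : realType) (B : R) : exists k, B <= (3 / 2) ^+ k.
Proof.
have h k : 1 + k%:R / 2 <= (3 / 2 : R) ^+ k.
  elim: k => [|k IH]; first by rewrite expr0 mul0r addr0.
  have k0 : 0 <= k%:R :> R by [].
  rewrite exprS -natr1; move: (ler_wpM2l (ler0n R 3) IH); lra.
have [k hk] : exists k : nat, B <= k%:R / 2.
  exists (Num.bound `|2 * B|); have := archi_boundP (normr_ge0 (2 * B)).
  by have := ler_norm (2 * B); lra.
by exists k; apply: le_trans (h k); lra.
Qed.

Lemma lipschitz_ivt (R : realType) (f : R -> R) (K a b v : R) : a <= b ->
  (forall x y, a <= x <= b -> a <= y <= b -> `|f x - f y| <= K * `|x - y|) ->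
  (f a <= v <= f b) || (f b <= v <= f a) -> exists2 c, a <= c <= b & f c = v.
Proof.
move=> ab fK hv.
(* Clamping the argument extends [f] to a Lipschitz function on the whole line. *)
pose cl x := clamp x a b.
have clab x : a <= cl x <= b by apply: clamp_bounds.
have clK x y : `|cl x - cl y| <= `|x - y|.
  by apply: le_trans (clamp_lip _ _ _ _ _ _) _; rewrite !subrr normr0 add0r addr0.
pose g x := f (cl x).
have gK x y : `|g x - g y| <= `|K| * `|x - y|.
  apply: le_trans (fK _ _ (clab x) (clab y)) _; apply: le_trans (_ : `|K| * `|cl x - cl y| <= _).
    by rewrite ler_wpM2r // ler_norm.
  by rewrite ler_wpM2l.
have gc : continuous g.
  move=> x; apply/cvgrPdist_le => e e0; near=> y.
  apply: le_trans (gK _ _) _; have K1 : 0 < `|K| + 1 by rewrite ltr_wpDl.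
  apply: (@le_trans _ _ ((`|K| + 1) * `|x - y|)); first by rewrite ler_wpM2r // lerDl.
  rewrite mulrC -ler_pdivlMr //; near: y.
  by apply: cvgr_dist_le => //; rewrite divr_gt0.
have ga : g a = f a by rewrite /g /cl clamp_id // lexx.
have gb : g b = f b by rewrite /g /cl clamp_id // lexx ab.
have [||c hc gcv] := @IVT R g a b v ab; first exact: continuous_subspaceT.
  by rewrite ga gb; case/orP: hv => /andP[h1 h2]; rewrite ge_min le_max h1 h2 !orbT.
have {}hc : a <= c <= b by move: hc; rewrite in_itv.
by exists c => //; rewrite -gcv /g /cl clamp_id.
Unshelve. all: by end_near.
Qed.

Section Orbits.
Variables (R : realType) (n : nat) (Y : set 'rV[R]_n) (p : 'rV[R]_n) (L d : R).
Variable F : R -> 'rV[R]_n -> 'rV[R]_n.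
Hypothesis L0 : 0 <= L.
Hypothesis hF : flow Y L F.
Hypothesis hc : almost_conic Y p (1 / 3) d F.
Let N x := enorm (x - p).

(** With error [1 / 3], the norm drops by at least [2 / 3] and the point moves by at most [4 / 3] of
    the ideal step: displacement is at most twice the change of norm, the factor 2 of
    [orbit_close]. *)
Lemma orbit_norm a b x : Y x -> 0 < a -> a / 2 <= b -> b <= a -> N (F a x) < d ->
  2 / 3 * ((1 - b / a) * N (F a x)) <= N (F a x) - N (F b x) /\
  enorm (F a x - F b x) <= 4 / 3 * ((1 - b / a) * N (F a x)).
Proof.
move=> Yx a0 ab ba hd; have h := hc Yx a0 ab ba hd.
have /andP[r1 r2] := ratio_bounds a0 ab ba.
rewrite -/(N _) in h; set mu := b / a in r1 r2 h *.
split.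
  have := enorm_subl (F b x - p) (mu *: (F a x - p)); rewrite enormZ ger0_norm; last by lra.
  rewrite -/(N _) -/(N _); move: h; rewrite -mulrA; move: (N (F a x)) (N (F b x)) (enorm _) => u w z.
  by rewrite mulrBl mul1r; lra.
have -> : F a x - F b x = (1 - mu) *: (F a x - p) - (F b x - p - mu *: (F a x - p)).
  by apply/rowP => i; rewrite !mxE; ring.
apply: le_trans (enormD _ _) _; rewrite enormN enormZ ger0_norm; last by lra.
by rewrite -/(N _); move: h; rewrite -mulrA; lra.
Qed.

Lemma orbit_half a x : Y x -> 0 < a -> N (F a x) < d -> N (F (a / 2) x) <= 2 / 3 * N (F a x).
Proof.
move=> Yx a0 hd; have [||h _] := @orbit_norm a (a / 2) x Yx a0 _ _ hd => //; first by lra.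
rewrite (_ : a / 2 / a = 1 / 2) in h; last by field; rewrite gt_eqF.
by move: h; move: (N _) (N _) => u w; lra.
Qed.

(** Almost conicity covers only [a / 2 <= b], so longer intervals are reached by repeated
    halving. *)
Lemma orbit_mono a b x : Y x -> 0 < b -> b <= a -> N (F a x) < d -> N (F b x) <= N (F a x).
Proof.
move=> Yx b0 ba; have a0 : 0 < a by apply: lt_le_trans ba.
have [k hk] := power_unbounded (a / b).
have {hk} : a <= 2 ^+ k * b.
  move: hk; rewrite ler_pdivrMr // => hk; apply: le_trans hk _; rewrite ler_pM2r //.
  by rewrite lerXn2r ?nnegrE //; lra.
elim: k a a0 ba => [|k IH] a a0 ba hk hd.
  by rewrite (_ : a = b) //; apply/eqP; rewrite eq_le ba andbT; rewrite expr0 mul1r in hk.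
case: (leP (a / 2) b) => hab.
  have [h _] := orbit_norm Yx a0 hab ba hd.
  have : 0 <= (1 - b / a) * N (F a x).
    by rewrite mulr_ge0 ?enorm_ge0 // subr_ge0 ler_pdivrMr // mul1r.
  by move: h; move: (N _) (N _) => u w; lra.
have h := orbit_half Yx a0 hd; have N0 := enorm_ge0 (F a x - p); rewrite -/(N _) in N0.
apply: (@le_trans _ _ (N (F (a / 2) x))); last by lra.
apply: IH; rewrite ?divr_gt0 // ?(ltW hab) //; last by lra.
by move: hk; rewrite exprS -mulrA; lra.
Qed.

(** Norms within a factor [3 / 2] force times within a factor 2, because halving the time shrinks
    the norm by [2 / 3]; then [orbit_norm] applies. *)
Lemma orbit_close a b x : Y x -> 0 < a -> 0 < b -> N (F a x) < d -> N (F b x) < d ->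
  N (F a x) < 3 / 2 * N (F b x) -> N (F b x) < 3 / 2 * N (F a x) ->
  enorm (F a x - F b x) <= 2 * `|N (F a x) - N (F b x)|.
Proof.
move=> Yx; wlog ba : a b / b <= a => [hw a0 b0 ad bd h1 h2|a0 b0 ad bd h1 h2].
  case/orP: (le_total b a) => ?; first exact: hw.
  by rewrite enorm_distC distrC; apply: hw.
have ab : a / 2 <= b.
  rewrite leNgt; apply/negP => hab; have h3 := orbit_half Yx a0 ad.
  have N0 := enorm_ge0 (F a x - p); rewrite -/(N _) in N0.
  have h4 : N (F b x) <= N (F (a / 2) x).
    by apply: orbit_mono => //; [exact: ltW | lra].
  by lra.
have [h3 h4] := orbit_norm Yx a0 ab ba ad.
have h5 := orbit_mono Yx b0 ba ad.
by rewrite ger0_norm ?subr_ge0 //; lra.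
Qed.

(** Halving the time brings the norm below [t]; doubling it would make the norm grow without bound
    as long as it stays below [t]. The norm is Lipschitz in time, so it takes the value [t] in
    between. *)
Lemma orbit_reaches x t : Y x -> 0 < N x -> N x < d -> 0 < t -> t < d ->
  exists2 a, 0 < a & N (F a x) = t.
Proof.
move=> Yx x0 xd t0 td; have [F1 F2 F3 F4] := hF.
have F1x : N (F 1 x) = N x by rewrite F2.
have p2 k : 0 < (2 : R) ^+ k by rewrite exprn_gt0.
have [a a0 ha] : exists2 a, 0 < a & N (F a x) <= t.
  have [k hk] := power_unbounded (N x / t).
  exists ((2 ^+ k)^-1); first by rewrite invr_gt0.
  have down j : N (F (2 ^+ j)^-1 x) <= N x /\ (3 / 2) ^+ j * N (F (2 ^+ j)^-1 x) <= N x.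
    elim: j => [|j [IH1 IH2]]; first by rewrite !expr0 invr1 mul1r F1x.
    have h := @orbit_half (2 ^+ j)^-1 x Yx _ (le_lt_trans IH1 xd).
    rewrite invr_gt0 p2 in h; have {}h := h isT.
    have N0 := enorm_ge0 (F (2 ^+ j)^-1 x - p); rewrite -/(N _) in N0.
    rewrite [2 ^+ j.+1]exprSr invfM; split; first by lra.
    rewrite exprSr -mulrA; apply: le_trans IH2; rewrite ler_pM2l ?exprn_gt0 ?divr_gt0 //.
    by lra.
  have [_ h] := down k; move: hk; rewrite ler_pdivrMr // => hk.
  by have := le_trans h hk; rewrite ler_pM2l // exprn_gt0 // divr_gt0.
have [b b0 hb] : exists2 b, 0 < b & t <= N (F b x).
  apply: contrapT => hno.
  have lt b : 0 < b -> N (F b x) < t.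
    by move=> b0; rewrite ltNge; apply/negP => h; apply: hno; exists b.
  have up j : (3 / 2) ^+ j * N x <= N (F (2 ^+ j) x).
    elim: j => [|j IH]; first by rewrite !expr0 mul1r F1x.
    have := @orbit_half (2 ^+ j.+1) x Yx (p2 _) (lt_trans (lt _ (p2 _)) td).
    rewrite (_ : 2 ^+ j.+1 / 2 = 2 ^+ j) => [h|]; last by rewrite exprSr mulfK.
    by rewrite exprS -mulrA; lra.
  have [k hk] := power_unbounded (t / N x).
  move: hk; rewrite ler_pdivrMr // => hk; have := lt _ (p2 k).
  by rewrite ltNge (le_trans hk (up k)).
have [M M0 hM] := F4 x Yx.
have lipN u v : 0 < u -> 0 < v -> `|N (F u x) - N (F v x)| <= M * `|u - v|.
  move=> u0 v0; apply: le_trans (enorm_dist_abs _ _) _.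
  by rewrite opprB addrA subrK; apply: hM.
have ivt u v : 0 < u -> u <= v -> (N (F u x) <= t <= N (F v x)) || (N (F v x) <= t <= N (F u x)) ->
    exists2 c, 0 < c & N (F c x) = t.
  move=> u0 uv hv; have hl y z : u <= y <= v -> u <= z <= v ->
      `|N (F y x) - N (F z x)| <= M * `|y - z|.
    by move=> /andP[u1 _] /andP[v1 _]; apply: lipN; [exact: lt_le_trans u1|exact: lt_le_trans v1].
  have [c /andP[c1 _] hct] := lipschitz_ivt uv hl hv.
  by exists c => //; apply: lt_le_trans c1.
case/orP: (le_total a b) => hab; first by apply: ivt hab _ => //; rewrite ha hb.
by apply: ivt hab _ => //; rewrite ha hb orbT.
Qed.

(* Pushing points along the flow onto the sphere of radius [t]. *)
Lemma radial_projection t : 0 < t -> t < d -> exists rho : 'rV[R]_n -> 'rV[R]_n,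
  [/\ forall x, Y x -> 0 < N x < d -> Y (rho x) /\ N (rho x) = t,
      forall x, Y x -> N x = t -> rho x = x,
      forall x (e : R), Y x -> 0 < N x < d -> 0 < e ->
        exists2 r, 0 < r & forall y, Y y -> 0 < N y < d -> enorm (x - y) <= r ->
          enorm (rho x - rho y) <= e &
      exists2 r, 0 < r & forall x y, Y x -> Y y -> 0 < N x < d -> 0 < N y < d ->
        3 / 4 * t <= N x -> enorm (x - y) <= r ->
          enorm (rho x - rho y) <= 9 * L * enorm (x - y)].
Proof.
move=> t0 td; have [F1 F2 F3 F4] := hF.
have /choice[al hal] : forall x, exists a, Y x -> 0 < N x < d -> 0 < a /\ N (F a x) = t.
  move=> x; case: (pselect (Y x /\ 0 < N x < d)) => [[Yx /andP[x0 xd]]|h]; last first.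
    by exists 0 => Yx hx; case: h.
  by have [a a0 ha] := orbit_reaches Yx x0 xd t0 td; exists a.
(* A change of norm by at most [m] at time [al x] keeps the moved point inside the radius [d] and
   its norm within a factor [3 / 2] of [t], as [orbit_close] demands. *)
pose m := Num.min (t / 4) ((d - t) / 2).
have m0 : 0 < m by rewrite lt_min !divr_gt0 // subr_gt0.
have [mt md] : m <= t / 4 /\ m <= (d - t) / 2 by rewrite /m !ge_min !lexx orbT.
have est x y : Y x -> Y y -> 0 < N x < d -> 0 < N y < d ->
    L * (1 + al x) * enorm (x - y) <= m ->
    enorm (F (al x) x - F (al y) y) <= 3 * (L * (1 + al x) * enorm (x - y)).
  move=> Yx Yy Nx Ny hm; have [a0 ha] := hal x Yx Nx; have [b0 hb] := hal y Yy Ny.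
  have h1 := F3 _ _ _ a0 Yx Yy; set E := L * _ * _ in hm h1 *.
  have h2 : `|N (F (al x) x) - N (F (al x) y)| <= E.
    by apply: le_trans (enorm_dist_abs _ _) _; rewrite opprB addrA subrK.
  have h3 := h2; rewrite ha ler_norml in h3; case/andP: h3 => h3 h4.
  have h5 : enorm (F (al x) y - F (al y) y) <= 2 * `|N (F (al x) y) - N (F (al y) y)|.
    by apply: orbit_close => //; rewrite ?hb; lra.
  rewrite hb -ha distrC in h5.
  apply: le_trans (enorm_dist _ _ (F (al x) y)) _; lra.
exists (fun x => F (al x) x); split.
- by move=> x Yx Nx; have [a0 ha] := hal x Yx Nx; split=> //; apply: F1.
- move=> x Yx Nx; have hx : 0 < N x < d by rewrite Nx t0.
  have [a0 ha] := hal x Yx hx; have F1x : N (F 1 x) = t by rewrite F2.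
  apply/eqP; rewrite -subr_eq0; apply/eqP/enorm_eq0/eqP; rewrite eq_le enorm_ge0 andbT.
  have [ad bd] : N (F (al x) x) < d /\ N (F 1 x) < d by rewrite ha F1x.
  have t32 : t < 3 / 2 * t by lra.
  have := orbit_close Yx a0 ltr01 ad bd; rewrite ha F1x subrr normr0 mulr0 F2 //; exact.
- move=> x e Yx Nx e0; have [a0 _] := hal x Yx Nx.
  pose A := L * (1 + al x) + 1; have A0 : 0 < A by rewrite ltr_wpDl // mulr_ge0 // addr_ge0 // ltW.
  pose r := Num.min m (e / 3) / A; have r0 : 0 < r by rewrite divr_gt0 // lt_min m0 divr_gt0.
  exists r => // y Yy Ny; rewrite ler_pdivlMr // mulrC => hr.
  have hr' : L * (1 + al x) * enorm (x - y) <= Num.min m (e / 3).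
    by apply: le_trans hr; rewrite ler_wpM2r ?enorm_ge0 // lerDl.
  move: hr'; rewrite le_min => /andP[h1 h2]; apply: le_trans (est x y Yx Yy Nx Ny h1) _.
  by lra.
pose A := 3 * L + 1; have A0 : 0 < A by rewrite ltr_wpDl // mulr_ge0.
exists (m / A); first by rewrite divr_gt0.
move=> x y Yx Yy Nx Ny xt; rewrite ler_pdivlMr // mulrC => hr.
have [a0 ha] := hal x Yx Nx.
(* A larger time would give, after halving, a norm at most [2 / 3 * t] at a time beyond 1, below the
   norm [3 / 4 * t] available at time 1. Hence [3 * (L * (1 + 2)) = 9 * L]. *)
have a2 : al x <= 2.
  rewrite leNgt; apply/negP => a2; have ad : N (F (al x) x) < d by rewrite ha.
  have h1 := orbit_half Yx a0 ad.
  have h2 : N (F 1 x) <= N (F (al x / 2) x).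
    by apply: orbit_mono => //; [lra | rewrite ha in h1; lra].
  by rewrite F2 // in h2; rewrite ha in h1; lra.
have h3 : L * (1 + al x) * enorm (x - y) <= 3 * L * enorm (x - y).
  by rewrite ler_wpM2r ?enorm_ge0 // mulrC ler_wpM2r //; lra.
apply: le_trans (est x y Yx Yy Nx Ny _) _.
  by apply: le_trans h3 _; apply: le_trans hr; rewrite ler_wpM2r ?enorm_ge0 // lerDl.
by lra.
Qed.

End Orbits.

(** * Paths in the links *)

Section Joining.
Variables (R : realType) (n : nat).
Implicit Types (S Y : set 'rV[R]_n) (p q : 'rV[R]_n).

Lemma lip_path_cat S K K' q r s g g' : 0 <= K -> 0 <= K' ->
  lip_path S K q r g -> lip_path S K' r s g' -> exists h, lip_path S (2 * (K + K')) q s h.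
Proof.
move=> K0 K'0 [g0 g1 gS gK] [h0 h1 hS hK].
exists (fun u => if u <= 1 / 2 then g (2 * u) else g' (2 * u - 1)); split.
- by rewrite ifT ?mulr0 // divr_ge0.
- have e21 : 2 * 1 - 1 = 1 :> R by lra.
  by case: (leP 1 (1 / 2)) => h12; [exfalso; lra | rewrite e21].
- by move=> u hu; case: (leP u (1 / 2)) => u2; [apply: gS | apply: hS]; lra.
move=> u v; wlog uv : u v / u <= v => [hw hu hv|hu hv].
  case/orP: (le_total u v) => h; first exact: hw.
  by rewrite enorm_distC distrC; apply: hw.
rewrite distrC ger0_norm ?subr_ge0 //.
have wlen (a b : R) : 0 <= a -> 0 <= b -> 0 <= a * b by apply: mulr_ge0.
have KK (x : R) : 0 <= x -> K * (2 * x) <= 2 * (K + K') * x /\ K' * (2 * x) <= 2 * (K + K') * x.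
  by move=> x0; have := wlen _ _ K0 x0; have := wlen _ _ K'0 x0; split; lra.
case: (leP u (1 / 2)) => u2; case: (leP v (1 / 2)) => v2; last 2 first.
- by lra.
- apply: le_trans (hK _ _ _ _) _; [lra|lra|].
  by rewrite distrC (_ : _ - _ = 2 * (v - u)) ?ger0_norm; [apply: (KK _ _).2; lra | lra | ring].
- apply: le_trans (gK _ _ _ _) _; [lra|lra|].
  by rewrite distrC -mulrBr ger0_norm; [apply: (KK _ _).1; lra | lra].
apply: le_trans (enorm_dist _ _ r) _.
have e1 : enorm (g (2 * u) - r) <= K * (1 - 2 * u).
  by rewrite -g1; apply: le_trans (gK _ _ _ _) _; [lra | lra | rewrite distrC ger0_norm //; lra].
have e2 : enorm (r - g' (2 * v - 1)) <= K' * (2 * v - 1).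
  rewrite -h0; apply: le_trans (hK _ _ _ _) _; [lra | lra | ].
  by rewrite sub0r normrN ger0_norm //; lra.
have w1 : K * (1 - 2 * u) <= K * (2 * (v - u)) by rewrite ler_wpM2l //; lra.
have w2 : K' * (2 * v - 1) <= K' * (2 * (v - u)) by rewrite ler_wpM2l //; lra.
apply: le_trans (lerD (le_trans e1 w1) (le_trans e2 w2)) _.
by rewrite le_eqVlt; apply/orP; left; apply/eqP; ring.
Qed.

Definition chained S (eps : R) q q' := exists k (z : nat -> 'rV[R]_n),
  [/\ z 0%N = q, z k = q', forall i, (i <= k)%N -> S (z i) &
      forall i, (i < k)%N -> enorm (z i - z i.+1) <= eps].

Lemma chained_step S eps q q' : S q -> S q' -> enorm (q - q') <= eps -> chained S eps q q'.
Proof.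
by move=> Sq Sq' h; exists 1%N, (fun i => if i == 0%N then q else q'); split=> // [[|i] | [|i]].
Qed.

Lemma chained_trans S eps q r s : chained S eps q r -> chained S eps r s -> chained S eps q s.
Proof.
move=> [k [z [z0 zk zS zd]]] [l [w [w0 wl wS wd]]].
exists (k + l)%N, (fun i => if (i <= k)%N then z i else w (i - k)%N); split.
- by rewrite leq0n.
- case: leqP; last by rewrite addKn.
  by rewrite -[X in (_ <= X)%N]addn0 leq_add2l leqn0 => /eqP h; rewrite h addn0 zk -w0 -wl h.
- by move=> i hi; case: leqP => ik; [exact: zS | apply: wS; rewrite leq_subLR].
move=> i hi; case: (ltngtP i k) => ik; first by apply: zd.
- rewrite /= subSn ?(ltnW ik) //; apply: wd.
  by rewrite ltn_subLR // ltnW.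
- have := wd 0%N; rewrite w0 -zk ik /= subSnn; apply.
  by move: hi; rewrite ik -[X in (X < _)%N]addn0 ltn_add2l.
Qed.

(* Peeling off, cell by cell, the part of a chain up to its last visit to the
   current cell bounds the length independently of the length of the chain. *)
Lemma chained_lip_path (T : finType) (cell : 'rV[R]_n -> T) S eps K : 0 <= K ->
  (forall x y, S x -> S y -> cell x = cell y -> enorm (x - y) <= eps) ->
  (forall x y, S x -> S y -> enorm (x - y) <= eps -> exists g, lip_path S K x y g) ->
  forall q q', chained S eps q q' -> exists g, lip_path S (16 ^+ #|T| * K) q q' g.
Proof.
move=> K0 hcell hK q q' [k [z [<- <- zS zd]]].
have p16 j : 1 <= (16 : R) ^+ j by rewrite exprn_ege1 // ler1n.
have weak K1 K2 x y : K1 <= K2 -> (exists g, lip_path S K1 x y g) -> exists g, lip_path S K2 x y g.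
  move=> KK [g [g0 g1 gS gK]]; exists g; split=> // s t hs ht.
  by apply: le_trans (gK s t hs ht) _; rewrite ler_wpM2r.
have : forall m (A : {set T}%type) k z, (#|A| <= m)%N -> (forall i, (i <= k)%N -> S (z i) /\ cell (z i) \in A) ->
    (forall i, (i < k)%N -> enorm (z i - z i.+1) <= eps) ->
    exists g, lip_path S (16 ^+ m * K) (z 0%N) (z k) g.
  elim=> [|m IH] {zS zd z}A {}k z hA zS zd.
    have [_] := zS 0%N isT; rewrite leqn0 cards_eq0 in hA.
    by rewrite (eqP hA) inE.
  pose Q j := (j <= k)%N && (cell (z j) == cell (z 0%N)).
  have Q0 : exists j, Q j by exists 0%N; rewrite /Q eqxx.
  have Qk j : Q j -> (j <= k)%N by case/andP.
  have [j /andP[jk /eqP cj] jmax] := ex_maxnP Q0 Qk.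
  have [S0 c0] := zS 0%N isT; have [Sj _] := zS j jk.
  have path0j := hK _ _ S0 Sj (hcell _ _ S0 Sj (esym cj)).
  have K16 : K <= 16 ^+ m.+1 * K by rewrite ler_peMl.
  move: jk; rewrite leq_eqVlt => /orP[/eqP jk|jk].
    by rewrite -jk; apply: weak path0j.
  have [Sj1 _] := zS j.+1 jk.
  have [g1 hg1] := path0j; have [g2 hg2] := hK _ _ Sj Sj1 (zd j jk).
  have [g3 hg3] : exists g, lip_path S (16 ^+ m * K) (z j.+1) (z k) g.
    have := IH (A :\ cell (z 0%N)) (k - j.+1)%N (fun i => z (j.+1 + i)%N).
    rewrite addn0 subnKC //; apply.
    - by rewrite -ltnS; apply: leq_trans hA; rewrite (cardsD1 (cell (z 0%N)) A) c0.
    - move=> i hi; have hi' : (j.+1 + i <= k)%N by rewrite -leq_subRL.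
      have [h1 h2] := zS _ hi'; split=> //; rewrite !inE h2 andbT.
      apply/negP => hc; have := jmax (j.+1 + i)%N; rewrite /Q hi' hc => /(_ isT).
      by rewrite leqNgt ltnS leq_addr.
    - by move=> i hi; rewrite addnS; apply: zd; rewrite -ltn_subRL.
  have m0 : 0 <= 16 ^+ m * K by rewrite mulr_ge0 // (le_trans ler01).
  have [g4 hg4] := lip_path_cat K0 m0 hg2 hg3.
  have m1 : 0 <= 2 * (K + 16 ^+ m * K) by rewrite mulr_ge0 // addr_ge0.
  have h5 := lip_path_cat K0 m1 hg1 hg4.
  (* The concatenations cost [2 * (K + 2 * (K + 16 ^+ m * K))], which is at most
     [10 * 16 ^+ m * K]. *)
  apply: weak h5; rewrite exprS -mulrA.
  by have : K <= 16 ^+ m * K by [rewrite ler_peMl]; move: (16 ^+ m * K) => x; lra.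
move=> h; apply: (h #|T| (finset.setTfor T)) => //; first by rewrite cardsT.
by move=> i hi; split; [exact: zS | rewrite inE].
Qed.

Lemma ball_cells (de : R) : 0 < de -> exists N, forall p (t : R), 0 < t ->
  exists cell : 'rV[R]_n -> {ffun 'I_n -> 'I_N.+1}, forall x y, enorm (x - p) <= t ->
    enorm (y - p) <= t -> cell x = cell y -> enorm (x - y) <= de * t.
Proof.
move=> de0; pose B := (Num.bound (n.+1%:R / de)).+1.
have hB : n.+1%:R / de <= B%:R.
  apply: ltW; apply: lt_le_trans (archi_boundP _) _; first by rewrite divr_ge0 // ltW.
  by rewrite ler_nat.
have B0 : 0 < B%:R :> R by rewrite ltr0n.
(* A grid of mesh [t / B] on a cube of side [2 * t]; the number of cells does not depend on [p] or
   [t]. The indices run from 0 to [2 * B] included, the last one for the far face. *)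
exists (2 * B)%N => p t t0.
pose w (x : 'rV[R]_n) i := ((x - p) 0 i / t + 1) * B%:R.
have wr x i : enorm (x - p) <= t -> 0 <= w x i /\ (Num.truncn (w x i) < (2 * B).+1)%N.
  move=> hx; have := le_trans (coord_le (x - p) i) hx; rewrite ler_norml => /andP[h1 h2].
  have h3 : - 1 <= (x - p) 0 i / t <= 1 by rewrite ler_pdivlMr // ler_pdivrMr // mulN1r mul1r h1.
  case/andP: h3 => h3 h4; have w0 : 0 <= w x i by rewrite mulr_ge0 // ?(ltW B0) //; lra.
  split=> //; rewrite ltnS -(ler_nat R); have /andP[h5 _] := truncn_itv w0.
  by apply: le_trans h5 _; rewrite natrM ler_wpM2r ?(ltW B0) //; lra.
exists (fun x => [ffun i => inord (Num.truncn (w x i))]) => x y hx hy /ffunP hxy.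
apply: (@le_trans _ _ (n.+1%:R * (t / B%:R))); last first.
  rewrite mulrCA mulrC ler_pM2r // ler_pdivrMr //.
  by move: hB; rewrite ler_pdivrMr // mulrC.
apply: enorm_coord => [|i]; first by rewrite divr_ge0 // ltW.
have := hxy i; rewrite !ffunE => /(congr1 val) /=.
have [w1 w2] := wr x i hx; have [w3 w4] := wr y i hy; rewrite !inordK // => e.
have /andP[a1 a2] := truncn_itv w1; have /andP[a3 a4] := truncn_itv w3.
rewrite e in a1 a2; rewrite -natr1 in a2; rewrite -natr1 in a4.
have : `|w x i - w y i| <= 1.
  rewrite ler_norml; move: a1 a2 a3 a4; move: (_%:R) => c; move: (w x i) (w y i) => a b.
  by move=> *; apply/andP; split; lra.
have -> : w x i - w y i = (x - y) 0 i / (t / B%:R).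
  by rewrite /w !mxE; field; rewrite !gt_eqF.
by rewrite normrM [`|_^-1|]gtr0_norm ?invr_gt0 ?divr_gt0 // ler_pdivrMr ?divr_gt0 // mul1r.
Qed.

End Joining.

(** * Lipschitz paths and the inner distance *)

Section InnerDistance.
Variables (R : realType) (n : nat).
Implicit Types (S : set 'rV[R]_n) (g : R -> 'rV[R]_n).

Lemma partition_sum_le g K (a b : R) s : 0 <= a -> b <= 1 -> itv_partition a b s ->
  (forall u v, 0 <= u <= 1 -> 0 <= v <= 1 -> enorm (g u - g v) <= K * `|u - v|) ->
  \sum_(0 <= i < size s) enorm (g (nth b (a :: s) i.+1) - g (nth b (a :: s) i)) <= K * (b - a).
Proof.
move=> a0 b1 + hg; elim: s a a0 => [|c s IH] a a0 [hp /eqP hl].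
  by rewrite big_nil -hl subrr mulr0.
move: hp => /= /andP[ac hp]; have hcb : itv_partition c b s by split=> //; apply/eqP.
rewrite big_nat_recl //= -[b - a](subrKA c) mulrDr addrC lerD //.
  by apply: IH => //; apply: le_trans (ltW ac).
have cb := itv_partition_le hcb.
have := hg c a; rewrite ger0_norm ?subr_ge0 ?(ltW ac) //; apply.
  by rewrite (le_trans a0 (ltW ac)) (le_trans cb).
by rewrite a0 (le_trans (ltW ac)) // (le_trans cb).
Qed.

Lemma lip_continuous g K :
  (forall u v, 0 <= u <= 1 -> 0 <= v <= 1 -> enorm (g u - g v) <= K * `|u - v|) ->
  {within `[0, 1], continuous g}.
Proof.
move=> gK; pose h x := g (clamp x 0 1).
have cl (x : R) : 0 <= clamp x 0 1 <= 1 by apply: clamp_bounds.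
apply: (@subspace_eq_continuous _ _ _ h g) => [x|].
  by rewrite inE /= in_itv => hx; rewrite /h /from_subspace /= clamp_id.
apply: continuous_subspaceT => x; apply/cvgrPdist_le => e e0; near=> y.
apply: le_trans (norm_enorm _) _; apply: le_trans (gK _ _ (cl x) (cl y)) _.
have K1 : 0 < `|K| + 1 by rewrite ltr_wpDl.
apply: (@le_trans _ _ ((`|K| + 1) * `|x - y|)).
  apply: le_trans (_ : (`|K| + 1) * `|clamp x 0 1 - clamp y 0 1| <= _).
    by rewrite ler_wpM2r // (le_trans (ler_norm K)) // lerDl.
  rewrite ler_wpM2l ?(ltW K1) //.
  by apply: le_trans (clamp_lip _ _ _ _ _ _) _; rewrite !subrr normr0 add0r addr0.
rewrite mulrC -ler_pdivlMr //; near: y.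
by apply: cvgr_dist_le => //; rewrite divr_gt0.
Unshelve. all: by end_near.
Qed.

Lemma lip_path_inner_dist S K q q' g : lip_path S K q q' g -> (inner_dist S q q' <= K%:E)%E.
Proof.
move=> [g0 g1 gS gK].
have len : (curve_length 0 1 g <= K%:E)%E.
  apply: ge_ereal_sup => _ [s hs <-]; rewrite lee_fin.
  by apply: le_trans (partition_sum_le _ _ hs gK) _; rewrite ?subr0 ?mulr1 //.
apply: (le_trans _ len); apply: ereal_inf_lbound; exists g => //; split=> //.
- exact: lip_continuous gK.
- by move=> _ [s /= + <-]; rewrite in_itv => /gS.
- by apply: le_lt_trans len _; rewrite ltry.
Qed.

End InnerDistance.

(** * Paths and chains inside a link *)

Section Links.
Variables (R : realType) (n : nat).
Implicit Types (S Y : set 'rV[R]_n) (p q : 'rV[R]_n).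

Lemma open_enorm_nbhd (A : set 'rV[R]_n) (r : R) :
  open [set w | exists2 z, A z & enorm (w - z) < r].
Proof.
rewrite openE => w [z Az wz]; pose e := (r - enorm (w - z)) / n.+1%:R.
have e0 : 0 < e by rewrite divr_gt0 // subr_gt0.
apply/nbhs_ballP; exists (e / 2) => /=; first by rewrite divr_gt0.
move=> v; rewrite -ball_normE /= => hv; exists z => //.
apply: le_lt_trans (enorm_dist _ _ w) _; rewrite -ltrBrDr.
apply: le_lt_trans (enorm_coord (d := e / 2) _ _) _.
- by rewrite divr_ge0 // ltW.
- move=> i; apply: le_trans (ltW hv); rewrite distrC -[`|v - w|]/(mx_norm (v - w)) mx_normrE.
  by apply: (le_bigmax _ (fun ij : 'I_1 * 'I_n => `|(v - w) ij.1 ij.2|) (0, i)).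
by rewrite /e mulrA mulrCA mulfV // mulr1 ltr_pdivrMr // ltr_pMr ?subr_gt0 // ltr1n.
Qed.

(** The points reachable by a chain form an open and closed part of [S], because a further step of
    size below [eps] is always allowed. *)
Lemma connected_chained S (eps : R) : 0 < eps -> connected S ->
  forall q q', S q -> S q' -> chained S eps q q'.
Proof.
move=> e0 cS q q' Sq Sq'; pose A := [set z | S z /\ chained S eps q z].
suff AS : A = S by have : A q' by [rewrite AS]; case.
apply: cS.
- by exists q; split=> //; apply: chained_step => //; rewrite subrr enorm0 ltW.
- exists [set w | exists2 z, A z & enorm (w - z) < eps]; first exact: open_enorm_nbhd.
  apply/seteqP; split=> [z [Sz Az]|z [Sz [w [Sw Aw] zw]]].
    by split=> //; exists z => //; rewrite subrr enorm0.
  split=> //; apply: chained_trans Aw _; apply: chained_step => //.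
  by rewrite enorm_distC ltW.
- exists (~` [set w | exists2 z, (S `\` A) z & enorm (w - z) < eps]).
    exact/open_closedC/open_enorm_nbhd.
  apply/seteqP; split=> [z [Sz Az]|z [Sz hz]].
    split=> // -[w [Sw nAw] zw]; apply: nAw; split=> //; apply: chained_trans Az _.
    by apply: chained_step => //; rewrite ltW.
  apply: contrapT => nAz; apply: hz; exists z => //.
  by rewrite subrr enorm0.
Qed.

(** A chain shortened through [ball_cells] gives a path of length at most a constant times [de * t],
    and for points further apart than [de * t] this is controlled by their distance. *)
Lemma LLNE_of_chains Y p (d de M : R) : 0 < d -> 0 < de -> 0 <= M ->
  (forall t q q', 0 < t < d -> slice Y p t q -> slice Y p t q' -> enorm (q - q') <= de * t ->
     exists g, lip_path (slice Y p t) (M * enorm (q - q')) q q' g) ->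
  (\forall t \near 0^'+, forall q q', slice Y p t q -> slice Y p t q' ->
     chained (slice Y p t) (de * t) q q') ->
  LLNE Y p.
Proof.
move=> d0 de0 M0 loc ch.
have [N hN] := @ball_cells R n de de0.
pose P : R := 16 ^+ #|{ffun 'I_n -> 'I_N.+1}|.
have P0 : 0 <= P by rewrite exprn_ge0.
exists (1 + M + P * M) => [|].
  by rewrite -addrA lerDl addr_ge0 // mulr_ge0.
near=> t => q q' hq hq'.
have t0 : 0 < t by near: t; exact: nbhs_right_gt.
have td : t < d by near: t; apply: nbhs_right_lt.
have htd : 0 < t < d by rewrite t0.
have n0 := enorm_ge0 (q - q').
case: (leP (enorm (q - q')) (de * t)) => hqq.
  have [g hg] := loc t q q' htd hq hq' hqq.
  apply: le_trans (lip_path_inner_dist hg) _; rewrite lee_fin ler_wpM2r //.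
  by have : 0 <= P * M by [rewrite mulr_ge0]; lra.
have [cell hcell] := hN p t t0.
have hch : chained (slice Y p t) (de * t) q q'.
  by move: q q' hq hq' {n0 hqq}; near: t.
have [|||g hg] := @chained_lip_path R n _ cell (slice Y p t) (de * t) (M * (de * t)) _ _ _ q q' hch.
- by rewrite !mulr_ge0 // ltW.
- by move=> x y [_ /= hx] [_ /= hy]; apply: hcell; rewrite ?hx ?hy.
- move=> x y hx hy hxy; have [g [g0 g1 gS gK]] := loc t x y htd hx hy hxy.
  exists g; split=> // u v hu hv; apply: le_trans (gK u v hu hv) _.
  by rewrite ler_wpM2r // ler_wpM2l.
apply: le_trans (lip_path_inner_dist hg) _; rewrite lee_fin.
apply: (@le_trans _ _ (P * M * enorm (q - q'))).
  by rewrite -mulrA ler_wpM2l // ler_wpM2l // ltW.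
by rewrite ler_wpM2r //; lra.
Unshelve. all: by end_near.
Qed.

Definition enorm_continuous (g : R -> 'rV[R]_n) := forall s, 0 <= s <= 1 -> forall r, 0 < r ->
  exists2 e, 0 < e & forall u, 0 <= u <= 1 -> `|u - s| <= e -> enorm (g s - g u) <= r.

Lemma slice_paths Y p Lq L : 0 <= Lq -> quasiconvex Lq Y -> 0 <= L -> conic Y p L ->
  exists2 d, 0 < d & exists2 de, 0 < de & exists2 M, 0 <= M & forall t, 0 < t < d ->
   (forall q q', slice Y p t q -> slice Y p t q' -> enorm (q - q') <= de * t ->
     exists g, lip_path (slice Y p t) (M * enorm (q - q')) q q' g) /\
   (forall g eps, enorm_continuous g -> 0 < eps ->
     (forall s, 0 <= s <= 1 -> Y (g s) /\ 0 < enorm (g s - p) < 2 * d) ->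
     slice Y p t (g 0) -> slice Y p t (g 1) -> chained (slice Y p t) eps (g 0) (g 1)).
Proof.
move=> Lq0 qY L0 hY.
have [d d0 [F hF hc]] := hY (1 / 3) ltac:(by rewrite divr_gt0).
(* Makes the joining path stay within [t / 4] of its endpoint, hence at norms between [3 / 4 * t]
   and [5 / 4 * t], where the projection is uniformly Lipschitz. *)
pose de := (4 * (Lq + 1))^-1.
have de0 : 0 < de by rewrite invr_gt0 mulr_gt0 // ltr_wpDl.
(* Halved so that norms up to [5 / 4 * t], and curves up to twice the new radius, stay in the range
   of the projection. *)
exists (d / 2); first by rewrite divr_gt0.
exists de => //; exists (9 * L * Lq); first by rewrite !mulr_ge0.
move=> t /andP[t0 td]; have td' : t < d by lra.
have [rho [r1 r2 r3 [r r0 r4]]] := radial_projection L0 hF hc t0 td'.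
have d2 : 2 * (d / 2) = d by rewrite mulrC divfK.
split.
- move=> q q' hq hq' hqq; have [Yq /= nq] := hq; have [Yq' /= nq'] := hq'.
  have [g [g0 g1 gY gK]] := qY q q' Yq Yq'.
  set K := Lq * enorm (q - q') in gK; have K0 : 0 <= K by rewrite mulr_ge0 ?enorm_ge0.
  have Kt : K <= t / 4.
    apply: (@le_trans _ _ ((Lq + 1) * (de * t))).
      by apply: ler_pM; rewrite ?enorm_ge0 // lerDl.
    have L1 : Lq + 1 != 0 by rewrite gt_eqF // ltr_wpDl.
    by rewrite /de le_eqVlt; apply/orP; left; apply/eqP; field.
  have near_q s : 0 <= s <= 1 -> 3 / 4 * t <= enorm (g s - p) <= 5 / 4 * t.
    move=> hs; have h01 : 0 <= (0 : R) <= 1 by rewrite lexx ler01.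
    have h1 := gK s 0 hs h01; rewrite subr0 g0 in h1.
    have h2 : K * `|s| <= t / 4.
      by apply: le_trans Kt; rewrite ler_piMr //; case/andP: hs => ? ?; rewrite ger0_norm.
    have h3 := enorm_dist_abs (g s - p) (q - p); rewrite opprB addrA subrK nq ler_norml in h3.
    by case/andP: h3 => ? ?; apply/andP; split; lra.
  have zone s : 0 <= s <= 1 -> 0 < enorm (g s - p) < d.
    by move=> /near_q /andP[h1 h2]; apply/andP; split; lra.
  exists (fun s => rho (g s)); split.
  + by rewrite g0 r2.
  + by rewrite g1 r2.
  + by move=> s hs; apply: r1; [exact: gY | exact: zone].
  move=> u v; wlog uv : u v / u <= v => [hw hu hv|hu hv].
    case/orP: (le_total u v) => h; first exact: hw.
    by rewrite enorm_distC distrC; apply: hw.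
  rewrite distrC ger0_norm ?subr_ge0 //.
  (* The projection is Lipschitz only between points closer than [r]; the constant being uniform
     along the path, short pieces add up. *)
  apply: (@creeping R (fun a b => enorm (rho (g a) - rho (g b)) <= 9 * L * Lq * enorm (q - q') * (b - a))) => //.
    move=> x /andP[ux xv]; have K1 : 0 < 2 * (K + 1) by rewrite mulr_gt0 // ltr_wpDl.
    exists (r / (2 * (K + 1))); first by rewrite divr_gt0.
    move=> y z uy zv /andP[y1 y2] /andP[z1 z2]; case/andP: hu => u0 _; case/andP: hv => _ v1.
    have hy : 0 <= y <= 1 by rewrite (le_trans u0 uy) (le_trans y2 (le_trans xv v1)).
    have hz : 0 <= z <= 1 by rewrite (le_trans u0 (le_trans ux z1)) (le_trans zv v1).
    have yz : `|y - z| = z - y by rewrite distrC ger0_norm // subr_ge0 (le_trans y2).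
    have hyz := gK y z hy hz; rewrite yz in hyz.
    have close : enorm (g y - g z) <= r.
      apply: le_trans hyz _; apply: (@le_trans _ _ ((K + 1) * (2 * (r / (2 * (K + 1)))))).
        by apply: ler_pM; [exact: K0 | rewrite subr_ge0 (le_trans y2) | rewrite lerDl | lra].
      by rewrite le_eqVlt; apply/orP; left; apply/eqP; field; rewrite gt_eqF // ltr_wpDl.
    have [h1 _] := andP (near_q y hy).
    apply: le_trans (r4 _ _ (gY y hy) (gY z hz) (zone y hy) (zone z hz) h1 close) _.
    apply: le_trans (ler_wpM2l _ hyz) _; first by rewrite mulr_ge0.
    by rewrite /K !mulrA.
  move=> x y z h1 h2; apply: le_trans (enorm_dist _ _ (rho (g y))) _.
  apply: le_trans (lerD h1 h2) _; rewrite -mulrDr [y - x + _](_ : _ = z - x) //; ring.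
move=> g eps gc e0; rewrite d2 => gY hg0 hg1.
have [Y0 /= n0] := hg0; have [Y1 /= n1] := hg1.
have <- : rho (g 0) = g 0 by apply: r2.
have <- : rho (g 1) = g 1 by apply: r2.
have Srho s : 0 <= s <= 1 -> slice Y p t (rho (g s)).
  by move=> hs; have [h1 h2] := gY s hs; apply: r1.
apply: (@creeping R (fun a b => chained (slice Y p t) eps (rho (g a)) (rho (g b)))) => //; last first.
  by move=> x y z; apply: chained_trans.
move=> x hx; have [Yx zx] := gY x hx.
have [r' r'0 hr'] := r3 _ _ Yx zx e0; have [e e0' he] := gc x hx r' r'0.
have near_x y : 0 <= y <= 1 -> `|y - x| <= e -> enorm (rho (g x) - rho (g y)) <= eps.
  by move=> hy hyx; have [Yy zy] := gY y hy; apply: hr' => //; apply: he.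
exists e => // y z y0 z1 /andP[y1 y2] /andP[x1 x2]; case/andP: (hx) => x0' x1'.
have hy : 0 <= y <= 1 by rewrite y0 (le_trans y2 x1').
have hz : 0 <= z <= 1 by rewrite (le_trans x0' x1) z1.
apply: (@chained_trans _ _ _ _ _ (rho (g x))); apply: chained_step; try exact: Srho.
  by rewrite enorm_distC; apply: near_x => //; rewrite ler_distl y1 (le_trans y2) // lerDl ltW.
by apply: near_x => //; rewrite ler_distl x2 andbT (le_trans _ x1) // gerBl ltW.
Qed.

End Links.

(** * Arcs of a submanifold avoiding a point *)

Section Arcs.
Variables (R : realType) (n : nat).

Lemma analytic_map_lipschitz_at m k (f : 'rV[R]_m -> 'rV[R]_k) a :
  (forall i, analytic_at (fun x => f x 0 i) a) ->
  exists2 K, 0 < K & exists2 d, 0 < d & forall x, enorm (x - a) <= d ->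
    enorm (f x - f a) <= K * enorm (x - a).
Proof.
move=> /analytic_map_lin[A [K K0 [d d0 h]]]; have [B B0 hB] := enorm_mulmx A.
exists (B + K * d); first by rewrite addr_gt0 // mulr_gt0.
exists d => // x hx; rewrite -[f x - f a](subrK ((x - a) *m A)).
apply: le_trans (enormD _ _) _; rewrite addrC mulrDl lerD // (le_trans (h x hx)) //.
by rewrite expr2 -mulrA ler_pM2l // ler_wpM2r ?enorm_ge0.
Qed.

Lemma lip_path_enorm_continuous (S : set 'rV[R]_n) K q q' g : 0 <= K -> lip_path S K q q' g ->
  enorm_continuous g.
Proof.
move=> K0 [_ _ _ gK] s hs r r0; have K1 : 0 < K + 1 by rewrite ltr_wpDl.
exists (r / (K + 1)); first by rewrite divr_gt0.
move=> u hu; rewrite ler_pdivlMr // => hus; apply: le_trans (gK s u hs hu) _.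
by apply: le_trans hus; rewrite distrC mulrC ler_wpM2l // lerDl.
Qed.

(** The segment passes through 0 only if [a'] is a multiple of [a]; a bump in a coordinate direction
    not parallel to [a] then avoids 0, and [2 <= k] provides such a direction among the first
    [k]. *)
Lemma arc_avoiding_origin k (a a' : 'rV[R]_n) (r : R) : (2 <= k)%N -> (k <= n)%N -> 0 < r ->
  a != 0 -> a' != 0 -> (forall i : 'I_n, (k <= i)%N -> a 0 i = 0) ->
  exists w : 'rV[R]_n, [/\ enorm w <= r, forall i : 'I_n, (k <= i)%N -> w 0 i = 0 &
    forall s, 0 <= s <= 1 -> (1 - s) *: a + s *: a' + (s * (1 - s)) *: w != 0].
Proof.
move=> k2 kn r0 a0 a'0 ha.
case: (pselect (forall s, 0 <= s <= 1 -> (1 - s) *: a + s *: a' != 0)) => [h|].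
  by exists 0; split=> [|i _|s hs]; rewrite ?enorm0 ?mxE ?(ltW r0) // scaler0 addr0 h.
move=> /existsNP[u] /not_implyP[hu /negP/negPn/eqP hz].
have u0 : u != 0 by apply: contra_neq a0 => uz; move: hz; rewrite uz subr0 scale1r scale0r addr0.
have [c hc] : exists c, a' = c *: a.
  exists (- (1 - u) / u); apply: (scalerI u0); rewrite scalerA mulrC divfK // scaleNr.
  by move/eqP: hz; rewrite addrC addr_eq0 => /eqP.
have [i0 hi0] : exists i0, a 0 i0 != 0.
  apply: contrapT => hno; move/eqP: a0; apply; apply/rowP => i; rewrite mxE.
  by apply/eqP; apply: contraT => hi; case: hno; exists i.
(* The component of index [i0] of the bent arc vanishes only where the segment does, and there the
   component of index [j] is nonzero. *)
have [j [jk ji]] : exists j : 'I_n, (j < k)%N /\ j != i0.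
  have n2 : (1 < n)%N := leq_trans k2 kn.
  case: (eqVneq i0 (Ordinal n2)) => [->|h].
    by exists (Ordinal (ltnW n2)); split=> //; apply: ltnW.
  by exists (Ordinal n2); rewrite eq_sym.
exists (r *: delta_mx 0 j); split.
- rewrite enormZ gtr0_norm // ler_piMr ?(ltW r0) // enorm_le // expr1n /dotv (bigD1 j) //= big1.
    by rewrite !mxE !eqxx mulr1 addr0.
  by move=> i ij; rewrite !mxE (negPf ij) andbF mul0r.
- by move=> i ki; rewrite !mxE (_ : (i == j) = false) ?andbF ?mulr0 //; apply/eqP => e; move: ki; rewrite e leqNgt jk.
move=> s hs; apply/eqP => /rowP hv.
have hj := hv i0; rewrite hc !mxE eqxx (_ : (i0 == j) = false) ?mulr0 ?addr0 in hj; last first.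
  by apply/negbTE; rewrite eq_sym.
have co : (1 - s) + s * c = 0.
  by move/eqP: hj; rewrite mulrA -mulrDl mulf_eq0 (negPf hi0) orbF => /eqP.
have hjj := hv j; rewrite hc !mxE !eqxx mulr1 mulrA -mulrDl co mul0r add0r in hjj.
move/eqP: hjj; rewrite !mulf_eq0 (gt_eqF r0) orbF => /orP[] /eqP s0.
  by move: co; rewrite s0 subr0 mul0r addr0 => /eqP; rewrite oner_eq0.
have s1 : s = 1 by apply/eqP; rewrite eq_sym -subr_eq0 s0.
by move: co a'0; rewrite s0 s1 add0r mul1r hc => ->; rewrite scale0r eqxx.
Qed.

(** In a chart at [p] the points of the link become nonzero vectors of a space of dimension at least
    2, joined by a short arc that misses the origin; the radii are divided according to the
    Lipschitz constants of the chart and its inverse. *)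
Lemma submanifold_arc k (Y : set 'rV[R]_n) p (d : R) : (2 <= k)%N -> analytic_submanifold k Y ->
  Y p -> 0 < d -> exists2 t0, 0 < t0 & forall t q q', 0 < t < t0 -> slice Y p t q -> slice Y p t q' ->
    exists g, [/\ enorm_continuous g, g 0 = q, g 1 = q' &
      forall s, 0 <= s <= 1 -> Y (g s) /\ 0 < enorm (g s - p) < d].
Proof.
move=> k2 [kn hM] Yp d0.
have [U [V [phi [psi [[oU oV aphi apsi] [UV phiK DU]]]]]] := hM p Yp.
have Up : U p by case: oU.
set b := phi p; have Vb : V b by rewrite -UV; exists p.
have psiK v : V v -> U (psi v) /\ phi (psi v) = v.
  by rewrite -UV => -[y Uy <-]; rewrite phiK ?inE.
have psib : psi b = p by rewrite phiK ?inE.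
have [K K0 [dK dK0 hK]] := analytic_map_lipschitz_at (fun i => aphi i p Up).
have [M M0 [dM dM0 hM']] := analytic_map_lipschitz_at (fun i => apsi i _ Vb).
have [rU rU0 hU] := nbhs_enorm (open_nbhs_nbhs oU).
have [rV rV0 hV] := nbhs_enorm (open_nbhs_nbhs (conj oV Vb)).
pose rho := Num.min rV (Num.min dM (d / (2 * M))).
have rho0 : 0 < rho by rewrite !lt_min rV0 dM0 divr_gt0 // mulr_gt0.
have [h1 h2 h3] : [/\ rho <= rV, rho <= dM & rho <= d / (2 * M)] by rewrite /rho !ge_min !lexx !orbT.
pose t0 := Num.min rU (Num.min dK (rho / 2 / K)).
have t00 : 0 < t0 by rewrite !lt_min rU0 dK0 !divr_gt0.
have [m1 m2 m3] : [/\ t0 <= rU, t0 <= dK & t0 <= rho / 2 / K] by rewrite /t0 !ge_min !lexx !orbT.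
exists t0 => // t q q' /andP[tp tt0].
have tan x : slice Y p t x -> [/\ U x, enorm (phi x - b) <= rho / 2, phi x - b != 0 &
    forall i : 'I_n, (k <= i)%N -> (phi x - b) 0 i = 0].
  move=> [Yx /= nx]; have Ux : U x by apply: hU; rewrite nx (le_trans (ltW tt0)).
  split=> //.
  - apply: le_trans (hK x _) _; rewrite nx ?(le_trans (ltW tt0)) // mulrC -ler_pdivlMr //.
    exact: le_trans (ltW tt0) m3.
  - rewrite subr_eq0; apply/eqP => e; move: tp; rewrite -nx.
    by rewrite -[x]phiK ?inE // e psib subrr enorm0 ltxx.
  - by move=> i ki; rewrite !mxE (DU x Ux).1 // (DU p Up).1 // subrr.
move=> /tan[Uq a1 a2 a3] /tan[Uq' a1' a2' a3'].
set a := phi q - b in a1 a2 a3; set a' := phi q' - b in a1' a2' a3'.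
have rho2 : 0 < rho / 2 by rewrite divr_gt0.
have [w [w1 w2 w3]] := arc_avoiding_origin k2 kn rho2 a2 a2' a3.
pose v (s : R) := (1 - s) *: a + s *: a' + (s * (1 - s)) *: w.
have vn s : 0 <= s <= 1 -> enorm (v s) <= rho.
  move=> /andP[s0 s1]; apply: le_trans (enormD _ _) _.
  apply: le_trans (lerD (enormD _ _) (lexx _)) _.
  rewrite !enormZ !ger0_norm ?mulr_ge0 ?subr_ge0 //.
  have e1 : (1 - s) * enorm a <= (1 - s) * (rho / 2) by rewrite ler_wpM2l // subr_ge0.
  have e2 : s * enorm a' <= s * (rho / 2) by rewrite ler_wpM2l.
  have e3 : s * (1 - s) * enorm w <= 1 * (rho / 2).
    apply: ler_pM; rewrite ?enorm_ge0 ?mulr_ge0 ?subr_ge0 //.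
    by apply: (@le_trans _ _ (1 * 1)); [apply: ler_pM; rewrite ?subr_ge0 //; lra | rewrite mulr1].
  lra.
have Vv s : 0 <= s <= 1 -> V (b + v s).
  by move=> hs; apply: hV; rewrite addrAC subrr add0r (le_trans (vn s hs)).
pose g s := psi (b + v s); exists g; split.
- move=> s hs r r0.
  have [Ks Ks0 [ds ds0 hds]] := analytic_map_lipschitz_at (fun i => apsi i _ (Vv s hs)).
  pose A := enorm a + enorm a' + enorm w + 1.
  have A0 : 0 < A by rewrite ltr_wpDl // !addr_ge0 ?enorm_ge0.
  have vlip u : 0 <= u <= 1 -> enorm (v u - v s) <= A * `|u - s|.
    move=> hu; have -> : v u - v s = (u - s) *: (a' - a + (1 - s - u) *: w).
      by apply/rowP => i; rewrite !mxE; ring.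
    rewrite enormZ mulrC ler_wpM2r //; apply: le_trans (enormD _ _) _.
    apply: le_trans (lerD (enormD _ _) (lexx _)) _; rewrite enormN enormZ.
    have : `|1 - s - u| * enorm w <= 1 * enorm w.
      by rewrite ler_wpM2r ?enorm_ge0 // ler_norml; apply/andP; split; lra.
    by rewrite /A; lra.
  pose m := Num.min ds (r / Ks); have mm0 : 0 < m by rewrite lt_min ds0 divr_gt0.
  exists (m / A); first by rewrite divr_gt0.
  move=> u hu; rewrite ler_pdivlMr // mulrC => hus.
  have := le_trans (vlip u hu) hus; rewrite le_min => /andP[n1 n2].
  have E : b + v u - (b + v s) = v u - v s by rewrite opprD addrACA subrr add0r.
  rewrite enorm_distC; apply: le_trans (hds (b + v u) _) _; rewrite E //.
  by rewrite mulrC -ler_pdivlMr.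
- by rewrite /g /v subr0 scale1r scale0r mul0r scale0r !addr0 addrC subrK phiK ?inE.
- by rewrite /g /v subrr scale1r scale0r mulr0 scale0r add0r addr0 addrC subrK phiK ?inE.
move=> s hs; have [Us pE] := psiK _ (Vv s hs); split.
  have vE i : (b + v s) 0 i = b 0 i + ((1 - s) * a 0 i + s * a' 0 i + s * (1 - s) * w 0 i).
    by rewrite /v !mxE.
  apply/(DU _ Us) => i ki; rewrite pE vE a3 // a3' // w2 // ((DU p Up).1 Yp i ki).
  by rewrite !mulr0 !addr0.
have ne : g s - p != 0.
  rewrite subr_eq0; apply/eqP => e; have := pE; rewrite -/(g s) e -/b => /eqP.
  rewrite -subr_eq0 opprD addrA subrr add0r oppr_eq0; apply/negP; exact: w3.
rewrite enorm_gt0 //=; have := hM' (b + v s); rewrite psib addrAC subrr add0r => h.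
apply: le_lt_trans (h (le_trans (vn s hs) h2)) _.
apply: (@le_lt_trans _ _ (M * (d / (2 * M)))).
  by rewrite ler_pM2l // (le_trans (vn s hs)).
rewrite (_ : M * _ = d / 2); last by field; rewrite gt_eqF.
by lra.
Qed.

End Arcs.

Theorem proposition2p10 (R : realType) (n : nat) (Y : set 'rV[R]_n)
    (hY : Lregular_cell Y) :
  (forall p : 'rV[R]_n, closure Y p -> connected_link Y p -> LLNE Y p) /\
  (forall k : nat, (2 <= k)%N -> analytic_submanifold k Y ->
     forall p : 'rV[R]_n, closure Y p -> LLNE Y p).
Proof.
have [C C0 hC] := hY; have [L L0 [qY cY]] := Lregular_geometry C0 hC.
split=> [p _ hp|k k2 mY p _].
  have [d d0 [de de0 [M M0 h]]] := slice_paths L0 qY L0 (cY p).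
  apply: (LLNE_of_chains d0 de0 M0) => [t q q' ht|]; first exact: (h t ht).1.
  near=> t => q q' hq hq'; apply: connected_chained => //.
    by rewrite mulr_gt0 //; near: t; exact: nbhs_right_gt.
  by near: t.
have [d d0 [de de0 [M M0 h]]] := slice_paths L0 qY L0 (cY p).
apply: (LLNE_of_chains d0 de0 M0) => [t q q' ht|]; first exact: (h t ht).1.
have [t0 t00 arc] : exists2 t0, 0 < t0 & forall t q q', 0 < t < t0 -> slice Y p t q ->
    slice Y p t q' -> exists g, [/\ enorm_continuous g, g 0 = q, g 1 = q' &
      forall s, 0 <= s <= 1 -> Y (g s) /\ 0 < enorm (g s - p) < 2 * d].
  (* A path in [Y] can meet [p] only if [p] belongs to [Y], and there the submanifold structure
     provides a detour. *)
  case: (pselect (Y p)) => Yp; first by apply: submanifold_arc k2 mY Yp _; rewrite mulr_gt0.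
  (* The path starts at distance [t] from [p] and moves by at most [L * (2 * t)]. *)
  exists (d / (1 + 2 * L)); first by rewrite divr_gt0 // ltr_pwDl // mulr_ge0.
  move=> t q q' /andP[tp]; rewrite ltr_pdivlMr ?ltr_pwDl ?mulr_ge0 // => td [Yq /= nq] [Yq' /= nq'].
  have [g hg] := qY q q' Yq Yq'; have [g0 g1 gY gK] := hg.
  have K0 : 0 <= L * enorm (q - q') by rewrite mulr_ge0 ?enorm_ge0.
  exists g; split=> //; first exact: lip_path_enorm_continuous K0 hg.
  move=> s hs; split; first exact: gY.
  rewrite enorm_gt0 ?subr_eq0 /=; last first.
    by apply/eqP => e; apply: Yp; rewrite -e; apply: gY.
  have h01 : 0 <= (0 : R) <= 1 by rewrite lexx ler01.
  have h1 := gK s 0 hs h01; rewrite subr0 g0 in h1.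
  have h2 : enorm (q - q') <= 2 * t.
    by apply: le_trans (enorm_dist _ _ p) _; rewrite nq enorm_distC nq'; lra.
  have h3 : L * enorm (q - q') * `|s| <= L * (2 * t).
    apply: (@le_trans _ _ (L * enorm (q - q'))); last by rewrite ler_wpM2l.
    by rewrite ler_piMr //; case/andP: hs => ? ?; rewrite ger0_norm.
  have := enorm_dist (g s) p q; rewrite nq => h4.
  by have := le_trans h1 h3; lra.
near=> t => q q' hq hq'.
have tp : 0 < t by near: t; exact: nbhs_right_gt.
have tt0 : 0 < t < t0 by rewrite tp; near: t; apply: nbhs_right_lt.
have td : 0 < t < d by rewrite tp; near: t; apply: nbhs_right_lt.
have [g [gc g0 g1 gY]] := arc t q q' tt0 hq hq'.
have e0 : 0 < de * t by rewrite mulr_gt0.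
rewrite -g0 -g1 in hq hq' *; exact: (h t td).2.
Unshelve. all: by end_near.
Qed.
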